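(* Let $N\ge1$, $0<s<1$, $1<p<2$ and $sp<1$. Consider the Cauchy problem for $\partial_tu+\mathcal L_{s,p}u=0$ in $\mathbb R^N$, $t>0$, with locally integrable initial data $u_0\ge0$. If $$\int_{\mathbb R^N}u_0(x)\varphi(x)\,dx<\infty$$ for some weight $\varphi\in\mathcal C(s,p)$, then there exists a weak solution $u$ of the problem defined in $Q_\infty=\mathbb R^N\times(0,\infty)$. This solution is continuous in the weighted space: $u\in C([0,T];L^1(\mathbb R^N,\varphi\,dx))$ for every $T>0$. The initial data are taken in the sense of strong convergence in $L^1_{loc}(\mathbb R^N)$: $u(\cdot,t)\to u_0$ in $L^1_{loc}(\mathbb R^N)$ as $t\to0^+$.
   Context: Let $\Phi_p(z)=|z|^{p-2}z$ and $\mathcal L_{s,p}(u)(x)=P.V.\int_{\mathbb R^N}\frac{\Phi_p(u(x)-u(y))}{|x-y|^{N+sp}}\,dy$. For a function $\varphi$ on $\mathbb R^N$ put $(\mathcal M_{sp/2}\varphi)(x)=P.V.\int_{\mathbb R^N}\frac{|\varphi(x)-\varphi(y)|}{|x-y|^{N+sp}}\,dy$. The class $\mathcal C(s,p)$ consists of the smooth, strictly positive functions $\varphi$ on $\mathbb R^N$, with $\varphi(x)\to0$ as $|x|\to\infty$, such that $\mathcal M_{sp/2}\varphi$ is locally bounded and $$\int_{\mathbb R^N}\frac{|\mathcal M_{sp/2}\varphi(x)|^{1/(2-p)}}{\varphi(x)^{(p-1)/(2-p)}}\,dx<\infty .$$ Weak solution: a function $u$ locally integrable in $\mathbb R^N\times[0,T]$,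 such that for every $\psi\in C^\infty([0,T]\times\mathbb R^N)$ with compact support in $Q_T=\mathbb R^N\times(0,T)$ the triple integral below is well defined and $$\int_0^T\!\!\int_{\mathbb R^N}u\,\psi_t\,dxdt=\frac12\int_0^T\!\!\iint\frac{\Phi_p(u(x,t)-u(y,t))\,(\psi(x,t)-\psi(y,t))}{|x-y|^{N+sp}}\,dxdydt .$$ A weak solution in $Q_\infty$ is one for every $T>0$. *)

(* Defs.v *)
From HB Require Import structures.
From mathcomp Require Import all_boot all_order all_algebra.
From mathcomp Require Import all_classical all_reals all_analysis.
Import Order.TTheory GRing.Theory Num.Theory.
Import numFieldNormedType.Exports.

Set Implicit Arguments.
Unset Strict Implicit.
Unset Printing Implicit Defensive.

Local Open Scope classical_set_scope.
Local Open Scope ring_scope.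

(* The sigma-algebra of R^n is generated by the n coordinates, as in the
   library for [n.-tuple]; it is the Borel sigma-algebra. *)
Section measurable_rV.
Context (R : realType) (n : nat).

Definition rV_coord (i : 'I_n) (x : 'rV[R]_n) : R := x ord0 i.

Let rV_set0 : g_sigma_preimage rV_coord set0.
Proof. exact: sigma_algebra0. Qed.

Let rV_setC A : g_sigma_preimage rV_coord A -> g_sigma_preimage rV_coord (~` A).
Proof. exact: sigma_algebraC. Qed.

Let rV_bigcup (F : (set 'rV[R]_n)^nat) :
  (forall i, g_sigma_preimage rV_coord (F i)) ->
  g_sigma_preimage rV_coord (\bigcup_i (F i)).
Proof. exact: sigma_algebra_bigcup. Qed.

HB.instance Definition _ := @isMeasurable.Build default_measure_display
  'rV[R]_n (g_sigma_preimage rV_coord) rV_set0 rV_setC rV_bigcup.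

Lemma measurable_rV_coord (i : 'I_n) : measurable_fun [set: _] (rV_coord i).
Proof.
move=> _ Y mY; rewrite setTI; apply: sub_sigma_algebra => /=.
rewrite -bigcup_seq/=; exists i => /=; first by rewrite mem_index_enum.
by exists Y => //; rewrite setTI.
Qed.

Lemma measurable_fun_rV d (T : measurableType d) (f : T -> 'rV[R]_n) :
  (forall i, measurable_fun [set: T] (rV_coord i \o f)) ->
  measurable_fun [set: T] f.
Proof.
move=> mf.
apply: (measurability
  (\big[setU/set0]_(i < n) preimage_set_system setT (rV_coord i) measurable)).
  by [].
move=> _ [A + <-]; rewrite -bigcup_seq => -[i _ [B mB <-]].
by have := mf i measurableT B mB; rewrite !setTI.
Qed.

End measurable_rV.

Section lebesgue_measure_rV.
Context (R : realType).
Local Open Scope ereal_scope.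

Definition cons_rV n (x : measurableTypeR R * 'rV[R]_n) : 'rV[R]_n.+1 := row_mx (x.1)%:M x.2.

Definition uncons_rV n (x : 'rV[R]_n.+1) : measurableTypeR R * 'rV[R]_n :=
  (x ord0 ord0, @rsubmx R 1 1 n x).

Let cons_rVEl n (x : measurableTypeR R * 'rV[R]_n) j :
  rV_coord (@lshift 1 n j : 'I_n.+1) (cons_rV x) = x.1.
Proof. by apply: etrans (row_mxEl _ _ _ _) _; rewrite mxE !ord1. Qed.

Let cons_rVEr n (x : measurableTypeR R * 'rV[R]_n) j :
  rV_coord (@rshift 1 n j : 'I_n.+1) (cons_rV x) = rV_coord j x.2.
Proof. exact: row_mxEr. Qed.

Let uncons_rVK n (x : measurableTypeR R * 'rV[R]_n) : uncons_rV (cons_rV x) = x.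
Proof.
case: x => a x; congr pair; last exact: row_mxKr.
rewrite -[RHS](@cons_rVEl _ (a, x) ord0) /rV_coord.
by congr (cons_rV _ _ _); apply: val_inj.
Qed.

Let measurable_cons_rV n : measurable_fun [set: measurableTypeR R * 'rV[R]_n] (@cons_rV n).
Proof.
apply: measurable_fun_rV => i.
have [j ->|j ->] := @split_ordP 1 n i.
  by rewrite (_ : _ \o _ = fst) //; apply/funext => x /=; exact: cons_rVEl.
rewrite (_ : _ \o _ = rV_coord j \o snd); last first.
  by apply/funext => x /=; exact: cons_rVEr.
by apply: measurableT_comp => //; exact: measurable_rV_coord.
Qed.

Let measurable_uncons_rV n : measurable_fun [set: 'rV[R]_n.+1] (@uncons_rV n).
Proof.
apply: measurable_fun_pair; first exact: measurable_rV_coord.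
apply: measurable_fun_rV => i.
rewrite (_ : _ \o _ = rV_coord (@rshift 1 n i)); first exact: measurable_rV_coord.
by apply/funext => x /=; rewrite /rV_coord mxE.
Qed.

(* Lebesgue measure on R^n: the n-fold product of Lebesgue measure on R,
   carried over to row vectors along [(a, x) |-> row_mx a%:M x]. *)
Fixpoint lebesgueN (n : nat) : set 'rV[R]_n -> \bar R :=
  match n with
  | 0 => dirac (0%R : 'rV[R]_0)
  | n'.+1 => pushforward (@lebesgue_measure R \x @lebesgueN n') (@cons_rV n')
  end.

Let sigma_finite_pack d (T : measurableType d) (mu : set T -> \bar R) :
    mu set0 = 0 -> (forall A, 0 <= mu A) -> semi_sigma_additive mu ->
    sigma_finite setT mu ->
  exists nu : {sigma_finite_measure set T -> \bar R}, mu = nu :> (set T -> _).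
Proof.
move=> mu0 mu_ge0 mu_add sf.
pose mM := isMeasure.Build _ _ _ mu mu0 mu_ge0 mu_add.
pose muM : {measure set T -> \bar R} := HB.pack mu mM.
pose sM := Measure_isSigmaFinite.Build _ _ _ muM sf.
pose nu : {sigma_finite_measure set T -> \bar R} := HB.pack mu mM sM.
by exists nu.
Qed.

Let lebesgueN_sigma_finite_measure n :
  exists mu : {sigma_finite_measure set 'rV[R]_n -> \bar R},
    @lebesgueN n = mu :> (set _ -> \bar R).
Proof.
elim: n => [|n [mu /= ->]]; first by exists (dirac (0%R : 'rV[R]_0)).
pose nu : {measure set 'rV[R]_n.+1 -> \bar R} :=
  measure_function_pushforward__canonical__measure_function_Measure
    (@lebesgue_measure R \x mu) (@measurable_cons_rV n).
have nu_sigma_finite : sigma_finite setT nu.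
  have [F FT Foo] : sigma_finite setT (@lebesgue_measure R \x mu).
    have /sigma_finiteP[F [TF ndF Foo]] := sigma_finiteT (@lebesgue_measure R).
    have /sigma_finiteP[G [TG ndG Goo]] := sigma_finiteT mu.
    exists (fun k => F k `*` G k).
      rewrite -setXTT TF TG predeqE => -[x y]; split.
        move=> [/= [i _ Fix] [j _ Gjy]]; exists (maxn i j) => //; split.
        - by move: x Fix; exact/subsetPset/ndF/leq_maxl.
        - by move: y Gjy; exact/subsetPset/ndG/leq_maxr.
      by move=> [i _ []/= ? ?]; split; exists i.
    move=> k; have [? ?] := Foo k; have [? ?] := Goo k.
    split; first exact: measurableX.
    by rewrite product_measure1E// lte_mul_pinfty// ge0_fin_numE.
  exists (fun i => @uncons_rV n @^-1` F i).
    by rewrite -preimage_bigcup -FT preimage_setT.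
  move=> i; have [mF Fio] := Foo i; split.
    by rewrite -[X in measurable X]setTI; exact: measurable_uncons_rV.
  rewrite /= /pushforward -comp_preimage.
  by rewrite (_ : _ \o _ = id) //; apply/funext => x /=; exact: uncons_rVK.
exact: (sigma_finite_pack (measure0 nu) (measure_ge0 nu)
  (measure_semi_sigma_additive (s := nu))).
Qed.

Let lebesgueN0 n : @lebesgueN n set0 = 0.
Proof. by have [mu ->] := lebesgueN_sigma_finite_measure n. Qed.

Let lebesgueN_ge0 n A : 0 <= @lebesgueN n A.
Proof. by have [mu ->] := lebesgueN_sigma_finite_measure n. Qed.

Let lebesgueN_sigma_additive n : semi_sigma_additive (@lebesgueN n).
Proof.
have [mu ->] := lebesgueN_sigma_finite_measure n.
exact: measure_semi_sigma_additive.
Qed.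

HB.instance Definition _ n := isMeasure.Build _ _ _ (@lebesgueN n)
  (@lebesgueN0 n) (@lebesgueN_ge0 n) (@lebesgueN_sigma_additive n).

Let lebesgueN_sigma_finite n : sigma_finite setT (@lebesgueN n).
Proof.
by have [mu ->] := lebesgueN_sigma_finite_measure n; exact: sigma_finiteT.
Qed.

HB.instance Definition _ n := Measure_isSigmaFinite.Build _ _ _ (@lebesgueN n)
  (@lebesgueN_sigma_finite n).

Lemma lebesgueN_box n (A : 'I_n -> set R) : (forall i, measurable (A i)) ->
  @lebesgueN n [set x | forall i, A i (x ord0 i)] =
  \prod_(i < n) @lebesgue_measure R (A i).
Proof.
elim: n A => [|n IH] A mA.
  by rewrite big_ord0 /= diracE mem_set// => -[].
rewrite big_ord_recl -IH; last by move=> i; exact: mA.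
rewrite /= /pushforward.
rewrite [X in product_measure1 _ _ X](_ : _ =
  A ord0 `*` [set x : 'rV[R]_n | forall i, A (lift ord0 i) (x ord0 i)]).
  rewrite product_measure1E//; first exact: mA.
  rewrite (_ : mkset _ = \bigcap_(i in [set: 'I_n])
     (rV_coord i @^-1` A (lift ord0 i))).
    apply: fin_bigcap_measurable => // i _.
    by rewrite -[X in measurable X]setTI; apply: measurable_rV_coord => //; exact: mA.
  by apply/seteqP; split => x /= xA i => [_|]; exact: xA.
have l0 : @lshift 1 n ord0 = ord0 by apply: val_inj.
have rl i : @rshift 1 n i = lift ord0 i by apply: val_inj.
apply/seteqP; split => -[a x] /=.
  move=> Aax; split => [|i].
    by have := Aax ord0; rewrite -[_ _ ord0 ord0]/(rV_coord _ _) -{2}l0 cons_rVEl.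
  by have := Aax (lift ord0 i); rewrite -[X in A _ X]/(rV_coord _ _) -{2}rl cons_rVEr.
move=> [/= Aa Ax] i; have [j ->|j ->] := @split_ordP 1 n i.
  by rewrite -[X in A _ X]/(rV_coord _ _) cons_rVEl (ord1 j) l0.
by rewrite -[X in A _ X]/(rV_coord _ _) cons_rVEr rl; exact: Ax.
Qed.

End lebesgue_measure_rV.
Arguments lebesgueN {R} n.

(* The library norm on row vectors is the sup norm. *)
Definition eucl_norm (R : realType) N (x : 'rV[R]_N) : R :=
  Num.sqrt (\sum_(i < N) x ord0 i ^+ 2).

Fixpoint Ck (R : realType) (V : normedModType R) (k : nat) (f : V -> R) : Prop :=
  match k with
  | 0 => continuous f
  | k'.+1 => (forall x, differentiable f x) /\ (forall v, Ck k' ('D_v f))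
  end.

Definition smooth (R : realType) (V : normedModType R) (f : V -> R) :=
  forall k, Ck k f.

(* Since [0 `^ r = 0] for r != 0, this is 0 at z = 0. *)
Definition Phi (R : realType) (p z : R) : R := `|z| `^ (p - 2) * z.

(* The principal value is the limit of the integrals over |x - y| > eps; these
   increase as eps decreases, so the limit exists in \bar R. *)
Definition Mop (R : realType) N (s p : R) (phi : 'rV[R]_N -> R) (x : 'rV[R]_N)
    : \bar R :=
  lim (\int[lebesgueN N]_(y in [set y | (eps < eucl_norm (x - y))%R])
         (`|phi x - phi y| / eucl_norm (x - y) `^ (N%:R + s * p))%:E
       @[eps --> 0^'+])%E.

Definition classC (R : realType) N (s p : R) (phi : 'rV[R]_N -> R) : Prop :=
  [/\ smooth phi,
      forall x, 0 < phi x,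
      forall e : R, 0 < e -> exists r : R, forall x, r < eucl_norm x -> `|phi x| < e,
      forall x : 'rV[R]_N, exists B : R, \forall y \near x, (`|Mop s p phi y| <= B%:E)%E
    & (\int[lebesgueN N]_x
         (`|Mop s p phi x| `^ (2 - p)^-1
          * ((phi x `^ ((p - 1) / (2 - p)))^-1)%:E) < +oo)%E].

Definition loc_integrable (R : realType) N (f : 'rV[R]_N -> R) : Prop :=
  forall K, compact K -> (lebesgueN N).-integrable K (EFin \o f).

Definition loc_integrable_strip (R : realType) N (T : R)
    (u : 'rV[R]_N * R -> R) : Prop :=
  forall K, compact K -> K `<=` [set: 'rV[R]_N] `*` `[0, T] ->
    (lebesgueN N \x lebesgue_measure)%E.-integrable K (EFin \o u).

(* A function in C^oo([0,T] x R^N) whose support is a compact subset of the open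
   set Q_T vanishes near t = 0 and t = T, hence is given by its extension by 0
   to R^N x R. *)
Definition test_function (R : realType) N (T : R) (psi : 'rV[R]_N * R -> R) :=
  let supp := closure [set z | psi z != 0] in
  [/\ smooth psi, compact supp & supp `<=` [set: 'rV[R]_N] `*` `]0, T[].

(* The triple integral, over ((x, y), t), is well defined when the integrand is
   Lebesgue integrable. *)
Definition weak_solution (R : realType) N (s p T : R) (u : 'rV[R]_N * R -> R)
    : Prop :=
  loc_integrable_strip T u /\
  forall psi, test_function T psi ->
    let psi_t (z : 'rV[R]_N * R) := derive1 (fun t => psi (z.1, t)) z.2 in
    let F (z : 'rV[R]_N * 'rV[R]_N * R) :=
      let: (x, y, t) := z in
      Phi p (u (x, t) - u (y, t)) * (psi (x, t) - psi (y, t))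
      / eucl_norm (x - y) `^ (N%:R + s * p) in
    let mu2 := (@lebesgueN R N \x lebesgue_measure)%E in
    let mu3 := (@lebesgueN R N \x @lebesgueN R N \x lebesgue_measure)%E in
    let Q2 := [set: 'rV[R]_N] `*` [set` `]0, T[] in
    let Q3 := [set: 'rV[R]_N * 'rV[R]_N] `*` [set` `]0, T[] in
    mu3.-integrable Q3 (EFin \o F) /\
    (\int[mu2]_(z in Q2) (u z * psi_t z)%:E
     = (2^-1)%:E * \int[mu3]_(z in Q3) (F z)%:E)%E.

Definition continuous_weighted_L1 (R : realType) N (phi : 'rV[R]_N -> R) (T : R)
    (u : 'rV[R]_N * R -> R) : Prop :=
  (forall t, t \in `[0, T] ->
     measurable_fun [set: 'rV[R]_N] (fun x => u (x, t)) /\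
     (\int[lebesgueN N]_x (`|u (x, t)| * phi x)%:E < +oo)%E) /\
  (forall t0, t0 \in `[0, T] ->
     (\int[lebesgueN N]_x (`|u (x, t) - u (x, t0)| * phi x)%:E)%E
       @[t --> within `[0, T] (nbhs t0)] --> 0%E).

Definition initial_trace_L1loc (R : realType) N (u0 : 'rV[R]_N -> R)
    (u : 'rV[R]_N * R -> R) : Prop :=
  forall K, compact K ->
    (\int[lebesgueN N]_(x in K) `|u (x, t) - u0 x|%:E)%E @[t --> 0^'+] --> 0%E.

(* Main.v *)
From HB Require Import structures.
Require Import Defs.
From mathcomp Require Import all_boot all_order all_algebra.
From mathcomp Require Import all_classical all_reals all_analysis.
From mathcomp Require Import measurable_realfun.
From mathcomp Require Import ring lra zify.
Import Order.TTheory GRing.Theory Num.Theory.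
Import numFieldNormedType.Exports.

(** Solutions are limits of a monotone explicit Euler scheme.

    Let K z = |z|^-(N + sp), truncated to K_m = min(K, m), and truncate Phi to
    an m-Lipschitz odd nondecreasing Phi_m.  For the bounded operator
    A_m u x = int Phi_m (u x - u y) K_m (x - y) dy, the step u - tau A_m u
    with tau * m * |K_m|_1 <= 1 is order preserving, preserves the bounds
    0 <= u <= M, and preserves the integral since the flux is antisymmetric.
    Order and mass together give an L1 contraction of positive parts
    ([step_Tcontr]).  The step also commutes with translations, so the
    seminorm iint e (x - y) |u x - u y| never increases ([iter_diff2]).

    For bounded integrable data v with iint K |v x - v y| finite, the levels m
    form a Cauchy sequence.  In the L2 norm of the difference of two levels,
    the monotone part of the operators has the good sign and what remains is
    iint e_m |v x - v y|, where e_m <= C K tends to 0 ([step_L2],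
    [cauchy_bound]).  An L1 bound and the decay of phi convert this into
    smallness in L1(phi) ([cauchy_small]).

    The weight condition of class C enters through one inequality, of Young
    type: with q = p - 1 and M phi x = int K (x - y) |phi x - phi y| dy,
    a^q * M phi <= a phi + (M phi)^(1/(2-p)) phi^(-(p-1)/(2-p)),
    the last term being integrable ([weight_control]).  Testing the scheme with
    phi gives a bound on int u phi, and on its variation in time, that depends
    neither on the truncation nor on the time step ([iter_bound],
    [iter_X_lip]).

    A general datum is approached by data v_n as above, increasing up to errors
    2^-n in L1.  With level m_n large enough, int (u_n - u_(n+1))^+ phi <= C 2^-n
    ([approx_sol_almost_mono]).  As int u_n phi is bounded, the increments
    |u_(n+1) - u_n| are then summable in L1(phi): at every time the
    approximations converge in L1(phi) under a common envelope, and the distance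
    to the limit is controlled by the difference of the weighted masses
    ([l_dist]).  The latter being Lipschitz in time, the limit is continuous
    with values in L1(phi) ([ulim_cont]).

    The scheme satisfies an exact discrete weak formulation ([discrete_weak]).
    Its integrands are dominated, with U the envelope and H a modulus of
    continuity of the test function, by multiples of U phi and of
    (U(x)^q + U(y)^q) K H.  The second one is integrable by the weight condition
    again: H is supported near the support of the test function, and for x far
    away, where phi is small, H (x, y) <= C |phi x - phi y| ([modulus_weight]).
    Dominated convergence concludes.

    The scheme and its limit are studied on a sigma-finite measure space with a
    translation structure ([evolution_exists]), and R^N comes in afterwards
    ([solution_exists]). *)

Set Implicit Arguments.
Unset Strict Implicit.
Unset Printing Implicit Defensive.

Local Open Scope classical_set_scope.
Local Open Scope ring_scope.

(** * Integration tools *)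

Notation intg mu f := (integrable mu [set: _] (EFin \o f)).

Lemma dist_itv (R : realType) (M a b : R) : 0 <= a <= M -> 0 <= b <= M ->
  `|a - b| <= M.
Proof.
by move=> /andP[? ?] /andP[? ?]; rewrite ler_norml; apply/andP; split; lra.
Qed.

Lemma dist_itvD (R : realType) (M a b : R) : 0 <= a <= M -> 0 <= b <= M ->
  `|a - b| <= a + b.
Proof.
by move=> /andP[? ?] /andP[? ?]; rewrite ler_norml; apply/andP; split; lra.
Qed.

Lemma lt_exp2n (R : realType) (x : R) : exists n : nat, x < 2 ^+ n.
Proof.
exists (Num.trunc x).+1.
apply: lt_le_trans (truncnS_gt x) _; rewrite -natrX ler_nat ltnW//.
exact: ltn_expl.
Qed.

Lemma measurable_sumR d (T : measurableType d) (R : realType) (I : Type)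
    (s : seq I) (h : I -> T -> R) : (forall i, measurable_fun setT (h i)) ->
  measurable_fun setT (fun x => \sum_(i <- s) h i x).
Proof.
move=> mh; elim: s => [|i s ih]; first by under eq_fun do rewrite big_nil; exact: measurable_cst.
by under eq_fun do rewrite big_cons; exact: measurable_funD.
Qed.

Section IntegrationTools.
Context d (T : measurableType d) (R : realType) (mu : {measure set T -> \bar R}).
Implicit Types f g : T -> R.

Lemma intg_measurable f : intg mu f -> measurable_fun setT f.
Proof. by move=> /measurable_int /measurable_EFinP. Qed.

Lemma intg_dom f g : measurable_fun setT f -> (forall x, `|f x| <= g x) ->
  intg mu g -> intg mu f.
Proof.
move=> mf fg ig; apply: le_integrable ig => //; first exact/measurable_EFinP.
move=> x _ /=; rewrite lee_fin (le_trans (fg x))// ler_norm//.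
Qed.

Lemma intgD f g : intg mu f -> intg mu g -> intg mu (fun x => f x + g x).
Proof.
move=> fi gi; rewrite (_ : _ \o _ = (EFin \o f) \+ (EFin \o g))%E//.
exact: integrableD.
Qed.

Lemma intgB f g : intg mu f -> intg mu g -> intg mu (fun x => f x - g x).
Proof.
move=> fi gi; rewrite (_ : _ \o _ = (EFin \o f) \- (EFin \o g))%E//.
exact: integrableB.
Qed.

Lemma intgZ c f : intg mu f -> intg mu (fun x => c * f x).
Proof.
move=> fi; rewrite (_ : _ \o _ = (fun x => c%:E * (EFin \o f) x))%E//.
exact: integrableZl.
Qed.

Lemma intg_norm f : intg mu f -> intg mu (fun x => `|f x|).
Proof. by move=> fi; exact: integrable_norm. Qed.

Lemma intg_mulb B f g : measurable_fun setT g -> (forall x, `|g x| <= B) ->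
  intg mu f -> intg mu (fun x => f x * g x).
Proof.
move=> mg gB fi; apply: (@intg_dom _ (fun x => B * `|f x|)).
- by apply: measurable_funM => //; exact: intg_measurable.
- by move=> x; rewrite normrM mulrC ler_wpM2r.
- exact/intgZ/intg_norm.
Qed.

Lemma intg_ge0P f : measurable_fun setT f -> (forall x, 0 <= f x) ->
  intg mu f <-> (\int[mu]_x (f x)%:E < +oo)%E.
Proof.
move=> mf f0; split=> [/integrable_lty -> //|h].
apply/integrableP; split; first exact/measurable_EFinP.
by rewrite (eq_integral (EFin \o f))// => x _ /=; rewrite ger0_norm.
Qed.

Lemma Rint_fine f : intg mu f -> (\int[mu]_x f x)%:E = (\int[mu]_x (f x)%:E)%E.
Proof. by move=> fi; rewrite fineK//; exact: integrable_fin_num. Qed.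

Lemma le_Rint f g : intg mu f -> intg mu g -> (forall x, f x <= g x) ->
  \int[mu]_x f x <= \int[mu]_x g x.
Proof. by move=> fi gi fg; apply: le_Rintegral. Qed.

Lemma RintD f g : intg mu f -> intg mu g ->
  \int[mu]_x (f x + g x) = \int[mu]_x f x + \int[mu]_x g x.
Proof. by move=> fi gi; exact: RintegralD. Qed.

Lemma RintB f g : intg mu f -> intg mu g ->
  \int[mu]_x (f x - g x) = \int[mu]_x f x - \int[mu]_x g x.
Proof. by move=> fi gi; exact: RintegralB. Qed.

Lemma RintZ c f : intg mu f -> \int[mu]_x (c * f x) = c * \int[mu]_x f x.
Proof. by move=> fi; exact: RintegralZl. Qed.

Lemma Rint_ge0 f : (forall x, 0 <= f x) -> 0 <= \int[mu]_x f x.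
Proof. by move=> f0; exact: Rintegral_ge0. Qed.

Lemma eq_Rint f g : f =1 g -> \int[mu]_x f x = \int[mu]_x g x.
Proof. by move=> fg; congr fine; apply: eq_integral => x _; rewrite fg. Qed.

Lemma le_norm_Rint f : intg mu f -> `|\int[mu]_x f x| <= \int[mu]_x `|f x|.
Proof. by move=> fi; exact: le_normr_Rintegral. Qed.

End IntegrationTools.

Section FubiniTools.
Context d1 d2 (T1 : measurableType d1) (T2 : measurableType d2) (R : realType).
Variables (m1 : {sigma_finite_measure set T1 -> \bar R})
  (m2 : {sigma_finite_measure set T2 -> \bar R}).
Implicit Types F : T1 * T2 -> R.

Lemma measurable_Rint2 F : measurable_fun setT F ->
  measurable_fun setT (fun x => \int[m2]_y F (x, y)).
Proof.
move=> mF; apply: measurableT_comp => //.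
have mF' : measurable_fun setT (EFin \o F) by exact/measurable_EFinP.
have h1 : measurable_fun setT (fubini_F m2 (EFin \o F)^\+%E).
  by apply: measurable_fun_fubini_tonelli_F => //; exact: measurable_funepos.
have h2 : measurable_fun setT (fubini_F m2 (EFin \o F)^\-%E).
  by apply: measurable_fun_fubini_tonelli_F => //; exact: measurable_funeneg.
rewrite (_ : (fun x => _) =
    (fubini_F m2 (EFin \o F)^\+ \- fubini_F m2 (EFin \o F)^\-)%E).
  exact: emeasurable_funB.
apply/funext => x; rewrite integralE /fubini_F; congr (_ - _)%E.
- by apply: eq_integral => y _; rewrite !unlock.
- by apply: eq_integral => y _; rewrite !unlock.
Qed.

Lemma Rfubini12 F : intg (m1 \x m2)%E F -> (forall x, intg m2 (fun y => F (x, y))) ->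
  intg m1 (fun x => \int[m2]_y F (x, y)) /\
  \int[m1]_x (\int[m2]_y F (x, y)) = \int[(m1 \x m2)%E]_z F z.
Proof.
move=> iF iFx.
have E x : (\int[m2]_y F (x, y))%:E = fubini_F m2 (EFin \o F) x.
  by rewrite Rint_fine.
have -> : EFin \o (fun x => \int[m2]_y F (x, y)) = fubini_F m2 (EFin \o F).
  by apply/funext => x /=; rewrite E.
split; first exact: integrable_fubini_F.
congr fine; rewrite -(integral12_prod_meas1 iF).
by apply: eq_integral => x _; rewrite E.
Qed.

End FubiniTools.

Section SwapTools.
Context d (T : measurableType d) (R : realType).
Variable (mu : {sigma_finite_measure set T -> \bar R}).
Implicit Types F : T * T -> R.

Lemma intg_swap F : intg (mu \x mu)%E F -> intg (mu \x mu)%E (fun z => F (z.2, z.1)).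
Proof.
move=> iF; have mF := intg_measurable iF.
apply/integrable12ltyP.
  by apply/measurable_EFinP; apply: (measurableT_comp mF); exact: measurable_swap.
by have /integrable21ltyP := iF; apply; exact/measurable_EFinP.
Qed.

Lemma Rint_swap F : intg (mu \x mu)%E F ->
  \int[(mu \x mu)%E]_z F (z.2, z.1) = \int[(mu \x mu)%E]_z F z.
Proof.
move=> iF; congr fine; rewrite -(integral21_prod_meas1 iF).
by rewrite -(integral12_prod_meas1 (intg_swap iF)).
Qed.

End SwapTools.

(** * Explicit Euler steps for a truncated nonlocal operator *)

(** [g] stands for a truncation of Phi and [k (x, y)] for a truncated kernel in
    [x - y].  The product [L * kap] bounds the Lipschitz constant of the
    operator up to a factor 2, and limits the time step. *)
Record is_scheme d (T : measurableType d) (R : realType)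
    (mu : {sigma_finite_measure set T -> \bar R})
    (g : R -> R) (L : R) (k : T * T -> R) (kap : R) : Prop := IsScheme {
  sc_L0 : 0 <= L;
  sc_kap0 : 0 <= kap;
  sc_odd : forall a, g (- a) = - g a;
  sc_nd : forall a b, a <= b -> g a <= g b;
  sc_lip : forall a b, a <= b -> g b - g a <= L * (b - a);
  sc_mk : measurable_fun setT k;
  sc_k0 : forall z, 0 <= k z;
  sc_ksym : forall x y, k (x, y) = k (y, x);
  sc_kint : forall x, intg mu (fun y => k (x, y));
  sc_kle : forall x, \int[mu]_y k (x, y) <= kap }.

Section SchemeDefs.
Context d (T : measurableType d) (R : realType).
Variable (mu : {sigma_finite_measure set T -> \bar R}).
Variables (g : R -> R) (k : T * T -> R).

Definition flux (u : T -> R) (z : T * T) : R := g (u z.1 - u z.2) * k z.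

Definition nonlocal (u : T -> R) (x : T) : R := \int[mu]_y flux u (x, y).

Definition step tau (u : T -> R) (x : T) : R := u x - tau * nonlocal u x.

Lemma stepE tau (u : T -> R) x : step tau u x = u x - tau * nonlocal u x.
Proof. by []. Qed.

Definition meas_bd B (u : T -> R) := measurable_fun setT u /\ forall x, `|u x| <= B.

(** The class left invariant by the scheme. *)
Definition good M (u : T -> R) :=
  [/\ measurable_fun setT u, forall x, 0 <= u x <= M & intg mu u].

End SchemeDefs.

Section Scheme.
Context d (T : measurableType d) (R : realType).
Variable (mu : {sigma_finite_measure set T -> \bar R}).
Variables (g : R -> R) (L : R) (k : T * T -> R) (kap : R).
Hypothesis Sc : is_scheme mu g L k kap.

Let L0 := sc_L0 Sc.
Let kap0 := sc_kap0 Sc.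
Let g_odd := sc_odd Sc.
Let g_nd := sc_nd Sc.
Let g_lip := sc_lip Sc.
Let mk := sc_mk Sc.
Let k0 := sc_k0 Sc.
Let ksym := sc_ksym Sc.
Let kint := sc_kint Sc.
Let kle := sc_kle Sc.
Implicit Types u v psi : T -> R.

Local Notation flux := (flux g k).
Local Notation nonlocal := (nonlocal mu g k).
Local Notation step := (step mu g k).
Local Notation good := (good mu).

Lemma g0 : g 0 = 0.
Proof. by have := g_odd 0; rewrite oppr0 => h; lra. Qed.

Lemma g_lipN a b : `|g a - g b| <= L * `|a - b|.
Proof.
wlog ab : a b / b <= a => [hw|].
  have [/hw//|/ltW /hw] := leP b a.
  by rewrite distrC => /le_trans; apply; rewrite [X in L * X]distrC.
by rewrite !ger0_norm ?subr_ge0 ?g_nd// g_lip.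
Qed.

Lemma g_bd a : `|g a| <= L * `|a|.
Proof. by have := g_lipN a 0; rewrite g0 !subr0. Qed.

Lemma measurable_g : measurable_fun setT g.
Proof. by apply: nondecreasing_measurable => // a b _ _; exact: g_nd. Qed.

Lemma kbound (h : T -> R) c x : measurable_fun setT h ->
    (forall y, `|h y| <= c) ->
  intg mu (fun y => h y * k (x, y)) /\
  `|\int[mu]_y (h y * k (x, y))| <= c * kap.
Proof.
move=> mh hc.
have c0 : 0 <= c by exact: le_trans (hc x).
have mkx : measurable_fun setT (fun y => k (x, y)).
  by apply: measurableT_comp mk _; exact: pair1_measurable.
have ih : intg mu (fun y => h y * k (x, y)).
  apply: (@intg_dom _ _ _ _ _ (fun y => c * k (x, y))).
  - exact: measurable_funM.
  - by move=> y; rewrite normrM (ger0_norm (k0 _)) ler_wpM2r.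
  - exact: intgZ.
split => //.
apply: (le_trans (le_norm_Rint ih)).
apply: (@le_trans _ _ (\int[mu]_y (c * k (x, y)))).
  apply: le_Rint; [exact: intg_norm|exact: intgZ|].
  by move=> y; rewrite normrM (ger0_norm (k0 _)) ler_wpM2r.
by rewrite RintZ// ler_wpM2l.
Qed.

Lemma good_meas_bd M u : good M u -> meas_bd M u.
Proof.
by move=> [mu_ uM _]; split=> // x; have /andP[? ?] := uM x; rewrite ger0_norm.
Qed.

Lemma measurable_diff u : measurable_fun setT u ->
  measurable_fun setT (fun z : T * T => u z.1 - u z.2).
Proof.
move=> mu_; apply: measurable_funB; apply: measurableT_comp mu_ _.
- exact: measurable_fst.
- exact: measurable_snd.
Qed.

Lemma measurable_flux u : measurable_fun setT u -> measurable_fun setT (flux u).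
Proof.
move=> mu_; apply: measurable_funM => //.
by apply: measurableT_comp measurable_g _; exact: measurable_diff.
Qed.

Lemma measurable_gdiff u x : measurable_fun setT u ->
  measurable_fun setT (fun y => g (u x - u y)).
Proof.
move=> mu_; apply: measurableT_comp measurable_g _.
by apply: measurable_funB.
Qed.

Lemma flux_sec B u x : meas_bd B u -> intg mu (fun y => flux u (x, y)).
Proof.
move=> [mu_ uB].
apply: (kbound (h := fun y => g (u x - u y)) (c := L * (B + B)) x _ _).1.
- exact: measurable_gdiff.
- move=> y; apply: (le_trans (g_bd _)); rewrite ler_wpM2l//.
  by apply: (le_trans (ler_normB _ _)); rewrite lerD.
Qed.

Lemma measurable_nonlocal u : measurable_fun setT u -> measurable_fun setT (nonlocal u).
Proof.
by move=> mu_; apply: measurable_Rint2; exact: measurable_flux.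
Qed.

Lemma le_nonlocal M u x : good M u -> `|nonlocal u x| <= L * M * kap.
Proof.
move=> [mu_ uM _]; apply: (kbound (h := fun y => g (u x - u y)) (c := L * M) x _ _).2.
- exact: measurable_gdiff.
- move=> y; apply: (le_trans (g_bd _)); rewrite ler_wpM2l//.
  exact: (dist_itv (uM x) (uM y)).
Qed.

Lemma nonlocal_lip B B' u v c x : meas_bd B u -> meas_bd B' v ->
  (forall y, `|u y - v y| <= c) -> `|nonlocal u x - nonlocal v x| <= L * (2 * c) * kap.
Proof.
move=> gu gv uvc; have [mu_ _] := gu; have [mv _] := gv.
rewrite /nonlocal -RintB; [|exact: (flux_sec x gu)|exact: (flux_sec x gv)].
rewrite (@eq_Rint _ _ _ _ _
  (fun y => (g (u x - u y) - g (v x - v y)) * k (x, y))); last first.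
  by move=> y; rewrite mulrBl.
apply: (kbound (h := fun y => g (u x - u y) - g (v x - v y)) x _ _).2.
- by apply: measurable_funB; exact: measurable_gdiff.
- move=> y; apply: (le_trans (g_lipN _ _)); rewrite ler_wpM2l//.
  rewrite (_ : _ - _ = (u x - v x) - (u y - v y)); last by ring.
  by apply: (le_trans (ler_normB _ _)); rewrite mulr2n mulrDl mul1r lerD.
Qed.

Lemma intg_fst_k (a : T -> R) : intg mu a -> intg (mu \x mu)%E (fun z => a z.1 * k z).
Proof.
move=> ia; have ma := intg_measurable ia.
have m : measurable_fun setT (fun z : T * T => a z.1 * k z).
  by apply: measurable_funM => //; apply: measurableT_comp ma _; exact: measurable_fst.
apply/integrable12ltyP; first exact/measurable_EFinP.
have iak : intg mu (fun x => kap * `|a x|) by exact/intgZ/intg_norm.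
apply: le_lt_trans (integrable_lty measurableT iak).
apply: ge0_le_integral => //.
- by move=> x _; exact: integral_ge0.
- apply: (measurable_fun_fubini_tonelli_F (m2 := mu)
    (fun z => `|(EFin \o (fun z : T * T => (a z.1 * k z)%R)) z|%E)) => //.
  by apply/measurableT_comp => //; exact/measurable_EFinP.
- by apply/measurable_EFinP; exact: intg_measurable iak.
move=> x _ /=.
rewrite (eq_integral (fun y => (`|a x| * k (x, y))%:E)); last first.
  by move=> y _; rewrite normrM (ger0_norm (k0 _)).
rewrite -Rint_fine; last exact: intgZ.
by rewrite RintZ// lee_fin mulrC ler_wpM2r.
Qed.

Lemma intg_snd_k (a : T -> R) : intg mu a -> intg (mu \x mu)%E (fun z => a z.2 * k z).
Proof.
move=> /intg_fst_k /intg_swap.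
by under [X in _ -> intg _ X]eq_fun do rewrite [z in k z]surjective_pairing ksym.
Qed.

Lemma le_Rint_fst_k (a : T -> R) : intg mu a -> (forall x, 0 <= a x) ->
  \int[(mu \x mu)%E]_z (a z.1 * k z) <= kap * \int[mu]_x a x.
Proof.
move=> ia a0.
have [h1 <-] := (@Rfubini12 _ _ _ _ _ mu mu (fun z => a z.1 * k z) (intg_fst_k ia)
  (fun x => @intgZ _ _ _ _ (a x) _ (kint x))).
rewrite -RintZ//; apply: le_Rint => //; first exact: intgZ.
by move=> x /=; rewrite RintZ// mulrC ler_wpM2r.
Qed.

Lemma flux_intg M u : good M u -> intg (mu \x mu)%E (flux u).
Proof.
move=> [mu_ uM iu].
apply: (@intg_dom _ _ _ _ _ (fun z => L * (u z.1 * k z + u z.2 * k z))).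
- exact: measurable_flux.
- move=> z; rewrite /flux normrM (ger0_norm (k0 _)) -mulrDl mulrA ler_wpM2r//.
  apply: (le_trans (g_bd _)); rewrite ler_wpM2l//.
  exact: (dist_itvD (uM z.1) (uM z.2)).
- by apply/intgZ/intgD; [exact: intg_fst_k|exact: intg_snd_k].
Qed.

Lemma nonlocal_intg M u : good M u -> intg mu (nonlocal u).
Proof.
move=> gu.
exact: (Rfubini12 (flux_intg gu) (fun x => flux_sec x (good_meas_bd gu))).1.
Qed.

Lemma flux_swap u z : flux u (z.2, z.1) = - flux u z.
Proof.
by rewrite /flux ksym -surjective_pairing /= -mulNr -g_odd opprB.
Qed.

(** Exchanging [x] and [y] changes the sign of the flux, so that [psi x] may be
    replaced by half of [psi x - psi y]. *)
Lemma nonlocal_weak M B u psi : good M u -> meas_bd B psi ->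
  intg (mu \x mu)%E (fun z => flux u z * (psi z.1 - psi z.2)) /\
  \int[mu]_x (nonlocal u x * psi x) =
  2^-1 * \int[(mu \x mu)%E]_z (flux u z * (psi z.1 - psi z.2)).
Proof.
move=> gu [mpsi psiB].
have iF := flux_intg gu.
have i1 : intg (mu \x mu)%E (fun z => flux u z * psi z.1).
  apply: (@intg_mulb _ _ _ _ B) => //.
  by apply: measurableT_comp mpsi _; exact: measurable_fst.
have i2 : intg (mu \x mu)%E (fun z => flux u z * psi z.2).
  apply: (@intg_mulb _ _ _ _ B) => //.
  by apply: measurableT_comp mpsi _; exact: measurable_snd.
have E : \int[mu]_x (nonlocal u x * psi x) = \int[(mu \x mu)%E]_z (flux u z * psi z.1).
  have [|_ <-] := (@Rfubini12 _ _ _ _ _ mu mu _ i1).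
    by move=> x /=; under eq_fun do rewrite mulrC; apply/intgZ/flux_sec/good_meas_bd/gu.
  apply: eq_Rint => x /=; rewrite /nonlocal mulrC -RintZ; last first.
    exact: (flux_sec x (good_meas_bd gu)).
  by apply: eq_Rint => y; rewrite mulrC.
split.
  by under eq_fun do rewrite mulrBr; exact: intgB.
rewrite [in RHS](eq_Rint _ (fun z => mulrBr (flux u z) (psi z.1) (psi z.2))).
rewrite RintB// {}E -(Rint_swap i2) /=.
under [X in _ = _ * (_ - X)]eq_Rint do rewrite flux_swap mulNr -mulN1r.
by rewrite RintZ//; lra.
Qed.

Variable tau : R.
Hypotheses (tau_ge0 : 0 <= tau) (cfl : tau * (L * kap) <= 1).

(** Since [g] is nondecreasing and [L]-Lipschitz, the stability condition makes
    [u x - tau * nonlocal u x] nondecreasing in the value at [x] and in all the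
    other values of [u].  The constant [c], which the operator does not see,
    yields stability in the sup norm as well ([step_sup]). *)
Lemma step_mono B B' u v c : meas_bd B u -> meas_bd B' v ->
  (forall y, u y <= v y + c) -> forall x, step tau u x <= step tau v x + c.
Proof.
move=> gu gv uv x.
have [mu_ _] := gu; have [mv _] := gv.
have mkx : measurable_fun setT (fun y => k (x, y)).
  by apply: measurableT_comp mk _; exact: pair1_measurable.
have d0 : 0 <= v x + c - u x by rewrite subr_ge0.
suff : nonlocal v x - nonlocal u x <= L * kap * (v x + c - u x).
  move=> h; rewrite /step -subr_ge0.
  have -> : v x - tau * nonlocal v x + c - (u x - tau * nonlocal u x) =
    (v x + c - u x) - tau * (nonlocal v x - nonlocal u x) by ring.
  rewrite subr_ge0 (le_trans (ler_wpM2l tau_ge0 h))//.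
  by rewrite mulrA ler_piMl.
rewrite /nonlocal -RintB; [|exact: (flux_sec x gv)|exact: (flux_sec x gu)].
apply: (@le_trans _ _ (\int[mu]_y (L * (v x + c - u x) * k (x, y)))).
  apply: le_Rint.
  - apply: intgB; [exact: (flux_sec x gv)|exact: (flux_sec x gu)].
  - exact: intgZ.
  move=> y; rewrite /flux /= -mulrBl ler_wpM2r//.
  apply: (@le_trans _ _ (g (v x + c - u y) - g (u x - u y))).
    rewrite lerB// g_nd//.
    by have := uv y; lra.
  apply: (le_trans (g_lip _)); last by apply: ler_wpM2l => //; lra.
  by have := uv x; lra.
rewrite RintZ// (mulrAC L kap) mulrAC (mulrAC L) ler_wpM2l//.
by rewrite mulr_ge0.
Qed.

Lemma step0 c : step tau (fun=> c) = (fun=> c).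
Proof.
apply/funext => x; rewrite /step /nonlocal (@eq_Rint _ _ _ _ _ (fun=> 0 * 0)).
  rewrite mul0r (_ : \int[mu]__ 0 = 0) ?mulr0 ?subr0//.
  by rewrite /Rintegral integral0.
by move=> y; rewrite /flux /= subrr g0 !mul0r.
Qed.

Lemma measurable_step u : measurable_fun setT u -> measurable_fun setT (step tau u).
Proof.
by move=> mu_; apply: measurable_funB => //; apply: measurable_funM => //; exact: measurable_nonlocal.
Qed.

Lemma step_good M u : good M u -> good M (step tau u).
Proof.
move=> gu; have [mu_ uM iu] := gu; split.
- exact: measurable_step.
- move=> x.
  have m0 (c : R) : meas_bd `|c| (fun _ : T => c) by split.
  have := @step_mono _ _ _ u 0 (m0 0) (good_meas_bd gu) _ x.
  rewrite step0 addr0 => -> //; last by move=> y; rewrite addr0; case/andP: (uM y).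
  have := @step_mono _ _ u _ 0 (good_meas_bd gu) (m0 M) _ x.
  by rewrite (step0 M) /= !addr0; apply => y; case/andP: (uM y).
- by apply: intgB => //; apply: intgZ; exact: nonlocal_intg gu.
Qed.

Lemma step_weak M B u psi : good M u -> meas_bd B psi ->
  \int[mu]_x (step tau u x * psi x) = \int[mu]_x (u x * psi x) -
  tau / 2 * \int[(mu \x mu)%E]_z (flux u z * (psi z.1 - psi z.2)).
Proof.
move=> gu hpsi; have [mu_ uM iu] := gu; have [mpsi psiB] := hpsi.
have iAp : intg mu (fun x => nonlocal u x * psi x).
  exact: (intg_mulb mpsi psiB (nonlocal_intg gu)).
have iup : intg mu (fun x => u x * psi x) by exact: (intg_mulb mpsi psiB).
rewrite (@eq_Rint _ _ _ _ _ (fun x => u x * psi x - tau * (nonlocal u x * psi x))).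
  by rewrite RintB ?RintZ//; [rewrite (nonlocal_weak gu hpsi).2 mulrA|exact: intgZ].
by move=> x; rewrite /step mulrBl mulrA.
Qed.

Lemma step_mass M u : good M u -> \int[mu]_x step tau u x = \int[mu]_x u x.
Proof.
move=> gu.
have m1 : meas_bd (1 : R) (fun _ : T => 1) by split => // x; rewrite normr1.
have := step_weak gu m1.
rewrite (eq_Rint _ (fun x => mulr1 (step tau u x))) (eq_Rint _ (fun x => mulr1 (u x))).
move=> ->; rewrite [X in _ - _ * X](@eq_Rint _ _ _ _ _ (fun=> 0)); last first.
  by move=> z; rewrite subrr mulr0.
by rewrite /Rintegral integral0/= mulr0 subr0.
Qed.

Lemma good_max M M' u v : good M u -> good M' v ->
  good (Num.max M M') (fun x => Num.max (u x) (v x)).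
Proof.
move=> [mu_ uM iu] [mv vM iv].
have m : measurable_fun setT (fun x => Num.max (u x) (v x)) by exact: measurable_maxr.
split => //.
  move=> x; have /andP[u1 u2] := uM x; have /andP[v1 v2] := vM x.
  by rewrite le_max u1 /= ge_max !le_max u2 v2 orbT.
apply: (@intg_dom _ _ _ _ _ (fun x => u x + v x)) => //; last exact: intgD.
move=> x; have /andP[u1 u2] := uM x; have /andP[v1 v2] := vM x.
by rewrite ger0_norm ?le_max ?u1// ge_max lerDl lerDr v1 u1.
Qed.

Lemma intg_posB u v : intg mu u -> intg mu v ->
  intg mu (fun x => Num.max (u x - v x) 0).
Proof.
move=> iu iv; have iuv := intgB iu iv.
apply: (intg_dom _ _ (intg_norm iuv)).
  by apply: measurable_maxr => //; exact: intg_measurable iuv.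
move=> x; rewrite ger0_norm ?le_max ?lexx ?orbT//.
by rewrite ge_max ler_norm normr_ge0.
Qed.

(** The argument of Crandall and Tartar: [(u - v)^+ = max u v - v], and the step
    preserves the integrals of both terms and the order between [max u v] and
    [u], [v]. *)
Lemma step_Tcontr M M' u v : good M u -> good M' v ->
  \int[mu]_x Num.max (step tau u x - step tau v x) 0 <=
  \int[mu]_x Num.max (u x - v x) 0.
Proof.
move=> gu gv; have gw := good_max gu gv.
set w := fun x => Num.max (u x) (v x) in gw.
have [_ _ isu] := step_good gu; have [_ _ isv] := step_good gv.
have [_ _ isw] := step_good gw.
have [_ _ iu] := gu; have [_ _ iv] := gv; have [_ _ iw] := gw.
rewrite [leRHS](@eq_Rint _ _ _ _ _ (fun x => w x - v x)); last first.
  move=> x; rewrite /w; have [?|?] := leP (u x) (v x).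
    by rewrite subrr; apply/max_idPr; rewrite subr_le0.
  by apply/max_idPl; rewrite subr_ge0 ltW.
rewrite RintB// -(step_mass gw) -(step_mass gv) -RintB//.
apply: le_Rint; [exact: intg_posB|exact: intgB|].
move=> x; rewrite ge_max; apply/andP; split.
  rewrite lerB//.
  have := @step_mono _ _ u w 0 (good_meas_bd gu) (good_meas_bd gw) _ x.
  by rewrite addr0; apply => y; rewrite addr0 /w le_max lexx.
rewrite subr_ge0.
have := @step_mono _ _ v w 0 (good_meas_bd gv) (good_meas_bd gw) _ x.
by rewrite addr0; apply => y; rewrite addr0 /w le_max lexx orbT.
Qed.

Lemma step_contr M M' u v : good M u -> good M' v ->
  \int[mu]_x `|step tau u x - step tau v x| <= \int[mu]_x `|u x - v x|.
Proof.
have E f h : intg mu f -> intg mu h -> \int[mu]_x `|f x - h x| =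
    \int[mu]_x Num.max (f x - h x) 0 + \int[mu]_x Num.max (h x - f x) 0.
  move=> fi hi; rewrite -RintD; [|exact: intg_posB|exact: intg_posB].
  apply: eq_Rint => x; have [fh|hf] := leP (f x) (h x).
    rewrite ler0_norm ?subr_le0// (max_idPr _) ?subr_le0// (max_idPl _) ?subr_ge0//.
    by rewrite add0r opprB.
  have /ltW fh := hf.
  rewrite ger0_norm ?subr_ge0// (max_idPl _) ?subr_ge0// (max_idPr _) ?subr_le0//.
  by rewrite addr0.
move=> gu gv.
have [_ _ isu] := step_good gu; have [_ _ isv] := step_good gv.
have [_ _ iu] := gu; have [_ _ iv] := gv.
by rewrite !E//; apply: lerD; [exact: step_Tcontr gu gv|exact: step_Tcontr gv gu].
Qed.

Lemma step_sup B B' u v c : meas_bd B u -> meas_bd B' v ->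
  (forall y, `|u y - v y| <= c) -> forall x, `|step tau u x - step tau v x| <= c.
Proof.
move=> gu gv uv x; rewrite ler_norml.
have h1 := @step_mono _ _ u v c gu gv _ x.
have h2 := @step_mono _ _ v u c gv gu _ x.
have {}h1 : step tau u x <= step tau v x + c.
  by apply: h1 => y; have := uv y; rewrite ler_norml => /andP[]; lra.
have {}h2 : step tau v x <= step tau u x + c.
  by apply: h2 => y; have := uv y; rewrite ler_norml => /andP[]; lra.
by apply/andP; split; lra.
Qed.

Lemma le_nonlocal_L1 M u : good M u -> \int[mu]_x `|nonlocal u x| <= 2 * (L * kap) * \int[mu]_x u x.
Proof.
move=> gu; have [mu_ uM iu] := gu.
have iF := flux_intg gu.
have i1 := intg_fst_k iu; have i2 := intg_snd_k iu.
have sec x : intg mu (fun y => `|flux u (x, y)|).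
  by apply: intg_norm; exact: (flux_sec x (good_meas_bd gu)).
have [h1 h2] := Rfubini12 (intg_norm iF) sec.
apply: (@le_trans _ _ (\int[mu]_x \int[mu]_y `|flux u (x, y)|)).
  apply: le_Rint => //; first by apply: intg_norm; exact: nonlocal_intg gu.
  by move=> x; apply: le_norm_Rint; exact: (flux_sec x (good_meas_bd gu)).
rewrite h2.
apply: (@le_trans _ _ (\int[(mu \x mu)%E]_z (L * (u z.1 * k z + u z.2 * k z)))).
  apply: le_Rint; [exact: intg_norm|by apply: intgZ; exact: intgD|].
  move=> z; rewrite /flux normrM (ger0_norm (k0 _)) -mulrDl mulrA ler_wpM2r//.
  apply: (le_trans (g_bd _)); rewrite ler_wpM2l//.
  exact: (dist_itvD (uM z.1) (uM z.2)).
rewrite RintZ; last exact: intgD.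
rewrite RintD//.
have -> : \int[(mu \x mu)%E]_z (u z.2 * k z) = \int[(mu \x mu)%E]_z (u z.1 * k z).
  rewrite -(Rint_swap i1); apply: eq_Rint => z /=.
  by rewrite ksym -surjective_pairing.
have := le_Rint_fst_k iu (fun x => proj1 (andP (uM x))).
move=> h; rewrite (_ : _ + _ = 2 * \int[(mu \x mu)%E]_z (u z.1 * k z)); last by ring.
rewrite mulrCA -!mulrA ler_wpM2l//.
by rewrite ler_wpM2l//.
Qed.

End Scheme.

(** * Iterated steps: substeps, and comparison of two operators *)

Lemma half_opp (R : realType) (x y eta : R) :
  x <= eta + eta -> - x <= y -> - eta <= 2^-1 * y.
Proof. lra. Qed.

Lemma sqr_balance (R : realType) (a b c tau eta q : R) : 0 <= tau ->
  - eta <= b -> c <= q ->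
  a - 2 * tau * b + tau ^+ 2 * c <= a + 2 * tau * eta + tau ^+ 2 * q.
Proof.
move=> t0 eb cq.
have := ler_wpM2l t0 eb; have := ler_wpM2l (sqr_ge0 tau) cq; lra.
Qed.

Lemma cross_bound (R : realType) (c c' a b : R) : 0 <= c -> 0 <= c' -> 0 <= a ->
  0 <= b -> 2 * c * a + 2 * c' * b <= 2 * (c + c') * (a + b).
Proof.
move=> c0 c'0 a0 b0.
by have := mulr_ge0 c0 b0; have := mulr_ge0 c'0 a0; lra.
Qed.

Lemma monotone_defect (R : realType) (p q r k l d e a b : R) :
  0 <= (p - q) * k * d -> `|(q * k - r * l) * d| <= e * (a + b) ->
  - 1 * (e * a + e * b) <= p * k * d - r * l * d.
Proof. by rewrite ler_norml => h /andP[]; lra. Qed.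

Section Iterates.
Context d (T : measurableType d) (R : realType).
Variable (mu : {sigma_finite_measure set T -> \bar R}).
Variables (g : R -> R) (L : R) (k : T * T -> R) (kap : R).
Hypothesis Sc : is_scheme mu g L k kap.
Implicit Types u v psi : T -> R.
Local Notation nonlocal := (nonlocal mu g k).
Local Notation step := (step mu g k).
Local Notation good := (good mu).
Let c := L * kap.
Let c0 : 0 <= c. Proof. by rewrite mulr_ge0// (sc_L0 Sc, sc_kap0 Sc). Qed.

Variable tau : R.
Hypotheses (tau_ge0 : 0 <= tau) (cfl : tau * (L * kap) <= 1).

Lemma iter_good M u n : good M u -> good M (iter n (step tau) u).
Proof. by move=> gu; elim: n => //= n ih; exact: (step_good Sc tau_ge0 cfl ih). Qed.

Lemma iter_mass M u n : good M u -> \int[mu]_x iter n (step tau) u x = \int[mu]_x u x.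
Proof.
move=> gu; elim: n => //= n <-.
exact: (step_mass Sc tau (iter_good n gu)).
Qed.

Lemma iter_Tcontr M M' u v n : good M u -> good M' v ->
  \int[mu]_x Num.max (iter n (step tau) u x - iter n (step tau) v x) 0 <=
  \int[mu]_x Num.max (u x - v x) 0.
Proof.
move=> gu gv; elim: n => //= n; apply: le_trans.
exact: (step_Tcontr Sc tau_ge0 cfl (iter_good n gu) (iter_good n gv)).
Qed.

Lemma iter_contr M M' u v n : good M u -> good M' v ->
  \int[mu]_x `|iter n (step tau) u x - iter n (step tau) v x| <=
  \int[mu]_x `|u x - v x|.
Proof.
move=> gu gv; elim: n => //= n; apply: le_trans.
exact: (step_contr Sc tau_ge0 cfl (iter_good n gu) (iter_good n gv)).
Qed.

Lemma iter_move M u n m : good M u ->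
  \int[mu]_x `|iter (n + m) (step tau) u x - iter n (step tau) u x| <=
  m%:R * (tau * (2 * c * \int[mu]_x u x)).
Proof.
move=> gu; elim: m => [|m ih].
  rewrite addn0 (@eq_Rint _ _ _ _ _ (fun=> 0)); last by move=> x; rewrite subrr normr0.
  by rewrite /Rintegral integral0 mul0r.
have gn := iter_good n gu; have gnm := iter_good (n + m) gu; have gnm1 := iter_good (n + m).+1 gu.
have [_ _ i1] := gn; have [_ _ i2] := gnm; have [_ _ i3] := gnm1.
rewrite addnS -natr1 mulrDl mul1r.
set U := fun n => iter n (step tau) u.
apply: (@le_trans _ _ (\int[mu]_x (`|U (n + m)%N x - U n x| + tau * `|nonlocal (U (n + m)%N) x|))).
  apply: le_Rint.
  - by apply: intg_norm; exact: intgB.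
  - by apply: intgD; [by apply: intg_norm; exact: intgB|apply: intgZ; apply: intg_norm; exact: (nonlocal_intg Sc gnm)].
  move=> x; rewrite /U iterS stepE -/(U (n + m)%N).
  rewrite (_ : _ - _ = (U (n + m)%N x - U n x) - tau * nonlocal (U (n + m)%N) x); last by rewrite /U; ring.
  by rewrite (le_trans (ler_normB _ _))// lerD2l normrM (ger0_norm tau_ge0).
have iA := intg_norm (nonlocal_intg Sc gnm).
rewrite RintD; [|by apply: intg_norm; exact: intgB|exact: intgZ].
rewrite lerD// RintZ// ler_wpM2l//.
by rewrite -(iter_mass (n + m) gu); exact: (le_nonlocal_L1 Sc gnm).
Qed.

Lemma iter_move_sup M u n m x : good M u ->
  `|iter (n + m) (step tau) u x - iter n (step tau) u x| <=
  m%:R * (tau * (c * M)).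
Proof.
move=> gu; elim: m => [|m ih].
  by rewrite addn0 subrr normr0 mul0r.
rewrite addnS iterS stepE -natr1 mulrDl mul1r.
have gn := iter_good (n + m) gu.
set w := iter (n + m) _ u in ih gn *.
rewrite (_ : _ - _ = (w x - iter n (step tau) u x) - tau * nonlocal w x); last by ring.
rewrite (le_trans (ler_normB _ _))// lerD// normrM (ger0_norm tau_ge0).
rewrite ler_wpM2l//; apply: (le_trans (le_nonlocal Sc x gn)).
by rewrite /c mulrAC.
Qed.

End Iterates.

Section Substeps.
Context d (T : measurableType d) (R : realType).
Variable (mu : {sigma_finite_measure set T -> \bar R}).
Variables (g : R -> R) (L : R) (k : T * T -> R) (kap : R).
Hypothesis Sc : is_scheme mu g L k kap.
Implicit Types u v psi : T -> R.
Local Notation nonlocal := (nonlocal mu g k).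
Local Notation step := (step mu g k).
Local Notation good := (good mu).
Let c := L * kap.
Let c0 : 0 <= c. Proof. by rewrite mulr_ge0// (sc_L0 Sc, sc_kap0 Sc). Qed.

Variables (tau tau' : R) (q : nat).
Hypotheses (tau'_ge0 : 0 <= tau') (cfl : tau * (L * kap) <= 1)
  (q0 : (0 < q)%N) (tauE : tau = q%:R * tau').

Let tau_ge0 : 0 <= tau. Proof. by rewrite tauE mulr_ge0. Qed.
Let cfl' : tau' * (L * kap) <= 1.
Proof.
apply: le_trans cfl; rewrite ler_wpM2r//.
by rewrite tauE ler_peMl// ler1n.
Qed.

(** Over [q] small steps the solution moves by [O(tau)], hence the operator
    varies by [O(tau)], and its accumulated effect by [O(tau ^ 2)]. *)
Lemma substep_err M u x : good M u ->
  `|iter q (step tau') u x - step tau u x| <= 2 * tau ^+ 2 * c ^+ 2 * M.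
Proof.
move=> gu.
have M0 : 0 <= M by have [_ /(_ x) /andP[h1 h2] _] := gu; exact: le_trans h2.
have gi i := iter_good Sc tau'_ge0 cfl' i gu.
have h1 i y : `|iter i (step tau') u y - u y| <= i%:R * (tau' * (c * M)).
  exact: (iter_move_sup Sc tau'_ge0 cfl' 0 i y gu).
have h2 i : (i <= q)%N -> `|iter i (step tau') u x - (u x - i%:R * tau' * nonlocal u x)| <=
    i%:R * (tau' * (L * (2 * (tau * (c * M))) * kap)).
  elim: i => [|i ih] iq; first by rewrite !mul0r subr0 subrr normr0.
  rewrite iterS stepE -natr1 !(mulrDl i%:R 1) !mul1r.
  have gw := gi i; have hw y := h1 i y.
  set w := iter i _ u in ih gw hw *.
  rewrite (_ : _ - _ = (w x - (u x - i%:R * tau' * nonlocal u x)) - tau' * (nonlocal w x - nonlocal u x)); last by ring.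
  apply: (le_trans (ler_normB _ _)); apply: lerD; first by rewrite ih// ltnW.
  rewrite normrM (ger0_norm tau'_ge0).
  rewrite ler_wpM2l//.
  apply: (nonlocal_lip Sc x (good_meas_bd gw) (good_meas_bd gu)) => y.
  have cM : 0 <= c * M by rewrite mulr_ge0.
  apply: le_trans (hw y) _; rewrite mulrA ler_wpM2r//.
  by rewrite tauE ler_wpM2r// ler_nat ltnW.
have := h2 q (leqnn q); rewrite -tauE => /le_trans; apply.
by rewrite mulrA -tauE /c le_eqVlt; apply/orP; left; apply/eqP; ring.
Qed.

(** The errors add up, because a step is nonexpansive in the sup norm. *)
Lemma substeps_err M u n x : good M u ->
  `|iter (n * q) (step tau') u x - iter n (step tau) u x| <=
  n%:R * (2 * tau ^+ 2 * c ^+ 2 * M).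
Proof.
move=> gu; elim: n x => [|n ih] x; first by rewrite mul0n subrr normr0 mul0r.
rewrite mulSn iterD iterS -natr1 mulrDl mul1r.
have gn := iter_good Sc tau_ge0 cfl n gu.
have gn' := iter_good Sc tau'_ge0 cfl' (n * q) gu.
set a := iter (n * q) _ u in ih gn' *; set b := iter n _ u in ih gn *.
rewrite (_ : _ - _ = (step tau a x - step tau b x) +
   (iter q (step tau') a x - step tau a x)); last by ring.
rewrite (le_trans (ler_normD _ _))// lerD//; last exact: substep_err.
exact: (step_sup Sc tau_ge0 cfl (good_meas_bd gn') (good_meas_bd gn) ih x).
Qed.

End Substeps.

Section TwoLevels.
Context d (T : measurableType d) (R : realType).
Variable (mu : {sigma_finite_measure set T -> \bar R}).
Variables (g : R -> R) (L : R) (k : T * T -> R) (kap : R).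
Hypothesis Sc : is_scheme mu g L k kap.
Variables (g' : R -> R) (L' : R) (k' : T * T -> R) (kap' : R).
Hypothesis Sc' : is_scheme mu g' L' k' kap'.
Implicit Types u v psi : T -> R.
Local Notation good := (good mu).
Let c := L * kap.
Let c' := L' * kap'.

Variable tau : R.
Hypotheses (tau_ge0 : 0 <= tau) (cfl : tau * (L * kap) <= 1)
  (cfl' : tau * (L' * kap') <= 1).
Variables (M : R) (e : T * T -> R).
Hypothesis (he : forall a z, `|a| <= M -> `|g a * k z - g' a * k' z| <= e z).

Lemma intg_sqr M1 (w : T -> R) : meas_bd M1 w -> intg mu w -> intg mu (fun x => w x ^+ 2).
Proof.
move=> [mw wM] iw; under eq_fun do rewrite expr2.
exact: (intg_mulb mw wM iw).
Qed.

(** In the expansion of the square the cross term is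
    [- 2 tau int (u - u') (A u - A' u')].  Symmetrised, it splits into the
    contribution of [g] and [k] alone, which has a sign by monotonicity of [g],
    and the defect between the two fluxes at [u'], bounded by [e]. *)
Lemma step_L2 u u' eta : good M u -> good M u' ->
    intg (mu \x mu)%E (fun z => e z * `|u z.1 - u z.2|) ->
    intg (mu \x mu)%E (fun z => e z * `|u' z.1 - u' z.2|) ->
    \int[(mu \x mu)%E]_z (e z * `|u z.1 - u z.2|) <= eta ->
    \int[(mu \x mu)%E]_z (e z * `|u' z.1 - u' z.2|) <= eta ->
  \int[mu]_x (step mu g k tau u x - step mu g' k' tau u' x) ^+ 2 <=
  \int[mu]_x (u x - u' x) ^+ 2 + 2 * tau * eta
   + tau ^+ 2 * (2 * (c + c') ^+ 2 * M * (\int[mu]_x u x + \int[mu]_x u' x)).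
Proof.
move=> gu gu' ie ie' he1 he2.
have [mu1 uM iu] := gu; have [mu2 u'M iu'] := gu'.
pose w x := u x - u' x.
have mw : meas_bd M w.
  split; first exact: measurable_funB.
  by move=> x; exact: (dist_itv (uM x) (u'M x)).
have iw : intg mu w by exact: intgB.
pose B x := nonlocal mu g k u x - nonlocal mu g' k' u' x.
have iAu := nonlocal_intg Sc gu; have iAu' := nonlocal_intg Sc' gu'.
have iB : intg mu B by exact: intgB.
have hB x : `|B x| <= (c + c') * M.
  apply: (le_trans (ler_normB _ _)); rewrite mulrDl.
  by apply: lerD; rewrite mulrAC; [exact: (le_nonlocal Sc x gu)|exact: (le_nonlocal Sc' x gu')].
have mB : meas_bd ((c + c') * M) B by split => //; exact: intg_measurable iB.
have iw2 := intg_sqr mw iw; have iB2 := intg_sqr mB iB.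
have iwB : intg mu (fun x => w x * B x) by exact: (intg_mulb mB.1 mB.2 iw).
rewrite (@eq_Rint _ _ _ _ _ (fun x => w x ^+ 2 - 2 * tau * (w x * B x) + tau ^+ 2 * B x ^+ 2)); last first.
  by move=> x; rewrite /step /w /B; ring.
rewrite RintD; [|by apply: intgB => //; exact: intgZ|exact: intgZ].
rewrite RintB//; last exact: intgZ.
rewrite !RintZ//.
have EB : \int[mu]_x B x ^+ 2 <= (c + c') * M * (2 * (c + c') * (\int[mu]_x u x + \int[mu]_x u' x)).
  apply: (@le_trans _ _ (\int[mu]_x ((c + c') * M * (`|nonlocal mu g k u x| + `|nonlocal mu g' k' u' x|)))).
    apply: le_Rint => //; first by apply: intgZ; apply: intgD; exact: intg_norm.
    move=> x; rewrite -[leLHS]ger0_norm ?sqr_ge0// normrX expr2 ler_pM//.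
    exact: ler_normB.
  have cc0 : 0 <= (c + c') * M.
    case: (pselect (exists x : T, True)) => [[x _]|nx]; first exact: le_trans (hB x).
    exfalso; apply: nx; exists point => //.
  rewrite RintZ; last by apply: intgD; exact: intg_norm.
  rewrite ler_wpM2l// RintD; [|exact: intg_norm|exact: intg_norm].
  have I0 : 0 <= \int[mu]_x u x by apply: Rint_ge0 => x; case/andP: (uM x).
  have I'0 : 0 <= \int[mu]_x u' x by apply: Rint_ge0 => x; case/andP: (u'M x).
  have a1 := le_nonlocal_L1 Sc gu; have a2 := le_nonlocal_L1 Sc' gu'.
  have c0 : 0 <= c by rewrite /c mulr_ge0// (sc_L0 Sc, sc_kap0 Sc).
  have c'0 : 0 <= c' by rewrite /c' mulr_ge0// (sc_L0 Sc', sc_kap0 Sc').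
  apply: (le_trans (lerD a1 a2)); rewrite -/c -/c'.
  exact: cross_bound.
have EW : - eta <= \int[mu]_x (w x * B x).
  have iFu := nonlocal_weak Sc gu mw; have iFu' := nonlocal_weak Sc' gu' mw.
  have ia : intg mu (fun x => nonlocal mu g k u x * w x) by exact: (intg_mulb mw.1 mw.2 iAu).
  have ia' : intg mu (fun x => nonlocal mu g' k' u' x * w x) by exact: (intg_mulb mw.1 mw.2 iAu').
  rewrite (@eq_Rint _ _ _ _ _ (fun x => nonlocal mu g k u x * w x - nonlocal mu g' k' u' x * w x)); last first.
    by move=> x; rewrite /B; ring.
  rewrite RintB// iFu.2 iFu'.2 -mulrBr -RintB; [|exact: iFu.1|exact: iFu'.1].
  set Y := \int[_]_z (_ - _).
  pose X := \int[(mu \x mu)%E]_z (e z * `|u z.1 - u z.2| + e z * `|u' z.1 - u' z.2|).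
  have hX : X <= eta + eta by rewrite /X RintD// lerD.
  suff hY : - X <= Y by exact: half_opp hX hY.
  rewrite /X /Y -mulN1r -RintZ; last exact: intgD.
  apply: le_Rint; [by apply: intgZ; exact: intgD|exact: (intgB iFu.1 iFu'.1)|].
  move=> z.
  have -> : w z.1 - w z.2 = (u z.1 - u z.2) - (u' z.1 - u' z.2) by rewrite /w; ring.
  rewrite /flux.
  have := dist_itv (u'M z.1) (u'M z.2).
  move: (u z.1 - u z.2) (u' z.1 - u' z.2) => a a' /(he z) ha'.
  have mono : 0 <= (g a - g a') * k z * (a - a').
    rewrite mulrAC mulr_ge0// ?(sc_k0 Sc)//.
    have [aa|/ltW aa] := leP a a'.
      by rewrite mulr_le0// subr_le0// (sc_nd Sc).
    by rewrite mulr_ge0// subr_ge0// (sc_nd Sc).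
  have d1 : `|(g a' * k z - g' a' * k' z) * (a - a')| <= e z * (`|a| + `|a'|).
    by rewrite normrM ler_pM// ler_normB.
  exact: (monotone_defect mono d1).
apply: sqr_balance => //; apply: (le_trans EB).
by rewrite le_eqVlt; apply/orP; left; apply/eqP; ring.
Qed.

Lemma iter_L2 v eta n : good M v ->
    (forall i, intg (mu \x mu)%E (fun z => e z *
       `|iter i (step mu g k tau) v z.1 - iter i (step mu g k tau) v z.2|)) ->
    (forall i, intg (mu \x mu)%E (fun z => e z *
       `|iter i (step mu g' k' tau) v z.1 - iter i (step mu g' k' tau) v z.2|)) ->
    (forall i, \int[(mu \x mu)%E]_z (e z *
       `|iter i (step mu g k tau) v z.1 - iter i (step mu g k tau) v z.2|) <= eta) ->
    (forall i, \int[(mu \x mu)%E]_z (e z *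
       `|iter i (step mu g' k' tau) v z.1 - iter i (step mu g' k' tau) v z.2|) <= eta) ->
  \int[mu]_x (iter n (step mu g k tau) v x - iter n (step mu g' k' tau) v x) ^+ 2 <=
  n%:R * (2 * tau * eta + tau ^+ 2 * (4 * (c + c') ^+ 2 * M * \int[mu]_x v x)).
Proof.
move=> gv i1 i2 h1 h2; elim: n => [|n ih].
  rewrite (@eq_Rint _ _ _ _ _ (fun=> 0)) ?mul0r.
    by rewrite /Rintegral integral0.
  by move=> x; rewrite subrr expr0n.
have gn := iter_good Sc tau_ge0 cfl n gv; have gn' := iter_good Sc' tau_ge0 cfl' n gv.
have := step_L2 gn gn' (i1 n) (i2 n) (h1 n) (h2 n).
rewrite (iter_mass Sc tau_ge0 cfl n gv) (iter_mass Sc' tau_ge0 cfl' n gv) !iterS.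
rewrite -natr1 mulrDl mul1r; lra.
Qed.

End TwoLevels.

(** * Translation invariance of the scheme *)

(** The additive group structure of R^N, reduced to what convolution kernels
    require. *)
Record is_translation d (T : measurableType d) (R : realType)
    (mu : {sigma_finite_measure set T -> \bar R}) (add sub : T -> T -> T) : Prop :=
  IsTranslation {
  tr_madd : measurable_fun setT (fun z : T * T => add z.1 z.2);
  tr_msub : measurable_fun setT (fun z : T * T => sub z.1 z.2);
  tr_addC : forall x y, add x y = add y x;
  tr_addK : forall x y, sub (add x y) y = x;
  tr_subD : forall x y h, sub (add x h) (add y h) = sub x y;
  tr_inv : forall h (f : T -> \bar R), measurable_fun setT f ->
    (forall x, 0 <= f x)%E -> (\int[mu]_x f (add x h) = \int[mu]_x f x)%E }.

Section TranslationSeminorm.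
Context d (T : measurableType d) (R : realType).
Variables (mu : {sigma_finite_measure set T -> \bar R}) (add sub : T -> T -> T).
Hypothesis Tr : is_translation mu add sub.
Implicit Types (e u v f : T -> R).

Lemma measurable_shift1 h : measurable_fun setT (fun x : T => add x h).
Proof. exact: (measurableT_comp (tr_madd Tr) (pair2_measurable h)). Qed.

Lemma intg_shift h f : intg mu f -> intg mu (fun x => f (add x h)).
Proof.
move=> fi; have mf := intg_measurable fi.
have m1 : measurable_fun setT (fun x : T => `|(f x)%:E|%E).
  by apply: measurableT_comp => //; exact/measurable_EFinP.
apply/integrableP; split.
  by apply/measurable_EFinP; apply: measurableT_comp mf _; exact: measurable_shift1.
rewrite (tr_inv Tr h m1) //.
by case/integrableP: fi.
Qed.

Lemma Rint_shift h f : intg mu f -> \int[mu]_x f (add x h) = \int[mu]_x f x.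
Proof.
move=> fi; have mf : measurable_fun setT (EFin \o f).
  by apply/measurable_EFinP; exact: intg_measurable fi.
congr fine; rewrite integralE [RHS]integralE; congr (_ - _)%E.
  rewrite -[RHS](tr_inv Tr h) //; last exact: measurable_funepos.
  by apply: eq_integral => x _; rewrite !funeposE.
rewrite -[RHS](tr_inv Tr h) //; last exact: measurable_funeneg.
by apply: eq_integral => x _; rewrite !funenegE.
Qed.

Definition diff2 e u (z : T * T) : R := e (sub z.1 z.2) * `|u z.1 - u z.2|.

Lemma measurable_diff2 e u : measurable_fun setT e ->
  measurable_fun setT u -> measurable_fun setT (diff2 e u).
Proof.
move=> me mu_; apply: measurable_funM.
  exact: measurableT_comp me (tr_msub Tr).
by apply: measurableT_comp => //; exact: measurable_diff.
Qed.

Let measurable_incr e u : measurable_fun setT e -> measurable_fun setT u ->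
  measurable_fun setT (fun z : T * T => (e z.1 * `|u (add z.2 z.1) - u z.2|)%:E).
Proof.
move=> me mu_; apply/measurable_EFinP; apply: measurable_funM.
  by apply: measurableT_comp me _; exact: measurable_fst.
apply: measurableT_comp => //; apply: measurable_funB; apply: measurableT_comp mu_ _.
  rewrite (_ : (fun z : T * T => add z.2 z.1) = (fun z => add z.1 z.2)).
    exact: tr_madd Tr.
  by apply/funext => z; exact: tr_addC Tr _ _.
exact: measurable_snd.
Qed.

(** The seminorm is the mean, with density [e h], of the L1 norms of the
    differences [u (. + h) - u].  This is why L1 contractions that commute with
    translations decrease it. *)
Lemma diff2_translate e u : measurable_fun setT e ->
    (forall z, 0 <= e z) -> measurable_fun setT u ->
  (\int[mu \x mu]_z (diff2 e u z)%:E =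
   \int[mu]_h \int[mu]_y ((e h * `|u (add y h) - u y|)%R%:E))%E.
Proof.
move=> me e0 mu_.
have mD := measurable_diff2 me mu_.
have D0 z : (0 <= (diff2 e u z)%:E)%E by rewrite lee_fin mulr_ge0.
have mD' : measurable_fun setT (EFin \o diff2 e u) by exact/measurable_EFinP.
rewrite (fubini_tonelli2 (m1 := mu) (m2 := mu) (EFin \o diff2 e u) mD' D0).
pose f (z : T * T) : \bar R := (e z.1 * `|u (add z.2 z.1) - u z.2|)%:E.
have f0 z : (0 <= f z)%E by rewrite lee_fin mulr_ge0.
have mf : measurable_fun setT f by exact: measurable_incr.
rewrite -[RHS]/(\int[mu]_h \int[mu]_y f (h, y))%E.
rewrite (fubini_tonelli (m1 := mu) (m2 := mu) f mf f0).
apply: eq_integral => y _; rewrite /fubini_G.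
have mDy : measurable_fun setT (fun x => (EFin \o diff2 e u) (x, y)).
  by apply: measurableT_comp mD' _; exact: pair2_measurable.
rewrite -(tr_inv Tr y mDy); last by move=> x; exact: D0.
by apply: eq_integral => x _; rewrite /f /diff2 /= (tr_addK Tr) (tr_addC Tr).
Qed.

Lemma diff2_contr e u v : measurable_fun setT e ->
    (forall z, 0 <= e z) -> intg mu u -> intg mu v ->
    (forall h, \int[mu]_y `|u (add y h) - u y| <= \int[mu]_y `|v (add y h) - v y|) ->
    intg (mu \x mu)%E (diff2 e v) ->
  intg (mu \x mu)%E (diff2 e u) /\
  \int[(mu \x mu)%E]_z diff2 e u z <= \int[(mu \x mu)%E]_z diff2 e v z.
Proof.
move=> me e0 iu iv hc ie.
have mu_ := intg_measurable iu; have mv := intg_measurable iv.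
have D0 w z : 0 <= diff2 e w z by rewrite mulr_ge0.
have iw (w : T -> R) h : intg mu w -> intg mu (fun y => `|w (add y h) - w y|).
  by move=> iw; apply: intg_norm; apply: intgB => //; exact: intg_shift.
have E (w : T -> R) h : intg mu w ->
    (\int[mu]_y ((e h * `|w (add y h) - w y|)%R%:E) =
    (e h * \int[mu]_y `|w (add y h) - w y|)%R%:E)%E.
  by move=> /(iw _ h) ih; rewrite -RintZ// -Rint_fine//; exact: intgZ.
have M (w : T -> R) : measurable_fun setT w ->
    measurable_fun setT (fun h => (\int[mu]_y ((e h * `|w (add y h) - w y|)%R%:E))%E).
  move=> mw.
  pose f (z : T * T) : \bar R := (e z.1 * `|w (add z.2 z.1) - w z.2|)%:E.
  apply: (measurable_fun_fubini_tonelli_F (m2 := mu) f); last first.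
    by move=> z; rewrite lee_fin mulr_ge0.
  exact: measurable_incr.
have L : (\int[mu \x mu]_z (diff2 e u z)%:E <= \int[mu \x mu]_z (diff2 e v z)%:E)%E.
  rewrite (diff2_translate me e0 mu_) (diff2_translate me e0 mv).
  apply: ge0_le_integral => //.
  - by move=> h _; apply: integral_ge0 => y _; rewrite lee_fin mulr_ge0.
  - exact: M.
  - exact: M.
  - by move=> h _; rewrite !E// lee_fin ler_wpM2l.
have ieu : intg (mu \x mu)%E (diff2 e u).
  apply/intg_ge0P => //; first exact: measurable_diff2.
  by apply: le_lt_trans L _; exact: integrable_lty ie.
split => //.
by rewrite -lee_fin (Rint_fine ieu) (Rint_fine ie).
Qed.

Definition translate (h : T) (u : T -> R) : T -> R := fun x => u (add x h).

Variables (g : R -> R) (L : R) (k : T -> R) (kap : R).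
Hypothesis Sc : is_scheme mu g L (fun z => k (sub z.1 z.2)) kap.
Local Notation stp tau := (step mu g (fun z => k (sub z.1 z.2)) tau).

Lemma step_shift tau h u B : meas_bd B u -> stp tau (translate h u) = translate h (stp tau u).
Proof.
move=> mbu; apply/funext => x; rewrite /translate !stepE; congr (_ - _ * _).
have iF := flux_sec Sc (add x h) mbu.
rewrite /nonlocal -(Rint_shift h iF).
by apply: eq_Rint => y; rewrite /flux /= (tr_subD Tr).
Qed.

Lemma good_shift M h u : good mu M u -> good mu M (translate h u).
Proof.
move=> [mu_ uM iu]; split.
- by apply: measurableT_comp mu_ _; exact: measurable_shift1.
- by move=> x; exact: uM.
- exact: intg_shift.
Qed.

Variable (tau : R).
Hypotheses (tau_ge0 : 0 <= tau) (cfl : tau * (L * kap) <= 1).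

Lemma iter_shift M n h u : good mu M u ->
  iter n (stp tau) (translate h u) = translate h (iter n (stp tau) u).
Proof.
move=> gu; elim: n => //= n ->.
by apply: step_shift; exact: good_meas_bd (iter_good Sc tau_ge0 cfl n gu).
Qed.

Lemma iter_diff2 M n v e : measurable_fun setT e ->
    (forall z, 0 <= e z) -> good mu M v -> intg (mu \x mu)%E (diff2 e v) ->
  intg (mu \x mu)%E (diff2 e (iter n (stp tau) v)) /\
  \int[(mu \x mu)%E]_z diff2 e (iter n (stp tau) v) z <=
  \int[(mu \x mu)%E]_z diff2 e v z.
Proof.
move=> me e0 gv ie.
have gn := iter_good Sc tau_ge0 cfl n gv.
have [_ _ iv] := gv; have [_ _ iu] := gn.
apply: diff2_contr => // h.
have := iter_contr Sc tau_ge0 cfl n (good_shift h gv) gv.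
by rewrite (iter_shift n h gv).
Qed.

End TranslationSeminorm.

(** * Comparison of truncation levels *)

Lemma two_levels_arith (R : realType) (q eta tau x y MI nt : R) :
  0 <= nt -> 0 <= MI -> 0 <= eta -> 0 <= tau -> tau * x <= y -> q = nt * tau ->
  nt * (2 * tau * eta + tau ^+ 2 * (4 * (4 * x) * MI)) <= q * (2 * eta + 16 * y * MI).
Proof.
move=> n0 M0 e0 t0 xy ->.
rewrite (_ : nt * _ = nt * tau * (2 * eta + 16 * (tau * x) * MI)); last by ring.
rewrite ler_wpM2l ?mulr_ge0// lerD2l ler_wpM2r// ler_wpM2l//.
Qed.

Lemma sqr_split (R : realType) (a b c : R) :
  (a - c) ^+ 2 <= 2 * (a - b) ^+ 2 + 2 * (b - c) ^+ 2.
Proof.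
rewrite -subr_ge0 (_ : _ - _ = (a - 2 * b + c) ^+ 2) ?sqr_ge0//; ring.
Qed.

Section Levels.
Context d (T : measurableType d) (R : realType).
Variables (mu : {sigma_finite_measure set T -> \bar R}) (add sub : T -> T -> T).
Hypothesis Tr : is_translation mu add sub.
Variables (Ph : nat -> R -> R) (km : nat -> T -> R) (kap : nat -> R).
Hypothesis Scm : forall m,
  is_scheme mu (Ph m) m%:R (fun z => km m (sub z.1 z.2)) (kap m).
Hypothesis kap_nd : forall m n, (m <= n)%N -> kap m <= kap n.
Local Notation stp m tau := (step mu (Ph m) (fun z => km m (sub z.1 z.2)) tau).

(** Up to constants, the speed of the scheme of level [m], in the sup norm as in L1. *)
Definition scheme_cst (m : nat) : R := m%:R * kap m.

Lemma scheme_cst_ge0 m : 0 <= scheme_cst m.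
Proof. by rewrite mulr_ge0//; exact: sc_kap0 (Scm m). Qed.

Lemma scheme_cst_nd m n : (m <= n)%N -> scheme_cst m <= scheme_cst n.
Proof.
move=> mn; rewrite /scheme_cst ler_pM//; [exact: sc_kap0 (Scm m)|by rewrite ler_nat|exact: kap_nd].
Qed.

(** Steps of the form [2 ^- j] make the time grids of all levels nested; the
    exponent is chosen so that even [tau m * scheme_cst m ^+ 2] is at most
    [2 ^- m]. *)
Definition step_exp (m : nat) : nat := (Num.trunc ((1 + scheme_cst m) ^+ 2 * 2 ^+ m)).+1.

Lemma step_exp_nd m n : (m <= n)%N -> (step_exp m <= step_exp n)%N.
Proof.
move=> mn; rewrite /step_exp ltnS; apply: le_truncn.
have h1 : 0 <= 1 + scheme_cst m by rewrite addr_ge0// scheme_cst_ge0.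
have h2 : 1 + scheme_cst m <= 1 + scheme_cst n by rewrite lerD2l scheme_cst_nd.
apply: ler_pM; rewrite ?sqr_ge0 ?exprn_ge0//.
  by rewrite lerXn2r// nnegrE// (le_trans h1).
by rewrite ler_weXn2l// ler1n.
Qed.

Definition tau (m : nat) : R := (2 ^+ step_exp m)^-1.

Lemma tau_gt0 m : 0 < tau m. Proof. by rewrite invr_gt0 exprn_gt0. Qed.

Lemma tau_small m : tau m * (1 + scheme_cst m) ^+ 2 <= (2 ^+ m)^-1.
Proof.
have p2 (k : nat) : 0 < 2 ^+ k :> R by rewrite exprn_gt0.
rewrite /tau ler_pdivrMl// ler_pdivlMr//.
apply: (le_trans (ltW (truncnS_gt _))); rewrite -/(step_exp m) -natrX ler_nat ltnW//.
exact: ltn_expl.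
Qed.

Lemma tau_cst2 m : tau m * scheme_cst m ^+ 2 <= (2 ^+ m)^-1.
Proof.
apply: le_trans (tau_small m); rewrite ler_wpM2l ?(ltW (tau_gt0 _))//.
by have := scheme_cst_ge0 m; rewrite -subr_ge0 sqrrD expr1n mul1r => ?; lra.
Qed.

Lemma tau_cst m : tau m * scheme_cst m <= (2 ^+ m)^-1.
Proof.
apply: le_trans (tau_small m); rewrite ler_wpM2l ?(ltW (tau_gt0 _))//.
have := scheme_cst_ge0 m; have := sqr_ge0 (scheme_cst m); rewrite sqrrD expr1n mul1r => ? ?; lra.
Qed.

Lemma inv2X_le1 (m : nat) : (2 ^+ m)^-1 <= 1 :> R.
Proof. by rewrite invf_le1 ?exprn_gt0// exprn_ege1// ler1n. Qed.

Lemma tau_le m : tau m <= (2 ^+ m)^-1.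
Proof.
apply: le_trans (tau_small m); rewrite ler_peMr ?(ltW (tau_gt0 _))//.
by have := scheme_cst_ge0 m; have := sqr_ge0 (scheme_cst m); rewrite sqrrD expr1n mul1r => ? ?; lra.
Qed.

Lemma cfl_m m : tau m * (m%:R * kap m) <= 1.
Proof. exact: le_trans (tau_cst m) (inv2X_le1 m). Qed.

Lemma cfl_mn m n : (m <= n)%N -> tau n * (m%:R * kap m) <= 1.
Proof.
move=> mn; apply: le_trans (cfl_m n); rewrite ler_wpM2l ?(ltW (tau_gt0 _))//.
exact: scheme_cst_nd mn.
Qed.

Lemma tau_ratio m n : (m <= n)%N -> tau m = (2 ^ (step_exp n - step_exp m))%N%:R * tau n.
Proof.
move=> mn; have E : 2 ^+ step_exp n = 2 ^+ (step_exp n - step_exp m) * 2 ^+ step_exp m :> R.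
  by rewrite -exprD subnK// step_exp_nd.
by rewrite /tau natrX E invfM mulrA divff ?mul1r// expf_neq0.
Qed.

Definition idx (m : nat) (t : R) : nat := Num.trunc (t * 2 ^+ step_exp m).

Lemma idx_tau m t : 0 <= t -> (idx m t)%:R * tau m <= t.
Proof.
move=> t0; rewrite /tau ler_pdivrMr ?exprn_gt0//.
by have /andP[] := truncn_itv (mulr_ge0 t0 (exprn_ge0 (step_exp m) (ler0n R 2))).
Qed.

Lemma idx_tauS m t : 0 <= t -> t < (idx m t).+1%:R * tau m.
Proof.
by move=> t0; rewrite /tau ltr_pdivlMr ?exprn_gt0// truncnS_gt.
Qed.

Lemma idx_ratio m n t : 0 <= t -> (m <= n)%N ->
  let q := (2 ^ (step_exp n - step_exp m))%N in
  (idx m t * q <= idx n t)%N /\ (idx n t - idx m t * q <= q)%N.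
Proof.
move=> t0 mn q.
have h1 := idx_tau m t0; have h2 := idx_tauS n t0.
have h3 := idx_tau n t0; have h4 := idx_tauS m t0.
have tn := tau_gt0 n.
have E := tau_ratio mn; rewrite -/q in E.
split.
  rewrite -ltnS -(ltr_nat R) -(ltr_pM2r tn) natrM -mulrA -E.
  exact: le_lt_trans h2.
rewrite leq_subLR -mulSnr -(ler_nat R) -(ler_pM2r tn) natrM -mulrA -E.
exact: le_trans h3 (ltW h4).
Qed.

Definition euler_flow (m : nat) (t : R) (v : T -> R) : T -> R :=
  iter (idx m t) (stp m (tau m)) v.

Lemma euler_flow0 m v : euler_flow m 0 v = v.
Proof. by rewrite /euler_flow /idx mul0r truncn0. Qed.

Lemma euler_flow_good M m t v : good mu M v -> good mu M (euler_flow m t v).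
Proof. by move=> gv; exact: (iter_good (Scm m) (ltW (tau_gt0 m)) (cfl_m m) _ gv). Qed.

Section Cauchy.
Variables (M : R) (e : nat -> T -> R) (v : T -> R).
Hypotheses (me : forall m, measurable_fun setT (e m)) (e0 : forall m z, 0 <= e m z)
  (he : forall m n a z, (m <= n)%N -> `|a| <= M ->
     `|Ph m a * km m z - Ph n a * km n z| <= e m z)
  (gv : good mu M v) (ie : forall m, intg (mu \x mu)%E (diff2 sub (e m) v)).

Let I := \int[mu]_x v x.
Let eta m := \int[(mu \x mu)%E]_z diff2 sub (e m) v z.

(** Two comparisons.  Changing the time step at the fixed level [m] costs
    [O(2 ^- m)] in the sup norm, including the steps needed to reach the last grid
    point of level [n].  At equal time step [tau n], the
    levels [m] and [n] are compared in L2 by [iter_L2]. *)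
Lemma cauchy_bound m n t : (m <= n)%N -> 0 <= t ->
  \int[mu]_x (euler_flow m t v x - euler_flow n t v x) ^+ 2 <=
  2 * ((2 * t + 1) * M * (2 ^+ m)^-1 * (2 * I)) +
  2 * (t * (2 * eta m + 16 * (2 ^+ m)^-1 * (M * I))).
Proof.
move=> mn t0.
have [mv vM iv] := gv.
have M0 : 0 <= M by have /andP[h1 h2] := vM point; exact: le_trans h2.
have I0 : 0 <= I by apply: Rint_ge0 => x; case/andP: (vM x).
have tm := tau_gt0 m; have tn := tau_gt0 n.
pose q := (2 ^ (step_exp n - step_exp m))%N.
have q0 : (0 < q)%N by rewrite expn_gt0.
have tE : tau m = q%:R * tau n by exact: tau_ratio.
have [iq1 iq2] := idx_ratio t0 mn; rewrite -/q in iq1 iq2.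
pose U := euler_flow m t v; pose W := euler_flow n t v.
pose V := iter (idx m t * q) (stp m (tau n)) v.
pose V' := iter (idx n t) (stp m (tau n)) v.
have gU : good mu M U by exact: euler_flow_good.
have gW : good mu M W by exact: euler_flow_good.
have gV' : good mu M V' by exact: (iter_good (Scm m) (ltW tn) (cfl_mn mn) _ gv).
have [mU UM iU] := gU; have [mW WM iW] := gW; have [mV' V'M iV'] := gV'.
(* [2 * t] comes from the change of time step, [1] from the at most [q] fine steps after
   the last coarse one. *)
pose B := (2 * t + 1) * M * (2 ^+ m)^-1.
have B0 : 0 <= B by rewrite !mulr_ge0 ?addr_ge0 ?mulr_ge0// invr_ge0 exprn_ge0.
have hB x : `|U x - V' x| <= B.
  rewrite (_ : U x - V' x = - (V x - U x) - (V' x - V x)); last by ring.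
  rewrite (le_trans (ler_normB _ _))// normrN /B -!mulrA mulrDl mul1r lerD//.
    have := substeps_err (Scm m) (ltW tn) (cfl_m m) q0 tE (idx m t) x gv.
    move=> /le_trans; apply; rewrite -/(scheme_cst m).
    rewrite (_ : _ * _ = 2 * ((idx m t)%:R * tau m) * (M * (tau m * scheme_cst m ^+ 2))); last by ring.
    have p1 : 0 <= 2 * ((idx m t)%:R * tau m).
      by do 2 apply: mulr_ge0 => //; exact: (ltW tm).
    have p2 : 0 <= M * (tau m * scheme_cst m ^+ 2) by apply: mulr_ge0 => //; apply: mulr_ge0; [exact: (ltW tm)|exact: sqr_ge0].
    apply: ler_pM => //; first by rewrite ler_wpM2l// idx_tau.
    by rewrite ler_wpM2l// tau_cst2.
  have := iter_move_sup (Scm m) (ltW tn) (cfl_mn mn) (idx m t * q) (idx n t - idx m t * q) x gv.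
  rewrite subnKC// => /le_trans; apply; rewrite -/(scheme_cst m).
  apply: (@le_trans _ _ (q%:R * (tau n * (scheme_cst m * M)))).
    rewrite ler_wpM2r ?ler_nat//; apply: mulr_ge0; first exact: (ltW tn).
    by apply: mulr_ge0 => //; exact: scheme_cst_ge0.
  by rewrite mulrA -tE mulrA mulrC ler_wpM2l// tau_cst.
have mb1 : meas_bd B (fun x => U x - V' x) by split => //; exact: measurable_funB.
have iw1 : intg mu (fun x => U x - V' x) by exact: intgB.
have iw2 : intg mu (fun x => V' x - W x) by exact: intgB.
have mb2 : meas_bd M (fun x => V' x - W x).
  by split; [exact: measurable_funB|move=> x; exact: (dist_itv (V'M x) (WM x))].
have i1 := intg_sqr mb1 iw1; have i2 := intg_sqr mb2 iw2.
have iUW : intg mu (fun x => (U x - W x) ^+ 2).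
  apply: (intg_sqr (M1 := M)); last exact: intgB.
  by split; [exact: measurable_funB|move=> x; exact: (dist_itv (UM x) (WM x))].
have h1 : \int[mu]_x (U x - V' x) ^+ 2 <= B * (2 * I).
  apply: (@le_trans _ _ (\int[mu]_x (B * (U x + V' x)))).
    apply: le_Rint => //; first by apply: intgZ; exact: intgD.
    move=> x; rewrite -[leLHS]ger0_norm ?sqr_ge0// normrX expr2 ler_pM//.
    exact: (dist_itvD (UM x) (V'M x)).
  rewrite RintZ ?RintD//; last exact: intgD.
  rewrite (iter_mass (Scm m) (ltW tm) (cfl_m m) _ gv).
  rewrite (iter_mass (Scm m) (ltW tn) (cfl_mn mn) _ gv).
  by rewrite mulr2n mulrDl mul1r.
have h2 : \int[mu]_x (V' x - W x) ^+ 2 <=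
    t * (2 * eta m + 16 * (2 ^+ m)^-1 * (M * I)).
  have hdm i := iter_diff2 Tr (Scm m) (ltW tn) (cfl_mn mn) i (me m) (e0 m) gv (ie m).
  have hdn i := iter_diff2 Tr (Scm n) (ltW tn) (cfl_m n) i (me m) (e0 m) gv (ie m).
  have := iter_L2 (Scm m) (Scm n) (ltW tn) (cfl_mn mn) (cfl_m n)
    (fun a z ha => he (sub z.1 z.2) mn ha) (idx n t) gv
    (fun i => (hdm i).1) (fun i => (hdn i).1) (fun i => (hdm i).2) (fun i => (hdn i).2).
  move=> /le_trans; apply; rewrite -/(scheme_cst m) -/(scheme_cst n) -/I.
  have eta0 : 0 <= eta m by apply: Rint_ge0 => z; rewrite mulr_ge0.
  have MI0 : 0 <= M * I by rewrite mulr_ge0.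
  have c4 : (scheme_cst m + scheme_cst n) ^+ 2 <= 4 * scheme_cst n ^+ 2.
    rewrite (_ : 4 * _ = (scheme_cst n + scheme_cst n) ^+ 2); last by ring.
    rewrite lerXn2r ?nnegrE ?addr_ge0 ?scheme_cst_ge0// lerD2r; exact: scheme_cst_nd.
  have nt0 : 0 <= (idx n t)%:R :> R by [].
  have step1 := two_levels_arith nt0 MI0 eta0 (ltW tn) (tau_cst2 n) erefl.
  apply: (@le_trans _ _ ((idx n t)%:R * (2 * tau n * eta m + tau n ^+ 2 * (4 * (4 * scheme_cst n ^+ 2) * (M * I))))).
    rewrite ler_wpM2l// lerD2l ler_wpM2l ?sqr_ge0// -mulrA ler_wpM2r//.
    by rewrite ler_wpM2l.
  apply: (le_trans step1).
  have y0 k : 0 <= (2 ^+ k)^-1 :> R by rewrite invr_ge0 exprn_ge0.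
  apply: (@le_trans _ _ (t * (2 * eta m + 16 * (2 ^+ n)^-1 * (M * I)))).
    by rewrite ler_wpM2r ?idx_tau// addr_ge0 ?mulr_ge0.
  rewrite ler_wpM2l// lerD2l ler_wpM2r// ler_wpM2l//.
  by rewrite lef_pV2 ?posrE ?exprn_gt0// ler_weXn2l// ler1n.
apply: (@le_trans _ _ (\int[mu]_x (2 * (U x - V' x) ^+ 2 + 2 * (V' x - W x) ^+ 2))).
  apply: le_Rint => //; first by apply: intgD; exact: intgZ.
  by move=> x; exact: sqr_split.
rewrite RintD; [|exact: intgZ|exact: intgZ].
by rewrite !RintZ// lerD// ler_wpM2l.
Qed.

End Cauchy.
End Levels.

(** * Growth of the weighted mass *)

Section WeightedGrowth.
Context d (T : measurableType d) (R : realType).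
Variables (mu : {sigma_finite_measure set T -> \bar R}).
Variables (q : R) (g : R -> R) (L : R) (k K : T * T -> R) (kap : R).
Hypothesis Sc : is_scheme mu g L k kap.
Hypotheses (kK : forall z, k z <= K z) (mK : measurable_fun setT K)
  (Ksym : forall x y, K (x, y) = K (y, x))
  (g_sub : forall a b, 0 <= a -> 0 <= b -> `|g (a - b)| <= a `^ q + b `^ q).
Variables (phi : T -> R) (B0 : R) (W : T -> \bar R).
Hypotheses (mphi : measurable_fun setT phi) (phi0 : forall x, 0 <= phi x)
  (phiB : forall x, phi x <= B0).
Hypotheses (mW : measurable_fun setT W) (W0 : forall x, (0 <= W x)%E)
  (Wfin : (\int[mu]_x W x < +oo)%E)
  (HW : forall x a, 0 <= a -> (\int[mu]_y
     ((a `^ q * (K (x, y) * `|phi x - phi y|))%R%:E) <= (a * phi x)%:E + W x)%E).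

Let w : R := fine (\int[mu]_x W x)%E.

Let wE : (w%:E = \int[mu]_x W x)%E.
Proof. by rewrite fineK// ge0_fin_numE// integral_ge0. Qed.

Lemma w_ge0 : 0 <= w. Proof. by rewrite /w fine_ge0// integral_ge0. Qed.

Let mbphi : meas_bd B0 phi.
Proof. by split => // x; rewrite ger0_norm. Qed.

Lemma intg_phi M u : good mu M u -> intg mu (fun x => u x * phi x).
Proof. by move=> [_ _ iu]; exact: (intg_mulb mbphi.1 mbphi.2 iu). Qed.

Let K0 z : 0 <= K z. Proof. exact: le_trans (sc_k0 Sc z) (kK z). Qed.

(** Integrate [HW] over [x] with [a = u x]. *)
Lemma weighted_flux M u : good mu M u ->
  intg (mu \x mu)%E (fun z => u z.1 `^ q * (K z * `|phi z.1 - phi z.2|)) /\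
  \int[(mu \x mu)%E]_z (u z.1 `^ q * (K z * `|phi z.1 - phi z.2|)) <=
  \int[mu]_x (u x * phi x) + w.
Proof.
move=> gu; have [mu_ uM iu] := gu.
pose F (z : T * T) := u z.1 `^ q * (K z * `|phi z.1 - phi z.2|).
have F0 z : 0 <= F z by rewrite mulr_ge0 ?powR_ge0// mulr_ge0.
have mF : measurable_fun setT F.
  apply: measurable_funM.
    apply: measurableT_comp (measurable_powR q) _.
    by apply: measurableT_comp mu_ _; exact: measurable_fst.
  apply: measurable_funM => //.
  by apply: measurableT_comp => //; exact: measurable_diff.
have mF' : measurable_fun setT (EFin \o F) by exact/measurable_EFinP.
have F0' z : (0 <= (EFin \o F) z)%E by rewrite lee_fin.
have iup := intg_phi gu.
have le1 : (\int[mu \x mu]_z (F z)%:E <= (\int[mu]_x (u x * phi x) + w)%R%:E)%E.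
  rewrite (fubini_tonelli1 (m1 := mu) (m2 := mu) (EFin \o F) mF' F0').
  rewrite EFinD wE (Rint_fine iup) -ge0_integralD//; last 2 first.
    by move=> x _; rewrite lee_fin mulr_ge0//; case/andP: (uM x).
    by apply/measurable_EFinP; exact: measurable_funM.
  apply: ge0_le_integral => //.
  - by move=> x _; apply: integral_ge0 => y _; rewrite lee_fin.
  - exact: (measurable_fun_fubini_tonelli_F (m2 := mu) (EFin \o F) mF' F0').
  - by apply: emeasurable_funD => //; apply/measurable_EFinP; exact: measurable_funM.
  - by move=> x _; exact: (HW x (proj1 (andP (uM x)))).
have iF : intg (mu \x mu)%E F.
  by apply/intg_ge0P => //; exact: le_lt_trans le1 (ltry _).
split => //; by rewrite -lee_fin (Rint_fine iF).
Qed.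

(** The flux is at most [(u x)^q + (u y)^q] times [K], and by symmetry of
    [K (x, y) * `|phi x - phi y|] both terms contribute the same integral. *)
Lemma weighted_nonlocal M u : good mu M u ->
  `|\int[mu]_x (nonlocal mu g k u x * phi x)| <= \int[mu]_x (u x * phi x) + w.
Proof.
move=> gu; have [mu_ uM iu] := gu.
have [iF hF] := nonlocal_weak Sc gu mbphi.
have [iG hG] := weighted_flux gu.
set F := fun z => u z.1 `^ q * (K z * `|phi z.1 - phi z.2|) in iG hG.
rewrite hF normrM ger0_norm ?invr_ge0//.
have iG' := intg_swap iG.
have h1 : \int[(mu \x mu)%E]_z `|flux g k u z * (phi z.1 - phi z.2)| <=
    \int[(mu \x mu)%E]_z (F z + F (z.2, z.1)).
  apply: le_Rint; [exact: intg_norm|exact: intgD|].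
  move=> z; rewrite /F /flux /= -(Ksym z.1 z.2) -surjective_pairing.
  rewrite (distrC (phi z.2)) -mulrDl normrM normrM -mulrA ler_pM//.
    by rewrite g_sub//; [case/andP: (uM z.1)|case/andP: (uM z.2)].
  by rewrite ler_wpM2r// ger0_norm ?(sc_k0 Sc)// kK.
rewrite RintD// (Rint_swap iG) in h1.
have h2 := le_norm_Rint iF.
have := le_trans h2 h1; move: hG.
move: (\int[_]_z F z) (\int[mu]_x (u x * phi x) + w) `|_| => a b c; lra.
Qed.

Variable tau : R.
Hypotheses (tau_ge0 : 0 <= tau) (cfl : tau * (L * kap) <= 1).
Local Notation stp := (step mu g k tau).
Local Notation XX u := (\int[mu]_x (u x * phi x)).

Lemma step_growth M u : good mu M u ->
  `|XX (stp u) - XX u| <= tau * (XX u + w).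
Proof.
move=> gu; have [mu_ uM iu] := gu.
have gs := step_good Sc tau_ge0 cfl gu.
have iA : intg mu (fun x => nonlocal mu g k u x * phi x).
  exact: (intg_mulb mbphi.1 mbphi.2 (nonlocal_intg Sc gu)).
rewrite -RintB; [|exact: intg_phi gs|exact: intg_phi gu].
rewrite (@eq_Rint _ _ _ _ _ (fun x => - tau * (nonlocal mu g k u x * phi x))); last first.
  by move=> x; rewrite stepE; ring.
rewrite RintZ// normrM normrN (ger0_norm tau_ge0) ler_wpM2l//.
exact: weighted_nonlocal gu.
Qed.

Lemma iter_growth M u n : good mu M u ->
  XX (iter n stp u) + w <= (XX u + w) * (1 + tau) ^+ n.
Proof.
move=> gu; elim: n => [|n ih]; first by rewrite expr0 mulr1.
have gn := iter_good Sc tau_ge0 cfl n gu.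
have := step_growth gn; rewrite iterS => h.
have := le_trans (ler_norm _) h => {}h.
rewrite exprSr mulrA.
apply: (@le_trans _ _ ((XX (iter n stp u) + w) * (1 + tau))).
  by move: h; move: (XX (iter n stp u)) (XX (stp (iter n stp u))) => a b; lra.
by rewrite ler_wpM2r// addr_ge0.
Qed.

Lemma weighted_mass_ge0 M u : good mu M u -> 0 <= XX u.
Proof.
by move=> [_ uM _]; apply: Rint_ge0 => x; rewrite mulr_ge0//; case/andP: (uM x).
Qed.

Lemma exp_growth n : (1 + tau) ^+ n <= expR (n%:R * tau).
Proof.
rewrite mulrC expRM_natr lerXn2r ?nnegrE ?expR_ge0 ?addr_ge0//.
exact: expR_ge1Dx.
Qed.

(** The discrete Gronwall lemma, with [(1 + tau) ^ n <= exp (n tau)]. *)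
Lemma iter_bound M u n tb : good mu M u -> n%:R * tau <= tb ->
  XX (iter n stp u) + w <= (XX u + w) * expR tb.
Proof.
move=> gu h; apply: (le_trans (iter_growth n gu)).
rewrite ler_wpM2l ?addr_ge0 ?w_ge0 ?(weighted_mass_ge0 gu)//.
by apply: (le_trans (exp_growth n)); rewrite ler_expR.
Qed.

Lemma iter_X_lip M u n j tb : good mu M u -> (n + j)%:R * tau <= tb ->
  `|XX (iter (n + j) stp u) - XX (iter n stp u)| <=
  j%:R * tau * ((XX u + w) * expR tb).
Proof.
move=> gu; elim: j => [|j ih] h.
  by rewrite addn0 subrr normr0 !mul0r.
have h' : (n + j)%:R * tau <= tb.
  by apply: le_trans h; rewrite ler_wpM2r// ler_nat addnS.
have gnj := iter_good Sc tau_ge0 cfl (n + j) gu.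
rewrite addnS iterS.
rewrite (_ : _ - _ = (XX (stp (iter (n + j) stp u)) - XX (iter (n + j) stp u)) +
  (XX (iter (n + j) stp u) - XX (iter n stp u))); last by ring.
apply: (le_trans (ler_normD _ _)); rewrite -natr1 (mulrDl _ 1) mul1r (mulrDl _ tau).
rewrite addrC lerD//; first exact: ih.
apply: (le_trans (step_growth gnj)); rewrite ler_wpM2l//.
exact: iter_bound gu h'.
Qed.

End WeightedGrowth.

(** * Almost monotone sequences in weighted L1 *)

Lemma cvgn_ge (R : realType) (u : nat -> R) (a l : R) (N : nat) :
  u n @[n --> \oo] --> l -> (forall n, (N <= n)%N -> a <= u n) -> a <= l.
Proof.
move=> cu h; rewrite -(cvg_lim _ cu)//; apply: limr_ge.
  by apply/cvg_ex; exists l.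
by near=> n; apply: h; near: n; exact: nbhs_infty_ge.
Unshelve. all: by end_near. Qed.

Lemma cvgn_le (R : realType) (u : nat -> R) (a l : R) (N : nat) :
  u n @[n --> \oo] --> l -> (forall n, (N <= n)%N -> u n <= a) -> l <= a.
Proof.
move=> cu h; rewrite -(cvg_lim _ cu)//; apply: limr_le.
  by apply/cvg_ex; exists l.
by near=> n; apply: h; near: n; exact: nbhs_infty_ge.
Unshelve. all: by end_near. Qed.

Section AlmostMonotone.
Context d (T : measurableType d) (R : realType).
Variables (mu : {measure set T -> \bar R}).
Variables (phi : T -> R) (f : nat -> T -> R) (C c1 : R).
Hypotheses (mphi : measurable_fun setT phi) (phi0 : forall x, 0 < phi x)
  (mf : forall n, measurable_fun setT (f n)) (f0 : forall n x, 0 <= f n x)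
  (fi : forall n, intg mu (fun x => f n x * phi x))
  (XB : forall n, \int[mu]_x (f n x * phi x) <= C)
  (PB : forall n, \int[mu]_x (Num.max (f n x - f n.+1 x) 0 * phi x) <= c1 * (2 ^+ n)^-1).

Let phi_ge0 x : 0 <= phi x. Proof. exact: ltW. Qed.

Definition incr n x := `|f n.+1 x - f n x|.

(** Majorant of all the [f n] at once. *)
Definition envelope (x : T) : \bar R := ((f 0%N x)%:E + \sum_(0 <= n <oo) (incr n x)%:E)%E.

Let pos_phi (a b : T -> R) : intg mu (fun x => a x * phi x) ->
  intg mu (fun x => b x * phi x) -> measurable_fun setT a -> measurable_fun setT b ->
  intg mu (fun x => Num.max (a x - b x) 0 * phi x).
Proof.
move=> ia ib ma meas_bd.
have iab := intgB ia ib.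
apply: (intg_dom _ _ (intg_norm iab)).
  by apply: measurable_funM => //; apply: measurable_maxr => //; exact: measurable_funB.
move=> x; rewrite -mulrBl !normrM ler_wpM2r//.
rewrite ger0_norm ?le_max ?lexx ?orbT//.
by rewrite ge_max ler_norm normr_ge0.
Qed.

Let abs_phi (a b : T -> R) : intg mu (fun x => a x * phi x) ->
  intg mu (fun x => b x * phi x) -> intg mu (fun x => `|a x - b x| * phi x).
Proof.
move=> ia ib; have := intg_norm (intgB ia ib).
under eq_fun do rewrite -mulrBl normrM (ger0_norm (phi_ge0 _)).
by [].
Qed.

Lemma norm_maxE (a b : R) : `|a - b| = (a - b) + 2 * Num.max (b - a) 0.
Proof.
have [ab|ab] := leP (b - a) 0; first by rewrite mulr0 addr0 ger0_norm// -oppr_le0 opprB.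
by rewrite ler0_norm; [ring|rewrite -oppr_ge0 opprB ltW].
Qed.

Let absE (a b : T -> R) : intg mu (fun x => a x * phi x) ->
  intg mu (fun x => b x * phi x) -> measurable_fun setT a -> measurable_fun setT b ->
  \int[mu]_x (`|a x - b x| * phi x) = \int[mu]_x (a x * phi x) - \int[mu]_x (b x * phi x)
    + 2 * \int[mu]_x (Num.max (b x - a x) 0 * phi x).
Proof.
move=> ia ib ma meas_bd.
rewrite -RintB// -RintZ; last exact: pos_phi.
rewrite -RintD; [|exact: intgB|by apply: intgZ; exact: pos_phi].
by apply: eq_Rint => x; rewrite norm_maxE; ring.
Qed.

Lemma c1_ge0 : 0 <= c1.
Proof.
have := PB 0; rewrite expr0 invr1 mulr1; apply: le_trans.
by apply: Rint_ge0 => x; rewrite mulr_ge0// le_max lexx orbT.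
Qed.

Lemma incr_i n : intg mu (fun x => incr n x * phi x).
Proof. exact: abs_phi. Qed.

(** As [|b - a| = (b - a) + 2 (a - b)^+], the integrals of the increments
    telescope up to the negative parts, which are summable. *)
Lemma sum_incr n m : \sum_(n <= i < n + m) \int[mu]_x (incr i x * phi x) <=
  \int[mu]_x (f (n + m) x * phi x) - \int[mu]_x (f n x * phi x) +
  4 * c1 * ((2 ^+ n)^-1 - (2 ^+ (n + m))^-1).
Proof.
elim: m => [|m ih]; first by rewrite addn0 big_geq// !subrr mulr0 addr0.
rewrite addnS big_nat_recr ?leq_addr//=.
apply: (le_trans (lerD ih (lexx _))).
rewrite /incr absE//.
have := PB (n + m); rewrite exprS invfM.
move: (\int[mu]_x (f (n + m) x * phi x)) (\int[mu]_x (f (n + m).+1 x * phi x)).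
move: (\int[mu]_x (f n x * phi x)) (\int[mu]_x (Num.max _ 0 * phi x)) => a b c e.
move: ((2 ^+ (n + m))^-1) ((2 ^+ n)^-1) => y z; lra.
Qed.

Lemma f_dist n m : (n <= m)%N ->
  \int[mu]_x (`|f m x - f n x| * phi x) <=
  \int[mu]_x (f m x * phi x) - \int[mu]_x (f n x * phi x) + 4 * c1 * (2 ^+ n)^-1.
Proof.
move=> /subnKC <-; set j := (m - n)%N.
apply: (@le_trans _ _ (\sum_(n <= i < n + j) \int[mu]_x (incr i x * phi x))).
  elim: j => [|j ih].
    rewrite addn0 big_geq// (@eq_Rint _ _ _ _ _ (fun=> 0)).
      by rewrite /Rintegral integral0.
    by move=> x; rewrite subrr normr0 mul0r.
  rewrite addnS big_nat_recr ?leq_addr//=.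
  apply: le_trans (lerD ih (lexx _)).
  rewrite -RintD; [|exact: abs_phi|exact: incr_i].
  apply: le_Rint; [exact: abs_phi|by apply: intgD; [exact: abs_phi|exact: incr_i]|].
  move=> x; rewrite -mulrDl ler_wpM2r//.
  rewrite [leRHS]addrC /incr (_ : f (n + j).+1 x - f n x = (f (n + j).+1 x - f (n + j)%N x) + (f (n + j)%N x - f n x)); last by ring.
  exact: ler_normD.
apply: (le_trans (sum_incr n j)).
have c0 := c1_ge0.
rewrite lerD2l ler_wpM2l ?mulr_ge0// gerBl.
by rewrite invr_ge0 exprn_ge0.
Qed.

Let incr0 n x : (0 <= (incr n x)%:E)%E. Proof. by rewrite lee_fin /incr. Qed.

Lemma measurable_incr n : measurable_fun setT (incr n).
Proof. by apply: measurableT_comp => //; exact: measurable_funB. Qed.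

Lemma measurable_env : measurable_fun setT envelope.
Proof.
apply: emeasurable_funD; first exact/measurable_EFinP.
apply: ge0_emeasurable_sum => [n x _ _|n _]; first exact: incr0.
by apply/measurable_EFinP; exact: measurable_incr.
Qed.

Lemma env_ge0 x : (0 <= envelope x)%E.
Proof.
by rewrite adde_ge0 ?lee_fin//; apply: nneseries_ge0 => n _ _; exact: incr0.
Qed.

Lemma le_env n x : ((f n x)%:E <= envelope x)%E.
Proof.
apply: (@le_trans _ _ ((f 0%N x)%:E + \sum_(0 <= i < n) (incr i x)%:E)%E).
  rewrite sumEFin -EFinD lee_fin.
  elim: n => [|n ih]; first by rewrite big_geq// addr0.
  rewrite big_nat_recr//= addrA -(lerD2r (incr n x)) in ih *.
  apply: le_trans ih; rewrite -lerBlDl /incr; exact: ler_norm.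
apply: leeD2l; apply: (@nneseries_lim_ge _ (fun i => (incr i x)%:E) xpredT 0 n).
by move=> i _ _; exact: incr0.
Qed.

Lemma env_int : (\int[mu]_x (envelope x * (phi x)%:E) <= (2 * C + 4 * c1)%:E)%E.
Proof.
have E x : (envelope x * (phi x)%:E = (f 0%N x * phi x)%:E + \sum_(0 <= n <oo) (incr n x * phi x)%:E)%E.
  rewrite /envelope ge0_muleDl ?lee_fin//; last by apply: nneseries_ge0 => n _ _; exact: incr0.
  congr (_ + _)%E.
  rewrite muleC -nneseriesZl//; apply: eq_eseriesr => n _.
  by rewrite -EFinM mulrC.
under eq_integral do rewrite E.
have mi n : measurable_fun setT (fun x => (incr n x * phi x)%:E).
  by apply/measurable_EFinP; exact: intg_measurable (incr_i n).
have i0 n x : (0 <= (incr n x * phi x)%:E)%E.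
  by rewrite lee_fin mulr_ge0// /incr.
rewrite ge0_integralD//; last 4 first.
- by move=> x _; rewrite lee_fin mulr_ge0.
- by apply/measurable_EFinP; exact: intg_measurable (fi 0).
- by move=> x _; apply: nneseries_ge0 => n _ _; exact: i0.
- by apply: ge0_emeasurable_sum => [n x _ _|n _]; [exact: i0|exact: mi].
rewrite integral_nneseries// -Rint_fine//.
have -> : (2 * C + 4 * c1)%:E = (C%:E + (C + 4 * c1)%:E)%E.
  by rewrite -EFinD; congr (_%:E); ring.
apply: leeD; first by rewrite lee_fin.
apply: lime_le; first by apply: is_cvg_nneseries => n _ _; apply: integral_ge0 => x _; exact: i0.
near=> n; rewrite (eq_bigr (fun i => (\int[mu]_x (incr i x * phi x))%:E)); last first.
  by move=> i _; rewrite Rint_fine//; exact: incr_i.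
rewrite sumEFin lee_fin; have := sum_incr 0 n; rewrite add0n => /le_trans; apply.
have c0 := c1_ge0.
apply: lerD.
  rewrite lerBlDr; apply: (le_trans (XB n)); rewrite lerDl.
  by apply: Rint_ge0 => x; rewrite mulr_ge0// ltW.
by rewrite expr0 invr1 -[leRHS]mulr1 ler_wpM2l ?mulr_ge0// gerBl invr_ge0 exprn_ge0.
Unshelve. all: by end_near. Qed.

Lemma env_cvg x : (envelope x < +oo)%E -> cvgn (fun n => f n x).
Proof.
move=> envx.
have sx : (\sum_(0 <= n <oo) (incr n x)%:E < +oo)%E.
  by apply: le_lt_trans envx; rewrite leeDr// lee_fin.
have c : cvgn (series (fun n => f n.+1 x - f n x)).
  by apply: normed_cvg; apply: nnseries_is_cvg => // n; rewrite /= normr_ge0.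
have -> : (fun n => f n x) = (fun n => f 0%N x + series (fun n => f n.+1 x - f n x) n).
  apply/funext => n; rewrite /series /= telescope_sumr//; ring.
by apply: is_cvgD => //; exact: is_cvg_cst.
Qed.

Variable l : T -> R.
Hypotheses (ml : measurable_fun setT l)
  (hl : forall x, (envelope x < +oo)%E -> f n x @[n --> \oo] --> l x).

Lemma env_ae : {ae mu, forall x, (envelope x < +oo)%E}.
Proof.
have i : mu.-integrable setT (fun x => envelope x * (phi x)%:E)%E.
  apply/integrableP; split.
    by apply: emeasurable_funM; [exact: measurable_env|exact/measurable_EFinP].
  under eq_integral do rewrite gee0_abs ?mule_ge0 ?env_ge0 ?lee_fin//.
  exact: le_lt_trans env_int (ltry _).
have := integrable_ae measurableT i; apply: filterS => x /(_ I).
have := env_ge0 x; case: (envelope x) => [r| |]//= _; first by rewrite ltry.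
by rewrite mulyr gtr0_sg// mul1e.
Qed.

Lemma l_bounds x : (envelope x < +oo)%E -> 0 <= l x /\ ((l x)%:E <= envelope x)%E.
Proof.
move=> envx; have cl := hl envx; split.
  by apply: (cvgn_ge (N := 0) cl) => n _; exact: f0.
have ef : envelope x \is a fin_num by rewrite ge0_fin_numE// env_ge0.
rewrite -(fineK ef) lee_fin; apply: (cvgn_le (N := 0) cl) => n _.
by rewrite -lee_fin fineK// le_env.
Qed.

Lemma l_intg_norm : intg mu (fun x => `|l x| * phi x).
Proof.
apply/intg_ge0P.
- by apply: measurable_funM => //; exact: measurableT_comp.
- by move=> x; rewrite mulr_ge0// ltW.
apply: le_lt_trans (ltry (2 * C + 4 * c1)).
apply: le_trans env_int.
apply: ae_ge0_le_integral => //.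
- by move=> x _; rewrite lee_fin mulr_ge0.
- by apply/measurable_EFinP; apply: measurable_funM => //; exact: measurableT_comp.
- by move=> x _; rewrite mule_ge0 ?env_ge0// lee_fin.
- by apply: emeasurable_funM; [exact: measurable_env|exact/measurable_EFinP].
apply: filterS env_ae => x envx _; rewrite EFinM lee_wpmul2r ?lee_fin//.
by have [l0 le] := l_bounds envx; rewrite ger0_norm.
Qed.

Lemma l_intg : intg mu (fun x => l x * phi x).
Proof.
apply: (intg_dom _ _ l_intg_norm).
  exact: measurable_funM.
by move=> x; rewrite normrM (ger0_norm (phi_ge0 _)).
Qed.

Lemma l_cvg : (\int[mu]_x (`|l x - f n x| * phi x)) @[n --> \oo] --> 0.
Proof.
pose h n x : \bar R := (`|l x - f n x| * phi x)%:E.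
have ih n : intg mu (fun x => `|l x - f n x| * phi x).
  by apply: abs_phi => //; exact: l_intg.
pose g x : \bar R := (2%:E * (envelope x * (phi x)%:E))%E.
have ig : mu.-integrable setT g.
  apply: integrableZl => //; apply/integrableP; split.
    by apply: emeasurable_funM; [exact: measurable_env|exact/measurable_EFinP].
  under eq_integral do rewrite gee0_abs ?mule_ge0 ?env_ge0 ?lee_fin//.
  exact: le_lt_trans env_int (ltry _).
have [|||||_ _ +] := @dominated_convergence _ _ _ mu setT measurableT h (cst 0%E) g.
- by move=> n; apply/measurable_EFinP; exact: intg_measurable (ih n).
- exact: measurable_cst.
- apply: filterS env_ae => x envx _; rewrite /h.
  have cl := hl envx.
  have c0 : (`|l x - f n x| * phi x) @[n --> \oo] --> (0 : R).
    rewrite -[X in _ --> X](mul0r (phi x)); apply: cvgM; last exact: cvg_cst.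
    rewrite -[X in _ --> X](@normr0 R R); apply: cvg_norm.
    by rewrite -(subrr (l x)); apply: cvgB => //; exact: cvg_cst.
  by apply: cvg_EFin; [near=> n|exact: c0].
- exact: ig.
- apply: filterS env_ae => x envx n _; rewrite /h /g.
  rewrite gee0_abs ?lee_fin ?mulr_ge0//.
  have [l0 le] := l_bounds envx.
  have ef : envelope x \is a fin_num by rewrite ge0_fin_numE// env_ge0.
  rewrite -(fineK ef) -!EFinM lee_fin mulrA ler_wpM2r//.
  have := le_env n x; rewrite -(fineK ef) lee_fin => h1.
  move: le; rewrite -(fineK ef) lee_fin => h2.
  rewrite (le_trans (ler_normB _ _))// !ger0_norm// mulr2n mulrDl mul1r.
  by rewrite lerD.
rewrite integral0 /= => /fine_cvgP[_].
by [].
Unshelve. all: by end_near. Qed.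

(** A distance is controlled by a difference of integrals, up to [2 ^- n].  This
    transfers regularity in time from the weighted masses to the functions. *)
Lemma l_dist n : \int[mu]_x (`|l x - f n x| * phi x) <=
  \int[mu]_x (l x * phi x) - \int[mu]_x (f n x * phi x) + 4 * c1 * (2 ^+ n)^-1.
Proof.
have il := l_intg.
pose D m := \int[mu]_x (`|l x - f m x| * phi x).
pose b := \int[mu]_x (l x * phi x) - \int[mu]_x (f n x * phi x) + 4 * c1 * (2 ^+ n)^-1.
have key m : (n <= m)%N -> D n <= b + 2 * D m.
  move=> nm; have := f_dist nm.
  have h1 : D n <= D m + \int[mu]_x (`|f m x - f n x| * phi x).
    rewrite -RintD; [|exact: abs_phi|exact: abs_phi].
    apply: le_Rint; [exact: abs_phi|by apply: intgD; exact: abs_phi|].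
    move=> x; rewrite -mulrDl ler_wpM2r//.
    rewrite (_ : l x - f n x = (l x - f m x) + (f m x - f n x)); last by ring.
    exact: ler_normD.
  have h2 : \int[mu]_x (f m x * phi x) <= \int[mu]_x (l x * phi x) + D m.
    rewrite -RintD//; last exact: abs_phi.
    apply: le_Rint => //; first by apply: intgD => //; exact: abs_phi.
    move=> x; rewrite -mulrDl ler_wpM2r//.
    by rewrite -lerBlDl -normrN opprB ler_norm.
  rewrite /b; move: h1 h2; move: (D n) (D m) => u v.
  move: (\int[mu]_x (f m x * phi x)) (\int[mu]_x (l x * phi x)) (\int[mu]_x (f n x * phi x)).
  move: (\int[mu]_x (`|f m x - f n x| * phi x)) (4 * c1 * (2 ^+ n)^-1) => *; lra.
have cD : (b + 2 * D m) @[m --> \oo] --> b.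
  rewrite -[X in _ --> X]addr0 -[X in _ + X](mulr0 2).
  by apply: cvgD; [exact: cvg_cst|apply: cvgM; [exact: cvg_cst|exact: l_cvg]].
exact: (cvgn_ge (N := n) cD).
Qed.

End AlmostMonotone.

(** * Approximate solutions *)

Lemma le_young (R : realType) (a w : R) : 0 < a -> `|w| <= a + a^-1 * w ^+ 2.
Proof.
move=> a0; have [wa|aw] := leP `|w| a.
  by rewrite ler_wpDr// mulr_ge0 ?sqr_ge0// invr_ge0 ltW.
apply: ler_wpDl; first exact: ltW.
rewrite -(real_normK (num_real w)) expr2 mulrA ler_peMl//.
by rewrite mulrC ler_pdivlMr// mul1r ltW.
Qed.

Lemma cauchy_arith (R : realType) (t tb MI eta y : R) : 0 <= MI -> 0 <= eta ->
  0 <= y -> t <= tb ->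
  2 * ((2 * t + 1) * (y * MI) * 2) + 2 * (t * (2 * eta + 16 * (y * MI))) <=
  (2 * ((2 * tb + 1) * MI * 2) + 2 * (tb * (16 * MI))) * y + 4 * tb * eta.
Proof.
move=> MI0 eta0 y0 ttb.
have s1 : t * (y * MI) <= tb * (y * MI) by rewrite ler_wpM2r ?mulr_ge0.
have s2 : t * eta <= tb * eta by rewrite ler_wpM2r.
lra.
Qed.

Section L2toL1.
Context d (T : measurableType d) (R : realType) (mu : {measure set T -> \bar R}).
Variables (phi : T -> R) (B0 : R).
Hypotheses (mphi : measurable_fun setT phi) (phi0 : forall x, 0 <= phi x)
  (phiB : forall x, phi x <= B0)
  (decay : forall e : R, 0 < e -> exists B, [/\ measurable B, (mu B < +oo)%E &
     forall x, ~ B x -> phi x <= e]).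

(** Outside of a set [B] of finite measure [phi] is small and the L1 bound is
    enough; on [B], use [|w| <= a + w^2 / a] with [a] small. *)
Lemma L2_to_weighted_L1 (I e : R) : 0 <= I -> 0 < e -> exists2 dl : R, 0 < dl &
  forall w, intg mu w -> intg mu (fun x => w x ^+ 2) ->
    \int[mu]_x `|w x| <= I -> \int[mu]_x w x ^+ 2 <= dl ->
    \int[mu]_x (`|w x| * phi x) <= e.
Proof.
move=> I0 e0.
have I1 : 0 < I + 1 by rewrite ltr_wpDl.
have B00 : 0 <= B0 by exact: le_trans (phiB point).
have e1 : 0 < e / (2 * (I + 1)) by rewrite divr_gt0// mulr_gt0.
have [B [mB Bfin hB]] := decay e1.
pose b := fine (mu B); have b0 : 0 <= b by rewrite fine_ge0.
have iB : intg mu (\1_B : T -> R).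
  by apply/intg_ge0P => //; rewrite integral_indic// setIT.
have Bb : \int[mu]_x \1_B x = b.
  by rewrite /Rintegral integral_indic// setIT.
(* [b] is the measure of [B]: the part [a * phi] of the integral over [B] is at most
   [e / 4]. *)
pose a := e / (4 * (B0 * b + 1)).
have Bb1 : 0 < B0 * b + 1 by rewrite ltr_wpDl// mulr_ge0.
have a0 : 0 < a by rewrite divr_gt0// mulr_gt0.
pose dl := e * a / (4 * (B0 + 1)).
have B1 : 0 < B0 + 1 by rewrite ltr_wpDl.
exists dl; first by rewrite /dl divr_gt0// mulr_gt0.
move=> w iw iw2 wI wd.
have iaw := intg_norm iw.
have mw := intg_measurable iw.
have key x : `|w x| * phi x <=
    e / (2 * (I + 1)) * `|w x| + (B0 * a * \1_B x + B0 * a^-1 * w x ^+ 2).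
  have r0 : 0 <= B0 * a^-1 * w x ^+ 2.
    by rewrite mulr_ge0 ?sqr_ge0// mulr_ge0// invr_ge0 ltW.
  have [xB|xB] := pselect (B x).
    rewrite indicE mem_set//= mulr1 -[leLHS]add0r lerD//.
      by rewrite mulr_ge0// (ltW e1).
    apply: (@le_trans _ _ (`|w x| * B0)); first by rewrite ler_wpM2l.
    by rewrite mulrC -mulrA -mulrDr ler_wpM2l// le_young.
  rewrite indicE memNset//= mulr0 add0r ler_wpDr//.
  by rewrite mulrC ler_wpM2r// hB.
have iR : intg mu (fun x => e / (2 * (I + 1)) * `|w x| + (B0 * a * \1_B x + B0 * a^-1 * w x ^+ 2)).
  by apply: intgD; [exact: intgZ|apply: intgD; exact: intgZ].
have iwp : intg mu (fun x => `|w x| * phi x).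
  apply: (intg_mulb (B := B0)) => //.
  by move=> x; rewrite ger0_norm.
apply: (le_trans (le_Rint iwp iR key)).
rewrite RintD; [|exact: intgZ|by apply: intgD; exact: intgZ].
rewrite RintD; [|exact: intgZ|exact: intgZ].
rewrite !RintZ// Bb.
have t1 : e / (2 * (I + 1)) * \int[mu]_x `|w x| <= e / 2.
  apply: (@le_trans _ _ (e / (2 * (I + 1)) * (I + 1))).
    by rewrite ler_wpM2l ?(ltW e1)// (le_trans wI)// lerDl.
  by rewrite le_eqVlt; apply/orP; left; apply/eqP; field; rewrite gt_eqF.
have t2 : B0 * a * b <= e / 4.
  rewrite mulrAC /a mulrA ler_pdivrMr ?mulr_gt0//.
  rewrite (_ : e / 4 * _ = e * (B0 * b + 1)); last by field.
  by rewrite mulrC ler_wpM2l ?(ltW e0)// lerDl.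
have t3 : B0 * a^-1 * \int[mu]_x w x ^+ 2 <= e / 4.
  apply: (@le_trans _ _ (B0 * a^-1 * dl)).
    by rewrite ler_wpM2l// mulr_ge0// invr_ge0 ltW.
  rewrite /dl (_ : _ * _ = (e / 4) * (B0 / (B0 + 1))); last first.
    by field; rewrite !gt_eqF.
  by rewrite ler_piMr ?divr_ge0 ?(ltW e0)// ler_pdivrMr// mul1r lerDl.
by move: t1 t2 t3; clear; lra.
Qed.

End L2toL1.

Section IdxFacts.
Context (R : realType) (kap : nat -> R).
Local Notation idx := (idx kap).
Local Notation tau := (tau kap).

Lemma idx_le m (t t' : R) : t <= t' -> (idx m t <= idx m t')%N.
Proof. by move=> tt; apply: le_truncn; rewrite ler_wpM2r// exprn_ge0. Qed.

Lemma idx_dist m (t t' : R) : 0 <= t -> t <= t' ->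
  (idx m t' - idx m t)%:R * tau m <= (t' - t) + tau m.
Proof.
move=> t0 tt; have t'0 := le_trans t0 tt.
rewrite natrB ?idx_le// mulrBl.
have := idx_tau kap m t'0; have := idx_tauS kap m t0.
rewrite -natr1 mulrDl mul1r.
move: ((idx m t)%:R * tau m) ((idx m t')%:R * tau m) (tau m) => x y z; lra.
Qed.

Lemma measurable_idx m k : measurable [set t : measurableTypeR R | idx m t = k].
Proof.
have me (j : nat) : measurable [set t : measurableTypeR R | (idx m t <= j)%N].
  rewrite (_ : [set t | _] = `]-oo, (j.+1%:R / 2 ^+ step_exp kap m)[%classic).
    exact: measurable_itv.
  apply/seteqP; split => t /=; rewrite in_itv/= /idx truncn_le_nat ltr_pdivlMr ?exprn_gt0//.
case: k => [|k].
  rewrite (_ : [set t | _] = [set t | (idx m t <= 0)%N])//.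
  by apply/seteqP; split => t /=; rewrite leqn0 => /eqP.
rewrite (_ : [set t | _] = [set t | (idx m t <= k.+1)%N] `\` [set t | (idx m t <= k)%N]).
  exact: measurableD.
apply/seteqP; split => t /=; first by move=> ->; split => //; rewrite ltnn.
by move=> [h1 /negP]; rewrite -ltnNge => h2; apply/eqP; rewrite eqn_leq h1.
Qed.

Lemma measurable_piecewise d (T : measurableType d) m (F : nat -> T -> R) :
  (forall k, measurable_fun setT (F k)) ->
  measurable_fun setT (fun z : T * measurableTypeR R => F (idx m z.2) z.1).
Proof.
move=> mF _ B mB; rewrite setTI.
rewrite (_ : _ @^-1` B = \bigcup_k ((F k @^-1` B) `*` [set t | idx m t = k])).
  apply: bigcupT_measurable => k; apply: measurableX; last exact: measurable_idx.
  by rewrite -[X in measurable X]setTI; exact: mF.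
apply/seteqP; split => -[x t] /=; first by exists (idx m t).
by move=> [k _ [/= h ->]].
Qed.

End IdxFacts.

Section Construction.
Context d (T : measurableType d) (R : realType).
Variables (mu : {sigma_finite_measure set T -> \bar R}) (add sub : T -> T -> T).
Hypothesis Tr : is_translation mu add sub.
Variables (Ph : nat -> R -> R) (km : nat -> T -> R) (kap : nat -> R) (K : T -> R) (q : R).
Hypothesis Scm : forall m,
  is_scheme mu (Ph m) m%:R (fun z => km m (sub z.1 z.2)) (kap m).
Hypothesis kap_nd : forall m n, (m <= n)%N -> kap m <= kap n.
Hypotheses (kmK : forall m z, km m z <= K z) (mK : measurable_fun setT K)
  (Ksym : forall x y, K (sub x y) = K (sub y x))
  (Ph_sub : forall m a b, 0 <= a -> 0 <= b -> `|Ph m (a - b)| <= a `^ q + b `^ q).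
(* [e M m] bounds the error of level [m] with respect to all higher levels, on
   functions with values in [0, M]. *)
Variable e : R -> nat -> T -> R.
Hypotheses (me : forall M m, measurable_fun setT (e M m))
  (e0 : forall M m z, 0 <= M -> 0 <= e M m z)
  (he : forall M m n a z, (m <= n)%N -> `|a| <= M ->
     `|Ph m a * km m z - Ph n a * km n z| <= e M m z).
Definition nice M (v : T -> R) := good mu M v /\ intg (mu \x mu)%E (diff2 sub K v).
Hypothesis e_small : forall M v, nice M v ->
  (forall m, intg (mu \x mu)%E (diff2 sub (e M m) v)) /\
  forall eps, 0 < eps -> exists m0, forall m, (m0 <= m)%N ->
    \int[(mu \x mu)%E]_z diff2 sub (e M m) v z <= eps.
Variables (phi : T -> R) (B0 : R) (W : T -> \bar R).
Hypotheses (mphi : measurable_fun setT phi) (phi0 : forall x, 0 < phi x)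
  (phiB : forall x, phi x <= B0)
  (decay : forall e : R, 0 < e -> exists B, [/\ measurable B, (mu B < +oo)%E &
     forall x, ~ B x -> phi x <= e])
  (mW : measurable_fun setT W) (W0 : forall x, (0 <= W x)%E)
  (Wfin : (\int[mu]_x W x < +oo)%E)
  (HW : forall x a, 0 <= a -> (\int[mu]_y
     ((a `^ q * (K (sub x y) * `|phi x - phi y|))%R%:E) <= (a * phi x)%:E + W x)%E).
Let phi_ge0 x : 0 <= phi x. Proof. exact: ltW. Qed.

Local Notation euler_flow := (euler_flow mu sub Ph km kap).
Local Notation idx := (idx kap).
Local Notation tau := (tau kap).

Let cflm m : tau m * (m%:R * kap m) <= 1.
Proof. exact: (@cfl_m _ _ _ mu sub Ph km kap Scm m). Qed.
Let tau0 m : 0 <= tau m. Proof. exact: ltW (tau_gt0 kap m). Qed.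
Let taule m : tau m <= (2 ^+ m)^-1.
Proof. exact: (@tau_le _ _ _ mu sub Ph km kap Scm m). Qed.
Let taucc m : tau m * scheme_cst kap m <= (2 ^+ m)^-1.
Proof. exact: (@tau_cst _ _ _ mu sub Ph km kap Scm m). Qed.
Let ccge0 m : 0 <= scheme_cst kap m.
Proof. exact: (@scheme_cst_ge0 _ _ _ mu sub Ph km kap Scm m). Qed.
Let flow_good M m t v : good mu M v -> good mu M (euler_flow m t v).
Proof. exact: (@euler_flow_good _ _ _ mu sub Ph km kap Scm M m t v). Qed.
Let flow_mass M m t v : good mu M v -> \int[mu]_x euler_flow m t v x = \int[mu]_x v x.
Proof. exact: (iter_mass (Scm m) (tau0 m) (cflm m)). Qed.

Let intg_w (w : T -> R) : intg mu w -> intg mu (fun x => w x * phi x).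
Proof. by move=> iw; apply: (intg_mulb (B := B0)) => // x; rewrite ger0_norm. Qed.

(** The bound of [cauchy_bound] is uniform in the higher level and in time. *)
Lemma cauchy_small M v eps tb : nice M v -> 0 < eps -> 0 <= tb ->
  exists m0, forall m n, (m0 <= m)%N -> (m <= n)%N -> forall t, 0 <= t <= tb ->
    \int[mu]_x (`|euler_flow m t v x - euler_flow n t v x| * phi x) <= eps.
Proof.
move=> nv eps0 tb0; have [gv iKv] := nv; have [ie hs] := e_small nv.
have [mv vM iv] := gv.
have M0 : 0 <= M by have /andP[h1 h2] := vM point; exact: le_trans h2.
pose I := \int[mu]_x v x.
have I0 : 0 <= I by apply: Rint_ge0 => x; case/andP: (vM x).
have I20 : 0 <= 2 * I by rewrite mulr_ge0.
have [dl dl0 hdl] := L2_to_weighted_L1 mphi phi_ge0 phiB decay I20 eps0.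
pose cst := 2 * ((2 * tb + 1) * M * (2 * I)) + 2 * (tb * (16 * (M * I))).
have MI0 : 0 <= M * I by rewrite mulr_ge0.
have cst0 : 0 <= cst.
  by rewrite addr_ge0// mulr_ge0// mulr_ge0// ?mulr_ge0// addr_ge0// mulr_ge0.
have d1 : 0 < dl / (2 * (4 * tb + 1)).
  by rewrite divr_gt0// mulr_gt0// ltr_wpDl// mulr_ge0.
have [m1 hm1] := hs _ d1.
have [m2 hm2] := lt_exp2n (2 * cst / dl).
exists (maxn m1 m2) => m n; rewrite geq_max => /andP[m1m m2m] mn t /andP[t0 ttb].
have gm := flow_good m t gv; have gn := flow_good n t gv.
have [mm SmM im] := gm; have [mn_ SnM iN] := gn.
have iw : intg mu (fun x => euler_flow m t v x - euler_flow n t v x) by exact: intgB.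
apply: hdl => //.
- apply: (intg_sqr (M1 := M)) => //; split; first exact: intg_measurable iw.
  by move=> x; exact: (dist_itv (SmM x) (SnM x)).
- apply: (@le_trans _ _ (\int[mu]_x (euler_flow m t v x + euler_flow n t v x))).
    apply: le_Rint; [exact: intg_norm|exact: intgD|].
    by move=> x; exact: (dist_itvD (SmM x) (SnM x)).
  rewrite RintD// (flow_mass m t gv) (flow_mass n t gv).
  by rewrite mulr2n mulrDl mul1r.
have e0' m' z : 0 <= e M m' z by exact: e0.
have := cauchy_bound Tr Scm kap_nd (me M) e0' (he (M := M)) gv ie mn t0.
move=> /le_trans; apply; rewrite -/I.
set eta := \int[_]_z _.
have eta0 : 0 <= eta by apply: Rint_ge0 => z; rewrite mulr_ge0// e0.
have etas : eta <= dl / (2 * (4 * tb + 1)) by exact: hm1.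
set y := (2 ^+ m)^-1.
have y0 : 0 <= y by rewrite invr_ge0 exprn_ge0.
have yc : cst * y <= dl / 2.
  rewrite /y ler_pdivrMr ?exprn_gt0//.
  have h : 2 * cst / dl <= 2 ^+ m.
    by apply: (le_trans (ltW hm2)); rewrite ler_weXn2l// ler1n.
  by move: h; rewrite ler_pdivrMr// => h; rewrite mulrAC ler_pdivlMr// mulrC (mulrC dl).
apply: (@le_trans _ _ (cst * y + 4 * tb * eta)).
  have := cauchy_arith MI0 eta0 y0 ttb; congr (_ <= _).
    by rewrite -/y; ring.
  by rewrite /cst; ring.
have : 4 * tb * eta <= dl / 2.
  apply: (@le_trans _ _ ((4 * tb + 1) * (dl / (2 * (4 * tb + 1))))).
    by apply: ler_pM => //; rewrite ?mulr_ge0// lerDl.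
  rewrite le_eqVlt; apply/orP; left; apply/eqP; field.
  by rewrite gt_eqF// ltr_wpDl// mulr_ge0.
by move: yc; move: (cst * y) (4 * tb * eta) => a b h1 h2; rewrite (splitr dl) lerD.
Qed.

Variables (u0 : T -> R) (v : nat -> T -> R) (MM : nat -> R) (X0 c0 : R).
Hypotheses (iu0 : intg mu (fun x => u0 x * phi x))
  (nv : forall n, nice (MM n) (v n))
  (vX : forall n, \int[mu]_x (v n x * phi x) <= X0)
  (vmono : forall n, \int[mu]_x Num.max (v n x - v n.+1 x) 0 <= c0 * (2 ^+ n)^-1)
  (vcvg : \int[mu]_x (`|v n x - u0 x| * phi x) @[n --> \oo] --> 0).

Let gv n : good mu (MM n) (v n). Proof. by have [] := nv n. Qed.
Let B00 : 0 <= B0. Proof. exact: le_trans (phiB point). Qed.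
Let In n : R := \int[mu]_x v n x.
Let In0 n : 0 <= In n.
Proof. by apply: Rint_ge0 => x; have [_ h _] := gv n; case/andP: (h x). Qed.

Let level_ex n : exists m0, forall m, (m0 <= m)%N ->
   (forall m', (m <= m')%N -> forall t, 0 <= t <= n%:R ->
      \int[mu]_x (`|euler_flow m t (v n) x - euler_flow m' t (v n) x| * phi x) <= (2 ^+ n)^-1) /\
   (2 ^+ m)^-1 * (2 * B0 * In n) <= (2 ^+ n)^-1.
Proof.
have e2 : 0 < (2 ^+ n)^-1 :> R by rewrite invr_gt0 exprn_gt0.
have [m1 hm1] := cauchy_small (nv n) e2 (ler0n R n).
have [m2 hm2] := lt_exp2n (2 * B0 * In n * 2 ^+ n).
exists (maxn m1 m2) => m; rewrite geq_max => /andP[h1 h2]; split.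
  by move=> m' mm' t; exact: hm1.
rewrite ler_pdivrMl ?exprn_gt0// ler_pdivlMr ?exprn_gt0//.
by apply: (le_trans (ltW hm2)); rewrite ler_weXn2l// ler1n.
Qed.

Let lev0 n : nat := sval (cid (level_ex n)).

(** The maximum makes the levels nondecreasing; the summand [n] makes them tend to
    infinity. *)
Definition level n : nat := (\max_(i < n.+1) lev0 i + n)%N.

Let level_ge n : (lev0 n <= level n)%N.
Proof.
apply: leq_trans (leq_addr _ _).
exact: (leq_bigmax (F := fun i : 'I_n.+1 => lev0 i) ord_max).
Qed.

Let level_n n : (n <= level n)%N. Proof. exact: leq_addl. Qed.

Let level_nd n : (level n <= level n.+1)%N.
Proof. by rewrite /level [X in (_ <= X + _)%N]big_ord_recr/= leq_add// leq_maxl. Qed.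

Let levelP n := svalP (cid (level_ex n)) (level n) (level_ge n).

Definition approx_sol n t : T -> R := euler_flow (level n) t (v n).

Lemma approx_sol_good n t : good mu (MM n) (approx_sol n t).
Proof. exact: flow_good. Qed.

Lemma approx_sol0 n : approx_sol n 0 = v n.
Proof. exact: euler_flow0. Qed.

Lemma approx_sol_phi n t : intg mu (fun x => approx_sol n t x * phi x).
Proof. by apply: intg_w; have [] := approx_sol_good n t. Qed.

Let tau_level n : tau (level n) <= (2 ^+ n)^-1.
Proof.
apply: le_trans (taule _) _.
by rewrite lef_pV2 ?posrE ?exprn_gt0// ler_weXn2l// ler1n.
Qed.

Definition defect_mass : R := fine (\int[mu]_x W x)%E.
Definition growth_bound (tb : R) : R := (X0 + defect_mass) * expR tb.

Lemma approx_sol_mass n t tb : 0 <= t -> t <= tb -> \int[mu]_x (approx_sol n t x * phi x) <= growth_bound tb.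
Proof.
move=> t0 ttb; pose m := level n.
have h := @iter_bound _ _ _ mu q (Ph m) m%:R (fun z => km m (sub z.1 z.2))
  (fun z => K (sub z.1 z.2)) (kap m) (Scm m) (fun z => kmK m _)
  (measurableT_comp mK (tr_msub Tr)) Ksym (Ph_sub m) phi B0 W mphi phi_ge0 phiB
  mW W0 Wfin HW (tau m) (ltW (tau_gt0 kap m)) (cflm m) (MM n) (v n) (idx m t) tb (gv n)
  (le_trans (idx_tau kap m t0) ttb).
have w0 : 0 <= defect_mass by rewrite fine_ge0// integral_ge0.
apply: (@le_trans _ _ (\int[mu]_x (approx_sol n t x * phi x) + defect_mass)); first by rewrite lerDl.
by apply: (le_trans h); rewrite ler_wpM2r ?expR_ge0// lerD2r.
Qed.

Lemma approx_sol_mass_lip n t t' tb : 0 <= t -> t <= t' -> t' <= tb ->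
  `|\int[mu]_x (approx_sol n t' x * phi x) - \int[mu]_x (approx_sol n t x * phi x)| <=
  (t' - t + (2 ^+ n)^-1) * growth_bound tb.
Proof.
move=> t0 tt ttb; pose m := level n.
have ii := idx_le kap m tt.
have := @iter_X_lip _ _ _ mu q (Ph m) m%:R (fun z => km m (sub z.1 z.2))
  (fun z => K (sub z.1 z.2)) (kap m) (Scm m) (fun z => kmK m _)
  (measurableT_comp mK (tr_msub Tr)) Ksym (Ph_sub m) phi B0 W mphi phi_ge0 phiB
  mW W0 Wfin HW (tau m) (ltW (tau_gt0 kap m)) (cflm m) (MM n) (v n) (idx m t)
  (idx m t' - idx m t) tb (gv n).
rewrite subnKC// => /(_ (le_trans (idx_tau kap m (le_trans t0 tt)) ttb)) /le_trans; apply.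
have w0 : 0 <= defect_mass by rewrite fine_ge0// integral_ge0.
have v0 : 0 <= \int[mu]_x (v n x * phi x).
  by apply: Rint_ge0 => x; rewrite mulr_ge0//; have [_ hh _] := gv n; case/andP: (hh x).
apply: ler_pM.
- by rewrite mulr_ge0// (ltW (tau_gt0 kap m)).
- by rewrite mulr_ge0 ?expR_ge0// addr_ge0.
- by apply: (le_trans (idx_dist kap m t0 tt)); rewrite lerD2l; exact: tau_level.
- by rewrite ler_wpM2r ?expR_ge0// lerD2r.
Qed.

Lemma approx_sol_move n t t' : 0 <= t -> t <= t' ->
  \int[mu]_x (`|approx_sol n t' x - approx_sol n t x| * phi x) <=
  (t' - t) * (B0 * (2 * scheme_cst kap (level n) * In n)) + (2 ^+ n)^-1.
Proof.
move=> t0 tt; pose m := level n.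
have ii := idx_le kap m tt.
have [mt tM it] := approx_sol_good n t; have [mt' tM' it'] := approx_sol_good n t'.
have i1 : intg mu (fun x => `|approx_sol n t' x - approx_sol n t x|) by apply: intg_norm; exact: intgB.
apply: (@le_trans _ _ (B0 * \int[mu]_x `|approx_sol n t' x - approx_sol n t x|)).
  rewrite -RintZ//; apply: le_Rint; [exact: intg_w|exact: intgZ|].
  by move=> x; rewrite mulrC ler_wpM2r.
have := iter_move (Scm m) (ltW (tau_gt0 kap m)) (cflm m) (idx m t) (idx m t' - idx m t) (gv n).
rewrite subnKC// -/(approx_sol n t') -/(approx_sol n t) -/(scheme_cst kap m) -/(In n) => h.
apply: (le_trans (ler_wpM2l B00 h)).
have cI : 0 <= 2 * scheme_cst kap m * In n by rewrite mulr_ge0// mulr_ge0// ccge0.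
rewrite (mulrA (_%:R)).
apply: (@le_trans _ _ (B0 * ((t' - t + tau m) * (2 * scheme_cst kap m * In n)))).
  by rewrite ler_wpM2l// ler_wpM2r// idx_dist.
rewrite mulrDl mulrDr (mulrCA B0 (t' - t)) lerD2l.
have [_ h2] := levelP n; apply: le_trans h2.
rewrite (_ : _ * _ = (tau m * scheme_cst kap m) * (2 * B0 * In n)); last by ring.
rewrite ler_wpM2r ?mulr_ge0//; exact: taucc.
Qed.

(** Passing from the level of [n] to that of [n.+1] with the same datum costs
    [2 ^- n] by the choice of the levels; then the data are exchanged at a fixed
    level, where positive parts are contracted. *)
Lemma approx_sol_almost_mono n t : 0 <= t <= n%:R ->
  \int[mu]_x (Num.max (approx_sol n t x - approx_sol n.+1 t x) 0 * phi x) <= (1 + B0 * c0) * (2 ^+ n)^-1.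
Proof.
move=> tn; pose V := euler_flow (level n.+1) t (v n).
have gV : good mu (MM n) V by exact: flow_good.
have [h1 _] := levelP n; have {}h1 := h1 _ (level_nd n) t tn; rewrite -/(approx_sol n t) -/V in h1.
have gn := approx_sol_good n t; have gn1 := approx_sol_good n.+1 t.
have [_ _ i1] := gn; have [_ _ i2] := gn1; have [_ _ i3] := gV.
have h2 : \int[mu]_x Num.max (V x - approx_sol n.+1 t x) 0 <= c0 * (2 ^+ n)^-1.
  apply: le_trans (vmono n).
  exact: (iter_Tcontr (Scm _) (tau0 _) (cflm _) _ (gv n) (gv n.+1)).
have iV := intg_posB i3 i2.
have iVp : intg mu (fun x => Num.max (V x - approx_sol n.+1 t x) 0 * phi x) by exact: intg_w.
have iab : intg mu (fun x => `|approx_sol n t x - V x| * phi x).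
  by apply: intg_w; apply: intg_norm; exact: intgB.
apply: (@le_trans _ _ (\int[mu]_x (`|approx_sol n t x - V x| * phi x + Num.max (V x - approx_sol n.+1 t x) 0 * phi x))).
  apply: le_Rint; [by apply: intg_w; exact: intg_posB|exact: intgD|].
  move=> x; rewrite -mulrDl ler_wpM2r// ge_max; apply/andP; split; last first.
    by rewrite addr_ge0// le_max lexx orbT.
  rewrite (_ : _ - _ = (approx_sol n t x - V x) + (V x - approx_sol n.+1 t x)); last by ring.
  by rewrite lerD// ?ler_norm// le_max lexx.
rewrite RintD// mulrDl mul1r lerD//.
rewrite -mulrA; apply: (@le_trans _ _ (B0 * \int[mu]_x Num.max (V x - approx_sol n.+1 t x) 0)).
  rewrite -RintZ//; apply: le_Rint => //; first exact: intgZ.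
  by move=> x; rewrite mulrC ler_wpM2r// le_max lexx orbT.
by rewrite ler_wpM2l.
Qed.

End Construction.

(** * The limit curve *)

Lemma cvg_inv2X (R : realType) (c : R) : c * (2 ^+ n)^-1 @[n --> \oo] --> 0.
Proof.
have -> : (fun n => c * (2 ^+ n)^-1) = geometric c (2^-1 : R).
  by apply/funext => n; rewrite /geometric /= exprVn.
by apply: cvg_geometric; rewrite ger0_norm ?invr_ge0// invf_lt1// ltr1n.
Qed.

Section LimitCurve.
Context d (T : measurableType d) (R : realType).
Variables (mu : {sigma_finite_measure set T -> \bar R}).
Variables (phi : T -> R) (f : nat -> R -> T -> R) (growth_bound : R -> R) (c1 : R) (D : nat -> R).
Hypotheses (mphi : measurable_fun setT phi) (phi0 : forall x, 0 < phi x)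
  (mf : forall n t, measurable_fun setT (f n t))
  (mf2 : forall n, measurable_fun setT (fun z : T * measurableTypeR R => f n z.2 z.1))
  (f0 : forall n t x, 0 <= f n t x)
  (fi : forall n t, intg mu (fun x => f n t x * phi x))
  (fX : forall n t tb, 0 <= t -> t <= tb -> \int[mu]_x (f n t x * phi x) <= growth_bound tb)
  (fL : forall n t t' tb, 0 <= t -> t <= t' -> t' <= tb ->
    `|\int[mu]_x (f n t' x * phi x) - \int[mu]_x (f n t x * phi x)| <=
    (t' - t + (2 ^+ n)^-1) * growth_bound tb)
  (fM : forall n t t', 0 <= t -> t <= t' ->
    \int[mu]_x (`|f n t' x - f n t x| * phi x) <= (t' - t) * D n + (2 ^+ n)^-1)
  (fP : forall n t, 0 <= t <= n%:R ->
    \int[mu]_x (Num.max (f n t x - f n.+1 t x) 0 * phi x) <= c1 * (2 ^+ n)^-1).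

(** The upper limit is jointly measurable in space and time; it is the limit at
    the points where the envelope is finite. *)
Definition ulim (t : R) (x : T) : R := fine (limn_esup (fun n => (f n t x)%:E)).

Lemma measurable_ulim : measurable_fun setT (fun z : T * measurableTypeR R => ulim z.2 z.1).
Proof.
apply: (measurableT_comp (f := fine)); first exact: fine_measurable.
apply: measurable_fun_limn_esup => n; apply/measurable_EFinP; exact: mf2.
Qed.

Lemma measurable_ulim1 t : measurable_fun setT (ulim t).
Proof.
apply: (measurableT_comp (f := fine)); first exact: fine_measurable.
apply: measurable_fun_limn_esup => n; apply/measurable_EFinP; exact: mf.
Qed.

(** The approximations are almost monotone at time [t] from the index [t] on, hence
    the shift by [L]. *)
Definition uenv (L : nat) (t : R) : T -> \bar R := envelope (fun i => f (i + L) t).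

Lemma measurable_uenv L :
  measurable_fun setT (fun z : T * measurableTypeR R => uenv L z.2 z.1).
Proof.
apply: emeasurable_funD; first by apply/measurable_EFinP; exact: mf2.
apply: ge0_emeasurable_sum => [n x _ _|n _]; first by rewrite lee_fin /incr.
apply/measurable_EFinP; apply: measurableT_comp => //.
by apply: measurable_funB; exact: mf2.
Qed.

Lemma ulim_cvgL L t x : (uenv L t x < +oo)%E -> f n t x @[n --> \oo] --> ulim t x.
Proof.
move=> h.
have c : cvgn (fun i => f (i + L) t x) by exact: (env_cvg (f := fun i => f (i + L) t)).
have {}c : f n t x @[n --> \oo] --> limn (fun i => f (i + L) t x).
  by rewrite -(cvg_shiftn L).
have ce : (f n t x)%:E @[n --> \oo] --> (limn (fun i => f (i + L) t x))%:E.
  by apply/fine_cvgP; split => //; near=> n.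
rewrite /ulim is_cvg_limn_esupE ?(cvg_lim _ ce)//.
Unshelve. all: by end_near. Qed.

Section Fixed.
Variables (L : nat) (t : R).
Hypothesis tL : 0 <= t <= L%:R.
Let t0 : 0 <= t. Proof. by case/andP: tL. Qed.
Let F i := f (i + L) t.
Let cL := c1 * (2 ^+ L)^-1.
Let FX i : \int[mu]_x (F i x * phi x) <= growth_bound L%:R.
Proof. by apply: fX => //; case/andP: tL. Qed.
Let FP i : \int[mu]_x (Num.max (F i x - F i.+1 x) 0 * phi x) <= cL * (2 ^+ i)^-1.
Proof.
rewrite /cL -mulrA -invfM -exprD addnC.
apply: fP; rewrite t0/=; case/andP: tL => _ /le_trans; apply.
by rewrite ler_nat leq_addl.
Qed.
Let Fl x : (envelope F x < +oo)%E -> F n x @[n --> \oo] --> ulim t x.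
Proof. by move=> /ulim_cvgL; rewrite -(cvg_shiftn L). Qed.
Let mF i : measurable_fun setT (F i). Proof. exact: mf. Qed.
Let F0 i x : 0 <= F i x. Proof. exact: f0. Qed.
Let Fi i : intg mu (fun x => F i x * phi x). Proof. exact: fi. Qed.

Lemma uenv_int : (\int[mu]_x (uenv L t x * (phi x)%:E) <=
   (2 * growth_bound L%:R + 4 * cL)%:E)%E.
Proof. exact: (env_int mphi phi0 mF F0 Fi FX FP). Qed.

Lemma ulim_intg_norm : intg mu (fun x => `|ulim t x| * phi x).
Proof. exact: (l_intg_norm mphi phi0 mF F0 Fi FX FP (measurable_ulim1 t) Fl). Qed.

Lemma ulim_intg : intg mu (fun x => ulim t x * phi x).
Proof. exact: (l_intg mphi phi0 mF F0 Fi FX FP (measurable_ulim1 t) Fl). Qed.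

Lemma ulim_cvg : \int[mu]_x (`|ulim t x - f n t x| * phi x) @[n --> \oo] --> 0.
Proof.
rewrite -(cvg_shiftn L).
exact: (l_cvg mphi phi0 mF F0 Fi FX FP (measurable_ulim1 t) Fl).
Qed.

Lemma ulim_dist n : (L <= n)%N -> \int[mu]_x (`|ulim t x - f n t x| * phi x) <=
  \int[mu]_x (ulim t x * phi x) - \int[mu]_x (f n t x * phi x) + 4 * c1 * (2 ^+ n)^-1.
Proof.
move=> Ln.
have := l_dist mphi phi0 mF F0 Fi FX FP (measurable_ulim1 t) Fl (n - L).
rewrite /F subnK// /cL mulrA -mulrA -invfM -exprD subnKC//.
Qed.

End Fixed.

Let X t := \int[mu]_x (ulim t x * phi x).
Let Y n t := \int[mu]_x (`|ulim t x - f n t x| * phi x).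

Let XY L n t : 0 <= t <= L%:R -> `|X t - \int[mu]_x (f n t x * phi x)| <= Y n t.
Proof.
move=> tL; rewrite /X -RintB; [|exact: (ulim_intg tL)|exact: fi].
have i1 := intgB (ulim_intg tL) (fi n t).
apply: (le_trans (le_norm_Rint i1)).
rewrite le_eqVlt; apply/orP; left; apply/eqP; apply: eq_Rint => x.
by rewrite -mulrBl normrM (gtr0_norm (phi0 x)).
Qed.

Lemma growth_bound_ge0 L : 0 <= growth_bound L%:R.
Proof.
apply: le_trans (fX 0 (lexx 0) (ler0n R L)); apply: Rint_ge0 => x.
by rewrite mulr_ge0// ltW.
Qed.

Let X_lip L t t' : 0 <= t -> t <= t' -> t' <= L%:R ->
  `|X t' - X t| <= (t' - t) * growth_bound L%:R.
Proof.
move=> t0 tt tL.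
have h1 : 0 <= t <= L%:R by rewrite t0 (le_trans tt).
have h2 : 0 <= t' <= L%:R by rewrite (le_trans t0 tt).
have c : (Y n t' + Y n t) + ((t' - t) * growth_bound L%:R + growth_bound L%:R * (2 ^+ n)^-1) @[n --> \oo] -->
    (0 + 0) + ((t' - t) * growth_bound L%:R + 0).
  apply: cvgD; apply: cvgD; [exact: ulim_cvg h2|exact: ulim_cvg h1|exact: cvg_cst|exact: cvg_inv2X].
rewrite !addr0 add0r in c; apply: (cvgn_ge (N := 0) c) => n _.
have a1 := XY n h2; have a2 := XY n h1; have a3 := fL n t0 tt tL.
move: a1 a2 a3; rewrite mulrDl (mulrC _^-1).
move: (\int[mu]_x _) (\int[mu]_x _) (Y n t') (Y n t) (X t') (X t) => a b y' y x' x.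
move: (_ * _) (_ * _) => p r h1' h2' h3'.
rewrite (_ : x' - x = (x' - b) + ((b - a) - (x - a))); last by ring.
apply: (le_trans (ler_normD _ _)); rewrite -[leRHS]addrA; apply: lerD => //.
by apply: (le_trans (ler_normB _ _)); rewrite addrC; apply: lerD.
Qed.

(** Freeze an index [n] that is good at [t0].  The distance of [ulim t] to [f n t]
    is at most a difference of weighted masses, by [ulim_dist]; these masses are
    Lipschitz in time, so this distance is also small for [t] near [t0]. *)
Lemma ulim_cont L t0 eps : 0 <= t0 <= L%:R -> 0 < eps -> exists2 dl, 0 < dl &
  forall t, 0 <= t <= L%:R -> `|t - t0| < dl ->
    \int[mu]_x (`|ulim t x - ulim t0 x| * phi x) <= eps.
Proof.
move=> t0L eps0.
pose C := growth_bound L%:R; have C0 : 0 <= C by exact: growth_bound_ge0.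
have cz : 2 * Y n t0 + (C + 4 * c1 + 1) * (2 ^+ n)^-1 @[n --> \oo] --> (2 * 0 + 0 : R).
  by apply: cvgD; [apply: cvgMr; exact: ulim_cvg t0L|exact: cvg_inv2X].
rewrite mulr0 addr0 in cz.
have e2 : 0 < eps / 2 by rewrite divr_gt0.
have [n Ln hn] : exists2 n, (L <= n)%N & 2 * Y n t0 + (C + 4 * c1 + 1) * (2 ^+ n)^-1 <= eps / 2.
  have /cvgrPdist_le/(_ _ e2)[n0 _ h] := cz.
  exists (maxn n0 L); first exact: leq_maxr.
  have := h _ (leq_maxl n0 L); rewrite sub0r normrN; apply: le_trans; exact: ler_norm.
pose E := 2 * C + `|D n| + 1.
have E0 : 0 < E by rewrite ltr_wpDl// addr_ge0// mulr_ge0.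
exists (eps / 2 / E); first by rewrite divr_gt0.
move=> t tL td.
have tdE : `|t - t0| * E <= eps / 2 by rewrite -ler_pdivlMr// ltW.
have fLt : `|\int[mu]_x (f n t x * phi x) - \int[mu]_x (f n t0 x * phi x)| <=
    (`|t - t0| + (2 ^+ n)^-1) * C.
  have [tt|tt] := leP t0 t.
    by rewrite (ger0_norm (x := t - t0)) ?subr_ge0//; apply: fL => //; [case/andP: t0L|case/andP: tL].
  rewrite distrC (ler0_norm (x := t - t0)) ?subr_le0 ?(ltW tt)// opprB.
  by apply: fL; [case/andP: tL|exact: ltW|case/andP: t0L].
have fMt : \int[mu]_x (`|f n t x - f n t0 x| * phi x) <= `|t - t0| * D n + (2 ^+ n)^-1.
  have [tt|tt] := leP t0 t.
    by rewrite (ger0_norm (x := t - t0)) ?subr_ge0//; apply: fM => //; case/andP: t0L.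
  rewrite (ler0_norm (x := t - t0)) ?subr_le0 ?(ltW tt)// opprB.
  under eq_Rint do rewrite distrC.
  by apply: fM; [case/andP: tL|exact: ltW].
have Xt : `|X t - X t0| <= `|t - t0| * C.
  have [tt|tt] := leP t0 t.
    by rewrite (ger0_norm (x := t - t0)) ?subr_ge0//; apply: X_lip => //; [case/andP: t0L|case/andP: tL].
  rewrite distrC (ler0_norm (x := t - t0)) ?subr_le0 ?(ltW tt)// opprB.
  by apply: X_lip; [case/andP: tL|exact: ltW|case/andP: t0L].
have d1 := ulim_dist tL Ln.
have y0 := XY n t0L.
have i1 := intg_norm (intgB (ulim_intg tL) (fi n t)).
have i2 := intg_norm (intgB (ulim_intg t0L) (fi n t0)).
have i3 := intg_norm (intgB (fi n t) (fi n t0)).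
have i4 := intg_norm (intgB (ulim_intg tL) (ulim_intg t0L)).
have nE (a b p : R) : 0 < p -> `|a * p - b * p| = `|a - b| * p.
  by move=> p0; rewrite -mulrBl normrM (gtr0_norm p0).
have key : \int[mu]_x (`|ulim t x - ulim t0 x| * phi x) <=
  Y n t + (Y n t0 + \int[mu]_x (`|f n t x - f n t0 x| * phi x)).
  move: i1 i2 i3 i4.
  under eq_fun do rewrite nE//.
  move=> i1; under eq_fun do rewrite nE//.
  move=> i2; under eq_fun do rewrite nE//.
  move=> i3; under eq_fun do rewrite nE//.
  move=> i4.
  rewrite /Y -(RintD i2 i3) -(RintD i1 (intgD i2 i3)).
  apply: le_Rint => //; first by apply: intgD => //; exact: intgD.
  move=> x; rewrite -!mulrDl; apply: ler_wpM2r; first exact: (ltW (phi0 x)).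
  rewrite (_ : ulim t x - ulim t0 x = (ulim t x - f n t x) +
    (- (ulim t0 x - f n t0 x) + (f n t x - f n t0 x))); last by ring.
  by rewrite (le_trans (ler_normD _ _))// lerD// (le_trans (ler_normD _ _))// normrN.
apply: (le_trans key).
have dD : `|t - t0| * D n <= `|t - t0| * `|D n| by rewrite ler_wpM2l// ler_norm.
rewrite /E in tdE; have := normr_ge0 (t - t0).
have := ler_norm (X t - X t0).
have := ler_norm (\int[mu]_x (f n t0 x * phi x) - \int[mu]_x (f n t x * phi x)).
rewrite distrC.
have := ler_norm (X t0 - \int[mu]_x (f n t0 x * phi x)).
move: dD tdE Xt fLt fMt d1 y0 hn.
rewrite -/(Y n t) -/(Y n t0) -/(X t) -/(X t0).
move: (\int[mu]_x (`|f n t x - f n t0 x| * phi x)) => g1.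
move: (\int[mu]_x (f n t x * phi x)) (\int[mu]_x (f n t0 x * phi x)) => a b.
move: (Y n t) (Y n t0) (X t) (X t0) ((2 ^+ n)^-1) => y y0 x x0 z.
clear -C0; move: (`|t - t0|) (`|D n|) (D n) => h dn dn'.
move: (`|x - x0|) (`|a - b|) (`|x0 - b|) => q1 q2 q3.
move=> *; lra.
Qed.

Variables (v : nat -> T -> R) (u0 : T -> R).
Hypotheses (fv : forall n, f n 0 = v n)
  (iu0 : intg mu (fun x => u0 x * phi x))
  (vcvg : \int[mu]_x (`|v n x - u0 x| * phi x) @[n --> \oo] --> 0).

Lemma ulim0 : \int[mu]_x (`|ulim 0 x - u0 x| * phi x) = 0.
Proof.
have z0 : 0 <= (0 : R) <= 0%:R by rewrite lexx.
have c : Y n 0 + \int[mu]_x (`|v n x - u0 x| * phi x) @[n --> \oo] --> 0 + 0.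
  by apply: cvgD => //; exact: ulim_cvg z0.
have nE (a b p : R) : 0 < p -> `|a * p - b * p| = `|a - b| * p.
  by move=> p0; rewrite -mulrBl normrM (gtr0_norm p0).
apply/eqP; rewrite eq_le; apply/andP; split; last first.
  by apply: Rint_ge0 => x; rewrite mulr_ge0// ltW.
rewrite addr0 in c; apply: (cvgn_ge (N := 0) c) => n _.
have := intg_norm (intgB (ulim_intg z0) (fi n 0)).
have := intg_norm (intgB (fi n 0) iu0).
have := intg_norm (intgB (ulim_intg z0) iu0).
under eq_fun do rewrite nE//.
move=> i1; under eq_fun do rewrite nE//.
move=> i2; under eq_fun do rewrite nE//.
rewrite fv in i2 * => i3.
rewrite /Y fv -(RintD i3 i2).
apply: le_Rint => //; first exact: intgD.
move=> x; rewrite -!mulrDl; apply: ler_wpM2r; first exact: (ltW (phi0 x)).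
rewrite (_ : ulim 0 x - u0 x = (ulim 0 x - v n x) + (v n x - u0 x)); last by ring.
exact: ler_normD.
Qed.

End LimitCurve.

(** * The discrete weak formulation *)

Section DominatedReal.
Context d (T : measurableType d) (R : realType) (mu : {measure set T -> \bar R}).

Lemma dominated_real (f_ : nat -> T -> R) (f : T -> R) (g : T -> \bar R) :
  (forall n, measurable_fun setT (f_ n)) -> measurable_fun setT f ->
  measurable_fun setT g -> (forall x, (0 <= g x)%E) -> (\int[mu]_x g x < +oo)%E ->
  (forall n x, (`|f_ n x|%:E <= g x)%E) ->
  (forall x, (g x < +oo)%E -> f_ n x @[n --> \oo] --> f x) ->
  intg mu f /\ \int[mu]_x f_ n x @[n --> \oo] --> \int[mu]_x f x.
Proof.
move=> mf_ mf mg g0 gi fg cf.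
have ig : mu.-integrable setT g.
  by apply/integrableP; split => //; under eq_integral do rewrite gee0_abs//.
have gae : {ae mu, forall x, setT x -> g x \is a fin_num} by exact: integrable_ae.
have [] := @dominated_convergence _ _ _ mu setT measurableT (fun n => EFin \o f_ n)
   (EFin \o f) g _ _ _ ig _.
- by move=> n; exact/measurable_EFinP.
- exact/measurable_EFinP.
- apply: filterS gae => x /= /(_ I) gx _; apply: cvg_EFin; first by near=> n.
  by apply: cf; rewrite -ge0_fin_numE.
- by apply: aeW => x n _ /=; exact: fg.
move=> fi _ c; split => //; rewrite /Rintegral.
by apply: fine_cvg; rewrite fineK//; exact: integrable_fin_num.
Unshelve. all: by end_near. Qed.

End DominatedReal.

Section Tensor.
Context d d' (X : measurableType d) (Y : measurableType d') (R : realType).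
Variables (nu : {sigma_finite_measure set X -> \bar R})
  (leb : {sigma_finite_measure set Y -> \bar R}).

Lemma tensor_intg (h : X -> R) (B : set Y) (b : R) : intg nu h ->
  measurable B -> leb B = b%:E ->
  intg (nu \x leb)%E (fun z => h z.1 * \1_B z.2) /\
  \int[(nu \x leb)%E]_z (h z.1 * \1_B z.2) = b * \int[nu]_x h x.
Proof.
move=> ih mB eB; have mh := intg_measurable ih.
have iB : intg leb (\1_B : _ -> R).
  by apply/intg_ge0P => //; rewrite integral_indic// setIT; have := ltry b; rewrite -eB.
have eBE : (\int[leb]_x (\1_B x)%:E = b%:E)%E.
  by rewrite integral_indic// setIT; exact: eB.
have eBR : \int[leb]_x \1_B x = b.
  by rewrite /Rintegral integral_indic// setIT; exact: (congr1 fine eB).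
have m1B : measurable_fun setT (\1_B : Y -> R) by exact: measurable_indic.
have mhB : measurable_fun setT (fun z : X * Y => h z.1 * \1_B z.2).
  apply: measurable_funM; first exact: (measurableT_comp mh).
  exact: (measurableT_comp m1B).
have i : intg (nu \x leb)%E (fun z => h z.1 * \1_B z.2).
  apply/integrable12ltyP; first exact/measurable_EFinP.
  under eq_integral => x _.
    under eq_integral => t _ do rewrite /= normrM (ger0_norm (x := \1_B t))// EFinM.
    rewrite ge0_integralZl//; last first.
    - by apply/measurable_EFinP.
    rewrite eBE.
    over.
  rewrite ge0_integralZr//.
  - rewrite lte_mul_pinfty//.
    + exact: integral_ge0.
    + by apply: integrable_fin_num => //; exact: intg_norm.
    + exact: ltry.
  - by apply/measurable_EFinP; exact: measurableT_comp.
  - by rewrite -eBE; apply: integral_ge0 => t _; rewrite lee_fin.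
split=> //; have [_ <-] := Rfubini12 i (fun x => intgZ (h x) iB).
under eq_Rint do rewrite /= RintZ// eBR.
by under eq_Rint do rewrite mulrC; rewrite RintZ.
Qed.

End Tensor.

Section TimeGrid.
Context d (X : measurableType d) (R : realType).
Variable nu : {sigma_finite_measure set X -> \bar R}.
Let leb : {sigma_finite_measure set (measurableTypeR R) -> \bar R} := @lebesgue_measure R.

Definition cell (J i : nat) : set (measurableTypeR R) :=
  `[i%:R / 2 ^+ J, i.+1%:R / 2 ^+ J[%classic.

Lemma measurable_cell J i : measurable (cell J i).
Proof. exact: measurable_itv. Qed.

Lemma leb_cell J i : leb (cell J i) = ((2 ^+ J)^-1)%:E.
Proof.
rewrite /leb /cell /= lebesgue_measure_itv /= lte_fin ltr_pM2r ?invr_gt0 ?exprn_gt0//.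
by rewrite ltr_nat ltnSn -EFinB -mulrBl -natrB// subSnn mul1r.
Qed.

Definition grid_fun (J I : nat) (h : nat -> X -> R) (z : X * measurableTypeR R) : R :=
  \sum_(i < I) h i z.1 * \1_(cell J i) z.2.

Lemma cell_trunc J i (t : R) : 0 <= t -> cell J i t <-> Num.trunc (t * 2 ^+ J) = i.
Proof.
move=> t0; have p : 0 < 2 ^+ J :> R by rewrite exprn_gt0.
rewrite /cell /= in_itv/= ler_pdivrMr// ltr_pdivlMr//; split=> [h|<-].
  by apply: truncn_def; exact: h.
by rewrite truncn_itv// mulr_ge0// ltW.
Qed.

Lemma grid_fun_eval J I h x t : 0 <= t -> (Num.trunc (t * 2 ^+ J) < I)%N ->
  grid_fun J I h (x, t) = h (Num.trunc (t * 2 ^+ J)) x.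
Proof.
move=> t0 tI; rewrite /grid_fun (bigD1 (Ordinal tI))//= indicE mem_set; last exact/cell_trunc.
rewrite mulr1 big1 ?addr0// => i /eqP ne.
rewrite indicE memNset ?mulr0//= => /(cell_trunc J i t0) e.
by apply: ne; apply: val_inj.
Qed.

Lemma grid_fun_out J I h x t : ~ (0 <= t < I%:R / 2 ^+ J) -> grid_fun J I h (x, t) = 0.
Proof.
move=> tI; rewrite /grid_fun big1// => i _.
rewrite indicE memNset ?mulr0//= /cell /= in_itv /= => /andP[h1 h2]; apply: tI.
rewrite (le_trans _ h1)/= ?divr_ge0 ?exprn_ge0//.
by apply: (lt_le_trans h2); rewrite ler_wpM2r ?invr_ge0 ?exprn_ge0// ler_nat.
Qed.

Lemma measurable_grid_fun J I h : (forall i, measurable_fun setT (h i)) ->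
  measurable_fun setT (grid_fun J I h).
Proof.
move=> mh; apply: measurable_sumR => i; apply: measurable_funM.
  exact: (measurableT_comp (mh i)).
have m1 : measurable_fun setT (\1_(cell J i) : measurableTypeR R -> R).
  by apply: measurable_indic; exact: measurable_cell.
exact: (measurableT_comp m1).
Qed.

Lemma Rint_grid_fun J I h : (forall i, intg nu (h i)) ->
  \int[(nu \x leb)%E]_z grid_fun J I h z = (2 ^+ J)^-1 * \sum_(i < I) \int[nu]_x h i x.
Proof.
move=> ih; rewrite mulr_sumr.
have key i := tensor_intg (ih i) (measurable_cell J i) (leb_cell J i).
rewrite (eq_bigr (fun i : 'I_I => \int[(nu \x leb)%E]_z (h i z.1 * \1_(cell J i) z.2))).
  2: by move=> i _; rewrite (key i).2.
suff [_ ->] : intg (nu \x leb)%E (grid_fun J I h) /\ \int[(nu \x leb)%E]_z grid_fun J I h z =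
  \sum_(i < I) \int[(nu \x leb)%E]_z (h i z.1 * \1_(cell J i) z.2) by [].
rewrite /grid_fun; elim: I => [|I [i1 i2]].
  under eq_fun do rewrite big_ord0; split.
    by have := intgZ 0 (key 0).1; under eq_fun do rewrite mul0r.
  by rewrite big_ord0 /Rintegral integral0.
split.
  under eq_fun do rewrite big_ord_recr/=.
  by apply: intgD => //; exact: (key I).1.
rewrite big_ord_recr/= -i2 -RintD//; last exact: (key I).1.
by apply: eq_Rint => z; rewrite big_ord_recr.
Qed.

End TimeGrid.

(** The product as a bundled sigma-finite measure, so that it can be a factor of
    another product. *)
Definition prod_sf d d' (X : measurableType d) (Y : measurableType d') (R : realType)
    (m1 : {sigma_finite_measure set X -> \bar R})
    (m2 : {sigma_finite_measure set Y -> \bar R}) :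
    {sigma_finite_measure set (X * Y)%type -> \bar R} :=
  HB.pack_for {sigma_finite_measure set (X * Y)%type -> \bar R} (m1 \x m2)%E
    (lebesgue_integral_fubini.measure_function_isMeasure__to__measure_function_isContent m1 m2)
    (lebesgue_integral_fubini.measure_function_isMeasure__to__measure_function_Content_isMeasure m1 m2)
    (lebesgue_integral_fubini.measure_function_Measure_isSigmaFinite__to__measure_function_isSFinite m1 m2)
    (lebesgue_integral_fubini.measure_function_Measure_isSigmaFinite__to__measure_function_isSigmaFinite m1 m2).

Section DiscreteWeak.
Context d (T : measurableType d) (R : realType).
Variable mu : {sigma_finite_measure set T -> \bar R}.
Let leb : {sigma_finite_measure set (measurableTypeR R) -> \bar R} := @lebesgue_measure R.
Variables (g : R -> R) (L : R) (k : T * T -> R) (kap : R).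
Hypothesis Sc : is_scheme mu g L k kap.
Variable J : nat.
Let tau : R := (2 ^+ J)^-1.
Hypothesis cfl : tau * (L * kap) <= 1.
Variables (M : R) (v : T -> R) (B : R) (psi : nat -> T -> R) (I : nat).
Hypotheses (gv : good mu M v) (mpsi : forall i, meas_bd B (psi i))
  (psi0 : forall x, psi 0%N x = 0) (psiI : forall x, psi I x = 0).
Let F i := iter i (step mu g k tau) v.
Let tau_gt0 : 0 < tau. Proof. by rewrite invr_gt0 exprn_gt0. Qed.

Let gF i : good mu M (F i).
Proof. exact: (iter_good Sc (ltW tau_gt0) cfl i gv). Qed.

Let iFpsi i j : intg mu (fun x => F i x * psi j x).
Proof. by have [m b] := mpsi j; have [_ _ iF] := gF i; exact: (intg_mulb m b iF). Qed.

Let h2 i (x : T) := F i x * ((psi i.+1 x - psi i x) / tau).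
Let h3 i (z : T * T) := flux g k (F i) z * (psi i.+1 z.1 - psi i.+1 z.2).

Lemma summation_by_parts : \sum_(i < I) \int[mu]_x (F i x * (psi i.+1 x - psi i x)) =
  tau / 2 * \sum_(i < I) \int[(mu \x mu)%E]_z h3 i z.
Proof.
have S i : \int[mu]_x (F i x * (psi i.+1 x - psi i x)) =
  \int[mu]_x (F i.+1 x * psi i.+1 x) - \int[mu]_x (F i x * psi i x) +
  tau / 2 * \int[(mu \x mu)%E]_z h3 i z.
  rewrite [X in X - _](_ : _ = \int[mu]_x (F i x * psi i.+1 x) -
    tau / 2 * \int[(mu \x mu)%E]_z h3 i z); last exact: (step_weak Sc tau (gF i) (mpsi i.+1)).
  rewrite (@eq_Rint _ _ _ _ _ (fun x => F i x * psi i.+1 x - F i x * psi i x)); last first.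
    by move=> x; rewrite mulrBr.
  rewrite RintB//; ring.
under eq_bigr do rewrite S; rewrite big_split/= -mulr_sumr.
rewrite -(big_mkord xpredT (fun i => \int[mu]_x (F i.+1 x * psi i.+1 x) - \int[mu]_x (F i x * psi i x))).
rewrite telescope_sumr//.
rewrite (@eq_Rint _ _ _ _ _ (fun=> 0)); last by move=> x; rewrite psiI mulr0.
rewrite [X in _ - X](@eq_Rint _ _ _ _ _ (fun=> 0)); last by move=> x; rewrite psi0 mulr0.
by rewrite subrr add0r.
Qed.

(** Abel summation of the scheme tested with [psi]: the time derivative becomes a
    difference quotient, and the space term sees [psi] at the end of the step.
    There is no error term. *)
Lemma discrete_weak :
  \int[(mu \x leb)%E]_z grid_fun J I h2 z =
  2^-1 * \int[(mu \x mu \x leb)%E]_z grid_fun J I h3 z.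
Proof.
rewrite Rint_grid_fun; last first.
  move=> i; have [m1 b1] := mpsi i.+1; have [m0 b0] := mpsi i.
  have [_ _ iF] := gF i; apply: (intg_mulb (B := (B + B) / tau)) => //.
    by apply: measurable_funM => //; exact: measurable_funB.
  move=> x; rewrite normrM (ger0_norm (x := tau^-1)) ?invr_ge0 ?(ltW tau_gt0)//.
  rewrite ler_wpM2r ?invr_ge0 ?(ltW tau_gt0)//.
  by apply: (le_trans (ler_normB _ _)); exact: lerD.
have ih3 i : intg (prod_sf mu mu) (h3 i).
  have [m1 b1] := mpsi i.+1.
  apply: (intg_mulb (B := B + B)); [exact: measurable_diff| |exact: (flux_intg Sc (gF i))].
  by move=> z; apply: (le_trans (ler_normB _ _)); exact: lerD.
rewrite (Rint_grid_fun J I ih3) -/tau mulrCA; congr (_ * _).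
transitivity (tau^-1 * \sum_(i < I) \int[mu]_x (F i x * (psi i.+1 x - psi i x))).
  rewrite mulr_sumr; apply: eq_bigr => i _; rewrite -RintZ.
    by apply: eq_Rint => x; rewrite /h2; ring.
  under eq_fun do rewrite mulrBr.
  exact: intgB.
by rewrite summation_by_parts 2!mulrA mulVf ?mul1r// gt_eqF.
Qed.

End DiscreteWeak.

(** * Passage to the limit in the weak formulation *)

Section WeakLimit.
Context d (T : measurableType d) (R : realType).
Variable mu : {sigma_finite_measure set T -> \bar R}.
Let leb : {sigma_finite_measure set (measurableTypeR R) -> \bar R} := @lebesgue_measure R.
Variables (gs : nat -> R -> R) (Ls : nat -> R) (ks : nat -> T * T -> R) (kaps : nat -> R)
  (J : nat -> nat) (v : nat -> T -> R) (MM : nat -> R) (G : R -> R) (K : T * T -> R) (q : R).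
Let tau n : R := (2 ^+ J n)^-1.
Hypotheses (Sc : forall n, is_scheme mu (gs n) (Ls n) (ks n) (kaps n))
  (cfl : forall n, tau n * (Ls n * kaps n) <= 1) (gv : forall n, good mu (MM n) (v n))
  (tau_le : forall n, tau n <= (2 ^+ n)^-1)
  (q0 : 0 < q) (g_sub : forall n a b, 0 <= a -> 0 <= b -> `|gs n (a - b)| <= a `^ q + b `^ q)
  (gcvg : forall a_ a, a_ n @[n --> \oo] --> a -> gs n (a_ n) @[n --> \oo] --> G a)
  (mG : measurable_fun setT G)
  (mK : measurable_fun setT K) (Ksym : forall x y, K (x, y) = K (y, x))
  (ksK : forall n z, ks n z <= K z) (kcvg : forall z, ks n z @[n --> \oo] --> K z).

Let F n i := iter i (step mu (gs n) (ks n) (tau n)) (v n).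
Let f n (t : R) : T -> R := F n (Num.trunc (t * 2 ^+ J n)).
(* From the index [L] on, the approximations [f] stay below [U] and converge to [u]
   where [U] is finite. *)
Variables (L : nat) (U : R -> T -> \bar R) (u : R -> T -> R) (phi : T -> R) (B0 C : R)
  (W : T -> \bar R).
Hypotheses (mphi : measurable_fun setT phi) (phi0 : forall x, 0 < phi x)
  (phiB : forall x, phi x <= B0)
  (mW : measurable_fun setT W) (W0 : forall x, (0 <= W x)%E)
  (Wfin : (\int[mu]_x W x < +oo)%E)
  (mU : measurable_fun setT (fun z : T * measurableTypeR R => U z.2 z.1))
  (U0 : forall t x, (0 <= U t x)%E)
  (fU : forall n t x, (L <= n)%N -> ((f n t x)%:E <= U t x)%E)
  (Ucvg : forall t x, (U t x < +oo)%E -> f n t x @[n --> \oo] --> u t x)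
  (mu2 : measurable_fun setT (fun z : T * measurableTypeR R => u z.2 z.1))
  (UI : forall t, 0 <= t <= L%:R -> (\int[mu]_x (U t x * (phi x)%:E) <= C%:E)%E).
Variables (psi : T * R -> R) (dpsi : T * R -> R) (Lam Lam' : R) (H : T * T -> R).
Hypotheses (mpsi : measurable_fun setT (psi : T * measurableTypeR R -> R))
  (mdpsi : measurable_fun setT (dpsi : T * measurableTypeR R -> R))
  (psi_out : forall x t, ~ (0 < t < L%:R) -> psi (x, t) = 0)
  (dpsi_out : forall x t, ~ (0 < t < L%:R) -> dpsi (x, t) = 0)
  (Lam0 : 0 < Lam) (psi_lip : forall x s t, `|psi (x, t) - psi (x, s)| <= Lam * phi x * `|t - s|)
  (psi_diff : forall x t e, 0 < e -> exists2 dl, 0 < dl & forall a b, a <= t -> t < b ->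
     b - a < dl -> `|(psi (x, b) - psi (x, a)) / (b - a) - dpsi (x, t)| <= e)
  (mH : measurable_fun setT H) (H0 : forall z, 0 <= H z)
  (Hsym : forall x y, H (x, y) = H (y, x))
  (psiH : forall x y t, `|psi (x, t) - psi (y, t)| <= H (x, y))
  (Lam'0 : 0 < Lam')
  (HH : forall x a, 0 <= a -> (\int[mu]_y ((a `^ q * (K (x, y) * H (x, y)))%R%:E) <=
     Lam'%:E * ((a * phi x)%:E + W x))%E).

Let K0 z : 0 <= K z. Proof. by apply: le_trans (ksK 0 z); exact: sc_k0 (Sc 0) z. Qed.
Let tau_gt0 n : 0 < tau n. Proof. by rewrite invr_gt0 exprn_gt0. Qed.
Let p2 n : 0 < 2 ^+ n :> R. Proof. by rewrite exprn_gt0. Qed.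

Let gF n i : good mu (MM n) (F n i).
Proof. exact: (iter_good (Sc n) (ltW (tau_gt0 n)) (cfl n) i (gv n)). Qed.

Let f_ge0 n t x : 0 <= f n t x.
Proof. by rewrite /f; have [_ h _] := gF n (Num.trunc (t * 2 ^+ J n)); case/andP: (h x). Qed.

Let psis n i x := psi (x, i%:R / 2 ^+ J n).
Let I n := (L * 2 ^ J n)%N.

Let I_tau n : (I n)%:R / 2 ^+ J n = L%:R :> R.
Proof. by rewrite /I natrM natrX mulfK// gt_eqF. Qed.

Let mpsi1 t : measurable_fun setT (fun x => psi (x, t)).
Proof.
have : measurable_fun setT (fun x : T => (x, t : measurableTypeR R)).
  by apply: measurable_fun_pair.
exact: measurableT_comp.
Qed.

Let B00 : 0 <= B0. Proof. exact: le_trans (ltW (phi0 point)) (phiB point). Qed.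

Let psi_bd n i : meas_bd (Lam * B0 * L%:R) (psis n i).
Proof.
split; first exact: mpsi1.
move=> x; rewrite /psis; set t := _ / _.
have [/andP[t0 tL]|h] := boolP (0 < t < L%:R); last first.
  rewrite psi_out ?normr0; last exact/negP.
  by rewrite !mulr_ge0// (ltW Lam0).
rewrite -[psi _]subr0 -(@psi_out x 0); last by rewrite ltxx.
apply: (le_trans (psi_lip _ _ _)); rewrite subr0 (gtr0_norm t0).
apply: ler_pM => //; [|exact: (ltW t0)| |exact: (ltW tL)].
  by apply: mulr_ge0; [exact: (ltW Lam0)|exact: (ltW (phi0 x))].
by rewrite ler_wpM2l// (ltW Lam0).
Qed.

Let h2 n i x := F n i x * ((psis n i.+1 x - psis n i x) / tau n).
Let h3 n i (z : T * T) := flux (gs n) (ks n) (F n i) z * (psis n i.+1 z.1 - psis n i.+1 z.2).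
(* The two integrands of the discrete weak formulation, as functions of space and
   time; they vanish for times outside of [0, L[. *)
Let f2 n := grid_fun (J n) (I n) (h2 n).
Let f3 n := grid_fun (J n) (I n) (h3 n).

Let weak_n n : \int[(mu \x leb)%E]_z f2 n z = 2^-1 * \int[(mu \x mu \x leb)%E]_z f3 n z.
Proof.
apply: (discrete_weak (Sc n) (cfl n) (gv n) (psi_bd n)) => x.
  by rewrite /psis mul0r psi_out// ltxx.
by rewrite /psis I_tau psi_out// ltxx andbF.
Qed.

Let low n (t : R) : R := (Num.trunc (t * 2 ^+ J n))%:R / 2 ^+ J n.
Let up n (t : R) : R := (Num.trunc (t * 2 ^+ J n)).+1%:R / 2 ^+ J n.

Let grid n t : 0 <= t -> [/\ low n t <= t, t < up n t & up n t - low n t = tau n].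
Proof.
move=> t0; have := (cell_trunc (J n) (Num.trunc (t * 2 ^+ J n)) t0).2 erefl.
rewrite /cell /= in_itv/= => /andP[-> ->]; split=> //.
by rewrite /up /low -mulrBl -natrB// subSnn mul1r.
Qed.

Let trunc_lt n (t : R) : 0 <= t < L%:R -> (Num.trunc (t * 2 ^+ J n) < I n)%N.
Proof.
move=> /andP[t0 tL]; have [h _ _] := grid n t0.
by rewrite -(ltr_nat R) -(ltr_pM2r (x := (2 ^+ J n)^-1)) ?invr_gt0// I_tau (le_lt_trans h).
Qed.

Let f2E n x t : 0 <= t < L%:R ->
  f2 n (x, t) = f n t x * ((psi (x, up n t) - psi (x, low n t)) / (up n t - low n t)).
Proof.
move=> tL; have t0 : 0 <= t by case/andP: tL.
by rewrite /f2 grid_fun_eval// ?trunc_lt//; have [_ _ ->] := grid n t0.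
Qed.

Let f3E n z t : 0 <= t < L%:R ->
  f3 n (z, t) = gs n (f n t z.1 - f n t z.2) * ks n z * (psi (z.1, up n t) - psi (z.2, up n t)).
Proof. by move=> tL; rewrite /f3 grid_fun_eval ?trunc_lt//; case/andP: tL. Qed.

Let f2_out n x t : ~ (0 <= t < L%:R) -> f2 n (x, t) = 0.
Proof. by move=> h; rewrite /f2 grid_fun_out// I_tau. Qed.
Let f3_out n z t : ~ (0 <= t < L%:R) -> f3 n (z, t) = 0.
Proof. by move=> h; rewrite /f3 grid_fun_out// I_tau. Qed.

Let mf2 n : measurable_fun setT (f2 n).
Proof.
apply: measurable_grid_fun => i; apply: measurable_funM; first by have [] := gF n i.
by apply: measurable_funM => //; apply: measurable_funB; exact: mpsi1.
Qed.

Let mf3 n : measurable_fun setT (f3 n).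
Proof.
apply: measurable_grid_fun => i; apply: measurable_funM.
  by apply: (measurable_flux (Sc n)); have [] := gF n i.
by apply: measurable_diff; exact: mpsi1.
Qed.

Let II : set (measurableTypeR R) := `[0, L%:R[%classic.
Let mII : measurable II. Proof. exact: measurable_itv. Qed.
Let m1II : measurable_fun setT (\1_II : measurableTypeR R -> R).
Proof. exact: measurable_indic. Qed.
Let IIE t : II t <-> 0 <= t < L%:R. Proof. by rewrite /II /= in_itv. Qed.

(* The dominating function of the [f2 n], by the Lipschitz bound on [psi] in time. *)
Let g2 (z : T * measurableTypeR R) : \bar R :=
  (U z.2 z.1 * ((Lam * phi z.1)%:E * (\1_II z.2)%:E))%E.

Let mg2 : measurable_fun setT g2.
Proof.
apply: emeasurable_funM => //; apply: emeasurable_funM; apply/measurable_EFinP.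
  by apply: measurable_funM => //; exact: (measurableT_comp mphi).
exact: (measurableT_comp m1II).
Qed.

Let g2_ge0 z : (0 <= g2 z)%E.
Proof.
by rewrite !mule_ge0 ?lee_fin//; apply: mulr_ge0; [exact: (ltW Lam0)|exact: (ltW (phi0 _))].
Qed.

Let leb_II : (\int[leb]_t (\1_II t)%:E = L%:R%:E)%E.
Proof.
rewrite integral_indic// setIT /leb /II /= lebesgue_measure_itv/= lte_fin.
by case: ltP => [|h]; [rewrite oppr0 addr0|rewrite le_eqVlt ltNge ler0n orbF in h; move/eqP: h => ->].
Qed.

Let time_bound (h : measurableTypeR R -> \bar R) (c : R) : measurable_fun setT h ->
  (forall t, 0 <= h t)%E -> 0 <= c -> (forall t, 0 <= t <= L%:R -> (h t <= c%:E)%E) ->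
  (\int[leb]_t (h t * (\1_II t)%:E) < +oo)%E.
Proof.
move=> mh h0 c0 hc.
apply: (@le_lt_trans _ _ (\int[leb]_t (c%:E * (\1_II t)%:E))%E).
  apply: ge0_le_integral => //.
  - by move=> t _; rewrite mule_ge0.
  - by apply: emeasurable_funM => //; apply/measurable_EFinP.
  - by apply: emeasurable_funM => //; apply/measurable_EFinP.
  move=> t _; rewrite indicE; have [tI|tI] := boolP (t \in II).
    rewrite lee_pmul2r ?lte_fin//; apply: hc.
    by move: tI; rewrite inE => /IIE/andP[-> /ltW].
  by rewrite !mule0.
rewrite ge0_integralZl//; last by apply/measurable_EFinP.
by rewrite leb_II -EFinM ltry.
Qed.

Let C0 : 0 <= C.
Proof.
rewrite -lee_fin; apply: le_trans (UI (t := 0) _); last by rewrite lexx ler0n.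
by apply: integral_ge0 => x _; rewrite mule_ge0// lee_fin ltW.
Qed.

Let mU1 t : measurable_fun setT (U t).
Proof.
have m1 : measurable_fun setT (fun x : T => (x, t : measurableTypeR R)).
  by apply: measurable_fun_pair.
exact: (measurableT_comp mU m1).
Qed.

Let g2_int : (\int[(mu \x leb)%E]_z g2 z < +oo)%E.
Proof.
rewrite (fubini_tonelli2 (m1 := mu) (m2 := leb) g2 mg2 g2_ge0) /fubini_G.
pose h (t : measurableTypeR R) := (Lam%:E * \int[mu]_x (U t x * (phi x)%:E))%E.
have mUp : measurable_fun setT (fun z : T * measurableTypeR R => (U z.2 z.1 * (phi z.1)%:E)%E).
  apply: emeasurable_funM => //; apply/measurable_EFinP; exact: (measurableT_comp mphi).
have Up0 (z : T * measurableTypeR R) : (0 <= U z.2 z.1 * (phi z.1)%:E)%E.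
  by rewrite mule_ge0// lee_fin ltW.
have mh : measurable_fun setT h.
  apply: emeasurable_funM => //.
  exact: (@measurable_fun_fubini_tonelli_G _ _ _ _ _ mu _ mUp Up0).
rewrite (eq_integral (fun t => h t * (\1_II t)%:E)%E); last first.
  move=> t _; rewrite /g2 /= /h -ge0_integralZl//; last first.
  - by rewrite lee_fin (ltW Lam0).
  - by move=> x _; exact: (Up0 (x, t)).
  - by apply: emeasurable_funM => //; exact/measurable_EFinP.
  rewrite -ge0_integralZr//.
  - by apply: eq_integral => x _; rewrite EFinM !muleA (muleC (U t x)).
  - apply: emeasurable_funM => //; apply: emeasurable_funM => //; exact/measurable_EFinP.
  - by move=> x _; rewrite mule_ge0 ?lee_fin ?(ltW Lam0)//; exact: (Up0 (x, t)).
apply: (time_bound (c := Lam * C)) => //.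
- by move=> t; rewrite mule_ge0 ?lee_fin ?(ltW Lam0)//; apply: integral_ge0 => x _; exact: (Up0 (x, t)).
- by rewrite mulr_ge0// ltW.
- by move=> t /UI h'; rewrite EFinM lee_wpmul2l// lee_fin ltW.
Qed.

Let f2_bd n z : (`|f2 (n + L) z|%:E <= g2 z)%E.
Proof.
case: z => x t; have [/IIE tI|tI] := pselect (II t); last first.
  by rewrite f2_out ?normr0 ?g2_ge0// => /IIE.
have t0 : 0 <= t by case/andP: tI.
rewrite /g2 /= indicE mem_set ?mule1/=; last exact/IIE.
have [l1 l2 l3] := grid (n + L) t0.
have lu : 0 < up (n + L) t - low (n + L) t by rewrite l3.
rewrite f2E// normrM (ger0_norm (f_ge0 _ _ _)) EFinM.
apply: lee_pmul; [by rewrite lee_fin|by rewrite lee_fin|exact: (fU _ _ (leq_addl _ _))|].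
rewrite lee_fin normrM normfV (gtr0_norm lu) ler_pdivrMr//.
by apply: (le_trans (psi_lip _ _ _)); rewrite (gtr0_norm lu).
Qed.

Let tau_small e : 0 < e -> \forall n \near \oo, tau n < e.
Proof.
move=> e0; have [n0 hn] := lt_exp2n e^-1.
exists n0 => // n /= nn; apply: (le_lt_trans (tau_le n)).
rewrite invf_plt ?posrE//; apply: (lt_le_trans hn).
by rewrite ler_weXn2l// ler1n.
Qed.

Let f2_cvg z : (g2 z < +oo)%E -> f2 n z @[n --> \oo] --> u z.2 z.1 * dpsi z.
Proof.
case: z => x t; have [/IIE tI|tI] := pselect (II t); last first.
  move=> _ /=; rewrite dpsi_out ?mulr0; last first.
    by move=> /andP[ha hb]; apply: tI; apply/IIE; rewrite (ltW ha).
  rewrite (_ : (fun n => _) = fun=> 0); first exact: cvg_cst.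
  by apply/funext => n; rewrite f2_out// => /IIE.
have t0 : 0 <= t by case/andP: tI.
rewrite /g2 /= indicE mem_set ?mule1/=; last exact/IIE.
move=> Ufin.
have Uxt : (U t x < +oo)%E.
  rewrite ltey; apply/eqP => e; move: Ufin; rewrite e gt0_mulye ?ltxx// lte_fin.
  by apply: mulr_gt0.
rewrite (_ : (fun n => _) = fun n => f n t x *
    ((psi (x, up n t) - psi (x, low n t)) / (up n t - low n t))); last first.
  by apply/funext => n; exact: f2E.
apply: cvgM; first exact: Ucvg.
apply/cvgrPdist_le => e e0.
have [dl dl0 hd] := psi_diff x t e0.
near=> n; rewrite distrC.
have [l1 l2 l3] := grid n t0; apply: hd => //.
by rewrite l3; near: n; exact: tau_small.
Unshelve. all: by end_near. Qed.

Lemma weak_lhs : intg (mu \x leb)%E (fun z : T * measurableTypeR R => u z.2 z.1 * dpsi z) /\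
  \int[(mu \x leb)%E]_z f2 n z @[n --> \oo] --> \int[(mu \x leb)%E]_z (u z.2 z.1 * dpsi z).
Proof.
have ml : measurable_fun setT (fun z : T * measurableTypeR R => u z.2 z.1 * dpsi z).
  exact: measurable_funM.
have [|i c] := dominated_real (fun n => mf2 (n + L)) ml mg2 g2_ge0 g2_int f2_bd.
  by move=> z /f2_cvg; rewrite -(cvg_shiftn L).
by split => //; rewrite -(cvg_shiftn L).
Qed.

Let KH z := K z * H z.
Let KH0 z : 0 <= KH z. Proof. exact: mulr_ge0. Qed.
Let mKH : measurable_fun setT KH. Proof. exact: measurable_funM. Qed.
Let mUq t : measurable_fun setT (fun x => (U t x `^ q)%E).
Proof. exact: (measurableT_comp (measurable_poweR q) (mU1 t)). Qed.

(* The dominating function of the [f3 n], by subadditivity of [a `^ q]. *)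
Let g3 (z : (T * T) * measurableTypeR R) : \bar R :=
  ((U z.2 z.1.1 `^ q + U z.2 z.1.2 `^ q) * (KH z.1)%:E * (\1_II z.2)%:E)%E.

Let mg3' : measurable_fun setT (fun z : (T * T) * measurableTypeR R =>
  (U z.2 z.1.1 `^ q + U z.2 z.1.2 `^ q) * (KH z.1)%:E)%E.
Proof.
have m11 : measurable_fun setT (fun z : (T * T) * measurableTypeR R => (z.1.1, z.2)).
  by apply: measurable_fun_pair => //; exact: (measurableT_comp measurable_fst).
have m12 : measurable_fun setT (fun z : (T * T) * measurableTypeR R => (z.1.2, z.2)).
  by apply: measurable_fun_pair => //; exact: (measurableT_comp measurable_snd).
apply: emeasurable_funM; last by apply/measurable_EFinP; exact: (measurableT_comp mKH).
apply: emeasurable_funD.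
  exact: (measurableT_comp (measurable_poweR q) (measurableT_comp mU m11)).
exact: (measurableT_comp (measurable_poweR q) (measurableT_comp mU m12)).
Qed.

Let mg3 : measurable_fun setT g3.
Proof.
apply: emeasurable_funM; first exact: mg3'.
by apply/measurable_EFinP; exact: (measurableT_comp m1II).
Qed.

Let g3'0 z : (0 <= (U z.2 z.1.1 `^ q + U z.2 z.1.2 `^ q) * (KH z.1)%:E)%E.
Proof. by rewrite mule_ge0 ?adde_ge0 ?poweR_ge0 ?lee_fin. Qed.

Let g3_ge0 z : (0 <= g3 z)%E.
Proof. by rewrite mule_ge0 ?g3'0 ?lee_fin. Qed.

Let w := fine (\int[mu]_x W x)%E.
Let wE : (\int[mu]_x W x)%E = w%:E.
Proof. by rewrite fineK// ge0_fin_numE// integral_ge0. Qed.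
Let w0 : 0 <= w. Proof. by rewrite fine_ge0// integral_ge0. Qed.

Let sec_bound t x : (\int[mu]_y (U t x `^ q * (KH (x, y))%:E) <=
  Lam'%:E * (U t x * (phi x)%:E + W x))%E.
Proof.
have mKx : measurable_fun setT (fun y => (KH (x, y))%:E).
  apply/measurable_EFinP; exact: (measurableT_comp mKH (measurable_pair1 x)).
have := U0 t x; case: (U t x) => [a| |]//= a0.
  rewrite (eq_integral (fun y => (a `^ q * (K (x, y) * H (x, y)))%:E)).
    2: by move=> y _; rewrite -EFinM.
  by rewrite -EFinM; exact: HH.
rewrite gt0_mulye ?lte_fin// addye; last by rewrite -ltNye (lt_le_trans _ (W0 x)).
by rewrite gt0_muley ?lte_fin// leey.
Qed.

Let sec_int t : 0 <= t <= L%:R ->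
  (\int[(mu \x mu)%E]_z (U t z.1 `^ q * (KH z)%:E) <= (Lam' * (C + w))%:E)%E.
Proof.
move=> tL.
have m : measurable_fun setT (fun z : T * T => (U t z.1 `^ q * (KH z)%:E)%E).
  apply: emeasurable_funM; last by apply/measurable_EFinP.
  exact: (measurableT_comp (mUq t) measurable_fst).
have n0 (z : T * T) : (0 <= U t z.1 `^ q * (KH z)%:E)%E.
  by rewrite mule_ge0 ?poweR_ge0 ?lee_fin.
rewrite (fubini_tonelli1 (m1 := mu) (m2 := mu) _ m n0) /fubini_F /=.
have mUp : measurable_fun setT (fun x => (U t x * (phi x)%:E)%E).
  by apply: emeasurable_funM => //; exact/measurable_EFinP.
have Up0 x : (0 <= U t x * (phi x)%:E)%E by rewrite mule_ge0// lee_fin ltW.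
apply: (@le_trans _ _ (\int[mu]_x (Lam'%:E * (U t x * (phi x)%:E + W x)))%E).
  apply: ge0_le_integral => //.
  - by move=> x _; apply: integral_ge0 => y _; exact: (n0 (x, y)).
  - exact: (measurable_fun_fubini_tonelli_F (m2 := mu) _ m n0).
  - by apply: emeasurable_funM => //; exact: emeasurable_funD.
rewrite ge0_integralZl//; last first.
- by rewrite lee_fin ltW.
- by move=> x _; rewrite adde_ge0.
- exact: emeasurable_funD.
rewrite EFinM lee_wpmul2l ?lee_fin ?(ltW Lam'0)// ge0_integralD//.
by rewrite wE EFinD leeD2r//; exact: UI.
Qed.

Let sec_int2 t : 0 <= t <= L%:R ->
  (\int[(mu \x mu)%E]_z ((U t z.1 `^ q + U t z.2 `^ q) * (KH z)%:E) <=
    (2 * (Lam' * (C + w)))%:E)%E.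
Proof.
move=> tL.
have m : measurable_fun setT (fun z : T * T => (U t z.1 `^ q * (KH z)%:E)%E).
  apply: emeasurable_funM; last by apply/measurable_EFinP.
  exact: (measurableT_comp (mUq t) measurable_fst).
have m' : measurable_fun setT (fun z : T * T => (U t z.2 `^ q * (KH z)%:E)%E).
  apply: emeasurable_funM; last by apply/measurable_EFinP.
  exact: (measurableT_comp (mUq t) measurable_snd).
have n0 (z : T * T) : (0 <= U t z.1 `^ q * (KH z)%:E)%E.
  by rewrite mule_ge0 ?poweR_ge0 ?lee_fin.
have n0' (z : T * T) : (0 <= U t z.2 `^ q * (KH z)%:E)%E.
  by rewrite mule_ge0 ?poweR_ge0 ?lee_fin.
have KHs x y : KH (x, y) = KH (y, x) by rewrite /KH Ksym Hsym.
under eq_integral do rewrite ge0_muleDl ?poweR_ge0//.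
rewrite ge0_integralD// mulr_natl mulr2n EFinD; apply: leeD; first exact: sec_int.
apply: le_trans (sec_int tL).
rewrite (fubini_tonelli2 (m1 := mu) (m2 := mu) _ m' n0') /fubini_G /=.
rewrite (fubini_tonelli1 (m1 := mu) (m2 := mu) _ m n0) /fubini_F /=.
by under eq_integral do under eq_integral do rewrite KHs.
Qed.

Let g3_int : (\int[(mu \x mu \x leb)%E]_z g3 z < +oo)%E.
Proof.
rewrite (fubini_tonelli2 (m1 := prod_sf mu mu) (m2 := leb) g3 mg3 g3_ge0) /fubini_G.
pose h (t : measurableTypeR R) :=
  (\int[prod_sf mu mu]_z ((U t z.1 `^ q + U t z.2 `^ q) * (KH z)%:E))%E.
have mh : measurable_fun setT h.
  exact: (@measurable_fun_fubini_tonelli_G _ _ _ _ _ (prod_sf mu mu) _ mg3' g3'0).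
rewrite (eq_integral (fun t => h t * (\1_II t)%:E)%E); last first.
  move=> t _; rewrite /g3 /= /h -ge0_integralZr//.
  - have m1 : measurable_fun setT (fun z : T * T => (z, t : measurableTypeR R)).
      by apply: measurable_fun_pair.
    exact: (measurableT_comp mg3' m1).
  - by move=> z _; exact: (g3'0 (z, t)).
apply: (time_bound (c := 2 * (Lam' * (C + w)))) => //.
- by move=> t; apply: integral_ge0 => z _; exact: (g3'0 (z, t)).
- by rewrite mulr_ge0// mulr_ge0 ?addr_ge0// ltW.
Qed.

Let f3_bd n z : (`|f3 (n + L) z|%:E <= g3 z)%E.
Proof.
case: z => z t; have [/IIE tI|tI] := pselect (II t); last first.
  by rewrite f3_out ?normr0 ?g3_ge0// => /IIE.
have t0 : 0 <= t by case/andP: tI.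
rewrite /g3 /= indicE mem_set ?mule1/=; last exact/IIE.
rewrite f3E// !normrM -mulrA EFinM.
have pw x : ((f (n + L) t x `^ q)%:E <= U t x `^ q)%E.
  rewrite -poweR_EFin; apply: gt0_ler_poweR; first exact: ltW.
  - by rewrite in_itv/= lee_fin f_ge0 leey.
  - by rewrite in_itv/= U0 leey.
  - exact: (fU _ _ (leq_addl _ _)).
apply: lee_pmul; [by rewrite lee_fin|by rewrite lee_fin mulr_ge0| |].
  apply: (@le_trans _ _ ((f (n + L) t z.1 `^ q + f (n + L) t z.2 `^ q)%:E)).
    by rewrite lee_fin g_sub.
  by rewrite EFinD leeD.
rewrite lee_fin (ger0_norm (sc_k0 (Sc _) _)); apply: ler_pM => //.
  exact: (sc_k0 (Sc _) _).
by case: z => x y /=; exact: psiH.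
Qed.

Let psi_up n x t : 0 <= t -> `|psi (x, up n t) - psi (x, t)| <= Lam * B0 * tau n.
Proof.
move=> t0; have [l1 l2 l3] := grid n t0.
apply: (le_trans (psi_lip _ _ _)); apply: ler_pM => //.
- by rewrite mulr_ge0 ?(ltW Lam0) ?(ltW (phi0 x)).
- by rewrite ler_wpM2l// (ltW Lam0).
- by rewrite gtr0_norm ?subr_gt0// -l3 lerD2l lerN2.
Qed.

Let psi_up_cvg x t : 0 <= t -> psi (x, up n t) @[n --> \oo] --> psi (x, t).
Proof.
move=> t0; apply/cvgrPdist_le => e e0.
have LB : 0 <= Lam * B0 by rewrite mulr_ge0// ltW.
have e1 : 0 < e / (Lam * B0 + 1) by rewrite divr_gt0// ltr_wpDl.
near=> n; rewrite distrC; apply: (le_trans (psi_up n x t0)).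
apply: (@le_trans _ _ ((Lam * B0 + 1) * (e / (Lam * B0 + 1)))); last first.
  by rewrite mulrC divfK// gt_eqF// ltr_wpDl.
apply: ler_pM => //; [exact: (ltW (tau_gt0 n))|by rewrite lerDl|].
by apply: ltW; near: n; exact: tau_small.
Unshelve. all: by end_near. Qed.

Let Fl (z : (T * T) * measurableTypeR R) : R :=
  G (u z.2 z.1.1 - u z.2 z.1.2) * K z.1 * (psi (z.1.1, z.2) - psi (z.1.2, z.2)).

Let mFl : measurable_fun setT Fl.
Proof.
have m11 : measurable_fun setT (fun z : (T * T) * measurableTypeR R => (z.1.1, z.2)).
  by apply: measurable_fun_pair => //; exact: (measurableT_comp measurable_fst).
have m12 : measurable_fun setT (fun z : (T * T) * measurableTypeR R => (z.1.2, z.2)).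
  by apply: measurable_fun_pair => //; exact: (measurableT_comp measurable_snd).
apply: measurable_funM.
  apply: measurable_funM; last exact: (measurableT_comp mK).
  apply: (measurableT_comp mG); apply: measurable_funB.
    exact: (measurableT_comp mu2 m11).
  exact: (measurableT_comp mu2 m12).
apply: measurable_funB; first exact: (measurableT_comp mpsi m11).
exact: (measurableT_comp mpsi m12).
Qed.

Let f3_cvg z : (g3 z < +oo)%E -> f3 n z @[n --> \oo] --> Fl z.
Proof.
case: z => z t; have [/IIE tI|tI] := pselect (II t); last first.
  move=> _ /=.
  have tI' : ~ (0 < t < L%:R).
    by move=> /andP[ha hb]; apply: tI; apply/IIE; rewrite (ltW ha).
  rewrite /Fl /= !psi_out// subrr mulr0.
  rewrite (_ : (fun n => _) = fun=> 0); first exact: cvg_cst.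
  by apply/funext => n; rewrite f3_out// => /IIE.
have t0 : 0 <= t by case/andP: tI.
rewrite /g3 /= indicE mem_set ?mule1/=; last exact/IIE.
rewrite (_ : (fun n => f3 n (z, t)) = fun n => gs n (f n t z.1 - f n t z.2) * ks n z *
  (psi (z.1, up n t) - psi (z.2, up n t))); last first.
  by apply/funext => n; exact: f3E.
(* If [KH z = 0] both sides vanish, whatever the values of [U]; otherwise the
   finiteness of [g3] forces [U] to be finite at both points of [z]. *)
have [KHz|KHz] := eqVneq (KH z) 0.
  move=> _.
  have z0 a b : 0 <= a <= K z -> `|b| <= H z -> a * b = 0.
    move=> /andP[a0 aK] bH; apply/eqP; rewrite -normr_le0 -KHz normrM (ger0_norm a0).
    exact: ler_pM.
  have pH s : `|psi (z.1, s) - psi (z.2, s)| <= H z by case: z {KHz z0} => x y; exact: psiH.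
  have z1 : K z * (psi (z.1, t) - psi (z.2, t)) = 0 by apply: z0 => //; rewrite K0 lexx.
  rewrite /Fl /= -mulrA z1 mulr0.
  rewrite (_ : (fun n => _) = fun=> 0); first exact: cvg_cst.
  apply/funext => n; rewrite -mulrA [X in _ * X]z0 ?mulr0//.
  by apply/andP; split; [exact: (sc_k0 (Sc n))|exact: ksK].
have KHp : 0 < KH z by rewrite lt_neqAle eq_sym KHz KH0.
move=> gfin.
have Usum : (U t z.1 `^ q + U t z.2 `^ q < +oo)%E.
  rewrite ltey; apply/eqP => e; move: gfin.
  by rewrite e gt0_mulye ?ltxx// lte_fin.
have U1 : (U t z.1 < +oo)%E.
  apply: (lty_poweRy (r := q)); first by rewrite gt_eqF.
  by apply: le_lt_trans Usum; rewrite leeDl// poweR_ge0.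
have U2 : (U t z.2 < +oo)%E.
  apply: (lty_poweRy (r := q)); first by rewrite gt_eqF.
  by apply: le_lt_trans Usum; rewrite leeDr// poweR_ge0.
rewrite /Fl /=; apply: cvgM; last by apply: cvgB; exact: psi_up_cvg.
apply: cvgM; last exact: kcvg.
by apply: gcvg; apply: cvgB; exact: Ucvg.
Qed.

Lemma weak_rhs : intg (mu \x mu \x leb)%E Fl /\
  \int[(mu \x mu \x leb)%E]_z f3 n z @[n --> \oo] --> \int[(mu \x mu \x leb)%E]_z Fl z.
Proof.
have [|i c] := dominated_real (fun n => mf3 (n + L)) mFl mg3 g3_ge0 g3_int f3_bd.
  by move=> z /f3_cvg; rewrite -(cvg_shiftn L).
by split => //; rewrite -(cvg_shiftn L).
Qed.

Lemma weak_limit :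
  Rintegral (mu \x leb)%E setT (fun z : T * measurableTypeR R => u z.2 z.1 * dpsi z) =
  2^-1 * \int[(mu \x mu \x leb)%E]_z Fl z.
Proof.
have [_ c1] := weak_lhs; have [_ c2] := weak_rhs.
apply: (cvg_unique _ c1) => //=.
under eq_fun do rewrite weak_n.
exact: cvgMr.
Qed.

Lemma weak_all :
  [/\ intg (mu \x mu \x leb)%E Fl, intg (mu \x leb)%E (fun z : T * measurableTypeR R => u z.2 z.1 * dpsi z) &
    Rintegral (mu \x leb)%E setT (fun z : T * measurableTypeR R => u z.2 z.1 * dpsi z) =
    2^-1 * \int[(mu \x mu \x leb)%E]_z Fl z].
Proof. by split; [exact: weak_rhs.1|exact: weak_lhs.1|exact: weak_limit]. Qed.

End WeakLimit.

(** * Existence for an abstract evolution *)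

(** [H] is a modulus of continuity in space, uniform in time.  The last condition
    is the weight inequality with [`|phi x - phi y|] replaced by [H]: it makes the
    space term of the weak formulation finite as soon as [int u phi] is. *)
Record is_test d (T : measurableType d) (R : realType)
    (mu : {sigma_finite_measure set T -> \bar R}) (K : T * T -> R) (q : R) (phi : T -> R)
    (L : nat) (psi dpsi : T * R -> R) (Lam Lam' : R) (H : T * T -> R) (W2 : T -> \bar R) : Prop :=
  IsTest {
  te_mpsi : measurable_fun setT (psi : T * measurableTypeR R -> R);
  te_mdpsi : measurable_fun setT (dpsi : T * measurableTypeR R -> R);
  te_out : forall x t, ~ (0 < t < L%:R) -> psi (x, t) = 0;
  te_dout : forall x t, ~ (0 < t < L%:R) -> dpsi (x, t) = 0;
  te_Lam0 : 0 < Lam;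
  te_lip : forall x s t, `|psi (x, t) - psi (x, s)| <= Lam * phi x * `|t - s|;
  te_diff : forall x t e, 0 < e -> exists2 dl, 0 < dl & forall a b, a <= t -> t < b ->
     b - a < dl -> `|(psi (x, b) - psi (x, a)) / (b - a) - dpsi (x, t)| <= e;
  te_mH : measurable_fun setT H;
  te_H0 : forall z, 0 <= H z;
  te_Hsym : forall x y, H (x, y) = H (y, x);
  te_psiH : forall x y t, `|psi (x, t) - psi (y, t)| <= H (x, y);
  te_Lam'0 : 0 < Lam';
  te_mW2 : measurable_fun setT W2;
  te_W20 : forall x, (0 <= W2 x)%E;
  te_W2fin : (\int[mu]_x W2 x < +oo)%E;
  te_HH : forall x a, 0 <= a -> (\int[mu]_y ((a `^ q * (K (x, y) * H (x, y)))%R%:E) <=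
     Lam'%:E * ((a * phi x)%:E + W2 x))%E }.

(** The solution [u] is a function of time with values in functions of space, and
    [L] is a time horizon. *)
Record is_evolution d (T : measurableType d) (R : realType)
    (mu : {sigma_finite_measure set T -> \bar R}) (G : R -> R) (K : T * T -> R) (q : R)
    (phi u0 : T -> R) (u : R -> T -> R) : Prop := IsEvolution {
  ev_mu2 : measurable_fun setT (fun z : T * measurableTypeR R => u z.2 z.1);
  ev_mu1 : forall t, measurable_fun setT (u t);
  ev_intg : forall (L : nat) t, 0 <= t <= L%:R -> intg mu (fun x => u t x * phi x);
  ev_bound : forall L : nat, exists B, forall t, 0 <= t <= L%:R ->
    \int[mu]_x (`|u t x| * phi x) <= B;
  ev_cont : forall (L : nat) t0 eps, 0 <= t0 <= L%:R -> 0 < eps -> exists2 dl, 0 < dl &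
    forall t, 0 <= t <= L%:R -> `|t - t0| < dl ->
      \int[mu]_x (`|u t x - u t0 x| * phi x) <= eps;
  ev_init : \int[mu]_x (`|u 0 x - u0 x| * phi x) = 0;
  ev_weak : forall (L : nat) psi dpsi Lam Lam' H W2,
    is_test mu K q phi L psi dpsi Lam Lam' H W2 ->
    let leb : {sigma_finite_measure set (measurableTypeR R) -> \bar R} := @lebesgue_measure R in
    let F := fun z : (T * T) * measurableTypeR R =>
      G (u z.2 z.1.1 - u z.2 z.1.2) * K z.1 * (psi (z.1.1, z.2) - psi (z.1.2, z.2)) in
    let E := fun z : T * measurableTypeR R => u z.2 z.1 * dpsi z in
    [/\ intg (mu \x mu \x leb)%E F, intg (mu \x leb)%E E &
      Rintegral (mu \x leb)%E setT E = 2^-1 * Rintegral (mu \x mu \x leb)%E setT F] }.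

Section Evolution.
Context d (T : measurableType d) (R : realType).
Variables (mu : {sigma_finite_measure set T -> \bar R}) (add sub : T -> T -> T).
Hypothesis Tr : is_translation mu add sub.
Let leb : {sigma_finite_measure set (measurableTypeR R) -> \bar R} := @lebesgue_measure R.
Variables (Ph : nat -> R -> R) (km : nat -> T -> R) (kap : nat -> R) (K : T -> R) (q : R)
  (G : R -> R).
Hypothesis Scm : forall m,
  is_scheme mu (Ph m) m%:R (fun z => km m (sub z.1 z.2)) (kap m).
Hypothesis kap_nd : forall m n, (m <= n)%N -> kap m <= kap n.
Hypotheses (kmK : forall m z, km m z <= K z) (mK : measurable_fun setT K)
  (Ksym : forall x y, K (sub x y) = K (sub y x))
  (q0 : 0 < q)
  (Ph_sub : forall m a b, 0 <= a -> 0 <= b -> `|Ph m (a - b)| <= a `^ q + b `^ q)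
  (Ph_cvg : forall (m_ : nat -> nat) a_ a, (forall n, (n <= m_ n)%N) ->
     a_ n @[n --> \oo] --> a -> Ph (m_ n) (a_ n) @[n --> \oo] --> G a)
  (mG : measurable_fun setT G)
  (km_cvg : forall (m_ : nat -> nat) z, (forall n, (n <= m_ n)%N) ->
     km (m_ n) z @[n --> \oo] --> K z).
Variable e : R -> nat -> T -> R.
Hypotheses (me : forall M m, measurable_fun setT (e M m))
  (e0 : forall M m z, 0 <= M -> 0 <= e M m z)
  (he : forall M m n a z, (m <= n)%N -> `|a| <= M ->
     `|Ph m a * km m z - Ph n a * km n z| <= e M m z)
  (e_small : forall M v, nice mu sub K M v ->
  (forall m, intg (mu \x mu)%E (diff2 sub (e M m) v)) /\
  forall eps, 0 < eps -> exists m0, forall m, (m0 <= m)%N ->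
    \int[(mu \x mu)%E]_z diff2 sub (e M m) v z <= eps).
Variables (phi : T -> R) (B0 : R) (W : T -> \bar R).
Hypotheses (mphi : measurable_fun setT phi) (phi0 : forall x, 0 < phi x)
  (phiB : forall x, phi x <= B0)
  (decay : forall e : R, 0 < e -> exists B, [/\ measurable B, (mu B < +oo)%E &
     forall x, ~ B x -> phi x <= e])
  (mW : measurable_fun setT W) (W0 : forall x, (0 <= W x)%E)
  (Wfin : (\int[mu]_x W x < +oo)%E)
  (HW : forall x a, 0 <= a -> (\int[mu]_y
     ((a `^ q * (K (sub x y) * `|phi x - phi y|))%R%:E) <= (a * phi x)%:E + W x)%E).
Variables (u0 : T -> R) (v : nat -> T -> R) (MM : nat -> R) (X0 c0 : R).
Hypotheses (iu0 : intg mu (fun x => u0 x * phi x))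
  (nv : forall n, nice mu sub K (MM n) (v n))
  (vX : forall n, \int[mu]_x (v n x * phi x) <= X0)
  (vmono : forall n, \int[mu]_x Num.max (v n x - v n.+1 x) 0 <= c0 * (2 ^+ n)^-1)
  (vcvg : \int[mu]_x (`|v n x - u0 x| * phi x) @[n --> \oo] --> 0).

Let l := level Tr Scm kap_nd me e0 he e_small mphi phi0 phiB decay nv.
Let f := approx_sol Tr Scm kap_nd me e0 he e_small mphi phi0 phiB decay nv.
Let C := growth_bound mu W X0.
Let c1 := 1 + B0 * c0.
Let D n := B0 * (2 * scheme_cst kap (l n) * \int[mu]_x v n x).

Let l_ge n : (n <= l n)%N. Proof. exact: leq_addl. Qed.

Let gf n t : good mu (MM n) (f n t). Proof. exact: approx_sol_good. Qed.
Let mf n t : measurable_fun setT (f n t). Proof. by have [] := gf n t. Qed.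
Let f_ge0 n t x : 0 <= f n t x.
Proof. by have [_ h _] := gf n t; case/andP: (h x). Qed.
Let fi n t : intg mu (fun x => f n t x * phi x). Proof. exact: approx_sol_phi. Qed.
Let fX n t tb : 0 <= t -> t <= tb -> \int[mu]_x (f n t x * phi x) <= C tb.
Proof.
exact: (approx_sol_mass Tr Scm kap_nd kmK mK Ksym Ph_sub me e0 he e_small mphi phi0 phiB decay
  mW W0 Wfin HW nv vX).
Qed.
Let fL n t t' tb : 0 <= t -> t <= t' -> t' <= tb ->
    `|\int[mu]_x (f n t' x * phi x) - \int[mu]_x (f n t x * phi x)| <=
    (t' - t + (2 ^+ n)^-1) * C tb.
Proof.
exact: (approx_sol_mass_lip Tr Scm kap_nd kmK mK Ksym Ph_sub me e0 he e_small mphi phi0 phiB decay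
  mW W0 Wfin HW nv vX).
Qed.
Let fM n t t' : 0 <= t -> t <= t' ->
    \int[mu]_x (`|f n t' x - f n t x| * phi x) <= (t' - t) * D n + (2 ^+ n)^-1.
Proof. exact: approx_sol_move. Qed.
Let fP n t : 0 <= t <= n%:R ->
    \int[mu]_x (Num.max (f n t x - f n.+1 t x) 0 * phi x) <= c1 * (2 ^+ n)^-1.
Proof. exact: (approx_sol_almost_mono Tr Scm kap_nd me e0 he e_small mphi phi0 phiB decay nv vmono). Qed.
Let mf2 n : measurable_fun setT (fun z : T * measurableTypeR R => f n z.2 z.1).
Proof.
apply: (@measurable_piecewise R kap d T (l n) (fun k =>
  iter k (step mu (Ph (l n)) (fun z => km (l n) (sub z.1 z.2)) (tau kap (l n))) (v n))).
move=> k.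
have := iter_good (Scm (l n)) (ltW (tau_gt0 kap (l n))) (@cfl_m _ _ _ mu sub Ph km kap Scm (l n)) k.
by move=> /(_ _ _ (nv n).1)[].
Qed.
Let f_0 n : f n 0 = v n. Proof. exact: approx_sol0. Qed.

Let u : R -> T -> R := ulim f.

Let uX (L : nat) t : 0 <= t <= L%:R -> \int[mu]_x (`|u t x| * phi x) <= C L%:R.
Proof.
move=> tL; have /andP[t0 tL'] := tL.
have ui := ulim_intg mphi phi0 mf f_ge0 fi fX fP tL.
have uin := ulim_intg_norm mphi phi0 mf f_ge0 fi fX fP tL.
have c : \int[mu]_x (`|u t x - f n t x| * phi x) + C L%:R @[n --> \oo] --> 0 + C L%:R.
  apply: cvgD; last exact: cvg_cst.
  exact: (ulim_cvg mphi phi0 mf f_ge0 fi fX fP tL).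
rewrite add0r in c; apply: (cvgn_ge (N := 0) c) => n _.
have i1 : intg mu (fun x => `|u t x - f n t x| * phi x).
  have := intg_norm (intgB ui (fi n t)).
  by under eq_fun do rewrite -mulrBl normrM (gtr0_norm (phi0 _)).
apply: (@le_trans _ _ (\int[mu]_x (`|u t x - f n t x| * phi x + f n t x * phi x))).
  apply: le_Rint => //; first exact: intgD.
  move=> x; rewrite -mulrDl; apply: ler_wpM2r; first exact: (ltW (phi0 x)).
  by rewrite -{2}(ger0_norm (f_ge0 n t x)) -{1}(subrK (f n t x) (u t x)) ler_normD.
by rewrite RintD// lerD2l; exact: fX.
Qed.

Section Weak.
Variables (L : nat) (psi : T * R -> R) (dpsi : T * R -> R) (Lam Lam' : R) (H : T * T -> R)
  (W2 : T -> \bar R).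
Hypothesis te : is_test mu (fun z => K (sub z.1 z.2)) q phi L psi dpsi Lam Lam' H W2.

Lemma evolution_weak :
  [/\ intg (mu \x mu \x leb)%E (fun z : (T * T) * measurableTypeR R =>
        G (u z.2 z.1.1 - u z.2 z.1.2) * K (sub z.1.1 z.1.2) * (psi (z.1.1, z.2) - psi (z.1.2, z.2))),
    intg (mu \x leb)%E (fun z : T * measurableTypeR R => u z.2 z.1 * dpsi z) &
    Rintegral (mu \x leb)%E setT (fun z : T * measurableTypeR R => u z.2 z.1 * dpsi z) =
    2^-1 * Rintegral (mu \x mu \x leb)%E setT (fun z : (T * T) * measurableTypeR R =>
        G (u z.2 z.1.1 - u z.2 z.1.2) * K (sub z.1.1 z.1.2) * (psi (z.1.1, z.2) - psi (z.1.2, z.2)))].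
Proof.
have cfl n := @cfl_m _ _ _ mu sub Ph km kap Scm (l n).
have tl n : tau kap (l n) <= (2 ^+ n)^-1.
  apply: le_trans (@tau_le _ _ _ mu sub Ph km kap Scm (l n)) _.
  by rewrite lef_pV2 ?posrE ?exprn_gt0// ler_weXn2l// ler1n.
have mK2 : measurable_fun setT (fun z : T * T => K (sub z.1 z.2)).
  exact: (measurableT_comp mK (tr_msub Tr)).
have UI t : 0 <= t <= L%:R ->
  (\int[mu]_x (uenv f L t x * (phi x)%:E) <= (2 * C L%:R + 4 * (c1 * (2 ^+ L)^-1))%:E)%E.
  exact: (uenv_int mphi phi0 mf f_ge0 fi fX fP).
have fU n t x : (L <= n)%N -> ((f n t x)%:E <= uenv f L t x)%E.
  by move=> Ln; rewrite -{1}(subnK Ln); apply: (@le_env _ _ _ (fun i => f (i + L) t)).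
apply: (@weak_all d T R mu (fun n => Ph (l n)) (fun n => (l n)%:R)
  (fun n z => km (l n) (sub z.1 z.2)) (fun n => kap (l n)) (fun n => step_exp kap (l n)) v MM G
  (fun z => K (sub z.1 z.2)) q _ _ _ _ _ _ _ _ _ _ _ _
  L (uenv f L) u phi B0 (2 * C L%:R + 4 * (c1 * (2 ^+ L)^-1)) W2 _ _ _ _ _ _ _ _ _ _ _ _
  psi dpsi Lam Lam' H).
- by move=> n; exact: Scm.
- exact: cfl.
- by move=> n; have [] := nv n.
- exact: tl.
- exact: q0.
- by move=> n; exact: Ph_sub.
- by move=> a_ a; exact: Ph_cvg.
- exact: mG.
- exact: mK2.
- by move=> x y; exact: Ksym.
- by move=> n z; exact: kmK.
- by move=> z; exact: km_cvg.
- exact: mphi.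
- exact: phi0.
- exact: phiB.
- exact: (te_mW2 te).
- exact: (te_W20 te).
- exact: (te_W2fin te).
- exact: (measurable_uenv mf2 L).
- by move=> t x; exact: env_ge0.
- exact: fU.
- by move=> t x; exact: (ulim_cvgL f_ge0).
- exact: (measurable_ulim mf2).
- exact: UI.
- exact: (te_mpsi te).
- exact: (te_mdpsi te).
- exact: (te_out te).
- exact: (te_dout te).
- exact: (te_Lam0 te).
- exact: (te_lip te).
- exact: (te_diff te).
- exact: (te_mH te).
- exact: (te_H0 te).
- exact: (te_Hsym te).
- exact: (te_psiH te).
- exact: (te_Lam'0 te).
- exact: (te_HH te).
Qed.

End Weak.

Lemma evolution_exists :
  exists u, is_evolution mu G (fun z => K (sub z.1 z.2)) q phi u0 u.
Proof.
exists u; constructor.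
- exact: (measurable_ulim mf2).
- by move=> t; exact: (measurable_ulim1 mf).
- by move=> L t; exact: (ulim_intg mphi phi0 mf f_ge0 fi fX fP).
- by move=> L; exists (C L%:R) => t; exact: uX.
- by move=> L t0 eps; exact: (ulim_cont mphi phi0 mf f_ge0 fi fX fL fM fP).
- exact: (ulim0 mphi phi0 mf f_ge0 fi fX fP f_0 iu0 vcvg).
- by move=> L psi dpsi Lam Lam' H W2 te; exact: (evolution_weak te).
Qed.

End Evolution.

(** * Measurability of open sets of R^N and of R^N x R *)

Section CountableBase.
Context d (T : measurableType d).

(** A countable base of measurable sets for the neighbourhoods [nb]. *)
Definition countable_base (nb : T -> set (set T)) (B : nat -> set T) :=
  (forall n, measurable (B n)) /\
  forall x U, nb x U -> exists n, B n x /\ B n `<=` U.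

(** The sigma-algebra of R^N is generated by the coordinates; that it contains the
    open sets is due to second countability. *)
Lemma countable_base_measurable nb B (U : set T) : countable_base nb B ->
  (forall x, U x -> nb x U) -> measurable U.
Proof.
move=> [mB hB] hU.
have -> : U = \bigcup_(n in [set n | B n `<=` U]) B n.
  apply/seteqP; split=> [x Ux|x [n /= BU Bx]]; last exact: BU.
  by have [n [Bx BU]] := hB _ _ (hU _ Ux); exists n.
exact: bigcup_measurable.
Qed.

End CountableBase.

Section Base.
Context (R : realType) (N : nat).

Definition Rbase (n : nat) : set R :=
  if unpickle n is Some (q, m) then ball (ratr q : R) (m.+1%:R^-1) else set0.

Lemma Rbase_nbhs (x : R) (U : set R) : nbhs x U ->
  exists n, Rbase n x /\ Rbase n `<=` U.
Proof.
move=> /nbhs_ballP[e /= e0 xU].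
have e2 : 0 < e / 2 by rewrite divr_gt0.
have [m] := ltr_add_invr e2; rewrite add0r => hm.
have [a [aE {}hm m0]] : exists a : R, [/\ a = m.+1%:R^-1, a < e / 2 & 0 < a].
  by exists m.+1%:R^-1; split => //; rewrite invr_gt0.
have [q] : exists q : rat, ratr q \in `](x - a), (x + a)[.
  have h : x - a < x + a by lra.
  exact: rat_in_itvoo h.
rewrite in_itv /= => /andP[h1 h2].
exists (pickle (q, m)); rewrite /Rbase pickleK -aE.
split; first by rewrite /ball /= ltr_distlC; apply/andP; split; lra.
move=> y; rewrite /ball /= => hy; apply: xU; rewrite /ball /=.
rewrite (_ : x - y = (x - ratr q) + (ratr q - y)); last by ring.
rewrite (le_lt_trans (ler_normD _ _))//.
have : `|x - ratr q| < a by rewrite ltr_distl; apply/andP; split; lra.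
lra.
Qed.

Lemma Rbase_countable : countable_base (T := measurableTypeR R) (fun x : R => nbhs x) Rbase.
Proof.
split; last exact: Rbase_nbhs.
by move=> n; rewrite /Rbase; case: unpickle => [[q m]|//]; exact: measurable_ball.
Qed.

Definition rVbase (n : nat) : set 'rV[R]_N :=
  if unpickle n is Some f then
    [set x : 'rV[R]_N | forall i, Rbase ((f : {ffun 'I_N -> nat}) i) (x ord0 i)]
  else set0.

Lemma measurable_rV_box (A : 'I_N -> set R) : (forall i, measurable (A i)) ->
  measurable [set x : 'rV[R]_N | forall i, A i (x ord0 i)].
Proof.
move=> mA.
rewrite (_ : mkset _ = \bigcap_(i in [set: 'I_N]) (rV_coord i @^-1` A i)).
  apply: fin_bigcap_measurable => // i _.
  by rewrite -[X in measurable X]setTI; exact: measurable_rV_coord.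
by apply/seteqP; split => x /= xA i => [_|]; exact: xA.
Qed.

Lemma rVbase_countable : countable_base (fun x : 'rV[R]_N => nbhs x) rVbase.
Proof.
have [mR hR] := Rbase_countable.
split.
  move=> n; rewrite /rVbase; case: unpickle => [f|//].
  by apply: (@measurable_rV_box (fun i => Rbase (f i))) => i; exact: mR.
move=> x U [P hP PU].
have /choice[f hf] : forall i : 'I_N, exists n, Rbase n (x ord0 i) /\ Rbase n `<=` P ord0 i.
  by move=> i; apply: hR; exact: hP.
exists (pickle [ffun i => f i]); rewrite /rVbase pickleK; split => [i|y hy].
  by rewrite ffunE; have [] := hf i.
apply: PU => i j; rewrite ord1.
by have [_] := hf j; apply; have := hy j; rewrite ffunE.
Qed.

Definition prodbase (n : nat) : set ('rV[R]_N * R) :=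
  if unpickle n is Some (a, b) then rVbase a `*` Rbase b else set0.

Lemma prodbase_countable : countable_base (T := ('rV[R]_N * measurableTypeR R)%type)
  (fun x : 'rV[R]_N * R => nbhs x) prodbase.
Proof.
have [mR hR] := Rbase_countable; have [mV hV] := rVbase_countable.
split.
  move=> n; rewrite /prodbase; case: unpickle => [[a b]|//].
  by apply: measurableX; [exact: mV|exact: mR].
move=> [x t] U [[P Q] /= [hP hQ] PQ].
have [a [ax aP]] := hV _ _ hP; have [b [bt bQ]] := hR _ _ hQ.
exists (pickle (a, b)); rewrite /prodbase pickleK; split => // -[y r] [/= ya rb].
by apply: PQ; split; [exact: aP|exact: bQ].
Qed.

Lemma open_measurable_rV (U : set 'rV[R]_N) : open U -> measurable U.
Proof.
by move=> oU; apply: (countable_base_measurable rVbase_countable) => x Ux; exact: open_nbhs_nbhs.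
Qed.

Lemma open_measurable_strip (U : set ('rV[R]_N * R)) : open U ->
  measurable (U : set ('rV[R]_N * measurableTypeR R)%type).
Proof.
by move=> oU; apply: (countable_base_measurable prodbase_countable) => x Ux; exact: open_nbhs_nbhs.
Qed.

Lemma continuous_measurable_rV (f : 'rV[R]_N -> R) :
  continuous f -> measurable_fun setT f.
Proof.
move=> /continuousP cf; apply: (measurability _ (RGenOpens.measurableE R)).
move=> _ [_ [a [b ->] <-]]; rewrite setTI; apply: open_measurable_rV.
exact/cf/interval_open.
Qed.

Lemma continuous_measurable_strip (f : 'rV[R]_N * R -> R) : continuous f ->
  measurable_fun [set: ('rV[R]_N * measurableTypeR R)%type] f.
Proof.
move=> /continuousP cf; apply: (measurability _ (RGenOpens.measurableE R)).
move=> _ [_ [a [b ->] <-]]; rewrite setTI; apply: open_measurable_strip.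
exact/cf/interval_open.
Qed.

Lemma compact_measurable_rV (K : set 'rV[R]_N) : compact K -> measurable K.
Proof.
move=> /compact_closed -/(_ (@norm_hausdorff _ _)) cK.
rewrite -[K]setCK; apply: measurableC; apply: open_measurable_rV.
exact: closed_openC.
Qed.

Lemma compact_measurable_strip (K : set ('rV[R]_N * R)) : compact K ->
  measurable (K : set ('rV[R]_N * measurableTypeR R)%type).
Proof.
move=> /compact_closed -/(_ (@norm_hausdorff _ _)) cK.
rewrite -[K]setCK; apply: (@measurableC _ ('rV[R]_N * measurableTypeR R)%type).
by apply: open_measurable_strip; exact: closed_openC.
Qed.

End Base.

(** * Translation invariance of the Lebesgue measure on R^N *)

Section Translation.
Context (R : realType).
Local Open Scope ereal_scope.

Lemma lebesgue_measure_translate (a : R) (A : set R) : measurable A ->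
  lebesgue_measure ((fun x : R => (x + a)%R) @^-1` A) = lebesgue_measure A.
Proof.
move=> mA.
have mf : measurable_fun setT ((fun x : measurableTypeR R => (x + a)%R) : measurableTypeR R -> measurableTypeR R).
  exact: measurable_funD.
pose nu : {measure set (measurableTypeR R) -> \bar R} :=
  measure_function_pushforward__canonical__measure_function_Measure
    (@lebesgue_measure R) mf.
suff : lebesgue_measure A = nu A by move=> ->.
apply/lebesgue_measure_unique => //= _ [[x y]] _ <-.
rewrite /= /pushforward.
rewrite (_ : _ @^-1` _ = `]x - a, y - a]%classic)%R.
  rewrite !lebesgue_measure_itv/= !lte_fin ltrD2r.
  by case: ifPn => // _; rewrite -!EFinB; congr (_%:E); ring.
by apply/seteqP; split => z /=; rewrite !in_itv/= ltrBlDr lerBrDr.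
Qed.

Lemma measurable_shift n (z : 'rV[R]_n) : measurable_fun setT (fun x : 'rV[R]_n => x + z)%R.
Proof.
apply: measurable_fun_rV => i.
rewrite (_ : _ \o _ = fun x => rV_coord i x + rV_coord i z)%R.
  by apply: measurable_funD => //; exact: measurable_rV_coord.
by apply/funext => x; rewrite /rV_coord /= mxE.
Qed.

Lemma cons_rVl n (x : measurableTypeR R * 'rV[R]_n) j :
  cons_rV x ord0 (@lshift 1 n j : 'I_n.+1) = x.1.
Proof. by apply: etrans (row_mxEl _ _ _ _) _; rewrite mxE !ord1. Qed.

Lemma cons_rVr n (x : measurableTypeR R * 'rV[R]_n) j :
  cons_rV x ord0 (@rshift 1 n j : 'I_n.+1) = x.2 ord0 j.
Proof. exact: row_mxEr. Qed.

Lemma measurable_cons n :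
  measurable_fun [set: (measurableTypeR R * 'rV[R]_n)%type] (@cons_rV R n).
Proof.
apply: measurable_fun_rV => i.
have [j ->|j ->] := @split_ordP 1 n i.
  rewrite (_ : _ \o _ = fst) //; apply/funext => x /=.
  exact: cons_rVl.
rewrite (_ : _ \o _ = rV_coord j \o snd); last first.
  by apply/funext => x /=; exact: cons_rVr.
by apply: measurableT_comp => //; exact: measurable_rV_coord.
Qed.

(** By induction on the dimension, from uniqueness of product measures. *)
Lemma lebesgueN_translate n (z : 'rV[R]_n) (A : set 'rV[R]_n) : measurable A ->
  lebesgueN n ((fun x => x + z)%R @^-1` A) = lebesgueN n A.
Proof.
elim: n z A => [|n IH] z A mA.
  rewrite (_ : _ @^-1` _ = A)//; apply/seteqP; split => x /=;
  by rewrite (_ : x + z = x)%R//; apply/rowP => -[].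
pose th (x : measurableTypeR R * 'rV[R]_n) : measurableTypeR R * 'rV[R]_n :=
  (x.1 + z ord0 ord0, x.2 + @rsubmx R 1 1 n z)%R.
have mth : measurable_fun setT th.
  apply: measurable_fun_pair.
    by apply: measurable_funD => //; exact: measurable_fst.
  by apply: measurableT_comp (measurable_shift _) _; exact: measurable_snd.
pose mu2 := (@lebesgue_measure R \x @lebesgueN R n).
pose nu : {measure set (measurableTypeR R * 'rV[R]_n) -> \bar R} :=
  measure_function_pushforward__canonical__measure_function_Measure mu2 mth.
have E : forall X, measurable X -> mu2 X = nu X.
  apply: product_measure_unique => B C mB mC.
  rewrite /= /pushforward (_ : th @^-1` _ =
     ((fun x : R => (x + z ord0 ord0)%R) @^-1` B) `*` ((fun x => x + @rsubmx R 1 1 n z)%R @^-1` C)); last first.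
    by apply/seteqP; split => -[].
  rewrite product_measure1E.
  - by congr (_ * _); [exact: lebesgue_measure_translate|exact: IH].
  - rewrite -[X in measurable X]setTI.
    by apply: (measurable_funD (T := measurableTypeR R) (f := id) (g := cst _)).
  - by rewrite -[X in measurable X]setTI; exact: measurable_shift.
rewrite /= /pushforward.
have mc := @measurable_cons n.
have mA' : measurable (@cons_rV R n @^-1` A) by rewrite -[X in measurable X]setTI; exact: mc.
rewrite [RHS]E// /nu /= /pushforward; congr (mu2 _).
have hc ax : cons_rV (th ax) = (cons_rV ax + z)%R.
  case: ax => a x; apply/rowP => i; rewrite [RHS]mxE.
  have [j ->|j ->] := @split_ordP 1 n i.
    rewrite !cons_rVl /=; congr (_ + z _ _)%R.
    by apply: val_inj; rewrite ord1.
  by rewrite !cons_rVr /= !mxE.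
by apply/seteqP; split => ax /=; rewrite hc.
Qed.

End Translation.

Section IntegralTranslation.
Context (R : realType) (N : nat).
Local Notation lam := (@lebesgueN R N).

Lemma integral_translate (z : 'rV[R]_N) (f : 'rV[R]_N -> \bar R) :
  measurable_fun setT f -> (forall x, 0 <= f x)%E ->
  (\int[lam]_x f (x + z)%R = \int[lam]_x f x)%E.
Proof.
move=> mf f0.
have ms := @measurable_shift R N z.
transitivity (\int[pushforward lam (fun x => x + z)%R]_x f x)%E.
  by rewrite ge0_integral_pushforward.
by apply: eq_measure_integral => A mA _; exact: lebesgueN_translate.
Qed.

Lemma intg_translate (z : 'rV[R]_N) (f : 'rV[R]_N -> R) :
  intg lam f -> intg lam (fun x => f (x + z)).
Proof.
move=> fi; have mf := intg_measurable fi.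
apply/integrableP; split.
  by apply/measurable_EFinP; apply: measurableT_comp mf _; exact: measurable_shift.
rewrite (integral_translate z (f := fun x => `|(f x)%:E|%E))//.
  by case/integrableP: fi.
by apply: measurableT_comp => //; exact/measurable_EFinP.
Qed.

Lemma Rint_translate (z : 'rV[R]_N) (f : 'rV[R]_N -> R) : intg lam f ->
  \int[lam]_x f (x + z) = \int[lam]_x f x.
Proof.
move=> fi; have mf := intg_measurable fi.
congr fine; rewrite integralE [RHS]integralE; congr (_ - _)%E.
  rewrite -[RHS](integral_translate z) //.
  - by apply: eq_integral => x _; rewrite !funeposE.
  - exact/measurable_funepos/measurable_EFinP.
rewrite -[RHS](integral_translate z) //.
- by apply: eq_integral => x _; rewrite !funenegE.
- exact/measurable_funeneg/measurable_EFinP.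
Qed.

End IntegralTranslation.

(** * Integrability of the fractional kernel *)

Section EuclNorm.
Context (R : realType) (N : nat).
Implicit Types x y z : 'rV[R]_N.

Lemma eucl_norm_ge0 z : 0 <= eucl_norm z.
Proof. exact: sqrtr_ge0. Qed.

Lemma eucl_normN z : eucl_norm (- z) = eucl_norm z.
Proof. by congr Num.sqrt; apply: eq_bigr => i _; rewrite mxE sqrrN. Qed.

Lemma eucl_normC x y : eucl_norm (x - y) = eucl_norm (y - x).
Proof. by rewrite -eucl_normN opprB. Qed.

Lemma coord_le_eucl z i : `|z ord0 i| <= eucl_norm z.
Proof.
rewrite -sqrtr_sqr ler_sqrt ?sumr_ge0//; last by move=> j _; exact: sqr_ge0.
by rewrite (bigD1 i)//= lerDl sumr_ge0// => j _; exact: sqr_ge0.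
Qed.

Lemma eucl_norm0 : eucl_norm (0 : 'rV[R]_N) = 0.
Proof.
by rewrite /eucl_norm big1 ?sqrtr0// => i _; rewrite mxE expr0n.
Qed.

Lemma eucl_norm_eq0 z : eucl_norm z = 0 -> z = 0.
Proof.
move=> z0; apply/rowP => i; rewrite mxE; apply/eqP; rewrite -normr_le0 -z0.
exact: coord_le_eucl.
Qed.

Lemma measurable_eucl : measurable_fun setT (fun z => eucl_norm z).
Proof.
have msqrt : measurable_fun setT (@Num.sqrt R).
  by apply: nondecreasing_measurable => //; exact: ler_wsqrtr.
apply: (measurableT_comp msqrt).
apply: measurable_sumR => i.
by apply: measurable_funX; exact: measurable_rV_coord.
Qed.

Lemma measurable_subXX : measurable_fun setT (fun u : 'rV[R]_N * 'rV[R]_N => u.1 - u.2).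
Proof.
apply: measurable_fun_rV => i.
rewrite (_ : _ \o _ = fun u => rV_coord i u.1 - rV_coord i u.2); last first.
  by apply/funext => u; rewrite /rV_coord /= !mxE.
apply: measurable_funB.
- by apply: measurableT_comp (measurable_rV_coord _) _; exact: measurable_fst.
- by apply: measurableT_comp (measurable_rV_coord _) _; exact: measurable_snd.
Qed.

Definition box (r : R) : set 'rV[R]_N := [set x | forall i, `|x ord0 i| <= r].

Lemma measurable_box (r : R) : measurable (box r).
Proof.
rewrite (_ : box r = [set x | forall i, `[- r, r]%classic (x ord0 i)]).
  exact: (@measurable_rV_box R N (fun=> `[- r, r]%classic)).
by apply/seteqP; split => x h i; have := h i; rewrite /= in_itv/= ler_norml.
Qed.

Lemma lebesgueN_cube (r : R) : 0 <= r -> lebesgueN N (box r) = ((2 * r) ^+ N)%:E.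
Proof.
move=> r0.
rewrite (_ : box r = [set x | forall i, `[- r, r]%classic (x ord0 i)]); last first.
  by apply/seteqP; split => x h i; have := h i; rewrite /= in_itv/= ler_norml.
rewrite (@lebesgueN_box R N (fun=> `[- r, r]%classic))//.
under eq_bigr do rewrite lebesgue_measure_itv/=.
rewrite (_ : (if _ then _ else _) = (2 * r)%:E); last first.
  rewrite lte_fin; case: ifPn => [_|].
    by rewrite -EFinB; congr EFin; ring.
  by rewrite -leNgt => h; congr EFin; lra.
by rewrite prodEFin prodr_const card_ord.
Qed.

End EuclNorm.

Section Dyadic.
Context (R : realType).

Lemma dyadic_small (r : R) : 0 < r -> r <= 1 ->
  exists j, (2 ^+ j.+1)^-1 < r /\ r <= (2 ^+ j)^-1.
Proof.
move=> r0 r1.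
have ex : exists j, (2 ^+ j.+1)^-1 < r.
  have [n hn] := lt_exp2n (r^-1); exists n.
  rewrite -[r]invrK ltf_pV2 ?posrE ?invr_gt0 ?exprn_gt0//.
  by rewrite (lt_le_trans hn)// exprS ler_peMl ?exprn_ge0// ler1n.
case: (ex_minnP ex) => -[|j] hj minj; first by exists 0%N; rewrite expr0 invr1.
exists j.+1; split => //; rewrite leNgt; apply/negP => h.
by have := minj j h; rewrite ltnn.
Qed.

Lemma dyadic_large (r : R) : 1 <= r -> exists j, 2 ^+ j <= r /\ r < 2 ^+ j.+1.
Proof.
move=> r1.
have ex : exists j, r < 2 ^+ j.+1.
  have [n hn] := lt_exp2n r; exists n.
  by rewrite (lt_le_trans hn)// exprS ler_peMl ?exprn_ge0// ler1n.
case: (ex_minnP ex) => -[|j] hj minj; first by exists 0%N.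
exists j.+1; split => //; rewrite leNgt; apply/negP => h.
by have := minj j h; rewrite ltnn.
Qed.

Lemma powR_exp2 (a : R) n : (2 ^+ n) `^ a = (2 `^ a) ^+ n :> R.
Proof.
by rewrite -powR_mulrn// -powRrM mulrC powRrM powR_mulrn// powR_ge0.
Qed.

End Dyadic.

Section KernelIntegral.
Context (R : realType) (N : nat).
Variable alpha : R.
Hypotheses (N1 : (1 <= N)%N) (a1 : N%:R < alpha) (a2 : alpha < N%:R + 1).
Local Notation lam := (@lebesgueN R N).

Definition frac_kernel (z : 'rV[R]_N) : R := (eucl_norm z `^ alpha)^-1.

Lemma frac_kernel_ge0 z : 0 <= frac_kernel z. Proof. by rewrite invr_ge0 powR_ge0. Qed.

Lemma frac_kernelN z : frac_kernel (- z) = frac_kernel z. Proof. by rewrite /frac_kernel eucl_normN. Qed.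

Lemma measurable_frac_kernel : measurable_fun setT frac_kernel.
Proof.
rewrite (_ : frac_kernel = (fun r => r `^ (- alpha)) \o @eucl_norm R N).
  by apply: measurableT_comp; [exact: measurable_powR|exact: measurable_eucl].
by apply/funext => z; rewrite /frac_kernel /= powRN.
Qed.

Lemma alpha0 : 0 < alpha. Proof. by apply: le_lt_trans a1. Qed.

(** The measure of a cube of half side [rho j] is [(2 * rho j) ^+ N]. *)
Lemma cubes_integrable (c rho : nat -> R) (C th : R) :
  (forall j, 0 <= c j) -> (forall j, 0 <= rho j) -> 0 <= th -> th < 1 ->
  (forall j, c j * (2 * rho j) ^+ N <= C * th ^+ j) ->
  (\int[lam]_z (\sum_(0 <= j <oo) (c j * \1_(@box R N (rho j)) z)%:E) < +oo)%E.
Proof.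
move=> c0 r0 th0 th1 h.
rewrite integral_nneseries//; last 2 first.
  move=> j; apply/measurable_EFinP; apply: measurable_funM => //.
  by apply: measurable_indic; exact: measurable_box.
  by move=> j z _; rewrite lee_fin mulr_ge0.
have E j : (\int[lam]_z (c j * \1_(@box R N (rho j)) z)%:E = (c j * (2 * rho j) ^+ N)%:E)%E.
  under eq_integral do rewrite EFinM.
  rewrite ge0_integralZl_EFin//; last first.
    by apply/measurable_EFinP; apply: measurable_indic; exact: measurable_box.
  rewrite integral_indic//; last exact: measurable_box.
  by rewrite setIT EFinM; congr (_ * _)%E; exact: lebesgueN_cube.
apply: (@le_lt_trans _ _ (\sum_(0 <= j <oo) (C * th ^+ j)%:E)%E).
  apply: lee_nneseries => j; rewrite E lee_fin// => _ _.
  by rewrite mulr_ge0// exprn_ge0// mulr_ge0.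
have C0 : 0 <= C by have := h 0%N; rewrite expr0 mulr1; apply: le_trans; rewrite mulr_ge0// exprn_ge0// mulr_ge0.
have cv := @cvg_geometric_series R C th.
rewrite (_ : (\sum_(0 <= j <oo) (C * th ^+ j)%:E)%E = (C / (1 - th))%:E) ?ltry//.
apply/cvg_lim => //.
rewrite (_ : (fun n => _) = EFin \o series (geometric C th)).
  apply: cvg_EFin; first by near=> n.
  by apply: cv; rewrite ger0_norm.
by apply/funext => n /=; rewrite /series /= sumEFin.
Unshelve. all: by end_near. Qed.

Lemma le_nneseries_term (u : nat -> \bar R) j : (forall n, 0 <= u n)%E ->
  (u j <= \sum_(0 <= n <oo) u n)%E.
Proof.
move=> u0; apply: le_trans (@nneseries_lim_ge _ u xpredT 0 j.+1 (fun n _ _ => u0 n)).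
by rewrite big_nat_recr//= leeDr// sume_ge0.
Qed.

Lemma small_shell z : eucl_norm z <= 1 ->
  ((eucl_norm z * frac_kernel z)%:E <= \sum_(0 <= j <oo)
    (((2 `^ (alpha - 1)) ^+ j.+1) * \1_(@box R N (2 ^+ j)^-1) z)%:E)%E.
Proof.
move=> z1.
have t0 n : (0 <= (((2 `^ (alpha - 1)) ^+ n.+1) * \1_(@box R N (2 ^+ n)^-1) z)%:E)%E.
  by rewrite lee_fin mulr_ge0// exprn_ge0// powR_ge0.
have := eucl_norm_ge0 z; rewrite le_eqVlt => /orP[/eqP <-|z0].
  by rewrite mul0r; exact: nneseries_ge0.
have [j [h1 h2]] := dyadic_small z0 z1.
apply: le_trans (le_nneseries_term j t0).
have -> : \1_(@box R N (2 ^+ j)^-1) z = 1 :> R.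
  rewrite indicE mem_set// => i; exact: le_trans (coord_le_eucl z i) _.
rewrite mulr1 lee_fin -powR_exp2.
have -> : eucl_norm z * frac_kernel z = (eucl_norm z)^-1 `^ (alpha - 1).
  rewrite -powR_inv1 ?ltW// -powRrM mulN1r opprB.
  rewrite powRB; last by rewrite (gt_eqF z0) implybT.
  by rewrite powRr1 ?ltW.
apply: ge0_ler_powR; rewrite ?nnegrE ?invr_ge0 ?exprn_ge0// ?ltW//.
  by rewrite subr_gt0; apply: le_lt_trans a1; rewrite ler1n.
by rewrite -[ltRHS]invrK ltf_pV2 ?posrE ?invr_gt0 ?exprn_gt0.
Qed.

Lemma large_shell z : 1 <= eucl_norm z ->
  ((frac_kernel z)%:E <= \sum_(0 <= j <oo)
    ((((2 `^ alpha) ^+ j)^-1) * \1_(@box R N (2 ^+ j.+1)) z)%:E)%E.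
Proof.
move=> z1.
have t0 n : (0 <= ((((2 `^ alpha) ^+ n)^-1) * \1_(@box R N (2 ^+ n.+1)) z)%:E)%E.
  by rewrite lee_fin mulr_ge0// invr_ge0 exprn_ge0// powR_ge0.
have [j [h1 h2]] := dyadic_large z1.
apply: le_trans (le_nneseries_term j t0).
have -> : \1_(@box R N (2 ^+ j.+1)) z = 1 :> R.
  rewrite indicE mem_set// => i; exact: le_trans (coord_le_eucl z i) (ltW h2).
rewrite mulr1 lee_fin -powR_exp2 lef_pV2 ?posrE ?powR_gt0 ?exprn_gt0//; last first.
  exact: lt_le_trans z1.
apply: ge0_ler_powR => //; rewrite ?nnegrE ?exprn_ge0//; first exact/ltW/alpha0.
exact: eucl_norm_ge0.
Qed.

Lemma powR2_lt1 (x : R) : x < 0 -> 2 `^ x < 1.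
Proof. by move=> x0; rewrite /powR gt_eqF// expR_lt1 nmulr_rlt0// ln_gt0// ltr1n. Qed.

(** Sum over dyadic cubes.  With [alpha = N + sp], small cubes contribute the powers
    of [2 `^ (alpha - 1 - N)], a convergent series because [sp < 1], and large ones
    the powers of [2 `^ (N - alpha)]. *)
Lemma kernel_moment : intg lam (fun z => Num.min (eucl_norm z) 1 * frac_kernel z).
Proof.
have mm : measurable_fun setT (fun z : 'rV[R]_N => Num.min (eucl_norm z) 1).
  by apply: measurable_minr => //; exact: measurable_eucl.
have mf : measurable_fun setT (fun z : 'rV[R]_N => Num.min (eucl_norm z) 1 * frac_kernel z).
  by apply: measurable_funM => //; exact: measurable_frac_kernel.
have m0 z : 0 <= Num.min (eucl_norm z) 1 * frac_kernel z.
  by rewrite mulr_ge0 ?frac_kernel_ge0// le_min eucl_norm_ge0 ler01.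
apply/intg_ge0P => //.
have p0 (x : R) : 0 < 2 `^ x by rewrite powR_gt0.
have pN : 2 `^ N%:R = 2 ^+ N :> R by rewrite powR_mulrn.
pose f1 z := (\sum_(0 <= j <oo)
    ((2 `^ (alpha - 1)) ^+ j.+1 * \1_(@box R N (2 ^+ j)^-1) z)%:E)%E.
pose f2 z := (\sum_(0 <= j <oo)
    (((2 `^ alpha) ^+ j)^-1 * \1_(@box R N (2 ^+ j.+1)) z)%:E)%E.
have b1 : (\int[lam]_z f1 z < +oo)%E.
  apply: (@cubes_integrable _ (fun j => (2 ^+ j)^-1)
   (2 `^ (alpha - 1) * 2 ^+ N) (2 `^ (alpha - 1 - N%:R))) => [j|j||| j].
  - by rewrite exprn_ge0 ?ltW.
  - by rewrite invr_ge0 exprn_ge0.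
  - by rewrite ltW.
  - by apply: powR2_lt1; have := a1; have := a2; lra.
  rewrite [X in _ <= _ * X ^+ _](powRB (s := N%:R)) ?pnatr_eq0 ?implybT// pN.
  rewrite !expr_div_n -!exprM (mulnC N) exprS.
  by rewrite le_eqVlt; apply/orP; left; apply/eqP; ring.
have b2 : (\int[lam]_z f2 z < +oo)%E.
  apply: (@cubes_integrable _ (fun j => 2 ^+ j.+1)
   (4 ^+ N) (2 `^ (N%:R - alpha))) => [j|j||| j].
  - by rewrite invr_ge0 exprn_ge0 ?ltW.
  - by rewrite exprn_ge0.
  - by rewrite ltW.
  - by apply: powR2_lt1; have := a1; have := a2; lra.
  rewrite [X in _ <= _ * X ^+ _](powRB (r := N%:R)) ?pnatr_eq0 ?implybT// pN.
  rewrite expr_div_n exprS mulrA exprMn.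
  rewrite (_ : (2 * 2 : R) = 4); last by rewrite -natrM.
  rewrite -!exprM (mulnC N).
  by rewrite le_eqVlt; apply/orP; left; apply/eqP; ring.
have t1 z n : (0 <= (((2 `^ (alpha - 1)) ^+ n.+1) * \1_(@box R N (2 ^+ n)^-1) z)%:E)%E.
  by rewrite lee_fin mulr_ge0// exprn_ge0// powR_ge0.
have t2 z n : (0 <= ((((2 `^ alpha) ^+ n)^-1) * \1_(@box R N (2 ^+ n.+1)) z)%:E)%E.
  by rewrite lee_fin mulr_ge0// invr_ge0 exprn_ge0// powR_ge0.
have meas_bd (c rho : nat -> R) n :
    measurable_fun setT (fun z => (c n * \1_(@box R N (rho n)) z)%:E).
  apply/measurable_EFinP; apply: measurable_funM => //.
  by apply: measurable_indic; exact: measurable_box.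
have m1 : measurable_fun setT f1.
  apply: ge0_emeasurable_sum => [n z _ _|n _]; first exact: t1.
  exact: (meas_bd (fun n => (2 `^ (alpha - 1)) ^+ n.+1) (fun n => (2 ^+ n)^-1)).
have m2 : measurable_fun setT f2.
  apply: ge0_emeasurable_sum => [n z _ _|n _]; first exact: t2.
  exact: (meas_bd (fun n => ((2 `^ alpha) ^+ n)^-1) (fun n => 2 ^+ n.+1)).
have f10 z : (0 <= f1 z)%E by apply: nneseries_ge0 => n _ _; exact: t1.
have f20 z : (0 <= f2 z)%E by apply: nneseries_ge0 => n _ _; exact: t2.
apply: (@le_lt_trans _ _ (\int[lam]_z (f1 z + f2 z))%E).
  apply: ge0_le_integral => //.
  - by move=> z _; rewrite lee_fin.
  - exact/measurable_EFinP.
  - exact: emeasurable_funD.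
  move=> z _; have [z1|/ltW z1] := leP (eucl_norm z) 1.
    by apply: le_trans (small_shell z1) _; rewrite leeDl.
  by rewrite mul1r; apply: le_trans (large_shell z1) _; rewrite leeDr.
by rewrite ge0_integralD// lte_add_pinfty.
Qed.

Definition trunc_kernel (m : nat) (z : 'rV[R]_N) : R := Num.min (frac_kernel z) m%:R.

Lemma trunc_kernel_ge0 m z : 0 <= trunc_kernel m z. Proof. by rewrite le_min frac_kernel_ge0 ler0n. Qed.

Lemma trunc_kernelN m z : trunc_kernel m (- z) = trunc_kernel m z. Proof. by rewrite /trunc_kernel frac_kernelN. Qed.

Lemma measurable_trunc_kernel m : measurable_fun setT (trunc_kernel m).
Proof. by apply: measurable_minr => //; exact: measurable_frac_kernel. Qed.

Lemma intg_trunc_kernel m : intg lam (trunc_kernel m).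
Proof.
apply: (@intg_dom _ _ _ _ _ (fun z => Num.min (eucl_norm z) 1 * frac_kernel z + m%:R * \1_(@box R N 1) z)).
- exact: measurable_trunc_kernel.
- move=> z; rewrite ger0_norm ?trunc_kernel_ge0//; have [z1|/ltW z1] := leP (eucl_norm z) 1.
    rewrite (_ : \1_(@box R N 1) z = 1); last first.
      rewrite indicE mem_set// => i; exact: le_trans (coord_le_eucl z i) z1.
    by rewrite mulr1 ler_wpDl ?mulr_ge0 ?frac_kernel_ge0 ?eucl_norm_ge0// /trunc_kernel ge_min lexx orbT.
  by rewrite mul1r ler_wpDr ?mulr_ge0// /trunc_kernel ge_min lexx.
- apply: intgD; first exact: kernel_moment.
  apply: intgZ; apply/intg_ge0P => //.
    by apply: measurable_indic; exact: measurable_box.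
  rewrite integral_indic//; last exact: measurable_box.
  have := @lebesgueN_cube R N 1 ler01; rewrite setIT => h.
  by apply: le_lt_trans (ltry ((2 * 1 : R) ^+ N)); rewrite -h.
Qed.

End KernelIntegral.

(** * Truncations of Phi *)

Section TruncatedPhi.
Context (R : realType) (p : R).
Hypotheses (p1 : 1 < p) (p2 : p < 2).

Definition trunc_Phi (m : nat) (a : R) : R := Num.min (`|a| `^ (p - 2)) m%:R * a.

Let pm1 : 0 < p - 1. Proof. by rewrite subr_gt0. Qed.

Lemma trunc_Phi_odd m a : trunc_Phi m (- a) = - trunc_Phi m a.
Proof. by rewrite /trunc_Phi normrN mulrN. Qed.

Lemma powR_pm1 (a : R) : 0 <= a -> a `^ (p - 2) * a = a `^ (p - 1).
Proof.
move=> a0; rewrite mulrC -(mulr_powRB1 a0 pm1); congr (_ * _ `^ _).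
by ring.
Qed.

Lemma trunc_PhiE m a : 0 <= a -> trunc_Phi m a = Num.min (a `^ (p - 1)) (m%:R * a).
Proof. by move=> a0; rewrite /trunc_Phi ger0_norm// minr_pMl// powR_pm1. Qed.

Lemma norm_Phi a : `|Phi p a| = `|a| `^ (p - 1).
Proof. by rewrite /Phi normrM ger0_norm ?powR_ge0// powR_pm1. Qed.

Lemma norm_trunc_Phi m a : `|trunc_Phi m a| = Num.min (`|a| `^ (p - 1)) (m%:R * `|a|).
Proof.
have m0 : 0 <= Num.min (`|a| `^ (p - 2)) m%:R by rewrite le_min powR_ge0 ler0n.
by rewrite /trunc_Phi normrM (ger0_norm m0) minr_pMl// powR_pm1.
Qed.

Lemma le_trunc_Phi m a : `|trunc_Phi m a| <= `|a| `^ (p - 1).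
Proof. by rewrite norm_trunc_Phi ge_min lexx. Qed.

Lemma powR_nd (q a b : R) : 0 <= q -> 0 <= a -> a <= b -> a `^ q <= b `^ q.
Proof. by move=> q0 a0 ab; apply: ge0_ler_powR; rewrite ?nnegrE// (le_trans a0). Qed.

Lemma powR_ni (q a b : R) : q <= 0 -> 0 < a -> a <= b -> b `^ q <= a `^ q.
Proof.
move=> q0 a0 ab; have b0 := lt_le_trans a0 ab.
rewrite -[q]opprK !(powRN _ (- q)) lef_pV2 ?posrE ?powR_gt0//.
by apply: powR_nd; rewrite ?oppr_ge0// ltW.
Qed.

Lemma trunc_Phi_ge0 m a : 0 <= a -> 0 <= trunc_Phi m a.
Proof. by move=> a0; rewrite /trunc_Phi mulr_ge0// le_min powR_ge0. Qed.

Let trunc_Phi_nd0 m a b : 0 <= a -> a <= b -> trunc_Phi m a <= trunc_Phi m b.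
Proof.
move=> a0 ab; have b0 := le_trans a0 ab; rewrite !trunc_PhiE//.
rewrite le_min !ge_min; apply/andP; split; apply/orP; [left|right].
  by apply: powR_nd => //; exact: ltW.
exact: ler_wpM2l.
Qed.

Let trunc_Phi_lip0 m a b : 0 <= a -> a <= b -> trunc_Phi m b - trunc_Phi m a <= m%:R * (b - a).
Proof.
move=> a0; rewrite le_eqVlt => /orP[/eqP ->|ab]; first by rewrite !subrr mulr0.
have b0 : 0 < b by exact: le_lt_trans ab.
move: a0; rewrite le_eqVlt => /orP[/eqP <-|a0].
  by rewrite {2}/trunc_Phi mulr0 !subr0 (trunc_PhiE m (ltW b0)) ge_min lexx orbT.
rewrite /trunc_Phi !gtr0_norm//.
set qa := Num.min (a `^ _) _; set qb := Num.min _ _.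
have qba : qb <= qa.
  rewrite /qa /qb le_min !ge_min lexx orbT andbT; apply/orP; left.
  by apply: powR_ni => //; [rewrite subr_le0 ltW|exact: ltW].
have qm : qa <= m%:R by rewrite ge_min lexx orbT.
apply: (@le_trans _ _ (qa * (b - a))); last by rewrite ler_wpM2r// subr_ge0 ltW.
by rewrite mulrBr lerB// ler_wpM2r// ltW.
Qed.

Lemma trunc_Phi_nd m a b : a <= b -> trunc_Phi m a <= trunc_Phi m b.
Proof.
move=> ab; have [a0|/ltW a0] := leP 0 a; first exact: trunc_Phi_nd0.
have [b0|/ltW b0] := leP 0 b.
  apply: (@le_trans _ _ 0); last exact: trunc_Phi_ge0.
  by rewrite -oppr_ge0 -trunc_Phi_odd trunc_Phi_ge0// oppr_ge0.
by rewrite -lerN2 -!trunc_Phi_odd trunc_Phi_nd0 ?oppr_ge0// lerN2.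
Qed.

Lemma trunc_Phi_lip m a b : a <= b -> trunc_Phi m b - trunc_Phi m a <= m%:R * (b - a).
Proof.
move=> ab; have [a0|/ltW a0] := leP 0 a; first exact: trunc_Phi_lip0.
have trunc_Phi0 : trunc_Phi m 0 = 0 by rewrite /trunc_Phi mulr0.
have [b0|/ltW b0] := leP 0 b.
  have h1 := trunc_Phi_lip0 m (lexx 0) b0.
  have h2 := @trunc_Phi_lip0 m 0 (- a) (lexx 0); rewrite oppr_ge0 in h2.
  have {}h2 := h2 a0; move: h1 h2; rewrite trunc_Phi0 trunc_Phi_odd !subr0 => h1 h2.
  by rewrite mulrDr lerD.
have := @trunc_Phi_lip0 m (- b) (- a); rewrite oppr_ge0 lerN2 => /(_ b0 ab).
by rewrite !trunc_Phi_odd !opprK addrC (addrC _ b).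
Qed.

(** The value of [a `^ (p - 1)] at the point where [a `^ (p - 2) = m]. *)
Definition Phi_err (m : nat) : R := m%:R `^ (- ((p - 1) / (2 - p))).

Lemma Phi_err_ge0 m : 0 <= Phi_err m. Proof. exact: powR_ge0. Qed.

(** The truncation only acts where [`|a| `^ (p - 2) > m], that is for small [a], and
    there [`|a| `^ (p - 1)] itself is below the error. *)
Lemma trunc_Phi_approx m a : (0 < m)%N -> `|Phi p a| - `|trunc_Phi m a| <= Phi_err m.
Proof.
move=> m0; rewrite norm_Phi norm_trunc_Phi.
have [h|h] := leP (`|a| `^ (p - 1)) (m%:R * `|a|); first by rewrite subrr Phi_err_ge0.
apply: (@le_trans _ _ (`|a| `^ (p - 1))).
  by rewrite gerDl oppr_le0 mulr_ge0.
have := normr_ge0 a; rewrite le_eqVlt => /orP[/eqP <-|a0].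
  by rewrite powR0 ?Phi_err_ge0// gt_eqF.
have mR : 0 < m%:R :> R by rewrite ltr0n.
have h2 : m%:R <= `|a| `^ (p - 2).
  by rewrite -(ler_pM2r a0) powR_pm1// ltW.
have d0 : 0 < 2 - p by rewrite subr_gt0.
have -> : `|a| `^ (p - 1) = (`|a| `^ (p - 2)) `^ (- ((p - 1) / (2 - p))).
  by rewrite -powRrM; congr (_ `^ _); field; rewrite gt_eqF.
rewrite /Phi_err !powRN lef_pV2 ?posrE ?powR_gt0//.
by apply: powR_nd => //; rewrite divr_ge0// ltW.
Qed.

Lemma Phi_err_small (e : R) : 0 < e -> exists m0, (0 < m0)%N /\ forall m, (m0 <= m)%N -> Phi_err m <= e.
Proof.
move=> e0; pose g := (p - 1) / (2 - p).
have g0 : 0 < g by rewrite divr_gt0// subr_gt0.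
exists (Num.trunc (e `^ (- g^-1))).+1; split => // m hm.
have mx : e `^ (- g^-1) <= m%:R.
  by apply: le_trans (ltW (truncnS_gt _)) _; rewrite ler_nat.
have m0 : 0 < m%:R :> R by rewrite ltr0n (leq_trans _ hm).
rewrite /Phi_err -/g powRN -[leRHS]invrK lef_pV2 ?posrE ?powR_gt0 ?invr_gt0//.
rewrite -(powR_inv1 (ltW e0)) (_ : -1 = (- g^-1) * g); last by field; rewrite gt_eqF.
by rewrite powRrM powR_nd ?powR_ge0// ltW.
Qed.

Lemma Phi_subadd (a b : R) : 0 <= a -> 0 <= b ->
  `|Phi p (a - b)| <= a `^ (p - 1) + b `^ (p - 1).
Proof.
move=> a0 b0; rewrite norm_Phi.
have q0 : 0 <= p - 1 by exact: ltW.
have [ab|/ltW ab] := leP a b.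
  have h : b - a <= b by rewrite gerDl oppr_le0.
  by rewrite distrC ger0_norm ?subr_ge0// ler_wpDl ?powR_ge0// powR_nd// subr_ge0.
have h : a - b <= a by rewrite gerDl oppr_le0.
by rewrite ger0_norm ?subr_ge0// ler_wpDr ?powR_ge0// powR_nd// subr_ge0.
Qed.

Lemma trunc_Phi_subadd m (a b : R) : 0 <= a -> 0 <= b ->
  `|trunc_Phi m (a - b)| <= a `^ (p - 1) + b `^ (p - 1).
Proof.
by move=> a0 b0; apply: (le_trans (le_trunc_Phi _ _)); rewrite -norm_Phi Phi_subadd.
Qed.

End TruncatedPhi.

(** * The truncated operators on R^N *)

Section KernelDefect.
Context d (T : measurableType d) (R : realType).
Variables (mu : {sigma_finite_measure set T -> \bar R}) (add sub : T -> T -> T).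
Hypothesis Tr : is_translation mu add sub.
Variables (K : T -> R) (km : nat -> T -> R) (err : nat -> R) (q : R).
Hypotheses (mK : measurable_fun setT K) (mkm : forall m, measurable_fun setT (km m))
  (km0 : forall m z, 0 <= km m z) (kmK : forall m z, km m z <= K z)
  (kcvg : forall z, km m z @[m --> \oo] --> K z)
  (err0 : forall m, 0 <= err m)
  (err_small : forall eps, 0 < eps -> exists m0, forall m, (m0 <= m)%N -> err m <= eps).

(** The first term accounts for the truncation of Phi, whose error is uniform, and
    the second one for that of the kernel, on values bounded by [M]. *)
Definition defect (M : R) (m : nat) (z : T) : R := err m * K z + M `^ q * (K z - km m z).

Lemma measurable_defect M m : measurable_fun setT (defect M m).
Proof.
apply: measurable_funD; apply: measurable_funM => //; exact: measurable_funB.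
Qed.

Lemma defect_ge0 M m z : 0 <= defect M m z.
Proof.
have K0 : 0 <= K z by exact: le_trans (km0 0 z) (kmK 0 z).
by rewrite addr_ge0// mulr_ge0// ?powR_ge0// subr_ge0.
Qed.

Variable v : T -> R.
Hypotheses (mv : measurable_fun setT v) (iv : intg (mu \x mu)%E (diff2 sub K v)).

Let k2 m := diff2 sub (fun z => K z - km m z) v.

Let k2_i m : intg (mu \x mu)%E (k2 m).
Proof.
apply: (intg_dom _ _ iv).
  by apply: (measurable_diff2 Tr) => //; exact: measurable_funB.
move=> z; rewrite /k2 /diff2 normrM normr_id ger0_norm ?subr_ge0//.
by rewrite ler_wpM2r// lerBlDr lerDl.
Qed.

Let k2_cvg : \int[(mu \x mu)%E]_z k2 m z @[m --> \oo] --> 0.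
Proof.
pose g z := (diff2 sub K v z)%:E.
have D0 z : 0 <= diff2 sub K v z.
  by rewrite mulr_ge0//; exact: le_trans (km0 0 _) (kmK 0 _).
have mD : measurable_fun setT (diff2 sub K v) by exact: (measurable_diff2 Tr).
have := @dominated_real _ _ _ (mu \x mu)%E k2 (cst 0) g.
case.
- by move=> m; exact: intg_measurable (k2_i m).
- exact: measurable_cst.
- exact/measurable_EFinP.
- by move=> z; rewrite lee_fin.
- by have /intg_ge0P := iv; apply.
- move=> m z; rewrite lee_fin /k2 /diff2 normrM normr_id ger0_norm ?subr_ge0//.
  by rewrite ler_wpM2r// lerBlDr lerDl.
- move=> z _; rewrite /k2 /diff2.
  rewrite (_ : (fun m => _) = fun m => (K (sub z.1 z.2) - km m (sub z.1 z.2)) * `|v z.1 - v z.2|)//.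
  rewrite (_ : cst 0 z = (K (sub z.1 z.2) - K (sub z.1 z.2)) * `|v z.1 - v z.2|); last by rewrite subrr mul0r.
  by apply: cvgM; [apply: cvgB => //; exact: cvg_cst|exact: cvg_cst].
move=> _; rewrite [X in _ --> X](_ : _ = 0)//.
by rewrite /Rintegral integral0.
Qed.

Let defectE M m z : diff2 sub (defect M m) v z = err m * diff2 sub K v z + M `^ q * k2 m z.
Proof. by rewrite /k2 /diff2 /defect mulrDl !mulrA. Qed.

Lemma defect_intg M m : intg (mu \x mu)%E (diff2 sub (defect M m) v).
Proof.
rewrite (_ : diff2 _ _ _ = fun z => err m * diff2 sub K v z + M `^ q * k2 m z).
  by apply: intgD; apply: intgZ.
by apply/funext => z; exact: defectE.
Qed.

Lemma defect_small M eps : 0 < eps -> exists m0, forall m, (m0 <= m)%N ->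
  \int[(mu \x mu)%E]_z diff2 sub (defect M m) v z <= eps.
Proof.
move=> e0; pose I := \int[(mu \x mu)%E]_z diff2 sub K v z.
have I0 : 0 <= I.
  by apply: Rint_ge0 => z; rewrite mulr_ge0//; exact: le_trans (km0 0 _) (kmK 0 _).
have e1 : 0 < eps / 2 / (I + 1) by rewrite divr_gt0 ?divr_gt0// ltr_wpDl.
have [m1 h1] := err_small e1.
pose B := M `^ q; have B0 : 0 <= B by exact: powR_ge0.
have e2 : 0 < eps / 2 / (B + 1) by rewrite divr_gt0 ?divr_gt0// ltr_wpDl.
have /cvgrPdist_le/(_ _ e2)[m2 _ h2] := k2_cvg.
exists (maxn m1 m2) => m; rewrite geq_max => /andP[mm1 mm2].
under eq_Rint do rewrite defectE.
rewrite RintD; [|exact: intgZ|exact: intgZ]; rewrite !RintZ//.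
rewrite (splitr eps) lerD//.
  apply: (@le_trans _ _ (eps / 2 / (I + 1) * (I + 1))).
    by apply: ler_pM => //; [exact: h1|rewrite lerDl].
  by rewrite divfK// gt_eqF// ltr_wpDl.
have /= := h2 m mm2; rewrite sub0r normrN => /(le_trans (ler_norm _)) hh.
apply: (@le_trans _ _ ((B + 1) * (eps / 2 / (B + 1)))).
  apply: ler_pM => //; last by rewrite lerDl.
  by apply: Rint_ge0 => z; rewrite /k2 /diff2 mulr_ge0// subr_ge0.
by rewrite mulrC divfK// gt_eqF// ltr_wpDl.
Qed.

End KernelDefect.

Section Concrete.
Context (R : realType) (N : nat).
Variables (alpha p : R).
Hypotheses (N1 : (1 <= N)%N) (a1 : N%:R < alpha) (a2 : alpha < N%:R + 1)
  (p1 : 1 < p) (p2 : p < 2).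
Local Notation lam := (@lebesgueN R N).
Local Notation K := (@frac_kernel R N alpha).
Local Notation trunc_kernel := (@trunc_kernel R N alpha).
Notation addN := (fun x y : 'rV[R]_N => x + y).
Notation subN := (fun x y : 'rV[R]_N => x - y).

Lemma measurable_addXX : measurable_fun setT (fun u : 'rV[R]_N * 'rV[R]_N => u.1 + u.2).
Proof.
apply: measurable_fun_rV => i.
rewrite (_ : _ \o _ = fun u => rV_coord i u.1 + rV_coord i u.2); last first.
  by apply/funext => u; rewrite /rV_coord /= !mxE.
apply: measurable_funD; apply: measurableT_comp => //; exact: measurable_rV_coord.
Qed.

Lemma translation_rV : is_translation lam addN subN.
Proof.
apply: IsTranslation.
- exact: measurable_addXX.
- exact: measurable_subXX.
- by move=> x y; rewrite addrC.
- by move=> x y; rewrite addrK.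
- by move=> x y h; rewrite opprD addrACA subrr addr0.
- by move=> h f mf f0; exact: (integral_translate h mf f0).
Qed.

Definition trunc_mass (m : nat) : R := \int[lam]_z trunc_kernel m z.

Lemma trunc_kernel_sec m x : intg lam (fun y => trunc_kernel m (x - y)).
Proof.
have -> : (fun y => trunc_kernel m (x - y)) = fun y => trunc_kernel m (y + - x).
  by apply/funext => y; rewrite -trunc_kernelN opprB.
exact: (intg_translate (- x) (intg_trunc_kernel N1 a1 a2 m)).
Qed.

Lemma trunc_kernel_sec_int m x : \int[lam]_y trunc_kernel m (x - y) = trunc_mass m.
Proof.
rewrite /trunc_mass -(Rint_translate (- x) (intg_trunc_kernel N1 a1 a2 m)).
by apply: eq_Rint => y; rewrite -trunc_kernelN opprB.
Qed.

Lemma trunc_scheme m :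
  is_scheme lam (@trunc_Phi R p m) m%:R (fun z : 'rV[R]_N * 'rV[R]_N => trunc_kernel m (subN z.1 z.2)) (trunc_mass m).
Proof.
apply: IsScheme.
- exact: ler0n.
- by apply: Rint_ge0 => z; exact: trunc_kernel_ge0.
- by move=> a; exact: trunc_Phi_odd.
- by move=> a b; exact: trunc_Phi_nd.
- by move=> a b; exact: trunc_Phi_lip.
- have h := measurableT_comp (@measurable_trunc_kernel R N alpha m) (@measurable_subXX R N).
  exact: h.
- by move=> z; exact: trunc_kernel_ge0.
- by move=> x y; rewrite /= -trunc_kernelN opprB.
- by move=> x; exact: (trunc_kernel_sec m x).
- by move=> x; rewrite (trunc_kernel_sec_int m x).
Qed.

Lemma trunc_mass_nd m n : (m <= n)%N -> trunc_mass m <= trunc_mass n.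
Proof.
move=> mn; apply: le_Rint; [exact: intg_trunc_kernel|exact: intg_trunc_kernel|].
by move=> z; rewrite /trunc_kernel le_min !ge_min lexx/= orbC ler_nat mn.
Qed.

Lemma trunc_kernel_le m z : trunc_kernel m z <= K z. Proof. by rewrite ge_min lexx. Qed.

Lemma trunc_kernel_cvg z : trunc_kernel m z @[m --> \oo] --> K z.
Proof.
apply/cvgrPdist_le => e e0; near=> m.
rewrite /trunc_kernel min_l ?subrr ?normr0 ?(ltW e0)//.
apply: (le_trans (ltW (truncnS_gt _))); rewrite ler_nat.
by near: m; exact: nbhs_infty_ge.
Unshelve. all: by end_near. Qed.

Lemma Ksym x y : K (subN x y) = K (subN y x).
Proof. by rewrite -frac_kernelN opprB. Qed.

Lemma trunc_Phi_pair m n a : (m <= n)%N ->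
  `|trunc_Phi p m a - trunc_Phi p n a| <= `|Phi p a| - `|trunc_Phi p m a|.
Proof.
move=> mn.
pose c (k : nat) : R := Num.min (`|a| `^ (p - 2)) k%:R.
have c0 k : 0 <= c k by rewrite le_min powR_ge0 ler0n.
have cmn : c m <= c n by rewrite /c le_min !ge_min lexx/= orbC ler_nat mn.
have cnP : c n <= `|a| `^ (p - 2) by rewrite ge_min lexx.
rewrite /trunc_Phi /Phi -/(c m) -/(c n) -mulrBl !normrM (ger0_norm (powR_ge0 _ _)).
rewrite (ger0_norm (c0 m)) (distrC (c m)) (ger0_norm (x := c n - c m)) ?subr_ge0// -mulrBl.
by rewrite ler_wpM2r// lerD2r.
Qed.

Lemma defect_bound M m n a z : (m <= n)%N -> `|a| <= M ->
  `|trunc_Phi p m a * trunc_kernel m z - trunc_Phi p n a * trunc_kernel n z| <=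
    defect K trunc_kernel (@Phi_err R p) (p - 1) M m z.
Proof.
move=> mn aM; have pm : 0 <= p - 1 by rewrite subr_ge0 ltW.
have K0 := frac_kernel_ge0 alpha z.
have Kmn : trunc_kernel m z <= trunc_kernel n z by rewrite /trunc_kernel le_min !ge_min lexx/= orbC ler_nat mn.
have Pn : `|trunc_Phi p n a| <= M `^ (p - 1).
  by apply: (le_trans (le_trunc_Phi _ _ _)) => //; exact: powR_nd.
have [m0|m0] := posnP m.
  have Km0 : trunc_kernel 0 z = 0 by rewrite /trunc_kernel min_r// frac_kernel_ge0.
  rewrite m0 /defect Km0 subr0.
  have -> : trunc_Phi p 0 a = 0 by rewrite /trunc_Phi min_r ?mul0r// powR_ge0.
  rewrite mulr0 sub0r normrN normrM (ger0_norm (trunc_kernel_ge0 _ _ _)).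
  by apply: ler_wpDl; [rewrite mulr_ge0// Phi_err_ge0|apply: ler_pM => //; [exact: trunc_kernel_ge0|exact: trunc_kernel_le]].
rewrite (_ : _ - _ = (trunc_Phi p m a - trunc_Phi p n a) * trunc_kernel m z + trunc_Phi p n a * (trunc_kernel m z - trunc_kernel n z)); last by ring.
apply: (le_trans (ler_normD _ _)); rewrite /defect !normrM (ger0_norm (trunc_kernel_ge0 _ _ _)).
rewrite (distrC (trunc_kernel m z)) (ger0_norm (x := trunc_kernel n z - _)) ?subr_ge0//.
apply: lerD; apply: ler_pM => //.
- exact: trunc_kernel_ge0.
- by apply: (le_trans (trunc_Phi_pair a mn)); exact: trunc_Phi_approx.
- exact: trunc_kernel_le.
- by rewrite subr_ge0.
- by rewrite -normrM; exact: Pn.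
- by rewrite lerD2r trunc_kernel_le.
Qed.

Lemma Phi_err_eventually eps : 0 < eps -> exists m0, forall m, (m0 <= m)%N -> Phi_err p m <= eps.
Proof. by move=> /(Phi_err_small p1 p2)[m0 [_ h]]; exists m0. Qed.

End Concrete.

(** * Density of Lipschitz functions in L1 *)

Section Approximation.
Import HBSimple.
Context d (T : measurableType d) (R : realType) (mu : {measure set T -> \bar R}).
Variable P : (T -> R) -> Prop.
Hypotheses (P_intg : forall v, P v -> intg mu v)
  (PD : forall v w, P v -> P w -> P (fun x => v x + w x))
  (PZ : forall c v, P v -> P (fun x => c * v x))
  (Pmax : forall v w, P v -> P w -> P (fun x => Num.max (v x) (w x))).

(** Approximation in L1 by elements of a function lattice [P]. *)
Definition approximable (g : T -> R) := intg mu g /\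
  forall eps, 0 < eps -> exists v, P v /\ \int[mu]_x `|v x - g x| <= eps.

Let dist_i f g : intg mu f -> intg mu g -> intg mu (fun x => `|f x - g x|).
Proof. by move=> fi gi; apply: intg_norm; exact: intgB. Qed.

Lemma apx_self v : P v -> approximable v.
Proof.
move=> Pv; split; first exact: P_intg.
move=> e e0; exists v; split => //; rewrite (@eq_Rint _ _ _ _ _ (fun=> 0)).
  by rewrite /Rintegral integral0 ltW.
by move=> x; rewrite subrr normr0.
Qed.

Lemma apx_closed g : intg mu g ->
  (forall eps, 0 < eps -> exists g', approximable g' /\ \int[mu]_x `|g' x - g x| <= eps) -> approximable g.
Proof.
move=> ig h; split => // e e0.
have e2 : 0 < e / 2 by rewrite divr_gt0.
have [g' [[ig' h'] gg']] := h _ e2; have [v [Pv vg]] := h' _ e2.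
exists v; split => //; have iv := P_intg Pv.
apply: (@le_trans _ _ (\int[mu]_x (`|v x - g' x| + `|g' x - g x|))).
  apply: le_Rint; [exact: dist_i|by apply: intgD; exact: dist_i|].
  move=> x; rewrite (_ : v x - g x = (v x - g' x) + (g' x - g x)); last by ring.
  exact: ler_normD.
rewrite RintD; [|exact: dist_i|exact: dist_i].
by rewrite (splitr e) lerD.
Qed.

Lemma apx_dct (gk : nat -> T -> R) (g h : T -> R) : (forall k, approximable (gk k)) ->
  measurable_fun setT g -> intg mu h -> (forall k x, `|gk k x - g x| <= h x) ->
  (forall x, gk k x @[k --> \oo] --> g x) -> approximable g.
Proof.
move=> ak mg ih gh cg.
have igk k := (ak k).1.
have ig : intg mu g.
  have := intgB (igk 0%N) (@intg_dom _ _ _ mu (fun x => gk 0%N x - g x) h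
     (measurable_funB (intg_measurable (igk 0%N)) mg) (gh 0%N) ih).
  by under eq_fun do rewrite subKr.
apply: apx_closed => // e e0.
have [] := @dominated_real _ _ _ mu (fun k x => `|gk k x - g x|) (cst 0) (EFin \o h).
- by move=> k; exact: intg_measurable (dist_i (igk k) ig).
- exact: measurable_cst.
- by apply/measurable_EFinP; exact: intg_measurable ih.
- by move=> x; rewrite lee_fin; apply: le_trans (gh 0%N x).
- have h0 x : 0 <= h x by apply: le_trans (gh 0%N x).
  by have /intg_ge0P := ih; apply => //; exact: intg_measurable ih.
- by move=> k x; rewrite lee_fin normr_id.
- move=> x _; rewrite -(normr0 R) -(subrr (g x)); apply: cvg_norm; apply: cvgB => //.
  exact: cvg_cst.
move=> _; rewrite [X in _ --> X](_ : _ = 0); last by rewrite /Rintegral integral0.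
move=> /cvgrPdist_le/(_ _ e0)[k0 _ /(_ k0 (leqnn k0))] /=.
rewrite sub0r normrN => /(le_trans (ler_norm _)) hk.
by exists (gk k0).
Qed.

Lemma apxD g h : approximable g -> approximable h -> approximable (fun x => g x + h x).
Proof.
move=> [ig hg] [ih hh]; split; first exact: intgD.
move=> e e0; have e2 : 0 < e / 2 by rewrite divr_gt0.
have [v [Pv vg]] := hg _ e2; have [w [Pw wh]] := hh _ e2.
exists (fun x => v x + w x); split; first exact: PD.
have iv := P_intg Pv; have iw := P_intg Pw.
apply: (@le_trans _ _ (\int[mu]_x (`|v x - g x| + `|w x - h x|))).
  apply: le_Rint; [by apply: dist_i; exact: intgD|by apply: intgD; exact: dist_i|].
  by move=> x; rewrite opprD addrACA; exact: ler_normD.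
rewrite RintD; [|exact: dist_i|exact: dist_i].
by rewrite (splitr e) lerD.
Qed.

Lemma apxZ c g : approximable g -> approximable (fun x => c * g x).
Proof.
move=> [ig hg]; split; first exact: intgZ.
move=> e e0; have c0 : 0 < `|c| + 1 by rewrite ltr_wpDl.
have [v [Pv vg]] := hg _ (divr_gt0 e0 c0).
exists (fun x => c * v x); split; first exact: PZ.
have iv := P_intg Pv; have id := dist_i iv ig.
rewrite (@eq_Rint _ _ _ _ _ (fun x => `|c| * `|v x - g x|)); last first.
  by move=> x; rewrite -mulrBr normrM.
rewrite RintZ//; apply: (@le_trans _ _ ((`|c| + 1) * (e / (`|c| + 1)))); last first.
  by rewrite mulrC divfK// gt_eqF.
by apply: ler_pM => //; [exact: Rint_ge0|rewrite lerDl].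
Qed.

Lemma dist_max (a b c e : R) : `|Num.max a b - Num.max c e| <= `|a - c| + `|b - e|.
Proof.
have H (a1 b1 c1 e1 : R) : Num.max a1 b1 - Num.max c1 e1 <= `|a1 - c1| + `|b1 - e1|.
  rewrite lerBlDr ge_max; apply/andP; split.
    rewrite -lerBlDl; apply: (@le_trans _ _ c1); last by rewrite le_max lexx.
    by rewrite opprD addrA lerBlDr ler_wpDr// lerBlDl -lerBlDr ler_norm.
  rewrite -lerBlDl; apply: (@le_trans _ _ e1); last by rewrite le_max lexx orbT.
  by rewrite opprD addrCA addrC lerBlDr ler_wpDr// lerBlDl -lerBlDr ler_norm.
rewrite ler_norml H andbT lerNl opprB (distrC a) (distrC b); exact: H.
Qed.

Lemma apx_max g h : approximable g -> approximable h -> approximable (fun x => Num.max (g x) (h x)).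
Proof.
move=> [ig hg] [ih hh].
have imax (f1 f2 : T -> R) : intg mu f1 -> intg mu f2 -> intg mu (fun x => Num.max (f1 x) (f2 x)).
  move=> i1 i2; apply: (intg_dom _ _ (intgD (intg_norm i1) (intg_norm i2))).
    exact: (measurable_maxr (intg_measurable i1) (intg_measurable i2)).
  move=> x; have [_|_] := leP (f1 x) (f2 x); first by rewrite lerDr.
  by rewrite lerDl.
split; first exact: imax.
move=> e e0; have e2 : 0 < e / 2 by rewrite divr_gt0.
have [v [Pv vg]] := hg _ e2; have [w [Pw wh]] := hh _ e2.
exists (fun x => Num.max (v x) (w x)); split; first exact: Pmax.
have iv := P_intg Pv; have iw := P_intg Pw.
apply: (@le_trans _ _ (\int[mu]_x (`|v x - g x| + `|w x - h x|))).
  apply: le_Rint; [by apply: dist_i; exact: imax|by apply: intgD; exact: dist_i|].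
  by move=> x; exact: dist_max.
rewrite RintD; [|exact: dist_i|exact: dist_i].
by rewrite (splitr e) lerD.
Qed.

Variable B : set T.
Hypotheses (mB : measurable B) (apxB : approximable (\1_B)).

(** Intersecting with [B] allows sets [A] of infinite measure. *)
Definition approximable_set (A : set T) := measurable A /\ approximable (\1_(A `&` B)).

(** Finite unions are obtained with maxima, complements by difference, and countable
    unions by dominated convergence. *)
Lemma apx_set_sigma : sigma_algebra setT approximable_set.
Proof.
have iB := apxB.1.
have set0A : approximable_set set0.
  split => //; rewrite set0I indic0.
  have := apxZ 0 apxB; rewrite (_ : (fun x => 0 * \1_B x) = cst 0)//.
  by apply/funext => x; rewrite mul0r.
have setUA A A' : approximable_set A -> approximable_set A' -> approximable_set (A `|` A').
  move=> [mA aA] [mA' aA']; split; first exact: measurableU.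
  have := apx_max aA aA'; congr approximable; apply/funext => x.
  rewrite !indicE setIUl in_setU.
  have E (b c : bool) : Num.max b%:R c%:R = (b || c)%:R :> R.
    by case: b; case: c => /=; rewrite ?maxxx//; [apply: max_l|apply: max_r]; exact: ler01.
  exact: E.
split => //.
  move=> A [mA aA]; split; first exact: measurableD.
  have := apxD apxB (apxZ (-1) aA); congr approximable; apply/funext => x.
  rewrite setTD !indicE !in_setI in_setC.
  by case: (x \in A); case: (x \in B) => /=; rewrite ?mulN1r ?subrr// ?mulr0 ?addr0// oppr0 ?addr0.
move=> F hF.
have mF k : measurable (F k) by case: (hF k).
have mUF : measurable (\bigcup_k F k) by exact: bigcupT_measurable.
split => //.
pose U k := \big[setU/set0]_(i < k) F i.
have hU k : approximable_set (U k).
  rewrite /U; elim: k => [|k ih]; first by rewrite big_ord0.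
  by rewrite big_ord_recr/=; exact: setUA.
apply: (apx_dct (gk := fun k => \1_(U k `&` B)) (h := \1_B)) => //.
- by move=> k; case: (hU k).
- by apply: measurable_indic; exact: measurableI.
- move=> k x; rewrite !indicE !in_setI; case: (x \in B); rewrite ?andbF ?andbT ?subrr ?normr0//.
  have [UF|UF] := boolP (x \in U k); last first.
    by rewrite sub0r normrN; case: (x \in _); rewrite ?normr1 ?normr0.
  rewrite [X in _ - X](_ : _ = 1) ?subrr ?normr0//.
  rewrite mem_set//; move: UF => /set_mem; rewrite /U -bigcup_mkord => -[i /= _ Fi].
  by exists i.
move=> x; have [[i _ Fi]|nF] := pselect ((\bigcup_k F k) x); last first.
  rewrite (_ : (fun k => _) = fun=> \1_((\bigcup_k F k) `&` B) x); first exact: cvg_cst.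
  apply/funext => k; rewrite !indicE !in_setI (memNset nF) memNset//.
  by rewrite /U -bigcup_mkord => -[j _ Fj]; apply: nF; exists j.
apply: cvg_near_cst; near=> k.
have x1 : x \in U k.
  apply: mem_set; rewrite /U -bigcup_mkord; exists i => //=.
  by near: k; exact: nbhs_infty_gt.
have x2 : x \in \bigcup_k F k by apply: mem_set; exists i.
by rewrite !indicE !in_setI x1 x2.
Unshelve. all: by end_near. Qed.

Hypothesis apx_all : forall A, measurable A -> approximable_set A.

Lemma apx_supported g : intg mu g -> (forall x, ~ B x -> g x = 0) -> approximable g.
Proof.
move=> ig g0; apply: apx_closed => // e e0.
have [s [si _ sc]] := approximation_sfun_integrable measurableT ig.
have [k hk] : exists k, (\int[mu]_z `|(g z)%:E - (s k z)%:E| <= e%:E)%E.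
  have /fine_cvgP[_ /cvgrPdist_le/(_ _ e0)[k _ h]] := sc.
  exists k; have /= := h k (leqnn k); rewrite sub0r normrN => /(le_trans (ler_norm _)).
  rewrite -lee_fin fineK// ge0_fin_numE ?integral_ge0//.
  have := intg_norm (intgB ig (si k)) => /integrable_lty; apply => //.
exists (fun x => s k x * \1_B x); split.
  have -> : (fun x => s k x * \1_B x) =
      fun x => \sum_(y <- finmap.enum_fset (fset_set (range (s k)))) y * \1_(s k @^-1` [set y] `&` B) x.
    apply/funext => x; rewrite {1}(fimfunE (s k) x) fsbig_finite//= mulr_suml.
    apply: eq_bigr => y _; rewrite -mulrA; congr (_ * _).
    by rewrite !indicE in_setI; case: (x \in _); case: (x \in B); rewrite ?mulr1 ?mulr0.
  elim: (finmap.enum_fset _) => [|y ys ih].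
    under eq_fun do rewrite big_nil.
    have := apxZ 0 apxB; congr approximable; apply/funext => x; exact: mul0r.
  under eq_fun do rewrite big_cons.
  apply: apxD => //; apply: apxZ; apply: (apx_all _).2.
  exact: measurable_sfunP.
have iB := apxB.1.
have isB : intg mu (fun x => s k x * \1_B x).
  apply: (intg_mulb (B := 1)) => //.
  by move=> x; rewrite indicE; case: (x \in B); rewrite ?normr1 ?normr0.
have id := intg_norm (intgB ig (si k)).
rewrite -lee_fin; apply: le_trans hk; rewrite -(Rint_fine id) lee_fin.
apply: le_Rint => //; first exact: dist_i.
move=> x; have [xB|xB] := pselect (B x).
  by rewrite indicE mem_set// mulr1 distrC.
by rewrite indicE memNset// mulr0 g0// subrr normr0.
Qed.

End Approximation.

Section LipschitzApproximation.
Context (R : realType) (N : nat).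
Local Notation lam := (@lebesgueN R N).
Implicit Types (x y : 'rV[R]_N) (v w l : 'rV[R]_N -> R).

Definition lip_compact v := exists C r : R, [/\ 0 <= C, 0 <= r,
  forall x y, `|v x - v y| <= C * `|x - y|, forall x, `|v x| <= C
  & forall x, r < `|x| -> v x = 0].

Lemma box_norm (r : R) x : 0 <= r -> box r x <-> `|x| <= r.
Proof.
move=> r0; have -> : `|x| = mx_norm x by [].
rewrite /box /= mx_normrE; split=> [h|/bigmax_leP[_ h] i].
  by apply/bigmax_leP; split => // -[i j] _ /=; rewrite (ord1 i).
by have /= := h (ord0, i) isT.
Qed.

Lemma norm_le_eucl x : `|x| <= eucl_norm x.
Proof.
by apply/box_norm; [exact: eucl_norm_ge0|move=> i; exact: coord_le_eucl].
Qed.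

Lemma intg_box (r : R) : 0 <= r -> intg lam (\1_(@box R N r) : _ -> R).
Proof.
move=> r0; have meas_bd := @measurable_box R N r; apply/intg_ge0P => //.
rewrite integral_indic// setIT.
by have := ltry ((2 * r) ^+ N); rewrite -lebesgueN_cube.
Qed.

Lemma lip_continuous v (C : R) : 0 <= C -> (forall x y, `|v x - v y| <= C * `|x - y|) ->
  continuous v.
Proof.
move=> C0 vl x; apply/(@cvgrPdist_le _ _ _ (nbhs x) (nbhs_filter x)) => e e0.
have e1 : 0 < e / (C + 1) by rewrite divr_gt0// ltr_wpDl.
apply: (@filterS _ (nbhs x) (nbhs_filter x) (ball x (e / (C + 1)))); last first.
  exact: nbhsx_ballx.
move=> y; rewrite -ball_normE /ball_/= => xy.
apply: (le_trans (vl x y)).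
apply: (@le_trans _ _ ((C + 1) * (e / (C + 1)))); last first.
  by rewrite mulrC divfK// gt_eqF// ltr_wpDl.
by apply: ler_pM => //; [rewrite lerDl|exact: ltW].
Qed.

Lemma lipc_measurable v : lip_compact v -> measurable_fun setT v.
Proof.
move=> [C [r [C0 r0 vl vC vr]]]; apply: continuous_measurable_rV.
exact: lip_continuous C0 vl.
Qed.

Lemma lipc_intg v : lip_compact v -> intg lam v.
Proof.
move=> lv; have mv := lipc_measurable lv; have [C [r [C0 r0 vl vC vr]]] := lv.
apply: (intg_dom mv _ (intgZ C (intg_box r0))) => x.
have [xr|xr] := leP `|x| r.
  by rewrite indicE mem_set ?mulr1//; apply/box_norm.
by rewrite vr// normr0 mulr_ge0.
Qed.

Lemma lipcD v w : lip_compact v -> lip_compact w -> lip_compact (fun x => v x + w x).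
Proof.
move=> [C [r [C0 r0 vl vC vr]]] [D [s [D0 s0 wl wD ws]]].
exists (C + D), (Num.max r s); split; rewrite ?addr_ge0// ?le_max ?r0//.
- by move=> x y; rewrite opprD addrACA mulrDl (le_trans (ler_normD _ _))// lerD.
- by move=> x; rewrite (le_trans (ler_normD _ _))// lerD.
- by move=> x; rewrite gt_max => /andP[h1 h2]; rewrite vr// ws// addr0.
Qed.

Lemma lipcZ (c : R) v : lip_compact v -> lip_compact (fun x => c * v x).
Proof.
move=> [C [r [C0 r0 vl vC vr]]]; exists (`|c| * C), r; split => //.
- by rewrite mulr_ge0.
- by move=> x y; rewrite -mulrBr normrM -mulrA ler_wpM2l.
- by move=> x; rewrite normrM ler_wpM2l.
- by move=> x h; rewrite vr// mulr0.
Qed.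

Lemma lipc_max v w : lip_compact v -> lip_compact w -> lip_compact (fun x => Num.max (v x) (w x)).
Proof.
move=> [C [r [C0 r0 vl vC vr]]] [D [s [D0 s0 wl wD ws]]].
exists (C + D), (Num.max r s); split; rewrite ?addr_ge0// ?le_max ?r0//.
- by move=> x y; rewrite mulrDl (le_trans (dist_max _ _ _ _))// lerD.
- move=> x; have [_|_] := leP (v x) (w x).
    by rewrite (le_trans (wD x))// lerDr.
  by rewrite (le_trans (vC x))// lerDl.
- by move=> x; rewrite gt_max => /andP[h1 h2]; rewrite vr// ws// maxxx.
Qed.

(** Continuous, with slope [k.+1], decreasing to the indicator of [t <= 0]. *)
Definition ramp (k : nat) (t : R) : R := Num.max 0 (1 - k.+1%:R * Num.max 0 t).

Lemma ramp_lip k (a b : R) : `|ramp k a - ramp k b| <= k.+1%:R * `|a - b|.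
Proof.
rewrite /ramp (le_trans (dist_max _ _ _ _))// subrr normr0 add0r.
rewrite opprB addrC addrA addrNK -mulrBr normrM ger0_norm// ler_wpM2l//.
by rewrite distrC (le_trans (dist_max _ _ _ _))// subrr normr0 add0r.
Qed.

Lemma ramp_itv k (t : R) : 0 <= ramp k t <= 1.
Proof.
rewrite /ramp le_max lexx/= ge_max ler01 /= lerBlDr lerDl mulr_ge0//.
by rewrite le_max lexx.
Qed.

Lemma ramp1 k (t : R) : t <= 0 -> ramp k t = 1.
Proof. by move=> t0; rewrite /ramp (max_l t0) mulr0 subr0 max_r// ler01. Qed.

Lemma ramp0 k (t : R) : 1 <= k.+1%:R * t -> ramp k t = 0.
Proof.
move=> t1; rewrite /ramp max_l// subr_le0 (le_trans t1)// ler_wpM2l//.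
by rewrite le_max lexx orbT.
Qed.

Lemma apx_sublevel l (n : R) : 0 <= n -> (forall x y, `|l x - l y| <= `|x - y|) ->
  (forall x, `|x| - n <= l x) -> approximable lam lip_compact (\1_[set x | l x <= 0]).
Proof.
move=> n0 ll ln.
have ml : measurable_fun setT l.
  apply: continuous_measurable_rV; apply: (@lip_continuous _ 1) => // x y.
  by rewrite mul1r.
have mS : measurable [set x | l x <= 0].
  rewrite (_ : [set x | _] = setT `&` l @^-1` `]-oo, 0]%classic); first exact: ml.
  by rewrite setTI; apply/seteqP; split => x /=; rewrite in_itv.
have n1 : 0 <= n + 1 by rewrite addr_ge0.
have far k x : n + 1 < `|x| -> ramp k (l x) = 0.
  move=> h; have l1 : 1 <= l x by apply: le_trans (ln x); rewrite lerBrDl ltW.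
  by rewrite ramp0// -[leLHS]mul1r ler_pM// ler1n.
apply: (apx_dct lipc_intg (gk := fun k x => ramp k (l x)) (h := \1_(@box R N (n + 1)))).
- move=> k; apply: (apx_self lipc_intg); exists k.+1%:R, (n + 1); split => //.
  + by move=> x y; apply: (le_trans (ramp_lip _ _ _)); rewrite ler_wpM2l.
  + move=> x; have /andP[h1 h2] := ramp_itv k (l x).
    by rewrite ger0_norm// (le_trans h2)// ler1n.
  + by move=> x; exact: far.
- exact: measurable_indic.
- exact: intg_box.
- move=> k x; have [h|h] := leP `|x| (n + 1).
    rewrite [leRHS](_ : _ = 1); last by rewrite indicE mem_set//; exact/box_norm.
    have /andP[h1 h2] := ramp_itv k (l x).
    by rewrite indicE ler_norml; case: (_ \in _) => /=; lra.
  rewrite far// sub0r normrN indicE memNset ?normr0//= => l0.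
  have := le_trans (ln x) l0; rewrite subr_le0 => /(lt_le_trans h).
  by rewrite ltNge lerDl ler01.
move=> x; have [lx|lx] := leP (l x) 0.
  rewrite (_ : (fun k => _) = fun=> \1_[set x | l x <= 0] x); first exact: cvg_cst.
  by apply/funext => k; rewrite ramp1// indicE mem_set.
rewrite indicE memNset//=; last by apply/negP; rewrite -ltNge.
apply: cvg_near_cst; near=> k; apply: ramp0.
rewrite -ler_pdivrMr// mul1r (le_trans (ltW (truncnS_gt _)))// ler_nat ltnS.
by near: k; exact: nbhs_infty_ge.
Unshelve. all: by end_near. Qed.

Lemma apx_box (n : R) : 0 <= n -> approximable lam lip_compact (\1_(@box R N n)).
Proof.
move=> n0; rewrite (_ : box n = [set x | `|x| - n <= 0]).
  by apply: (apx_sublevel n0) => // x y; rewrite opprD addrACA subrr addr0 ler_dist_dist.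
by apply/seteqP; split => x /=; rewrite subr_le0 => /(box_norm _ n0).
Qed.

Lemma coord_le_norm x i : `|x ord0 i| <= `|x|.
Proof. exact: (box_norm x (normr_ge0 x)).2 (lexx _) i. Qed.

(** Half spaces generate the sigma-algebra; cut by a box, they are sublevel sets of
    the 1-Lipschitz function [max (a - x_i) (|x| - n)]. *)
Lemma apx_half (n a : R) i : 0 <= n ->
  approximable_set lam lip_compact (@box R N n) [set x | a <= x ord0 i].
Proof.
move=> n0.
have mH : measurable [set x : 'rV[R]_N | a <= x ord0 i].
  rewrite (_ : [set x | _] = setT `&` rV_coord i @^-1` `[a, +oo[%classic).
    exact: measurable_rV_coord.
  by rewrite setTI; apply/seteqP; split => x /=; rewrite in_itv/= andbT.
split; first exact: mH.
rewrite (_ : _ `&` _ = [set x : 'rV[R]_N | Num.max (a - x ord0 i) (`|x| - n) <= 0]).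
  apply: (apx_sublevel n0) => [x y|x]; last by rewrite le_max lexx orbT.
  have H (x1 y1 : 'rV[R]_N) : Num.max (a - x1 ord0 i) (`|x1| - n) <=
      `|x1 - y1| + Num.max (a - y1 ord0 i) (`|y1| - n).
    rewrite ge_max; apply/andP; split.
      apply: (@le_trans _ _ (`|x1 - y1| + (a - y1 ord0 i))).
        have := coord_le_norm (x1 - y1) i; rewrite !mxE => h.
        by have := le_trans (ler_norm _) h; have := ler_norm (y1 ord0 i - x1 ord0 i);
          rewrite distrC => h2 _; lra.
      by rewrite lerD2l le_max lexx.
    apply: (@le_trans _ _ (`|x1 - y1| + (`|y1| - n))); last by rewrite lerD2l le_max lexx orbT.
    by rewrite addrA lerD2r -lerBlDr; apply: (le_trans (ler_norm _)); exact: ler_dist_dist.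
  rewrite ler_norml; apply/andP; split; last by rewrite lerBlDr; exact: H.
  by rewrite lerBrDr addrC lerBlDl distrC; have := H y x; rewrite addrC.
apply/seteqP; split => x /=.
  by move=> [h1 /(box_norm _ n0) h2]; rewrite ge_max !subr_le0 h1 h2.
by rewrite ge_max !subr_le0 => /andP[h1 h2]; split => //; exact/box_norm.
Qed.

Lemma apx_measurable (n : R) (A : set 'rV[R]_N) : 0 <= n -> measurable A ->
  approximable_set lam lip_compact (@box R N n) A.
Proof.
move=> n0 mA.
have sg := apx_set_sigma lipc_intg lipcD lipcZ lipc_max (@measurable_box R N n) (apx_box n0).
move: A mA; apply: smallest_sub => //.
move=> B; rewrite -bigcup_seq => -[i _ [Y mY <-]].
rewrite setTI.
have mY' : <<s @RGenCInfty.G R >> Y.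
  change ((@ocitv R).-sigma.-measurable Y) in mY.
  by rewrite RGenCInfty.measurableE in mY.
move: Y mY' {mY}; apply: smallest_sub; last first.
  move=> _ [a ->]; have := apx_half a i n0; congr approximable_set; apply/seteqP; split => x /=.
    by rewrite in_itv/= andbT.
  by rewrite in_itv/= andbT.
have [s0 sD sU] := sg; split.
- by rewrite preimage_set0.
- by move=> Y hY; have := sD _ hY; rewrite !setTD.
- by move=> F hF; rewrite preimage_bigcup; exact: sU.
Qed.

Lemma apx_box_supported (n : R) g : 0 <= n -> intg lam g ->
  (forall x, n < `|x| -> g x = 0) -> approximable lam lip_compact g.
Proof.
move=> n0 ig g0.
apply: (apx_supported lipc_intg lipcD lipcZ (@measurable_box R N n) (apx_box n0)) => //.
  by move=> A; exact: apx_measurable.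
by move=> x xn; apply: g0; rewrite ltNge; apply/negP => /(box_norm _ n0).
Qed.

End LipschitzApproximation.

(** * Approximation of the initial datum *)

Section Data.
Context d (T : measurableType d) (R : realType) (mu : {sigma_finite_measure set T -> \bar R}).
Variables (nice : R -> (T -> R) -> Prop) (B : nat -> set T) (phi u0 : T -> R) (B0 : R).
Hypotheses (mB : forall n, measurable (B n)) (iB : forall n, intg mu (\1_(B n) : T -> R))
  (B_nd : forall n x, B n x -> B n.+1 x) (B_all : forall x, exists n, B n x)
  (mphi : measurable_fun setT phi) (phi0 : forall x, 0 < phi x) (phiB : forall x, phi x <= B0)
  (mu0 : measurable_fun setT u0) (u00 : forall x, 0 <= u0 x)
  (iu0 : intg mu (fun x => u0 x * phi x))
  (nice_bd : forall M v, nice M v -> [/\ measurable_fun setT v, forall x, 0 <= v x <= M & intg mu v])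
  (dense : forall n (g : T -> R) (eps : R), measurable_fun setT g -> (forall x, 0 <= g x <= n%:R) ->
     (forall x, ~ B n x -> g x = 0) -> 0 < eps ->
     exists2 v, nice n%:R v & \int[mu]_x `|v x - g x| <= eps).

(** These truncations of [u0] increase, and [data n] is [2 ^- n] close to [cut n]. *)
Definition cut n x : R := Num.min (u0 x) n%:R * \1_(B n) x.

Let m1 n : measurable_fun setT (\1_(B n) : T -> R). Proof. exact: measurable_indic. Qed.

Let cut_itv n x : 0 <= cut n x <= n%:R.
Proof.
rewrite /cut indicE; have m0 : 0 <= Num.min (u0 x) n%:R by rewrite le_min u00/=.
case: (x \in B n); rewrite ?mulr1 ?mulr0 ?lexx ?ler0n ?m0//=.
by rewrite ge_min lexx orbT.
Qed.

Let mcut n : measurable_fun setT (cut n).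
Proof. by apply: measurable_funM => //; exact: (measurable_minr mu0 (measurable_cst _)). Qed.

Let icut n : intg mu (cut n).
Proof.
apply: (intg_dom (mcut n) _ (intgZ n%:R (iB n))) => x.
have /andP[c0 cn] := cut_itv n x; rewrite ger0_norm// indicE.
by case: (boolP (x \in B n)) => h; rewrite ?mulr1// mulr0 /cut indicE (negPf h) mulr0.
Qed.

Let cut_out n x : ~ B n x -> cut n x = 0.
Proof. by move=> h; rewrite /cut indicE memNset// mulr0. Qed.

Let cut_le n x : cut n x <= u0 x.
Proof.
rewrite /cut indicE; case: (x \in B n); rewrite ?mulr1 ?mulr0//.
by rewrite ge_min lexx.
Qed.

Let cut_nd n x : cut n x <= cut n.+1 x.
Proof.
have [xB|xB] := pselect (B n x); last first.
  by rewrite cut_out//; case/andP: (cut_itv n.+1 x).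
rewrite /cut !indicE !mem_set ?mulr1//; last exact: B_nd.
by rewrite le_min !ge_min lexx ler_nat leqnSn/= orbT.
Qed.

Let e2 n : 0 < (2 ^+ n)^-1 :> R. Proof. by rewrite invr_gt0 exprn_gt0. Qed.

Let data_ex n : exists v, nice n%:R v /\ \int[mu]_x `|v x - cut n x| <= (2 ^+ n)^-1.
Proof.
by have [v h1 h2] := dense (mcut n) (cut_itv n) (@cut_out n) (e2 n); exists v.
Qed.

Definition data n : T -> R := sval (cid (data_ex n)).

Lemma data_nice n : nice n%:R (data n).
Proof. by rewrite /data; case: cid => ? []. Qed.

Let data_cut n : \int[mu]_x `|data n x - cut n x| <= (2 ^+ n)^-1.
Proof. by rewrite /data; case: cid => ? []. Qed.

Let idata n : intg mu (data n). Proof. by have [_ _] := nice_bd (data_nice n). Qed.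

Let idc n : intg mu (fun x => `|data n x - cut n x|).
Proof. by apply: intg_norm; apply: intgB; [exact: idata|exact: icut]. Qed.

Lemma data_mono n : \int[mu]_x Num.max (data n x - data n.+1 x) 0 <= 2 * (2 ^+ n)^-1.
Proof.
apply: (@le_trans _ _ (\int[mu]_x (`|data n x - cut n x| + `|data n.+1 x - cut n.+1 x|))).
  apply: le_Rint; [exact: intg_posB|exact: intgD|].
  move=> x; rewrite ge_max addr_ge0// andbT.
  have h1 := ler_norm (data n x - cut n x).
  have h2 := ler_norm (cut n.+1 x - data n.+1 x); rewrite distrC in h2.
  have h3 := cut_nd n x.
  by move: h1 h2 h3; move: (`|_|) (`|_|) => a b; lra.
rewrite RintD// (_ : 2 * _ = (2 ^+ n)^-1 + (2 ^+ n)^-1); last by ring.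
apply: lerD; first exact: data_cut.
apply: (le_trans (data_cut _)); rewrite lef_pV2 ?posrE ?exprn_gt0//.
by rewrite ler_weXn2l// ler1n.
Qed.

Let B00 : 0 <= B0. Proof. exact: le_trans (ltW (phi0 point)) (phiB point). Qed.
Let phi_abs x : `|phi x| <= B0. Proof. by rewrite gtr0_norm. Qed.
Let intg_w (w : T -> R) : intg mu w -> intg mu (fun x => w x * phi x).
Proof. by move=> iw; exact: (intg_mulb mphi phi_abs iw). Qed.

Let data_cut_phi n : \int[mu]_x (`|data n x - cut n x| * phi x) <= B0 * (2 ^+ n)^-1.
Proof.
apply: (@le_trans _ _ (\int[mu]_x (B0 * `|data n x - cut n x|))).
  apply: le_Rint; [exact: intg_w|exact: intgZ|].
  by move=> x; rewrite mulrC ler_wpM2r.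
by rewrite RintZ// ler_wpM2l.
Qed.

Lemma data_X n : \int[mu]_x (data n x * phi x) <= \int[mu]_x (u0 x * phi x) + B0.
Proof.
have i1 := intg_w (idc n).
apply: (@le_trans _ _ (\int[mu]_x (u0 x * phi x + `|data n x - cut n x| * phi x))).
  apply: le_Rint; [exact: intg_w|exact: intgD|].
  move=> x; rewrite -mulrDl; apply: ler_wpM2r; first exact: (ltW (phi0 x)).
  rewrite -lerBlDl; apply: le_trans (ler_norm (data n x - cut n x)).
  by rewrite lerD2l lerN2.
rewrite RintD// lerD2l; apply: (le_trans (data_cut_phi n)).
by rewrite ler_piMr// inv2X_le1.
Qed.

Let cut_cvg : \int[mu]_x (`|cut n x - u0 x| * phi x) @[n --> \oo] --> 0.
Proof.
have ic n : intg mu (fun x => `|cut n x - u0 x| * phi x).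
  apply: (intg_dom _ _ iu0).
    apply: measurable_funM => //; apply: measurableT_comp => //; exact: measurable_funB.
  move=> x; rewrite normrM normr_id (gtr0_norm (phi0 x)).
  apply: ler_wpM2r; first exact: (ltW (phi0 x)).
  rewrite distrC ger0_norm ?subr_ge0// lerBlDr lerDl.
  by case/andP: (cut_itv n x).
have [] := @dominated_real _ _ _ mu (fun n x => `|cut n x - u0 x| * phi x) (cst 0)
   (fun x => (u0 x * phi x)%:E).
- by move=> n; exact: intg_measurable (ic n).
- exact: measurable_cst.
- by apply/measurable_EFinP; exact: measurable_funM.
- by move=> x; rewrite lee_fin mulr_ge0// ltW.
- have /intg_ge0P := iu0; apply; first exact: measurable_funM.
  by move=> x; rewrite mulr_ge0// ltW.
- move=> n x; rewrite lee_fin normrM normr_id (gtr0_norm (phi0 x)).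
  apply: ler_wpM2r; first exact: (ltW (phi0 x)).
  rewrite distrC ger0_norm ?subr_ge0// lerBlDr lerDl.
  by case/andP: (cut_itv n x).
- move=> x _; apply: cvg_near_cst; have [n0 xB] := B_all x.
  near=> n; have xn : B n x.
    have : (n0 <= n)%N by near: n; exact: nbhs_infty_ge.
    by move=> /subnKC <-; elim: (n - n0)%N => [|j ih]; rewrite ?addn0// addnS; exact: B_nd.
  rewrite /cut indicE mem_set// mulr1 min_l ?subrr ?normr0 ?mul0r//.
  apply: (le_trans (ltW (truncnS_gt _))); rewrite ler_nat.
  by near: n; exact: nbhs_infty_ge.
move=> _; rewrite [X in _ --> X](_ : _ = 0)//.
by rewrite /Rintegral integral0.
Unshelve. all: by end_near. Qed.

Lemma data_cvg : \int[mu]_x (`|data n x - u0 x| * phi x) @[n --> \oo] --> 0.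
Proof.
have ic n : intg mu (fun x => `|cut n x - u0 x| * phi x).
  have := intg_norm (intgB (intg_w (icut n)) iu0).
  by under eq_fun do rewrite -mulrBl normrM (gtr0_norm (phi0 _)).
have id n : intg mu (fun x => `|data n x - u0 x| * phi x).
  have := intg_norm (intgB (intg_w (idata n)) iu0).
  by under eq_fun do rewrite -mulrBl normrM (gtr0_norm (phi0 _)).
have c : B0 * (2 ^+ n)^-1 + \int[mu]_x (`|cut n x - u0 x| * phi x) @[n --> \oo] --> (0 + 0 : R).
  by apply: cvgD => //; exact: cvg_inv2X.
rewrite addr0 in c.
apply: (squeeze_cvgr _ (cvg_cst 0) c); near=> n; apply/andP; split.
  by apply: Rint_ge0 => x; rewrite mulr_ge0// ltW.
have i1 := intg_w (idc n).
apply: (@le_trans _ _ (\int[mu]_x (`|data n x - cut n x| * phi x + `|cut n x - u0 x| * phi x))).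
  apply: le_Rint => //; first exact: intgD.
  move=> x; rewrite -mulrDl; apply: ler_wpM2r; first exact: (ltW (phi0 x)).
  rewrite (_ : data n x - u0 x = (data n x - cut n x) + (cut n x - u0 x)); last by ring.
  exact: ler_normD.
by rewrite RintD// lerD2r; exact: data_cut_phi.
Unshelve. all: by end_near. Qed.

End Data.

Lemma clamp_dist (R : realType) (a b M : R) :
  `|Num.max 0 (Num.min a M) - Num.max 0 (Num.min b M)| <= `|a - b|.
Proof.
apply: (le_trans (dist_max _ _ _ _)); rewrite subrr normr0 add0r.
have H (c e : R) : Num.min c M - Num.min e M <= `|c - e|.
  have [eM|eM] := leP e M.
    rewrite lerBlDr; apply: (@le_trans _ _ c); first by rewrite ge_min lexx.
    by rewrite -lerBlDr ler_norm.
  by apply: (@le_trans _ _ 0); rewrite // subr_le0 ge_min lexx orbT.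
by rewrite ler_norml H andbT lerNl opprB distrC H.
Qed.

Section LipschitzNice.
Context (R : realType) (N : nat).
Variables (alpha p : R).
Hypotheses (N1 : (1 <= N)%N) (a1 : N%:R < alpha) (a2 : alpha < N%:R + 1).
Local Notation lam := (@lebesgueN R N).
Local Notation K := (@frac_kernel R N alpha).
Notation subN := (fun x y : 'rV[R]_N => x - y).

(** Integrable majorant of [K z * |v x - v y|], [z = x - y], for a bounded Lipschitz
    function [v]. *)
Definition kernel_mom (C : R) (z : 'rV[R]_N) : R := C * (Num.min (eucl_norm z) 1 * K z).

Lemma kernel_mom_ge0 C z : 0 <= C -> 0 <= kernel_mom C z.
Proof.
move=> C0; rewrite mulr_ge0// mulr_ge0 ?frac_kernel_ge0// le_min ler01 andbT.
exact: eucl_norm_ge0.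
Qed.

Lemma intg_kernel_mom C : intg lam (kernel_mom C).
Proof. exact: (intgZ C (kernel_moment N1 a1 a2)). Qed.

Lemma kernel_momN C z : kernel_mom C (- z) = kernel_mom C z.
Proof. by rewrite /kernel_mom eucl_normN frac_kernelN. Qed.

Lemma kernel_mom_sec C x : intg lam (fun y => kernel_mom C (x - y)).
Proof.
have -> : (fun y => kernel_mom C (x - y)) = fun y => kernel_mom C (y + - x).
  by apply/funext => y; rewrite -kernel_momN opprB.
exact: (intg_translate (- x) (intg_kernel_mom C)).
Qed.

Lemma kernel_mom_sec_int C x : \int[lam]_y kernel_mom C (x - y) = \int[lam]_y kernel_mom C y.
Proof.
rewrite -(Rint_translate (- x) (intg_kernel_mom C)).
by apply: eq_Rint => y; rewrite -kernel_momN opprB.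
Qed.

(** With a zero flux, the integrability lemmas of the scheme become available for this
    kernel. *)
Lemma kernel_mom_scheme C : 0 <= C ->
  is_scheme lam (fun=> 0) 0 (fun z : 'rV[R]_N * 'rV[R]_N => kernel_mom C (subN z.1 z.2))
    (\int[lam]_y kernel_mom C y).
Proof.
move=> C0; apply: IsScheme.
- exact: lexx.
- by apply: Rint_ge0 => z; exact: kernel_mom_ge0.
- by move=> a; rewrite oppr0.
- by move=> a b; rewrite lexx.
- by move=> a b; rewrite subrr mul0r lexx.
- have h := measurableT_comp (intg_measurable (intg_kernel_mom C)) (@measurable_subXX R N).
  exact: h.
- by move=> z; exact: kernel_mom_ge0.
- by move=> x y; rewrite /= -kernel_momN opprB.
- by move=> x; exact: (kernel_mom_sec C x).
- by move=> x; rewrite (kernel_mom_sec_int C x).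
Qed.

Lemma kernel_mom_bound (C : R) (a b : R) (z : 'rV[R]_N) : 0 <= C ->
  `|a - b| <= C * eucl_norm z -> `|a| <= C -> `|b| <= C ->
  K z * `|a - b| <= kernel_mom (2 * C) z.
Proof.
move=> C0 h1 h2 h3; rewrite /kernel_mom mulrA mulrC ler_wpM2r ?frac_kernel_ge0//.
have [_|_] := leP (eucl_norm z) 1.
  by apply: (le_trans h1); rewrite ler_wpM2r ?eucl_norm_ge0// mulr2n mulrDl mul1r lerDl.
by rewrite mulr1 mulr2n mulrDl mul1r (le_trans (ler_normB _ _))// lerD.
Qed.

Lemma lipc_diff2 (v : 'rV[R]_N -> R) : lip_compact v -> intg (lam \x lam)%E (diff2 subN K v).
Proof.
move=> lv; have [C [r [C0 r0 vl vC vr]]] := lv.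
have mv := lipc_measurable lv.
have C20 : 0 <= 2 * C by rewrite mulr_ge0.
have ib := intg_box N r0.
have i1 := intg_fst_k (kernel_mom_scheme C20) ib.
have i2 := intg_snd_k (kernel_mom_scheme C20) ib.
have mD : measurable_fun setT (diff2 subN K v).
  exact: (measurable_diff2 (translation_rV R N) (measurable_frac_kernel alpha) mv).
apply: (intg_dom mD _ (intgD i1 i2)) => -[x y].
rewrite /diff2 [(x, y).1]/= [(x, y).2]/= ger0_norm ?mulr_ge0 ?frac_kernel_ge0// -mulrDl.
have kb : K (x - y) * `|v x - v y| <= kernel_mom (2 * C) (x - y).
  apply: kernel_mom_bound => //; apply: (le_trans (vl x y)).
  by rewrite ler_wpM2l// norm_le_eucl.
have k0 := kernel_mom_ge0 (x - y) C20.
have [xr|xr] := leP `|x| r.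
  have -> : \1_(box r) x = 1 :> R by rewrite indicE mem_set//; exact/box_norm.
  by apply: (le_trans kb); rewrite ler_peMl// lerDl indicE.
have [yr|yr] := leP `|y| r.
  have -> : \1_(box r) y = 1 :> R by rewrite indicE mem_set//; exact/box_norm.
  by apply: (le_trans kb); rewrite ler_peMl// lerDr indicE.
by rewrite !vr// subrr normr0 mulr0 mulr_ge0// addr_ge0// indicE.
Qed.

Lemma lipc_clamp (M : R) (v : 'rV[R]_N -> R) : 0 <= M -> lip_compact v -> lip_compact (fun x => Num.max 0 (Num.min (v x) M)).
Proof.
move=> M0 [C [r [C0 r0 vl vC vr]]]; exists (C + M), r; split => //.
- by rewrite addr_ge0.
- move=> x y; apply: (le_trans (clamp_dist _ _ _)); apply: (le_trans (vl x y)).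
  by rewrite ler_wpM2r// lerDl.
- move=> x; rewrite ger0_norm; last by rewrite le_max lexx.
  by rewrite ge_max addr_ge0//= ge_min lerDr C0 orbT.
- by move=> x xr; rewrite vr// min_l// maxxx.
Qed.

Lemma dense_nice (n : nat) (g : 'rV[R]_N -> R) (eps : R) : measurable_fun setT g ->
  (forall x, 0 <= g x <= n%:R) -> (forall x, ~ box n%:R x -> g x = 0) -> 0 < eps ->
  exists2 v, nice lam subN K n%:R v & \int[lam]_x `|v x - g x| <= eps.
Proof.
move=> mg g0 gb e0.
have n0 : 0 <= n%:R :> R by [].
have ig : intg lam g.
  apply: (intg_dom mg _ (intgZ n%:R (intg_box N n0))) => x.
  have /andP[h1 h2] := g0 x; rewrite ger0_norm// indicE.
  case: (boolP (x \in _)) => h; rewrite ?mulr1// mulr0 gb// => h3.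
  by move: h; rewrite mem_set.
have [_ /(_ _ e0)[w [lw wg]]] : approximable lam (@lip_compact R N) g.
  apply: (apx_box_supported n0 ig) => x xn; apply: gb => /(box_norm _ n0).
  by rewrite leNgt xn.
have lv := lipc_clamp n0 lw.
exists (fun x => Num.max 0 (Num.min (w x) n%:R)).
  split; last exact: lipc_diff2.
  split; [exact: lipc_measurable|move=> x|exact: lipc_intg].
  by rewrite le_max lexx/= ge_max n0/= ge_min lexx orbT.
apply: le_trans wg; apply: le_Rint.
- by apply: intg_norm; apply: intgB => //; exact: lipc_intg.
- by apply: intg_norm; apply: intgB => //; exact: lipc_intg.
move=> x; have /andP[h1 h2] := g0 x.
by rewrite -{1}(max_r h1) -{1}(min_l h2) clamp_dist.
Qed.

End LipschitzNice.

(** * Weights of class C *)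

Lemma powR_geom_le (R : realType) (q a b : R) : 0 < q -> q < 1 -> 0 <= a -> 0 <= b ->
  a `^ q * b `^ (1 - q) <= a + b.
Proof.
move=> q0 q1 a0 b0; have q1' : 0 < 1 - q by rewrite subr_gt0.
have E c : 0 <= c -> c `^ q * c `^ (1 - q) = c.
  move=> c0; have [->|cn0] := eqVneq c 0; first by rewrite powR0 ?mul0r// gt_eqF.
  by rewrite -powRD; [rewrite addrC subrK powRr1|rewrite addrC subrK oner_eq0].
have [ab|/ltW ba] := leP a b.
  apply: (@le_trans _ _ b); last by rewrite lerDr.
  by rewrite -[leRHS](E b b0) ler_wpM2r ?powR_ge0// powR_nd// ltW.
apply: (@le_trans _ _ a); last by rewrite lerDl.
by rewrite -[leRHS](E a a0) ler_wpM2l ?powR_ge0// powR_nd// ltW.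
Qed.

(** The left-hand side is the product of the powers [q] and [1 - q] of the two terms on
    the right. *)
Lemma weight_young (R : realType) (q a f M : R) : 0 < q -> q < 1 -> 0 <= a -> 0 < f -> 0 <= M ->
  a `^ q * M <= a * f + M `^ (1 - q)^-1 * (f `^ (q / (1 - q)))^-1.
Proof.
move=> q0 q1 a0 f0 M0; have q1' : 0 < 1 - q by rewrite subr_gt0.
have w0 : 0 <= M `^ (1 - q)^-1 * (f `^ (q / (1 - q)))^-1.
  by rewrite mulr_ge0 ?invr_ge0 ?powR_ge0.
apply: le_trans (powR_geom_le q0 q1 (mulr_ge0 a0 (ltW f0)) w0).
rewrite le_eqVlt; apply/orP; left; apply/eqP.
have e1 : (a * f) `^ q = a `^ q * f `^ q by rewrite powRM// ltW.
have e2 : (M `^ (1 - q)^-1 * (f `^ (q / (1 - q)))^-1) `^ (1 - q) = M * (f `^ q)^-1.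
  rewrite powRM ?powR_ge0 ?invr_ge0 ?powR_ge0//; congr (_ * _).
    by rewrite -powRrM mulVf ?gt_eqF// powRr1.
  by rewrite -!powRN -powRrM mulNr divfK ?gt_eqF// powRN.
by rewrite e1 e2 mulrACA mulfV ?mulr1// gt_eqF// powR_gt0.
Qed.

Section CompactRV.
Context (R : realType) (N : nat).
Implicit Types (f : 'rV[R]_N -> R).

Lemma compact_box (r : R) : compact [set x : 'rV[R]_N | forall i, `[- r, r]%classic (x ord0 i)].
Proof.
by apply: (@rV_compact _ _ (fun=> `[- r, r]%classic)) => i; exact: segment_compact.
Qed.

Lemma box_itv (r : R) : [set x : 'rV[R]_N | forall i, `[- r, r]%classic (x ord0 i)] = box r.
Proof. by apply/seteqP; split => x h i; have := h i; rewrite /= in_itv/= ler_norml. Qed.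

Lemma continuous_box_max f (r : R) : continuous f -> 0 <= r ->
  exists c, `|c| <= r /\ forall x, `|x| <= r -> f x <= f c.
Proof.
move=> cf r0.
have cb : compact (@box R N r) by rewrite -box_itv; exact: compact_box.
have [||c cb' h] := EVT_max_rV _ cb (f := f).
- by exists 0; apply/box_norm => //; rewrite normr0.
- exact: continuous_subspaceT.
exists c; split; first by apply/box_norm => //; exact: set_mem.
by move=> x xr; apply: h; apply: mem_set; exact/box_norm.
Qed.

Lemma continuous_box_min f (r : R) : continuous f -> 0 <= r ->
  exists c, `|c| <= r /\ forall x, `|x| <= r -> f c <= f x.
Proof.
move=> cf r0.
have cb : compact (@box R N r) by rewrite -box_itv; exact: compact_box.
have [||c cb' h] := EVT_min_rV _ cb (f := f).
- by exists 0; apply/box_norm => //; rewrite normr0.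
- exact: continuous_subspaceT.
exists c; split; first by apply/box_norm => //; exact: set_mem.
by move=> x xr; apply: h; apply: mem_set; exact/box_norm.
Qed.

Lemma compact_norm_bound (A : set 'rV[R]_N) : compact A ->
  exists r : R, 0 <= r /\ forall x, A x -> `|x| <= r.
Proof.
move=> /compact_bounded [M [_ h]]; exists (`|M| + 1); split; first by rewrite addr_ge0.
by move=> x Ax; apply: (h (`|M| + 1)) => //; rewrite ltr_pwDr// ler_norm.
Qed.

End CompactRV.

Section Weight.
Context (R : realType) (N : nat).
Variables (s p : R).
Hypotheses (N1 : (1 <= N)%N) (s0 : 0 < s) (p1 : 1 < p) (p2 : p < 2) (sp1 : s * p < 1).
Let alpha := N%:R + s * p.
Let a1 : N%:R < alpha.
Proof. by rewrite /alpha ltrDl mulr_gt0// (lt_trans _ p1). Qed.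
Let a2 : alpha < N%:R + 1. Proof. by rewrite /alpha ltrD2l. Qed.
Local Notation lam := (@lebesgueN R N).
Local Notation K := (@frac_kernel R N alpha).
Let q := p - 1.
Let q0 : 0 < q. Proof. by rewrite /q subr_gt0. Qed.
Let q1 : q < 1. Proof. by rewrite /q ltrBlDr. Qed.

Variable phi : 'rV[R]_N -> R.
Hypothesis hphi : classC s p phi.

Lemma weight_gt0 x : 0 < phi x. Proof. by have [] := hphi. Qed.

Lemma weight_continuous : continuous phi. Proof. by have [/(_ 0)] := hphi. Qed.

Lemma measurable_weight : measurable_fun setT phi.
Proof. exact: continuous_measurable_rV weight_continuous. Qed.

Lemma weight_far e : 0 < e -> exists r : R, 0 <= r /\ forall x, r < `|x| -> phi x < e.
Proof.
move=> e0; have [_ _ /(_ _ e0)[r h] _ _] := hphi.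
exists (Num.max r 0); split; first by rewrite le_max lexx orbT.
move=> x; rewrite gt_max => /andP[xr _].
have := h x (lt_le_trans xr (norm_le_eucl x)).
by rewrite gtr0_norm// weight_gt0.
Qed.

Lemma weight_bounded : exists B0, forall x, phi x <= B0.
Proof.
have [r [r0 h]] := weight_far ltr01.
have [c [_ hc]] := continuous_box_max weight_continuous r0.
exists (Num.max (phi c) 1) => x; rewrite le_max.
have [xr|xr] := leP `|x| r; first by rewrite hc.
by rewrite (ltW (h _ xr)) orbT.
Qed.

Lemma weight_decay e : 0 < e -> exists B, [/\ measurable B, (lam B < +oo)%E &
     forall x, ~ B x -> phi x <= e].
Proof.
move=> /weight_far[r [r0 h]]; exists (box r); split.
- exact: measurable_box.
- by have := ltry ((2 * r) ^+ N); rewrite -lebesgueN_cube.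
- by move=> x /(box_norm _ r0)/negP; rewrite -ltNge => /h/ltW.
Qed.

Lemma weight_below (r : R) : 0 <= r -> exists2 m, 0 < m & forall x, `|x| <= r -> m <= phi x.
Proof.
move=> r0.
have [c [_ hc]] := continuous_box_min weight_continuous r0.
by exists (phi c); [exact: weight_gt0|exact: hc].
Qed.

Definition weight_kernel (z : 'rV[R]_N * 'rV[R]_N) : R := K (z.1 - z.2) * `|phi z.1 - phi z.2|.

Lemma measurable_weight_kernel : measurable_fun setT weight_kernel.
Proof.
have h := measurable_diff2 (translation_rV R N) (measurable_frac_kernel alpha) measurable_weight.
exact: h.
Qed.

Lemma weight_kernel_ge0 z : 0 <= weight_kernel z. Proof. by rewrite mulr_ge0// frac_kernel_ge0. Qed.

Definition weight_op (x : 'rV[R]_N) : \bar R := (\int[lam]_y (weight_kernel (x, y))%:E)%E.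

Let mwker1 x : measurable_fun setT (fun y => (weight_kernel (x, y))%:E).
Proof.
apply/measurable_EFinP; exact: (measurableT_comp measurable_weight_kernel (measurable_pair1 x)).
Qed.

Lemma weight_op_ge0 x : (0 <= weight_op x)%E.
Proof. by apply: integral_ge0 => y _; rewrite lee_fin weight_kernel_ge0. Qed.

Lemma measurable_weight_op : measurable_fun setT weight_op.
Proof.
have m : measurable_fun setT (EFin \o weight_kernel) by apply/measurable_EFinP; exact: measurable_weight_kernel.
have n0 z : (0 <= (EFin \o weight_kernel) z)%E by rewrite lee_fin weight_kernel_ge0.
exact: (measurable_fun_fubini_tonelli_F (m2 := lam) (EFin \o weight_kernel) m n0).
Qed.

Let far x (e : R) : set 'rV[R]_N := [set y | e < eucl_norm (x - y)].

Let mfar x e : measurable (far x e).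
Proof.
have m : measurable_fun setT (fun y : 'rV[R]_N => eucl_norm (x - y)).
  have h := measurableT_comp (@measurable_eucl R N) (@measurable_subXX R N).
  exact: (measurableT_comp h (measurable_pair1 x)).
rewrite (_ : far x e = setT `&` (fun y : 'rV[R]_N => eucl_norm (x - y)) @^-1` `]e, +oo[%classic).
  exact: m.
by rewrite setTI; apply/seteqP; split => y /=; rewrite in_itv/= andbT.
Qed.

Let I x e : \bar R := (\int[lam]_(y in far x e) (weight_kernel (x, y))%:E)%E.

(** The truncated integrals increase to the full one, where the diagonal contributes
    nothing. *)
Lemma Mop_weight_op x : Mop s p phi x = weight_op x.
Proof.
rewrite /Mop.
have -> : (fun eps => (\int[lam]_(y in [set y | (eps < eucl_norm (x - y))%R])
         (`|phi x - phi y| / eucl_norm (x - y) `^ (N%:R + s * p))%:E)%E) = I x.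
  apply/funext => e; rewrite /I /far; apply: eq_integral => y _.
  by rewrite /weight_kernel /= mulrC.
have wp y e : far x e y -> (0 <= (weight_kernel (x, y))%:E)%E by rewrite lee_fin weight_kernel_ge0.
have c := @nonincreasing_at_right_cvge R (I x) 0 (BInfty _ false) isT.
apply: (cvg_lim (@ereal_hausdorff R)); rewrite (_ : weight_op x = ereal_sup [set I x e | e in [set` `]0, +oo[]]).
  apply: c => e e' _ _ ee'; apply: ge0_subset_integral => //.
  - exact: measurable_funTS.
  - by move=> y _; rewrite lee_fin weight_kernel_ge0.
  - by move=> y; exact: le_lt_trans.
apply/eqP; rewrite eq_le; apply/andP; split; last first.
  apply: ge_ereal_sup => _ [e _ <-]; apply: ge0_subset_integral => //.
  by move=> y _; rewrite lee_fin weight_kernel_ge0.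
have cI : I x (k.+1%:R^-1) @[k --> \oo] --> (\int[lam]_(y in \bigcup_k far x (k.+1%:R^-1)) (weight_kernel (x, y))%:E)%E.
  apply: ge0_nondecreasing_set_cvg_integral => //.
  - move=> k l kl; apply/subsetPset => y; apply: le_lt_trans.
    by rewrite lef_pV2 ?posrE// ler_nat ltnS.
  - by move=> k; exact: measurable_funTS.
  - by move=> k y _; rewrite lee_fin weight_kernel_ge0.
have EU : weight_op x = (\int[lam]_(y in \bigcup_k far x (k.+1%:R^-1)) (weight_kernel (x, y))%:E)%E.
  rewrite [RHS]integral_mkcond; apply: eq_integral => y _; rewrite patchE.
  case: ifPn => // /negP yU; rewrite /weight_kernel /=.
  have [xy|xy] := eqVneq (eucl_norm (x - y)) 0.
    by rewrite (eucl_norm_eq0 xy) /frac_kernel eucl_norm0 powR0 ?invr0 ?mul0r// gt_eqF// (alpha0 a1).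
  exfalso; apply: yU; apply: mem_set.
  have xy0 : 0 < eucl_norm (x - y) by rewrite lt_neqAle eq_sym xy eucl_norm_ge0.
  exists (Num.trunc (eucl_norm (x - y))^-1) => //; rewrite /far /=.
  by rewrite invf_plt ?posrE// truncnS_gt.
rewrite EU -(cvg_lim _ cI)//; apply: lime_le; first by apply/cvg_ex; eexists; exact: cI.
near=> k; apply: ereal_sup_ubound; exists k.+1%:R^-1 => //=.
by rewrite in_itv/= andbT invr_gt0.
Unshelve. all: by end_near. Qed.

Lemma weight_op_fin x : (weight_op x < +oo)%E.
Proof.
have [_ _ _ /(_ x)[B hB] _] := hphi.
have := nbhs_singleton hB; rewrite /= Mop_weight_op gee0_abs ?weight_op_ge0// => /le_lt_trans; apply.
exact: ltry.
Qed.

(** The integrand in the definition of class C. *)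
Definition weight_density x : \bar R :=
  (weight_op x `^ (2 - p)^-1 * ((phi x `^ ((p - 1) / (2 - p)))^-1)%:E)%E.

Lemma measurable_weight_density : measurable_fun setT weight_density.
Proof.
apply: emeasurable_funM; first exact: (measurableT_comp (measurable_poweR _) measurable_weight_op).
apply/measurable_EFinP.
rewrite (_ : (fun x => _) = (fun r => r `^ (- ((p - 1) / (2 - p)))) \o phi).
  exact: (measurableT_comp (measurable_powR _) measurable_weight).
by apply/funext => x /=; rewrite powRN.
Qed.

Lemma weight_density_ge0 x : (0 <= weight_density x)%E.
Proof. by rewrite mule_ge0 ?poweR_ge0// lee_fin invr_ge0 powR_ge0. Qed.

Lemma weight_density_int : (\int[lam]_x weight_density x < +oo)%E.
Proof.
have [_ _ _ _] := hphi; congr (_ < _)%E; apply: eq_integral => x _.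
by rewrite Mop_weight_op gee0_abs// weight_op_ge0.
Qed.

Lemma weight_control x a : 0 <= a -> (\int[lam]_y
  ((a `^ q * (K (x - y) * `|phi x - phi y|))%R%:E) <= (a * phi x)%:E + weight_density x)%E.
Proof.
move=> a0; under eq_integral do rewrite EFinM.
rewrite ge0_integralZl//; first last.
- by rewrite lee_fin powR_ge0.
- by move=> y _; rewrite lee_fin; exact: (weight_kernel_ge0 (x, y)).
- exact: (mwker1 x).
rewrite -[X in (_ * X)%E]/(weight_op x) /weight_density.
have := weight_op_fin x; have := weight_op_ge0 x; case: (weight_op x) => [m| |]//; rewrite lee_fin => m0 _.
rewrite poweR_EFin -EFinM -EFinM -EFinD lee_fin.
have := weight_young q0 q1 a0 (weight_gt0 x) m0.
by rewrite /q (_ : 1 - (p - 1) = 2 - p)//; ring.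
Qed.

End Weight.

(** * Test functions *)

Section TestFunction.
Context (R : realType) (N : nat).
Let V : normedModType R := ('rV[R]_N * R)%type.
Variables (T : R) (psi : 'rV[R]_N * R -> R).
Hypothesis hpsi : test_function T psi.
Let supp := closure [set z : V | psi z != 0].

Lemma test_out_supp z : ~ supp z -> psi z = 0.
Proof.
move=> nz; apply/eqP; apply: contrapT => /negP pz; apply: nz.
exact: subset_closure.
Qed.

Lemma test_out x t : ~ (0 < t < T) -> psi (x, t) = 0.
Proof.
move=> h; apply: test_out_supp => sz; have [_ _ /(_ _ sz)[_ /=]] := hpsi.
by rewrite in_itv.
Qed.

Lemma test_continuous : continuous psi. Proof. by have [/(_ 0)] := hpsi. Qed.

Lemma measurable_test : measurable_fun setT (psi : 'rV[R]_N * measurableTypeR R -> R).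
Proof. exact: continuous_measurable_strip test_continuous. Qed.

Lemma test_differentiable z : differentiable psi z.
Proof. by have [/(_ 1)[h _]] := hpsi. Qed.

Lemma test_D_continuous v : continuous ('D_v psi).
Proof. by have [/(_ 1)[_ h] _ _] := hpsi; exact: h. Qed.

Lemma test_D_out v z : ~ supp z -> 'D_v psi z = 0.
Proof.
move=> nz; rewrite (@near_eq_derive _ _ _ psi (cst 0)) ?derive_cst//.
have : nbhs z (~` supp).
  apply: open_nbhs_nbhs; split => //; apply: closed_openC; exact: closed_closure.
by apply: filterS => y; exact: test_out_supp.
Qed.

Lemma supp_bounded (g : V -> R) : continuous g -> (forall z, ~ supp z -> g z = 0) ->
  exists2 C, 0 <= C & forall z, `|g z| <= C.
Proof.
move=> cg g0; have [_ cs _] := hpsi.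
have cgs : compact (g @` supp) by apply: continuous_compact => //; exact: continuous_subspaceT.
have [M [_ hM]] := compact_bounded cgs.
exists (`|M| + 1); first by rewrite addr_ge0.
move=> z; have [sz|sz] := pselect (supp z); last by rewrite g0// normr0 addr_ge0.
by apply: (hM (`|M| + 1)); [rewrite ltr_pwDr// ler_norm|exists z].
Qed.

Lemma test_far : exists2 r : R, 0 <= r & forall x t, r < `|x| -> psi (x, t) = 0.
Proof.
have [_ cs _] := hpsi; have [M [_ hM]] := compact_bounded cs.
exists (`|M| + 1); first by rewrite addr_ge0.
move=> x t xM; apply: test_out_supp => sz.
have : `|((x, t) : V)| <= `|M| + 1 by apply: (hM (`|M| + 1)) => //; rewrite ltr_pwDr// ler_norm.
by rewrite prod_normE/= ge_max leNgt xM.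
Qed.

(** Mean value inequality along a segment. *)
Lemma test_line (z v : V) (C : R) : (forall y, `|'D_v psi y| <= C) -> `|psi (z + v) - psi z| <= C.
Proof.
move=> hC; pose h (k : R) := psi (z + k *: v).
have hd (k : R) : is_derive k (1 : R) h ('D_v psi (z + k *: v)).
  have E : (fun a : R => a^-1 *: ((h \o shift k) (a *: 1) - h k)) =
           (fun a => a^-1 *: ((psi \o shift (z + k *: v)) (a *: v) - psi (z + k *: v))).
    apply/funext => a; rewrite /h /= /shift /= !/GRing.scale /= mulr1.
    by congr (_ * (psi _ - _)); rewrite addrCA; congr (_ + _); rewrite -scalerDl.
  split.
    rewrite /derivable E; apply: diff_derivable; exact: test_differentiable.
  by rewrite /derive E.
have ch : {within `[0, 1], continuous h}.
  apply: derivable_within_continuous => k _; exact: (@ex_derive _ _ _ _ _ _ _ (hd k)).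
have [c _] := MVT ltr01 (fun k _ => hd k) ch.
rewrite /h scale1r scale0r addr0 subr0 mulr1 => ->; exact: hC.
Qed.

Lemma test_lip_space : exists2 C, 0 <= C & forall x y t, `|psi (x, t) - psi (y, t)| <= C * `|x - y|.
Proof.
pose e (i : 'I_N) : V := (delta_mx ord0 i, 0).
have he i : exists C, 0 <= C /\ forall z, `|'D_(e i) psi z| <= C.
  have [C C0 h] := supp_bounded (@test_D_continuous (e i)) (@test_D_out (e i)).
  by exists C.
pose Ci i := sval (cid (he i)).
have Ci0 i : 0 <= Ci i by rewrite /Ci; case: cid => ? [].
have hCi i z : `|'D_(e i) psi z| <= Ci i by rewrite /Ci; case: cid => ? [].
exists (\sum_i Ci i); first exact: sumr_ge0.
move=> x y t; pose v : V := (x - y, 0).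
have -> : (x, t) = (y, t) + v by rewrite /v; congr pair => /=; [rewrite addrC subrK|rewrite addr0].
apply: test_line => z.
have vE : v = \sum_i (x - y) ord0 i *: e i.
  rewrite /v {1}(row_sum_delta (x - y)).
  rewrite (@big_morph _ _ (fun a : 'rV[R]_N => ((a, 0) : V)) 0 +%R 0 +%R) //; last first.
    by move=> a b; congr pair; rewrite /= addr0.
  by apply: eq_bigr => i _; rewrite /e; congr pair; rewrite /= scaler0.
rewrite deriveE; last exact: test_differentiable.
rewrite vE linear_sum (le_trans (ler_norm_sum _ _ _))// mulr_suml ler_sum// => i _.
rewrite linearZ /= normrM mulrC; apply: ler_pM => //; last exact: coord_le_norm.
by rewrite -deriveE ?hCi//; exact: test_differentiable.
Qed.

Let ev : V := (0, 1).
Definition dtest (z : 'rV[R]_N * R) : R := 'D_ev psi z.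

Lemma measurable_dtest : measurable_fun setT (dtest : 'rV[R]_N * measurableTypeR R -> R).
Proof. exact: (continuous_measurable_strip (@test_D_continuous ev)). Qed.

Lemma dtest_out x t : ~ (0 < t < T) -> dtest (x, t) = 0.
Proof.
move=> h; apply: test_D_out => sz; have [_ _ /(_ _ sz)[_ /=]] := hpsi.
by rewrite in_itv.
Qed.

Lemma test_lip_time : exists2 C, 0 <= C & forall x t t', `|psi (x, t) - psi (x, t')| <= C * `|t - t'|.
Proof.
have [C C0 h] := supp_bounded (@test_D_continuous ev) (@test_D_out ev).
exists C => // x t t'; pose v : V := (t - t') *: ev.
have -> : (x, t) = (x, t') + v.
  by rewrite /v /ev; congr pair; rewrite /= ?scaler0 ?addr0// /GRing.scale/= mulr1 addrC subrK.
apply: test_line => z; rewrite deriveE; last exact: test_differentiable.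
rewrite linearZ /= normrM mulrC ler_wpM2r// -deriveE ?h//; exact: test_differentiable.
Qed.

Let quotE x t : (fun a : R => a^-1 *: (((fun t' => psi (x, t')) \o shift t) (a *: 1) - psi (x, t))) =
  (fun a => a^-1 *: ((psi \o shift (x, t)) (a *: ev) - psi (x, t))).
Proof.
apply/funext => a; rewrite /= /shift /=; congr (_ *: (psi _ - _)).
by congr pair; rewrite /= ?scaler0 ?add0r.
Qed.

Lemma derive1_test x t : derive1 (fun t' => psi (x, t')) t = dtest (x, t).
Proof. by rewrite derive1E /dtest /derive quotE. Qed.

Lemma test_diff x t e : 0 < e -> exists2 dl, 0 < dl & forall a b, a <= t -> t < b ->
  b - a < dl -> `|(psi (x, b) - psi (x, a)) / (b - a) - dtest (x, t)| <= e.
Proof.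
move=> e0.
have : (fun a => a^-1 *: ((psi \o shift (x, t)) (a *: ev) - psi (x, t))) @ 0^' --> dtest (x, t).
  have /cvg_ex[l hl] : derivable psi (x, t) ev by apply: diff_derivable; exact: test_differentiable.
  by rewrite /dtest /derive (cvg_lim _ hl).
move=> /cvgrPdist_le/(_ _ e0)/nbhs_ballP[dl /= dl0 hdl].
exists dl => // a b at_ tb ba.
have key k : `|k| < dl -> `|psi (x, t + k) - psi (x, t) - dtest (x, t) * k| <= e * `|k|.
  move=> kd; have [->|k0] := eqVneq k 0; first by rewrite addr0 subrr mulr0 subr0 normr0 mulr0.
  have := hdl k; rewrite /ball/= sub0r normrN => /(_ kd k0).
  rewrite /shift /= (_ : k *: ev + (x, t) = (x, t + k)); last first.
    by congr pair; rewrite /= ?scaler0 ?add0r// /GRing.scale/= mulr1 addrC.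
  rewrite distrC -(ler_pM2r (x := `|k|)) ?normr_gt0// -normrM mulrBl.
  by rewrite /GRing.scale/= mulrAC mulVf ?mul1r.
have ba0 : 0 < b - a by rewrite subr_gt0; exact: le_lt_trans at_ tb.
have k1 := key (b - t); have k2 := key (a - t).
rewrite !(addrC t) !subrK in k1 k2.
have n1 : `|b - t| = b - t by rewrite ger0_norm// subr_ge0 ltW.
have n2 : `|a - t| = t - a by rewrite ler0_norm ?opprB// subr_le0.
have {}k1 : `|psi (x, b) - psi (x, t) - dtest (x, t) * (b - t)| <= e * (b - t).
  by move: k1; rewrite n1; apply; apply: le_lt_trans ba; rewrite lerD2l lerN2.
have {}k2 : `|psi (x, a) - psi (x, t) - dtest (x, t) * (a - t)| <= e * (t - a).
  by move: k2; rewrite n2; apply; apply: le_lt_trans ba; rewrite lerD2r ltW.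
rewrite -(ler_pM2r ba0) -[X in _ * X <= _](gtr0_norm ba0) -normrM mulrBl divfK ?gt_eqF//.
rewrite (_ : _ - _ = (psi (x, b) - psi (x, t) - dtest (x, t) * (b - t)) -
  (psi (x, a) - psi (x, t) - dtest (x, t) * (a - t))); last by ring.
rewrite (le_trans (ler_normB _ _))// (_ : b - a = (b - t) + (t - a)); last by ring.
by rewrite [leRHS]mulrDr; apply: lerD.
Qed.

Lemma test_bounded : exists2 C, 0 <= C & forall z, `|psi z| <= C.
Proof. exact: supp_bounded test_continuous test_out_supp. Qed.

End TestFunction.

Section TestWeight.
Context (R : realType) (N : nat).
Variables (s p : R).
Hypotheses (N1 : (1 <= N)%N) (s0 : 0 < s) (p1 : 1 < p) (p2 : p < 2) (sp1 : s * p < 1).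
Let alpha := N%:R + s * p.
Let a1 : N%:R < alpha.
Proof. by rewrite /alpha ltrDl mulr_gt0// (lt_trans _ p1). Qed.
Let a2 : alpha < N%:R + 1. Proof. by rewrite /alpha ltrD2l. Qed.
Local Notation lam := (@lebesgueN R N).
Local Notation K := (@frac_kernel R N alpha).
Let q := p - 1.
Let q0 : 0 < q. Proof. by rewrite /q subr_gt0. Qed.
Let q1 : q < 1. Proof. by rewrite /q ltrBlDr. Qed.
Variable phi : 'rV[R]_N -> R.
Hypothesis hphi : classC s p phi.
Variables (C r : R).
Hypotheses (C0 : 0 <= C) (r0 : 0 <= r).
Let ind x : R := \1_(@box R N r) x.

(** Modulus of continuity of a function that vanishes outside of the box of radius [r],
    with [C] bounding its size and its Lipschitz constant. *)
Definition modulus (z : 'rV[R]_N * 'rV[R]_N) : R :=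
  2 * C * Num.min (eucl_norm (z.1 - z.2)) 1 * (\1_(box r) z.1 + \1_(box r) z.2).

Lemma measurable_modulus : measurable_fun setT modulus.
Proof.
have m1 : measurable_fun setT (\1_(@box R N r) : _ -> R).
  by apply: measurable_indic; exact: measurable_box.
apply: measurable_funM.
  apply: measurable_funM => //; apply: measurable_minr => //.
  have h := measurableT_comp (@measurable_eucl R N) (@measurable_subXX R N).
  exact: h.
apply: measurable_funD; first exact: (measurableT_comp m1).
exact: (measurableT_comp m1).
Qed.

Lemma modulus_ge0 z : 0 <= modulus z.
Proof.
rewrite mulr_ge0// ?mulr_ge0 ?addr_ge0// ?indicE//.
by rewrite le_min eucl_norm_ge0 ler01.
Qed.

Lemma modulus_sym x y : modulus (x, y) = modulus (y, x).
Proof. by rewrite /modulus /= eucl_normC (addrC (\1_(box r) x)). Qed.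

Lemma modulusP (f : 'rV[R]_N -> R) x y : `|f x - f y| <= C * `|x - y| ->
  `|f x| <= C -> `|f y| <= C -> (forall z, r < `|z| -> f z = 0) ->
  `|f x - f y| <= modulus (x, y).
Proof.
move=> h hx hy f0; rewrite /modulus /=.
have kb : `|f x - f y| <= 2 * C * Num.min (eucl_norm (x - y)) 1.
  have [_|_] := leP (eucl_norm (x - y)) 1.
    apply: (le_trans h); apply: ler_pM => //; last exact: norm_le_eucl.
    by rewrite mulr2n mulrDl mul1r lerDl.
  by rewrite mulr1 mulr2n mulrDl mul1r (le_trans (ler_normB _ _))// lerD.
have k0 : 0 <= 2 * C * Num.min (eucl_norm (x - y)) 1 by exact: le_trans kb.
have [xr|xr] := leP `|x| r.
  have -> : \1_(box r) x = 1 :> R by rewrite indicE mem_set//; exact/box_norm.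
  by apply: (le_trans kb); rewrite ler_peMr// lerDl indicE.
have [yr|yr] := leP `|y| r.
  have -> : \1_(box r) y = 1 :> R by rewrite indicE mem_set//; exact/box_norm.
  by apply: (le_trans kb); rewrite ler_peMr// lerDr indicE.
by rewrite !f0// subrr normr0 mulr_ge0// addr_ge0// indicE.
Qed.

Let KM z := K (z.1 - z.2) * modulus z.
Let KM_kmom x y : KM (x, y) = kernel_mom alpha (2 * C) (x - y) * (ind x + ind y).
Proof. by rewrite /KM /modulus /kernel_mom /ind /=; ring. Qed.

Let Kap := \int[lam]_z kernel_mom alpha (2 * C) z.
Let C20 : 0 <= 2 * C. Proof. by rewrite mulr_ge0. Qed.
Let Kap0 : 0 <= Kap. Proof. by apply: Rint_ge0 => z; exact: kernel_mom_ge0. Qed.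

Let mKM x : measurable_fun setT (fun y => (KM (x, y))%:E).
Proof.
apply/measurable_EFinP; apply: (measurableT_comp _ (measurable_pair1 x)).
apply: measurable_funM; last exact: measurable_modulus.
have h := measurableT_comp (measurable_frac_kernel alpha) (@measurable_subXX R N).
exact: h.
Qed.

Let KM0 z : 0 <= KM z. Proof. by rewrite mulr_ge0 ?frac_kernel_ge0 ?modulus_ge0. Qed.

Let KM_all x : (\int[lam]_y (KM (x, y))%:E <= (2 * Kap)%:E)%E.
Proof.
have ik := kernel_mom_sec N1 a1 a2 (2 * C) x.
have i2 := intgZ 2 ik.
have e : \int[lam]_y (2 * kernel_mom alpha (2 * C) (x - y)) = 2 * Kap.
  by rewrite /Kap -(kernel_mom_sec_int N1 a1 a2 (2 * C) x); exact: (RintZ 2 ik).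
rewrite -e (Rint_fine i2).
apply: ge0_le_integral => //.
- by move=> y _; rewrite lee_fin.
- by apply/measurable_EFinP; exact: intg_measurable (intgZ 2 ik).
move=> y _; rewrite lee_fin KM_kmom mulrC ler_wpM2r ?kernel_mom_ge0//.
by rewrite mulr2n lerD// /ind indicE; case: (_ \in _).
Qed.

Let wk z := weight_kernel s p phi z.

(** On a large box [phi] is bounded below and the kernel moment of [modulus] is bounded.
    Outside of it, only the points [y] in the box of radius [r] contribute; there
    [phi y >= m], while [phi x < m / 2], hence [modulus (x, y)] is at most a multiple of
    [`|phi x - phi y|], and [weight_control] applies. *)
Lemma modulus_weight : exists Lam rho : R, [/\ 0 < Lam, 0 <= rho &
  forall x a, 0 <= a -> (\int[lam]_y ((a `^ q * (K (x - y) * modulus (x, y)))%R%:E) <=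
     Lam%:E * ((a * phi x)%:E + (weight_density s p phi x + (\1_(box rho) x)%:E)))%E].
Proof.
have [m m0 hm] := weight_below hphi r0.
have m2 : 0 < m / 2 by rewrite divr_gt0.
have [r1 [r10 hr1]] := weight_far hphi m2.
pose rho := Num.max r r1; have rho0 : 0 <= rho by rewrite le_max r0.
have [mm mm0 hmm] := weight_below hphi rho0.
(* One summand for each of the cases [`|x| <= rho] and [rho < `|x|]. *)
pose Lam := 2 * Kap * (1 + mm^-1) + 4 * C / m + 1.
have LA : 0 <= 2 * Kap * (1 + mm^-1) by rewrite !mulr_ge0// addr_ge0// invr_ge0 ltW.
have LB : 0 <= 4 * C / m by rewrite divr_ge0 ?mulr_ge0// ltW.
have Lam0 : 0 < Lam by rewrite ltr_wpDl// addr_ge0.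
exists Lam, rho; split => // x a a0.
have q00 := ltW q0.
under eq_integral do rewrite EFinM.
rewrite ge0_integralZl//; first last.
- by rewrite lee_fin powR_ge0.
- by move=> y _; rewrite lee_fin; exact: (KM0 (x, y)).
- exact: (mKM x).
have W0 := weight_density_ge0 s p phi x.
have ap0 : 0 <= a * phi x by rewrite mulr_ge0// ltW// (weight_gt0 hphi).
have [xr|xr] := leP `|x| rho.
  have -> : \1_(box rho) x = 1 :> R by rewrite indicE mem_set//; exact/box_norm.
  apply: (@le_trans _ _ ((a `^ q * (2 * Kap))%:E)).
    by rewrite EFinM lee_wpmul2l ?lee_fin ?powR_ge0//; exact: KM_all.
  apply: (@le_trans _ _ (Lam%:E * (a * phi x + 1)%:E)%E); last first.
    by rewrite lee_wpmul2l ?lee_fin ?(ltW Lam0)// EFinD leeD2l// leeDr.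
  rewrite -EFinM lee_fin.
  have aq : a `^ q <= a + 1.
    have := powR_geom_le q0 q1 a0 ler01; by rewrite powR1 mulr1.
  apply: (@le_trans _ _ ((a + 1) * (2 * Kap))); first by rewrite ler_wpM2r// mulr_ge0.
  have ph : 1 <= mm^-1 * phi x by rewrite ler_pdivlMl// mulr1 hmm.
  apply: (@le_trans _ _ (2 * Kap * (1 + mm^-1) * (a * phi x + 1))); last first.
    by rewrite ler_wpM2r ?addr_ge0// /Lam -addrA lerDl addr_ge0.
  rewrite mulrC -mulrA ler_wpM2l ?mulr_ge0//.
  have := ler_wpM2l a0 ph; rewrite mulr1 mulrCA => h.
  have : 0 <= mm^-1 by rewrite invr_ge0 ltW.
  by move: h ap0; rewrite mulrDl mul1r mulrDr; move: (mm^-1) (a * phi x) => c1 c2; lra.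
have -> : \1_(box rho) x = 0 :> R.
  by rewrite indicE memNset// => /(box_norm _ rho0); rewrite leNgt xr.
rewrite adde0.
have xr0 : r < `|x| by apply: le_lt_trans xr; rewrite le_max lexx.
have px : phi x < m / 2 by apply: hr1; apply: le_lt_trans xr; rewrite le_max lexx orbT.
have x0 : ind x = 0.
  by rewrite /ind indicE memNset// => /(box_norm _ r0); rewrite leNgt xr0.
apply: (@le_trans _ _ ((a `^ q)%:E * \int[lam]_y ((4 * C / m)%:E * (wk (x, y))%:E))%E).
  rewrite lee_wpmul2l ?lee_fin ?powR_ge0//; apply: ge0_le_integral => //.
  - by move=> y _; rewrite lee_fin; exact: (KM0 (x, y)).
  - exact: (mKM x).
  - apply: emeasurable_funM => //; apply/measurable_EFinP.
    exact: (measurableT_comp (measurable_weight_kernel hphi) (measurable_pair1 x)).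
  move=> y _; rewrite -EFinM lee_fin -[leLHS]/(KM (x, y)) KM_kmom x0 add0r /kernel_mom /wk /weight_kernel /= /ind.
  have [yr|yr] := leP `|y| r; last first.
    have -> : \1_(box r) y = 0 :> R.
      by rewrite indicE memNset// => /(box_norm _ r0); rewrite leNgt yr.
    rewrite mulr0; apply: mulr_ge0 => //.
    by apply: mulr_ge0; [exact: frac_kernel_ge0|exact: normr_ge0].
  have -> : \1_(box r) y = 1 :> R by rewrite indicE mem_set//; exact/box_norm.
  have py := hm _ yr.
  have d : m / 2 <= `|phi x - phi y|.
    rewrite distrC (le_trans _ (ler_norm _))//.
    by move: px py; move: (phi x) (phi y) => c1 c2; lra.
  rewrite [leLHS](_ : _ = K (x - y) * (2 * C * Num.min (eucl_norm (x - y)) 1)); last by ring.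
  rewrite [leRHS](_ : _ = K (x - y) * (4 * C / m * `|phi x - phi y|)); last by rewrite -/alpha; ring.
  apply: ler_wpM2l; first exact: frac_kernel_ge0.
  apply: (@le_trans _ _ (2 * C)); first by rewrite ler_piMr// ge_min lexx orbT.
  apply: (@le_trans _ _ (4 * C / m * (m / 2))); last by rewrite ler_wpM2l.
  by rewrite le_eqVlt; apply/orP; left; apply/eqP; field; rewrite gt_eqF.
have mwk : measurable_fun setT (fun y => (wk (x, y))%:E).
  apply/measurable_EFinP.
  exact: (measurableT_comp (measurable_weight_kernel hphi) (measurable_pair1 x)).
have wk0 y : (0 <= (wk (x, y))%:E)%E by rewrite lee_fin; exact: weight_kernel_ge0.
rewrite ge0_integralZl// muleCA.
apply: (@le_trans _ _ ((4 * C / m)%:E * ((a * phi x)%:E + weight_density s p phi x))%E).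
  rewrite lee_wpmul2l ?lee_fin//.
  apply: le_trans (weight_control s0 p1 p2 hphi x a0).
  under [leRHS]eq_integral do rewrite EFinM.
  rewrite ge0_integralZl// ?lee_fin ?powR_ge0//.
  by move=> y _; exact: wk0.
apply: lee_wpmul2r; first by rewrite adde_ge0// lee_fin.
by rewrite lee_fin /Lam addrAC lerDr addr_ge0.
Qed.

End TestWeight.

(** * Convergence of the truncations, and existence on R^N *)

Section StripTools.
Context d (T : measurableType d) (R : realType).
Variable mu : {sigma_finite_measure set T -> \bar R}.
Let leb : {sigma_finite_measure set (measurableTypeR R) -> \bar R} := @lebesgue_measure R.
Variable phi : T -> R.
Hypotheses (mphi : measurable_fun setT phi) (phi0 : forall x, 0 < phi x).

Lemma set_weight_bound (A : set T) (m : R) (w : T -> R) : measurable A -> 0 < m ->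
  (forall x, A x -> m <= phi x) -> measurable_fun setT w ->
  intg mu (fun x => `|w x| * phi x) ->
  (\int[mu]_(x in A) `|w x|%:E <= (m^-1 * \int[mu]_x (`|w x| * phi x))%:E)%E.
Proof.
move=> mA m0 hm mw iw.
have mwn : measurable_fun setT (fun x => `|w x|) by exact: measurableT_comp.
have i2 := intgZ m^-1 iw.
rewrite -(RintZ m^-1 iw) (Rint_fine i2).
apply: (@le_trans _ _ (\int[mu]_(x in A) (m^-1 * (`|w x| * phi x))%:E)%E).
  apply: ge0_le_integral => //.
  - by apply/measurable_EFinP; exact: measurable_funTS.
  - by apply: measurable_funTS; exact: measurable_int i2.
  move=> x Ax; rewrite lee_fin mulrCA ler_peMr// ler_pdivlMl// mulr1; exact: hm.
apply: ge0_subset_integral => //; first exact: measurable_int i2.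
by move=> x _; rewrite lee_fin !mulr_ge0// ?invr_ge0 ltW.
Qed.

(** On [A] the weight is bounded below, so that [u] is dominated by [u phi / m], whose
    integral over each time is bounded. *)
Lemma strip_integrable (u : R -> T -> R) (L : nat) (B m : R) (A : set (T * measurableTypeR R)) :
  measurable_fun setT (fun z : T * measurableTypeR R => u z.2 z.1) ->
  (forall t, 0 <= t <= L%:R -> intg mu (fun x => u t x * phi x)) ->
  (forall t, 0 <= t <= L%:R -> \int[mu]_x (`|u t x| * phi x) <= B) ->
  0 < m -> measurable A -> (forall z, A z -> m <= phi z.1 /\ 0 <= z.2 <= L%:R) ->
  (mu \x leb)%E.-integrable A (EFin \o (fun z : T * measurableTypeR R => u z.2 z.1)).
Proof.
move=> mu2 iu uB m0 mA hA.
pose II : set (measurableTypeR R) := `[0, L%:R]%classic.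
have mII : measurable II by exact: measurable_itv.
have m1 : measurable_fun setT (\1_II : measurableTypeR R -> R) by exact: measurable_indic.
pose g (z : T * measurableTypeR R) : \bar R := (m^-1 * (`|u z.2 z.1| * phi z.1) * \1_II z.2)%:E.
have mg : measurable_fun setT g.
  apply/measurable_EFinP; apply: measurable_funM; last exact: (measurableT_comp m1).
  apply: measurable_funM => //; apply: measurable_funM; first exact: measurableT_comp.
  exact: (measurableT_comp mphi).
have m'0 : 0 <= m^-1 by rewrite invr_ge0 ltW.
have g0 z : (0 <= g z)%E.
  rewrite lee_fin mulr_ge0// mulr_ge0// mulr_ge0//.
  exact: ltW.
have B0 : 0 <= B.
  apply: le_trans (uB 0 _); last by rewrite lexx ler0n.
  by apply: Rint_ge0 => x; rewrite mulr_ge0// ltW.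
have iup t : 0 <= t <= L%:R -> intg mu (fun x => `|u t x| * phi x).
  move=> /iu/intg_norm; congr (mu.-integrable setT _); apply/funext => x /=.
  by rewrite normrM (gtr0_norm (phi0 x)).
have gi : (\int[(mu \x leb)%E]_z g z < +oo)%E.
  rewrite (fubini_tonelli2 (m1 := mu) (m2 := leb) g mg g0) /fubini_G.
  apply: (@le_lt_trans _ _ (\int[leb]_t ((m^-1 * B)%:E * (\1_II t)%:E))%E).
    apply: ge0_le_integral => //.
    - by move=> t _; apply: integral_ge0 => x _; exact: (g0 (x, t)).
    - exact: (measurable_fun_fubini_tonelli_G (m1 := mu) g mg g0).
    - by apply: emeasurable_funM => //; apply/measurable_EFinP.
    move=> t _; rewrite indicE; have [tI|tI] := boolP (t \in II); last first.
      rewrite mule0 (eq_integral (fun=> 0%E)) ?integral0// => x _.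
      by rewrite /g /= indicE (negPf tI) mulr0.
    have tL : 0 <= t <= L%:R by move: tI => /set_mem; rewrite /II /= in_itv.
    rewrite mule1 (eq_integral (fun x => (m^-1 * (`|u t x| * phi x))%:E)).
      rewrite -(Rint_fine (intgZ m^-1 (iup t tL))) (RintZ m^-1 (iup t tL)) lee_fin.
      by rewrite ler_wpM2l// uB.
    by move=> x _; rewrite /g /= indicE tI mulr1.
  rewrite ge0_integralZl//.
  - rewrite integral_indic// setIT lte_mul_pinfty// ?lee_fin ?mulr_ge0//.
    by rewrite /leb /II /= lebesgue_measure_itv/=; case: ifP => _; rewrite ?ltry// -EFinD ltry.
  - by apply/measurable_EFinP.
  - by rewrite lee_fin mulr_ge0.
apply/integrableP; split; first by apply/measurable_EFinP; exact: measurable_funTS.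
apply: le_lt_trans gi.
apply: (@le_trans _ _ (\int[(mu \x leb)%E]_(z in A) g z)%E).
  apply: ge0_le_integral => //.
  - by apply: measurableT_comp => //; apply/measurable_EFinP; exact: measurable_funTS.
  - exact: measurable_funTS.
  move=> z /hA[hm zL]; rewrite /g lee_fin indicE mem_set; last by rewrite /II /= in_itv.
  by rewrite mulr1 mulrCA ler_peMr// ler_pdivlMl// mulr1.
exact: ge0_subset_integral.
Qed.

End StripTools.

Section PhiLimits.
Context (R : realType) (p : R).
Hypotheses (p1 : 1 < p) (p2 : p < 2).

Lemma trunc_Phi_dist m a : (0 < m)%N -> `|trunc_Phi p m a - Phi p a| <= Phi_err p m.
Proof.
move=> m0; apply: le_trans (trunc_Phi_approx p1 p2 a m0).
pose c : R := Num.min (`|a| `^ (p - 2)) m%:R.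
have c0 : 0 <= c by rewrite le_min powR_ge0 ler0n.
have cP : c <= `|a| `^ (p - 2) by rewrite ge_min lexx.
rewrite /trunc_Phi /Phi -/c -mulrBl !normrM (ger0_norm (powR_ge0 _ _)) (ger0_norm c0).
by rewrite (distrC c) (ger0_norm (x := _ - c)) ?subr_ge0// -mulrBl.
Qed.

Lemma trunc_Phi_lip_norm m a b : `|trunc_Phi p m a - trunc_Phi p m b| <= m%:R * `|a - b|.
Proof.
wlog ab : a b / a <= b.
  by have [ab|/ltW ba] := leP a b => h; [exact: h|rewrite distrC (distrC a); exact: h].
rewrite distrC (distrC a) ger0_norm ?subr_ge0; last exact: trunc_Phi_nd.
by rewrite (ger0_norm (x := b - a)) ?subr_ge0//; exact: trunc_Phi_lip.
Qed.

(** [trunc_Phi] converges uniformly to [Phi], and for a fixed level it is Lipschitz. *)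
Lemma trunc_Phi_cvg (m_ : nat -> nat) (a_ : nat -> R) (a : R) : (forall n, (n <= m_ n)%N) ->
  a_ n @[n --> \oo] --> a -> trunc_Phi p (m_ n) (a_ n) @[n --> \oo] --> Phi p a.
Proof.
move=> mn ca; apply/cvgrPdist_le => e e0.
have e4 : 0 < e / 4 by rewrite divr_gt0.
have [m [m0 hm]] := Phi_err_small p1 p2 e4.
have hme := hm m (leqnn m).
have mR : 0 < m%:R :> R by rewrite ltr0n.
have e5 : 0 < e / 4 / m%:R by rewrite divr_gt0.
have /cvgrPdist_le/(_ _ e5) h := ca.
near=> n.
have mle : (m <= m_ n)%N by apply: leq_trans (mn n); near: n; exact: nbhs_infty_ge.
rewrite (_ : _ - _ = - (trunc_Phi p m a - Phi p a) + (trunc_Phi p m a - trunc_Phi p m (a_ n)) +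
   (trunc_Phi p m (a_ n) - trunc_Phi p (m_ n) (a_ n))); last by ring.
have b1 := le_trans (trunc_Phi_dist a m0) hme.
have b2 : `|trunc_Phi p m a - trunc_Phi p m (a_ n)| <= e / 4.
  apply: (le_trans (trunc_Phi_lip_norm _ _ _)); rewrite mulrC -ler_pdivlMr//.
  by near: n.
have b3 : `|trunc_Phi p m (a_ n) - trunc_Phi p (m_ n) (a_ n)| <= e / 4.
  apply: (le_trans (trunc_Phi_pair p (a_ n) mle)).
  exact: le_trans (trunc_Phi_approx p1 p2 (a_ n) m0) hme.
apply: (le_trans (ler_normD _ _)); apply: (le_trans (lerD (ler_normD _ _) (lexx _))).
rewrite normrN; move: b1 b2 b3; move: (`|_|) (`|_|) (`|_|) => x y z.
by move: e0; clear; lra.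
Unshelve. all: by end_near. Qed.

Lemma measurable_Phi : measurable_fun setT (@Phi R p).
Proof.
apply: (measurable_fun_cvg (h := fun m => @trunc_Phi R p m)).
  by move=> m; apply: nondecreasing_measurable => // x y; exact: trunc_Phi_nd.
move=> a _; apply: (@trunc_Phi_cvg id (fun=> a)) => //; exact: cvg_cst.
Qed.

End PhiLimits.

Lemma loc_integrable_measurable (R : realType) N (f : 'rV[R]_N -> R) :
  loc_integrable f -> measurable_fun setT f.
Proof.
move=> lf.
have -> : [set: 'rV[R]_N] = \bigcup_n (@box R N n%:R).
  apply/esym; rewrite -subTset => x _; exists (Num.trunc `|x|).+1 => //.
  by apply/box_norm => //; apply/ltW; exact: truncnS_gt.
apply/measurable_fun_bigcup => [n|n]; first exact: measurable_box.
have /integrableP[/measurable_EFinP] : (lebesgueN N).-integrable (@box R N n%:R) (EFin \o f).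
  by apply: lf; rewrite -box_itv; exact: compact_box.
by [].
Qed.

Section Main.
Context (R : realType) (N : nat).
Variables (s p : R).
Hypotheses (N1 : (1 <= N)%N) (s0 : 0 < s) (p1 : 1 < p) (p2 : p < 2) (sp1 : s * p < 1).
Let alpha := N%:R + s * p.
Let a1 : N%:R < alpha.
Proof. by rewrite /alpha ltrDl mulr_gt0// (lt_trans _ p1). Qed.
Let a2 : alpha < N%:R + 1. Proof. by rewrite /alpha ltrD2l. Qed.
Local Notation lam := (@lebesgueN R N).
Local Notation K := (@frac_kernel R N alpha).
Local Notation trunc_kernel := (@trunc_kernel R N alpha).
Notation subN := (fun x y : 'rV[R]_N => x - y).
Let q := p - 1.
Let q0 : 0 < q. Proof. by rewrite /q subr_gt0. Qed.
Variable phi : 'rV[R]_N -> R.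
Hypothesis hphi : classC s p phi.
Variable u0 : 'rV[R]_N -> R.
Hypotheses (mu0 : measurable_fun setT u0) (u00 : forall x, 0 <= u0 x)
  (iu0 : intg lam (fun x => u0 x * phi x)).
Let leb : {sigma_finite_measure set (measurableTypeR R) -> \bar R} := @lebesgue_measure R.

Let e := defect K trunc_kernel (@Phi_err R p) q.

Let e_small M v : nice lam subN K M v ->
  (forall m, intg (lam \x lam)%E (diff2 subN (e M m) v)) /\
  forall eps, 0 < eps -> exists m0, forall m, (m0 <= m)%N ->
    \int[(lam \x lam)%E]_z diff2 subN (e M m) v z <= eps.
Proof.
move=> [[mv _ _] iv].
split=> [m|eps e0].
  exact: (defect_intg (translation_rV R N) (@Phi_err R p) q (measurable_frac_kernel alpha)
    (@measurable_trunc_kernel R N alpha) (@trunc_kernel_ge0 R N alpha) (@trunc_kernel_le R N alpha) mv iv M m).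
exact: (defect_small (translation_rV R N) q (measurable_frac_kernel alpha)
  (@measurable_trunc_kernel R N alpha) (@trunc_kernel_ge0 R N alpha) (@trunc_kernel_le R N alpha) (@trunc_kernel_cvg R N alpha)
  (@Phi_err_ge0 R p) (@Phi_err_eventually R p p1 p2) mv iv M e0).
Qed.

Let trunc_kernel_cvg_diag (m_ : nat -> nat) z : (forall n, (n <= m_ n)%N) ->
  trunc_kernel (m_ n) z @[n --> \oo] --> K z.
Proof.
move=> mn; apply: cvg_near_cst; near=> n.
rewrite /trunc_kernel min_l//; apply: (le_trans (ltW (truncnS_gt _))); rewrite ler_nat.
by apply: leq_trans (mn n); near: n; exact: nbhs_infty_ge.
Unshelve. all: by end_near. Qed.

(** The data are clamped Lipschitz functions with compact support, which are [nice]. *)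
Let data_exists B0 : (forall x, phi x <= B0) -> exists v : nat -> 'rV[R]_N -> R,
  [/\ forall n, nice lam subN K n%:R (v n),
    forall n, \int[lam]_x (v n x * phi x) <= \int[lam]_x (u0 x * phi x) + B0,
    forall n, \int[lam]_x Num.max (v n x - v n.+1 x) 0 <= 2 * (2 ^+ n)^-1 &
    \int[lam]_x (`|v n x - u0 x| * phi x) @[n --> \oo] --> 0].
Proof.
move=> phiB.
have mB n := @measurable_box R N n%:R.
have iB n : intg lam (\1_(@box R N n%:R) : _ -> R) by exact: intg_box.
have Bnd n x : @box R N n%:R x -> @box R N n.+1%:R x.
  by move=> h i; apply: (le_trans (h i)); rewrite ler_nat.
have Ball x : exists n, @box R N n%:R x.
  by exists (Num.trunc `|x|).+1; apply/box_norm => //; apply/ltW; exact: truncnS_gt.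
have bd M w : nice lam subN K M w ->
  [/\ measurable_fun setT w, forall x, 0 <= w x <= M & intg lam w] by case.
have mphi := measurable_weight hphi; have phi0 := weight_gt0 hphi.
have ds := @dense_nice R N alpha N1 a1 a2.
exists (data (nice := nice lam subN K) mB mu0 u00 ds); split.
- exact: data_nice.
- exact: (data_X mB iB mphi phi0 phiB mu0 u00 iu0 bd ds).
- exact: (data_mono mB iB Bnd mu0 u00 bd ds).
- exact: (data_cvg mB iB Bnd Ball mphi phi0 phiB mu0 u00 iu0 bd ds).
Qed.

Lemma solution_exists : exists u, is_evolution lam (@Phi R p)
  (fun z : 'rV[R]_N * 'rV[R]_N => K (subN z.1 z.2)) q phi u0 u.
Proof.
have [B0 phiB] := weight_bounded hphi.
have [v [v1 v2 v3 v4]] := data_exists phiB.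
apply: (@evolution_exists _ _ _ lam (fun x y => x + y) subN (translation_rV R N) (@trunc_Phi R p) trunc_kernel
  (@trunc_mass R N alpha) K q (@Phi R p) _ _ _ _ _ _ _ _ _ _ e _ _ _ _ phi B0 (weight_density s p phi)
  _ _ _ _ _ _ _ _ u0 v (fun n => n%:R) (\int[lam]_x (u0 x * phi x) + B0) 2 _ _ _ _ _).
- by move=> m; exact: (trunc_scheme N1 a1 a2 p1 p2 m).
- exact: (trunc_mass_nd N1 a1 a2).
- exact: trunc_kernel_le.
- exact: (measurable_frac_kernel alpha).
- exact: (Ksym alpha).
- exact: q0.
- by move=> m a b a0 b0; exact: trunc_Phi_subadd.
- exact: (trunc_Phi_cvg p1 p2).
- exact: (measurable_Phi p1 p2).
- exact: trunc_kernel_cvg_diag.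
- by move=> M m; apply: measurable_defect; [exact: measurable_frac_kernel|exact: measurable_trunc_kernel].
- move=> M m z _.
  exact: (@defect_ge0 _ _ _ K trunc_kernel _ q (@trunc_kernel_ge0 R N alpha) (@trunc_kernel_le R N alpha) (@Phi_err_ge0 R p) M m z).
- by move=> M m n a z mn aM; apply: (defect_bound alpha p1 p2 z mn aM).
- exact: e_small.
- exact: (measurable_weight hphi).
- exact: (weight_gt0 hphi).
- exact: phiB.
- exact: (weight_decay hphi).
- exact: (measurable_weight_density hphi).
- exact: weight_density_ge0.
- exact: (weight_density_int s0 p1 hphi).
- by move=> x a a0; exact: (weight_control s0 p1 p2 hphi x a0).
- exact: iu0.
- exact: v1.
- exact: v2.
- exact: v3.
- exact: v4.
Qed.

End Main.

(** * The Cauchy problem *)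

Section Final.
Context (R : realType) (N : nat).
Variables (s p : R).
Hypotheses (N1 : (1 <= N)%N) (s0 : 0 < s) (p1 : 1 < p) (p2 : p < 2) (sp1 : s * p < 1).
Let alpha := N%:R + s * p.
Local Notation lam := (@lebesgueN R N).
Local Notation K := (@frac_kernel R N alpha).
Notation subN := (fun x y : 'rV[R]_N => x - y).
Variable phi : 'rV[R]_N -> R.
Hypothesis hphi : classC s p phi.
Let leb : {sigma_finite_measure set (measurableTypeR R) -> \bar R} := @lebesgue_measure R.

(** Where [psi] does not vanish [phi] is bounded below, which turns the Lipschitz constant
    in time into a multiple of [phi].  The indicator of a box in the last argument comes
    from [modulus_weight]. *)
Lemma test_function_is_test (T : R) (L : nat) psi : T <= L%:R -> test_function T psi ->
  exists Lam Lam' H W2,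
    is_test lam (fun z => K (subN z.1 z.2)) (p - 1) phi L psi (dtest psi) Lam Lam' H W2.
Proof.
move=> TL hpsi.
have TLt t : ~ (0 < t < L%:R) -> ~ (0 < t < T).
  by move=> h /andP[a b]; apply: h; rewrite a (lt_le_trans b).
have [r r0 hr] := test_far hpsi.
have [m m0 hm] := weight_below hphi r0.
have [Ct Ct0 ht] := test_lip_time hpsi.
have [Cs Cs0 hs] := test_lip_space hpsi.
have [Cb Cb0 hb] := test_bounded hpsi.
pose C := Cs + Cb.
have C0 : 0 <= C by rewrite addr_ge0.
have [Lam' [rho [Lam'0 rho0 hL]]] := modulus_weight N1 s0 p1 p2 sp1 hphi C0 r0.
have phi0 := weight_gt0 hphi.
have mbx : measurable (@box R N rho) by exact: measurable_box.
exists (Ct / m + 1), Lam', (modulus C r), (fun x => weight_density s p phi x + (\1_(box rho) x)%:E)%E.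
constructor.
- exact: (measurable_test hpsi).
- exact: (measurable_dtest hpsi).
- by move=> x t /TLt; exact: (test_out hpsi).
- by move=> x t /TLt; exact: (dtest_out hpsi).
- by rewrite ltr_wpDl// divr_ge0// ltW.
- move=> x t' t; have [xr|xr] := leP `|x| r; last first.
    rewrite !hr// subrr normr0 mulr_ge0// mulr_ge0//; last exact: ltW.
    by rewrite addr_ge0// divr_ge0// ltW.
  rewrite (distrC t t'); apply: (le_trans (ht x t t')); rewrite (distrC t t') ler_wpM2r//.
  apply: (@le_trans _ _ (Ct / m * phi x)).
    by rewrite mulrAC ler_pdivlMr// ler_wpM2l// hm.
  by rewrite ler_wpM2r// ?ltW// ltr_pwDr.
- by move=> x t e e0; exact: (test_diff hpsi).
- exact: measurable_modulus.
- by move=> z; exact: modulus_ge0.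
- by move=> x y; exact: modulus_sym.
- move=> x y t; apply: (modulusP C0 r0 (f := fun x => psi (x, t))).
  + by apply: (le_trans (hs x y t)); rewrite ler_wpM2r// lerDl.
  + by apply: (le_trans (hb _)); rewrite lerDr.
  + by apply: (le_trans (hb _)); rewrite lerDr.
  + by move=> z /hr.
- exact: Lam'0.
- apply: emeasurable_funD; first exact: (measurable_weight_density hphi).
  by apply/measurable_EFinP; exact: measurable_indic.
- by move=> x; rewrite adde_ge0 ?weight_density_ge0// lee_fin indicE.
- rewrite ge0_integralD//; first last.
  + by apply/measurable_EFinP; exact: measurable_indic.
  + exact: (measurable_weight_density hphi).
  + by move=> x _; exact: weight_density_ge0.
  rewrite lte_add_pinfty//; first exact: (weight_density_int s0 p1 hphi).
  by rewrite -(Rint_fine (intg_box _ rho0)) ltry.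
- exact: hL.
Qed.

Section Solution.
Variables (u0p : 'rV[R]_N -> R) (u : R -> 'rV[R]_N -> R).
Hypothesis Hu : is_evolution lam (@Phi R p)
  (fun z : 'rV[R]_N * 'rV[R]_N => K (subN z.1 z.2)) (p - 1) phi u0p u.
Let mu2 := ev_mu2 Hu.
Let mu1 := ev_mu1 Hu.
Let iu := ev_intg Hu.
Let phi0 := weight_gt0 hphi.
Let sol (z : 'rV[R]_N * R) : R := u z.2 z.1.

Let nat_above (T : R) : exists L : nat, T <= L%:R.
Proof. by exists (Num.trunc T).+1; apply/ltW; exact: truncnS_gt. Qed.

Let intg_absM w : intg lam (fun x => w x * phi x) -> intg lam (fun x => `|w x| * phi x).
Proof.
move=> /intg_norm; congr (lam.-integrable setT _); apply/funext => x /=.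
by rewrite normrM (gtr0_norm (phi0 x)).
Qed.

Let intg_absB w w' : intg lam (fun x => w x * phi x) -> intg lam (fun x => w' x * phi x) ->
  intg lam (fun x => `|w x - w' x| * phi x).
Proof.
move=> i i'; apply: intg_absM; rewrite (_ : (fun x => _) = fun x => w x * phi x - w' x * phi x).
  exact: intgB.
by apply/funext => x; rewrite mulrBl.
Qed.

Lemma solution_weighted_continuous T : 0 < T -> continuous_weighted_L1 phi T sol.
Proof.
move=> T0; have [L TL] := nat_above T.
have tL t : t \in `[0, T] -> 0 <= t <= L%:R.
  by rewrite in_itv /= => /andP[-> h]; rewrite (le_trans h).
split=> [t /tL ht|t0 /tL ht0]; first split.
- exact: mu1.
- by rewrite -(Rint_fine (intg_absM (iu ht))) ltry.
pose g t := \int[lam]_x (`|u t x - u t0 x| * phi x).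
apply: (@cvg_trans _ (EFin (g t) @[t --> within `[0, T] (nbhs t0)])).
  apply: near_eq_cvg; rewrite near_withinE; near=> t => tT.
  by rewrite /g (Rint_fine (intg_absB (iu (tL t tT)) (iu ht0))).
apply: cvg_EFin; first by near=> t.
apply/cvgrPdist_le => eps eps0; have [dl dl0 h] := ev_cont Hu ht0 eps0.
rewrite near_withinE; near=> t => tT; rewrite /= sub0r normrN ger0_norm.
  apply: h; first exact: tL.
  by rewrite distrC; near: t; apply: nbhsx_ballx.
by apply: Rint_ge0 => x; rewrite mulr_ge0// ltW.
Unshelve. all: by end_near. Qed.

(** The weight is bounded below on a compact set, and [u0p] differs from [u0] on a null set
    only. *)
Lemma solution_initial_trace u0 : loc_integrable u0 -> measurable_fun setT u0p ->
  {ae lam, forall x, u0 x = u0p x} -> intg lam (fun x => u0p x * phi x) ->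
  initial_trace_L1loc u0 sol.
Proof.
move=> hu0 mu0p u0E iu0p A cA; have mA := compact_measurable_rV cA.
have [r [r0 hr]] := compact_norm_bound cA.
have [m m0 hm] := weight_below hphi r0.
have t00 : 0 <= (0 : R) <= 1%:R by rewrite lexx ler0n.
have i0 := intg_absB (iu t00) iu0p.
have ub t : 0 <= t <= 1%:R -> (\int[lam]_(x in A) `|sol (x, t) - u0 x|%:E <=
   (m^-1 * \int[lam]_x (`|u t x - u 0%R x| * phi x))%:E)%E.
  move=> ht; have i1 := intg_absB (iu ht) (iu t00).
  rewrite (_ : (\int[lam]_(x in A) _)%E = \int[lam]_(x in A) `|u t x - u0p x|%:E)%E.
    have i2 := intg_absB (iu ht) iu0p.
    have h := @set_weight_bound _ _ _ lam phi phi0 A m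
      (fun x => u t x - u0p x) mA m0.
    apply: (le_trans (h _ _ _)) => //.
    - by move=> x Ax; apply: hm; exact: hr.
    - by apply: measurable_funB.
    rewrite lee_fin; apply: ler_wpM2l; first by rewrite invr_ge0 ltW.
    rewrite -[leRHS]addr0 -[X in _ <= _ + X](ev_init Hu) -RintD//; apply: le_Rint => //; first exact: intgD.
    move=> x; rewrite -mulrDl; apply: ler_wpM2r; first exact: ltW.
    by apply: le_trans (ler_normD _ _); rewrite addrA subrK.
  apply: ae_eq_integral => //.
  - apply/measurable_EFinP; apply: measurableT_comp => //; apply: measurable_funB.
      by apply: measurable_funTS; exact: (mu1 t).
    by apply: measurable_funTS; exact: loc_integrable_measurable.
  - apply/measurable_EFinP; apply: measurable_funTS; apply: measurableT_comp => //.
    exact: measurable_funB.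
  by apply: filterS u0E => x E _; rewrite E.
pose g t := m^-1 * \int[lam]_x (`|u t x - u 0 x| * phi x).
apply: (squeeze_cvge (f := fun=> 0%E) (h := EFin \o g)).
- near=> t; apply/andP; split; first by apply: integral_ge0 => x _; rewrite lee_fin.
  by apply: ub; apply/andP; split; near: t; [exact: nbhs_right_ge|exact: nbhs_right_le].
- exact: cvg_cst.
apply: cvg_EFin; first by near=> t.
apply/cvgrPdist_le => eps eps0.
have e1 : 0 < m * eps by rewrite mulr_gt0.
have [dl dl0 h] := ev_cont Hu t00 e1.
near=> t; rewrite /= sub0r normrN ger0_norm.
  have t0 : 0 <= t by near: t; exact: nbhs_right_ge.
  rewrite /g ler_pdivrMl//; apply: h.
    by rewrite t0/=; near: t; exact: nbhs_right_le.
  by rewrite subr0 ger0_norm//; near: t; exact: nbhs_right_lt.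
rewrite /g mulr_ge0//; first by rewrite invr_ge0 ltW.
by apply: Rint_ge0 => x; rewrite mulr_ge0// ltW.
Unshelve. all: by end_near. Qed.

Lemma solution_loc_integrable T : 0 < T -> loc_integrable_strip T sol.
Proof.
move=> T0 A cA AT; have [L TL] := nat_above T.
have [B hB] := ev_bound Hu L.
have [M [_ hM]] := compact_bounded cA.
have r0 : 0 <= `|M| + 1 by rewrite addr_ge0.
have hr z : A z -> `|z.1| <= `|M| + 1.
  move=> Az; apply: (@le_trans _ _ `|z|); first by rewrite prod_normE le_max lexx.
  by apply: (hM (`|M| + 1)) => //; rewrite ltr_pwDr// ler_norm.
have [m m0 hm] := weight_below hphi r0.
apply: (@strip_integrable _ _ _ lam phi (measurable_weight hphi) phi0 u L B m A) => //.
- exact: iu.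
- exact: compact_measurable_strip.
move=> z Az; split; first by apply: hm; exact: hr.
have [_ ] := AT _ Az; rewrite /= in_itv /= => /andP[-> h].
exact: le_trans h TL.
Qed.

Lemma solution_weak T : 0 < T -> weak_solution s p T sol.
Proof.
move=> T0; split; first exact: solution_loc_integrable.
move=> psi hpsi psi_t F nu2 nu3 Q2 Q3; have [L TL] := nat_above T.
have [Lam [Lam' [H [W2 te]]]] := test_function_is_test TL hpsi.
have [iF iE EF] := ev_weak Hu te.
set F' := (fun z : _ * _ => _) in iF; set E := (fun z : _ * _ => _) in iE.
have FE : F = F'.
  apply/funext => -[[x y] t]; rewrite /F /F' /sol /=.
  by rewrite /frac_kernel mulrAC.
have EE : (fun z => sol z * psi_t z) = E.
  by apply/funext => -[x t]; rewrite /E /sol /psi_t /= derive1_test.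
have mT : measurable [set` `]0, T[] by exact: measurable_itv.
have mQ3 : measurable (Q3 : set (('rV[R]_N * 'rV[R]_N) * measurableTypeR R)).
  by apply: measurableX.
have mQ2 : measurable (Q2 : set ('rV[R]_N * measurableTypeR R)).
  by apply: measurableX.
split.
  rewrite FE; exact: integrableS iF.
have -> : (\int[nu2]_(z in Q2) (sol z * psi_t z)%:E = \int[nu2]_z (E z)%:E)%E.
  rewrite integral_mkcond; apply: eq_integral => -[x t] _; rewrite /patch.
  case: ifPn => [_|/negP h]; first by rewrite -EE.
  rewrite /E /= (dtest_out hpsi) ?mulr0// => tT; apply: h; exact/mem_set.
have -> : (\int[nu3]_(z in Q3) (F z)%:E = \int[nu3]_z (F' z)%:E)%E.
  rewrite integral_mkcond; apply: eq_integral => -[[x y] t] _; rewrite /patch.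
  case: ifPn => [_|/negP h]; first by rewrite FE.
  rewrite /F' /= !(test_out hpsi) ?subrr ?mulr0// => tT; apply: h; exact/mem_set.
by rewrite -(Rint_fine iE) -(Rint_fine iF) EF.
Qed.

End Solution.
End Final.

Lemma weighted_integrable_pos (R : realType) (N : nat) (u0 phi : 'rV[R]_N -> R) :
  measurable_fun setT u0 -> measurable_fun setT phi -> (forall x, 0 < phi x) ->
  {ae lebesgueN N, forall x, 0 <= u0 x} ->
  (\int[lebesgueN N]_x (u0 x * phi x)%:E < +oo)%E ->
  {ae lebesgueN N, forall x, u0 x = Num.max (u0 x) 0} /\
  intg (lebesgueN N) (fun x => Num.max (u0 x) 0 * phi x).
Proof.
move=> mu mphi phi0 ae0 fin.
have E : {ae lebesgueN N, forall x, u0 x = Num.max (u0 x) 0}.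
  by apply: filterS ae0 => x h; rewrite max_l.
split=> //.
have mm : measurable_fun setT (fun x => Num.max (u0 x) 0 * phi x).
  by apply: measurable_funM => //; apply: measurable_maxr.
apply/integrableP; split; first exact/measurable_EFinP.
rewrite (_ : (\int[_]_x _)%E = (\int[lebesgueN N]_x (u0 x * phi x)%:E)%E)//.
apply: ae_eq_integral => //.
- by apply: measurableT_comp => //; exact/measurable_EFinP.
- by apply/measurable_EFinP; apply: measurable_funM.
apply: filterS E => x E _ /=; rewrite -E ger0_norm// mulr_ge0//; last exact: ltW.
by rewrite E le_max lexx orbT.
Qed.

Theorem theorem3p1 (R : realType) (N : nat) (s p : R)
    (hN : (1 <= N)%N) (hs : 0 < s < 1) (hp : 1 < p < 2) (hsp : s * p < 1)
    (u0 : 'rV[R]_N -> R) (hu0 : loc_integrable u0)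
    (hu0_ge0 : {ae lebesgueN N, forall x, 0 <= u0 x})
    (phi : 'rV[R]_N -> R) (hphi : classC s p phi)
    (hu0phi : (\int[lebesgueN N]_x (u0 x * phi x)%:E < +oo)%E) :
  exists u : 'rV[R]_N * R -> R,
    [/\ forall T : R, 0 < T -> weak_solution s p T u,
        forall T : R, 0 < T -> continuous_weighted_L1 phi T u
      & initial_trace_L1loc u0 u].
Proof.
have /andP[s0 _] := hs; have /andP[p1 p2] := hp.
have mu0 := loc_integrable_measurable hu0.
have [u0E iu0] := weighted_integrable_pos mu0 (measurable_weight hphi) (weight_gt0 hphi)
  hu0_ge0 hu0phi.
(* [u0] is nonnegative almost everywhere only: the scheme starts from its positive
   part. *)
have mu0p : measurable_fun setT (fun x => Num.max (u0 x) 0) by exact: measurable_maxr.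
have u0p0 x : 0 <= Num.max (u0 x) 0 by rewrite le_max lexx orbT.
have [u Hu] := solution_exists hN s0 p1 p2 hsp hphi mu0p u0p0 iu0.
exists (fun z => u z.2 z.1); split.
- by move=> T T0; exact: (solution_weak hN s0 p1 p2 hsp hphi Hu T0).
- by move=> T T0; exact: (solution_weighted_continuous hphi Hu T0).
- exact: (solution_initial_trace hphi Hu hu0 mu0p u0E iu0).
Qed.
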